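(* The generalised Mumford–Tate conjecture and the Isogeny conjecture (both stated in the context) are equivalent. More precisely: let $(G,X)$ be a Shimura datum, let $l$ be a prime, let $K=K_l\times K^l\subset G(\mathbb A_f)$ be a neat compact open subgroup with $K_l\subset G(\mathbb Q_l)$ compact open, let $L$ be a number field, and let $x=[s,\overline 1]\in \mathrm{Sh}_K(G,X)(L)$, $\widetilde x=[s,1]$, with associated $l$-adic Galois representation $\rho_{\widetilde x,l}:\mathrm{Gal}(\overline L/L)\to K_l$. Let $M=MT(s)$ and let $H_{\mathbb Q_l}$ be the neutral component of the Zariski closure of $\rho_{\widetilde x,l}(\mathrm{Gal}(\overline L/L))$ in $G_{\mathbb Q_l}$. Then the following are equivalent: (i) for every finite-dimensional representation $\mu:G\to \mathrm{GL}(V_{\mathbb Q})$ over $\mathbb Q$ and every lattice $V_{\mathbb Z}\subset V_{\mathbb Q}$ with $\mu(K_l)\subset \mathrm{GL}(V_{\mathbb Z_l})$, the $(\infty,l)$-integral structure $(V_{\mathbb Z},\mu\circ s,\mu\circ\rho_{\widetilde x,l})$ is Tate; (ii) $H_{\mathbb Q_l}=M_{\mathbb Q_l}$.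
   Context: Conventions. $\mathbb S=\mathrm{Res}_{\mathbb C/\mathbb R}\mathbb G_{m,\mathbb C}$. Number fields are subfields of $\mathbb C$; reductive groups are connected; $\mathbb A_f$ is the ring of finite adeles of $\mathbb Q$. A Shimura datum $(G,X)$ is a reductive $\mathbb Q$-group $G$ with a $G(\mathbb R)$-conjugacy class $X$ of morphisms $\mathbb S\to G_{\mathbb R}$ such that for $s\in X$: the Hodge structure on $\mathrm{Lie}(G_{\mathbb R})$ given by $\mathrm{Ad}\circ s$ is of type $\{(-1,1),(0,0),(1,-1)\}$; $\mathrm{ad}\,s(i)$ is a Cartan involution of $G^{\mathrm{ad}}_{\mathbb R}$; $G^{\mathrm{ad}}$ has no $\mathbb Q$-factor on which the projection of $s$ is trivial. $MT(s)$ is the smallest $\mathbb Q$-subgroup $M$ of $G$ such that $s$ factors through $M_{\mathbb R}$; $MT(X)$ is the smallest $\mathbb Q$-subgroup containing all $MT(s)$, $s\in X$; it is always assumed that $G=MT(X)$. $E(G,X)$ is the reflex field. For $K\subset G(\mathbb A_f)$ compact open, $\mathrm{Sh}_K(G,X)$ is the canonical model over $E(G,X)$, with $\mathrm{Sh}_K(G,X)(\mathbb C)=G(\mathbb Q)\backslash X\times G(\mathbb A_f)/K$, and $\mathrm{Sh}(G,X)=\varprojlim_K\mathrm{Sh}_K(G,X)$, with $\mathrm{Sh}(G,X)(\mathbb C)=G(\mathbb Q)\backslash X\times G(\mathbb A_f)$. $[s,\overline g]$ and $[s,g]$ denote the images of $(s,g)\in X\times G(\mathbb A_f)$ in these two sets.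 An element $g=(g_p)\in G(\mathbb A_f)$ is neat if, for a faithful representation of $G$ and $\Gamma_p\subset\overline{\mathbb Q}_p^*$ the group generated by the eigenvalues of $g_p$, one has $\bigcap_p(\overline{\mathbb Q}^*\cap\Gamma_p)_{\mathrm{tors}}=\{1\}$; a subgroup is neat if all its elements are. Galois representations. Let $K$ be neat, $\pi:\mathrm{Sh}(G,X)\to\mathrm{Sh}_K(G,X)$ the projection, $L\supset E(G,X)$ a number field, $x=[s,\overline 1]\in\mathrm{Sh}_K(G,X)(L)$, $\widetilde x=[s,1]$. The right action of $K$ on $\pi^{-1}(x)$ is simply transitive and commutes with the left action of $\mathrm{Gal}(\overline L/L)$; $\rho_{\widetilde x}:\mathrm{Gal}(\overline L/L)\to K$ is the homomorphism with $\sigma(\widetilde x)=[s,\rho_{\widetilde x}(\sigma)]$, and $\rho_{\widetilde x,l}$ is its composite with the projection $G(\mathbb A_f)\to G(\mathbb Q_l)$. $(\infty,l)$-integral structures. Fix a number field $L$ and a prime $l$. An $(\infty,l)$-integral structure $(V_{\mathbb Z},s,\rho)$ on a finite-dimensional $\mathbb Q$-vector space $V_{\mathbb Q}$ consists of a lattice $V_{\mathbb Z}\subset V_{\mathbb Q}$, a polarised $\mathbb Z$-Hodge structure $s:\mathbb S\to\mathrm{GL}(V_{\mathbb R})$, and a continuous representation $\rho:\mathrm{Gal}(\overline L/L)\to\mathrm{GL}(V_{\mathbb Z_l})$, such that $\mathrm{End}_{\mathbb Z\text{-}HS}(V_{\mathbb Z})\otimes\mathbb Z_l\subset\mathrm{End}_{\mathrm{Gal}(\overline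 L/L)}(V_{\mathbb Z_l})$. It is Tate if $\rho\otimes\mathbb Q_l$ is semi-simple and this inclusion is an equality. It is of Shimura type if it is of the form $(V_{\mathbb Z},\mu\circ s,\mu\circ\rho_{\widetilde x,l})$ for some Shimura datum $(G,X)$, neat $K=K_lK^l$, point $x=[s,\overline 1]\in\mathrm{Sh}_K(G,X)(L)$, representation $\mu:G\to\mathrm{GL}(V_{\mathbb Q})$ and lattice $V_{\mathbb Z}$ with $\mu(K_l)\subset\mathrm{GL}(V_{\mathbb Z_l})$. Standing assumptions on $L$: $L$ contains $E(G,X)$ and $E(M,X_M)$, where $X_M$ is the $M(\mathbb R)$-conjugacy class of $s$ (then $(M,X_M)$ is a Shimura datum), and $L$ is large enough that the Zariski closure of the image of the Galois representation is connected. Conjectures. Generalised Mumford–Tate: for every Shimura datum $(G,X)$, every prime $l$, every neat compact open subgroup $K=K_l\times K^l\subset G(\mathbb A_f)$ with $K_l\subset G(\mathbb Q_l)$ compact open, every number field $L$ satisfying the standing assumptions on $L$, and every point $x=[s,\overline 1]\in\mathrm{Sh}_K(G,X)(L)$, one has $H_{\mathbb Q_l}=M_{\mathbb Q_l}$, where $M=MT(s)$, $\widetilde x=[s,1]$ and $H_{\mathbb Q_l}$ is the neutral component of the Zariski closure of $\rho_{\widetilde x,l}(\mathrm{Gal}(\overline L/L))$ in $G_{\mathbb Q_l}$. Isogeny conjecture: every $(\infty,l)$-integral structure of Shimura type is Tate. *)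

(* Defs.v *)
From HB Require Import structures.
From mathcomp Require Import all_boot all_order all_algebra.
From mathcomp Require Import complex.
From mathcomp Require mpoly.
From mathcomp Require Import zify.
From mathcomp Require Import all_classical all_reals all_analysis.
Set Implicit Arguments.
Unset Strict Implicit.
Unset Printing Implicit Defensive.
Import Order.TTheory GRing.Theory Num.Theory numFieldNormedType.Exports.
Local Open Scope classical_set_scope.
Local Open Scope ring_scope.

Definition primeT := {p : nat | prime p}.

Fact modz_dvd (d e m : int) : (e %| d)%Z -> ((m %% d)%Z = m %[mod e])%Z.
Proof.
by case/dvdzP=> k ->; rewrite {2}(divz_eq m (k * e)) mulrA modzMDl.
Qed.

Section PadicIntegers.
Variable p : primeT.
Let q (n : nat) : int := ((val p) ^ n)%:Z.

(* x n is the representative in [0, p^n) of the residue modulo p^n *)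
Record padic_int := PadicInt {
  residue :> nat -> int;
  residueP : forall n, (residue n.+1 %% q n)%Z = residue n }.

Lemma padic_int_eq (x y : padic_int) :
  (forall n, (residue x n = residue y n %[mod q n])%Z) -> x = y.
Proof.
case: x y => [x hx] [y hy] /= e; have exy : x = y.
  apply/funext => n; have := e n.
  by rewrite -(hx n) -(hy n) !modz_mod.
by subst y; rewrite (Prop_irrelevance hx hy).
Qed.

Let dvdq n : (q n %| q n.+1)%Z.
Proof. by rewrite /q dvdzE /= expnS dvdn_mull. Qed.

Fact of_residues_subproof (f : nat -> int)
    (hf : forall n, (f n.+1 = f n %[mod q n])%Z) n :
  ((f n.+1 %% q n.+1)%Z %% q n)%Z = (f n %% q n)%Z.
Proof. by rewrite modz_dvd ?dvdq// hf. Qed.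

Definition of_residues f hf : padic_int :=
  PadicInt (@of_residues_subproof f hf).

Let res_mod (x : padic_int) n : (residue x n.+1 = residue x n %[mod q n])%Z.
Proof. by rewrite -(residueP x n) modz_mod. Qed.

Fact add_subproof (x y : padic_int) n :
  (x n.+1 + y n.+1 = x n + y n %[mod q n])%Z.
Proof. by rewrite -modzDm !res_mod modzDm. Qed.
Fact opp_subproof (x : padic_int) n : (- x n.+1 = - x n %[mod q n])%Z.
Proof. by rewrite -modzNm res_mod modzNm. Qed.
Fact mul_subproof (x y : padic_int) n :
  (x n.+1 * y n.+1 = x n * y n %[mod q n])%Z.
Proof. by rewrite -modzMm !res_mod modzMm. Qed.

Definition padic_cst (a : int) := @of_residues (fun=> a) (fun=> erefl).
Definition padic_add x y := of_residues (add_subproof x y).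
Definition padic_opp x := of_residues (opp_subproof x).
Definition padic_mul x y := of_residues (mul_subproof x y).

HB.instance Definition _ := gen_eqMixin padic_int.
HB.instance Definition _ := gen_choiceMixin padic_int.

Let tac := (modzDml, modzDmr, modzMml, modzMmr, modzNm, modz_mod).

Fact padic_addA : associative padic_add.
Proof. by move=> x y z; apply: padic_int_eq => n /=; rewrite !tac addrA. Qed.
Fact padic_addC : commutative padic_add.
Proof. by move=> x y; apply: padic_int_eq => n /=; rewrite addrC. Qed.
Fact padic_add0 : left_id (padic_cst 0) padic_add.
Proof. by move=> x; apply: padic_int_eq => n /=; rewrite !tac add0r. Qed.
Fact padic_addN : left_inverse (padic_cst 0) padic_opp padic_add.
Proof. by move=> x; apply: padic_int_eq => n /=; rewrite !tac addNr. Qed.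

HB.instance Definition _ := GRing.isZmodule.Build padic_int
  padic_addA padic_addC padic_add0 padic_addN.

Fact padic_mulA : associative padic_mul.
Proof. by move=> x y z; apply: padic_int_eq => n /=; rewrite !tac mulrA. Qed.
Fact padic_mulC : commutative padic_mul.
Proof. by move=> x y; apply: padic_int_eq => n /=; rewrite mulrC. Qed.
Fact padic_mul1 : left_id (padic_cst 1) padic_mul.
Proof. by move=> x; apply: padic_int_eq => n /=; rewrite !tac mul1r. Qed.
Fact padic_mulD : left_distributive padic_mul padic_add.
Proof.
by move=> x y z; apply: padic_int_eq => n /=; rewrite !tac mulrDl.
Qed.
Fact padic_1neq0 : padic_cst 1 != 0.
Proof.
apply/eqP => /(congr1 (fun x : padic_int => residue x 1%N)) /=.
have p1 : (1 < val p)%N by exact: prime_gt1 (valP p).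
by rewrite mod0z modz_small ?/q ?expn1 //= ltz_nat.
Qed.

HB.instance Definition _ := GRing.Zmodule_isComNzRing.Build padic_int
  padic_mulA padic_mulC padic_mul1 padic_mulD padic_1neq0.

Definition padic_unit := [pred x : padic_int | `[< exists y, y * x = 1 >]].
Definition padic_inv (x : padic_int) :=
  match pselect (exists y, y * x = 1) with
  | left h => projT1 (cid h) | right _ => x end.

Fact padic_mulVx : {in padic_unit, left_inverse 1 padic_inv *%R}.
Proof.
move=> x /asboolP h; rewrite /padic_inv; case: pselect => // h'.
by case: cid.
Qed.
Fact padic_unitP x y : y * x = 1 -> padic_unit x.
Proof. by move=> h; apply/asboolP; exists y. Qed.
Fact padic_inv_out : {in [predC padic_unit], padic_inv =1 id}.
Proof.
move=> x /asboolPn h; rewrite /padic_inv; case: pselect => // h'.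
Qed.

HB.instance Definition _ := GRing.ComNzRing_hasMulInverse.Build padic_int
  padic_mulVx padic_unitP padic_inv_out.

Let residue_add (x : padic_int) n k :
  (residue x (n + k) = residue x n %[mod q n])%Z.
Proof.
elim: k => [|k IH]; first by rewrite addn0.
rewrite addnS -IH -[LHS](@modz_dvd (q (n + k)%N)); last first.
  by rewrite /q dvdzE /= dvdn_exp2l ?leq_addr.
by rewrite -[in RHS](@modz_dvd (q (n + k)%N)) ?res_mod //
  /q dvdzE /= dvdn_exp2l ?leq_addr.
Qed.

Fact padic_idomain (x y : padic_int) :
  x * y = 0 -> (x == 0) || (y == 0).
Proof.
have nz (z : padic_int) : z != 0 -> exists n, ~~ (q n %| residue z n)%Z.
  move=> /eqP hz; apply/not_existsP => h; apply: hz; apply: padic_int_eq => n.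
  move/negP: (h n); rewrite negbK => /dvdz_mod0P /= ->.
  by rewrite !mod0z.
move=> xy0; case: eqP => //= /eqP /nz [a ha]; apply/negPn/negP => /nz [b hb].
have {}ha : ~~ (q a %| residue x (a + b))%Z.
  apply: contra ha => /dvdz_mod0P h; apply/dvdz_mod0P.
  by rewrite -(residue_add x a b).
have {}hb : ~~ (q b %| residue y (a + b))%Z.
  rewrite addnC; apply: contra hb => /dvdz_mod0P h; apply/dvdz_mod0P.
  by rewrite -(residue_add y b a).
have := congr1 (fun z : padic_int => residue z (a + b)%N) xy0.
move=> /=; rewrite mod0z => /dvdz_mod0P.
rewrite dvdzE abszM /q /= => h.
have pp := valP p.
have x0 : (0 < `|residue x (a + b)%N|)%N.
  by rewrite lt0n; apply: contra ha => /eqP e; rewrite dvdzE e dvdn0.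
have y0 : (0 < `|residue y (a + b)%N|)%N.
  by rewrite lt0n; apply: contra hb => /eqP e; rewrite dvdzE e dvdn0.
move: h ha hb; rewrite !dvdzE /= !pfactor_dvdn ?muln_gt0 ?x0 ?y0 //.
by rewrite lognM//; lia.
Qed.

HB.instance Definition _ :=
  GRing.ComUnitRing_isIntegral.Build padic_int padic_idomain.

End PadicIntegers.

Definition Qp (p : primeT) : fieldType := {fraction padic_int p}.

Definition Zp_in_Qp (p : primeT) : set (Qp p) :=
  range (fun a : padic_int p => (tofrac a : Qp p)).

Section Numbers.
Variable R : realType.

Definition CC : numClosedFieldType := R[i]%C.
Definition toC : R -> CC := real_complex R.

Definition is_algebraic : pred CC :=
  [pred z : CC | `[< algebraicOver (ratr : rat -> CC) z >]].

Fact is_algebraic_divring : divring_closed is_algebraic.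
Proof.
split=> [|x y /asboolP hx /asboolP hy|x y /asboolP hx /asboolP hy];
  apply/asboolP.
- exact: algebraic1.
- exact: algebraic_sub.
- exact: algebraic_div.
Qed.
HB.instance Definition _ :=
  GRing.isDivringClosed.Build CC is_algebraic is_algebraic_divring.

Record Qbar := QbarOf { qbar_val : CC; qbarP : qbar_val \in is_algebraic }.
HB.instance Definition _ := [isSub for qbar_val].
HB.instance Definition _ := [Choice of Qbar by <:].
HB.instance Definition _ := [SubChoice_isSubIntegralDomain of Qbar by <:].
HB.instance Definition _ := [SubIntegralDomain_isSubField of Qbar by <:].

Definition rat_basis (E : set CC) d (e : 'I_d -> CC) :=
  (forall z, E z <-> exists q : 'I_d -> rat, z = \sum_i ratr (q i) * e i) /\
  (forall q : 'I_d -> rat, \sum_i ratr (q i) * e i = 0 -> forall i, q i = 0).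

Definition number_field (L : set CC) :=
  [/\ L 1, forall x y, L x -> L y -> L (x - y),
      forall x y, L x -> L y -> L (x / y)
    & exists d, exists e : 'I_d -> CC, rat_basis L e].

(* Gal(Qbar/L) for a subfield L of C: field endomorphisms of Qbar are
   automorphisms. *)
Definition Gal (L : set CC) : set {rmorphism Qbar -> Qbar} :=
  [set sigma | forall x : Qbar, L (val x) -> sigma x = x].

Definition abelian_ext (E F : set CC) :=
  [/\ number_field F, E `<=` F,
      forall sigma, Gal E sigma ->
        forall x : Qbar, F (val x) -> F (val (sigma x))
    & forall sigma tau, Gal E sigma -> Gal E tau ->
        forall x : Qbar, F (val x) -> sigma (tau x) = tau (sigma x)].

Definition ringint (E : set CC) : set CC :=
  [set z | E z /\ integralOver (intr : int -> CC) z].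

Definition prime_above (p : nat) (P : set CC) :=
  let Zbar := ringint setT in
  [/\ P `<=` Zbar, P p%:R /\ ~ P 1,
      forall x y, P x -> P y -> P (x - y),
      forall x y, Zbar x -> P y -> P (x * y)
    & forall x y, Zbar x -> Zbar y -> P (x * y) -> P x \/ P y].

(* alpha generates the prime ideal P /\ O_E after inverting the integers
   prime to p, i.e. it is a uniformizer at P /\ O_E and a unit at the other
   primes of E above p. *)
Definition local_generator (E : set CC) (p : nat) (P : set CC) (alpha : CC) :=
  [/\ alpha != 0, ringint E alpha, P alpha
    & forall beta, ringint E beta -> P beta ->
      exists2 m : nat, ~~ (p %| m)%N & ringint E (m%:R * beta / alpha)].

Definition residue_card (E P : set CC) (q : nat) :=
  exists rep : 'I_q -> CC, (forall i, ringint E (rep i)) /\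
    forall x, ringint E x -> exists! i, P (x - rep i).

(* The matrix of multiplication by alpha in the basis e. For a field K over
   Q, E (x) K is identified with the commutant in M_d(K) of the matrices of
   the elements of E. *)
Definition mult_matrix d (e : 'I_d -> CC) (alpha : CC) (A : 'M[rat]_d) :=
  forall j, alpha * e j = \sum_i ratr (A i j) * e i.

End Numbers.

Arguments toC {R}.

Definition adele_mx n := forall p : primeT, 'M[Qp p]_n.

Definition Zp_mx (p : primeT) n (g : 'M[Qp p]_n) :=
  forall i j, Zp_in_Qp (g i j).

Definition adele_mul n (g h : adele_mx n) : adele_mx n :=
  fun p => g p *m h p.
Definition adele_inv n (g : adele_mx n) : adele_mx n :=
  fun p => invmx (g p).
Definition adele_one n : adele_mx n := fun p => 1%:M.

Definition GL_Af n : set (adele_mx n) :=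
  [set g | (forall p, g p \in unitmx) /\
    exists B : nat, forall p : primeT, (B < val p)%N ->
      Zp_mx (g p) /\ Zp_mx (invmx (g p))].

Definition congr_level (p : primeT) n (N : nat) (u : 'M[Qp p]_n) :=
  [/\ Zp_mx u, Zp_mx (invmx u)
    & exists2 A : 'M[Qp p]_n, Zp_mx A & u = 1%:M + N%:R *: A].

Definition is_subgroup T (one : T) (mul : T -> T -> T) (inv : T -> T)
    (K : set T) :=
  [/\ K one, forall g h, K g -> K h -> K (mul g h)
    & forall g, K g -> K (inv g)].

Definition cover_compact T (opens : set (set T)) (K : set T) :=
  forall F : set (set T), F `<=` opens -> K `<=` \bigcup_(U in F) U ->
    exists2 s : seq (set T), (forall U, List.In U s -> F U) &
      forall g, K g -> exists2 U, List.In U s & U g.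

(* A closed subscheme of GL_n over k is given by a set of polynomials in the
   matrix entries; over a field of characteristic 0 a closed subgroup is
   determined by its points in the field extensions of k. *)
Definition entry_poly (k : fieldType) n := mpoly.mpoly (n * n) k.

Definition entry_eval (k K : fieldType) (f : k -> K) n (g : 'M[K]_n)
    (P : entry_poly k n) : K :=
  mpoly.mmap f (fun i => mxvec g 0 i) P.

Definition pts (k K : fieldType) (f : k -> K) n (E : set (entry_poly k n)) :
    set 'M[K]_n :=
  [set g | g \in unitmx /\ forall P, E P -> entry_eval f g P = 0].

Definition base_change (k K : fieldType) (f : k -> K) n
    (E : set (entry_poly k n)) : set (entry_poly K n) :=
  [set mpoly.map_mpoly f P | P in E].

Section AlgebraicGroups.
Variable k : fieldType.

Definition alg_subset n (E E' : set (entry_poly k n)) :=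
  forall (K : fieldType) (f : {rmorphism k -> K}), pts f E `<=` pts f E'.

Definition alg_eq n (E E' : set (entry_poly k n)) :=
  forall (K : fieldType) (f : {rmorphism k -> K}), pts f E = pts f E'.

Definition alg_group n (E : set (entry_poly k n)) :=
  forall (K : fieldType) (f : {rmorphism k -> K}),
    is_subgroup 1%:M (@mulmx K n n n) (@invmx K n) (pts f E).

Definition clopen_partition n (E A B : set (entry_poly k n)) :=
  forall (K : fieldType) (f : {rmorphism k -> K}),
    pts f E = pts f A `|` pts f B /\ pts f A `&` pts f B = set0.

Definition alg_empty n (A : set (entry_poly k n)) :=
  forall (K : fieldType) (f : {rmorphism k -> K}), pts f A = set0.

Definition alg_connected n (E : set (entry_poly k n)) :=
  forall A B, clopen_partition E A B -> alg_empty A \/ alg_empty B.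

(* intersection of the open and closed subsets of E containing 1 *)
Definition neutral_component n (E : set (entry_poly k n)) :
    set (entry_poly k n) :=
  [set P | exists A B,
    [/\ clopen_partition E A B, pts idfun A 1%:M & A P]].

Definition zariski_closure n (S : set 'M[k]_n) : set (entry_poly k n) :=
  [set P | forall g, S g -> entry_eval idfun g P = 0].

Definition general_linear n : set (entry_poly k n) := set0.

(* the regular map g |-> det(g)^(-denom) numer(g) from GL_a to b x b
   matrices *)
Record regmap a b := RegMap { numer : 'M[entry_poly k a]_b; denom : nat }.

Definition regapp (K : fieldType) (f : k -> K) a b (phi : regmap a b)
    (g : 'M[K]_a) : 'M[K]_b :=
  (\det g) ^- denom phi *: \matrix_(i, j) entry_eval f g (numer phi i j).

Definition alg_hom a b (E : set (entry_poly k a)) (E' : set (entry_poly k b))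
    (phi : regmap a b) :=
  forall (K : fieldType) (f : {rmorphism k -> K}),
    (forall g, pts f E g -> pts f E' (regapp f phi g)) /\
    (forall g h, pts f E g -> pts f E h ->
      regapp f phi (g *m h) = regapp f phi g *m regapp f phi h).

Definition vanishing_ideal n (E : set (entry_poly k n)) :
    set (entry_poly k n) :=
  [set P | forall (K : fieldType) (f : {rmorphism k -> K}) g,
    pts f E g -> entry_eval f g P = 0].

Definition Lie (K : fieldType) (f : k -> K) n (E : set (entry_poly k n)) :
    set 'M[K]_n :=
  [set A | forall P, vanishing_ideal E P ->
    \sum_i entry_eval f 1%:M (mpoly.mderiv i P) * mxvec A 0 i = 0].

End AlgebraicGroups.

Arguments general_linear {k} n.

Section Shimura.
Variable R : realType.
Local Notation C := (CC R).
Local Notation Qbar := (Qbar R).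

Definition unipotent n (U : set 'M[C]_n) :=
  forall g, U g -> (g - 1%:M) ^+ n = 0.

Definition reductive n (G : set (entry_poly rat n)) :=
  [/\ alg_group G, alg_connected G
    & forall U : set (entry_poly C n),
        alg_group U -> alg_connected U -> alg_subset U (base_change ratr G) ->
        (forall g u, pts (ratr : rat -> C) G g -> pts idfun U u ->
          pts idfun U (g *m u *m invmx g)) ->
        unipotent (pts idfun U) -> pts idfun U = [set 1%:M]].

Definition torus n (T : set (entry_poly rat n)) :=
  [/\ alg_group T, alg_connected T
    & exists2 P : 'M[C]_n, P \in unitmx &
        forall t, pts (ratr : rat -> C) T t ->
          is_diag_mx (P *m t *m invmx P)].

(* S = Res_{C/R} G_m in GL_2: a + b i acts on C = R + R i *)
Definition S_mx (K : fieldType) (a b : K) : 'M[K]_2 :=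
  \matrix_(i, j) (if i == j then a else if (i < j)%N then - b else b).

Definition deligne_torus : set (entry_poly R 2) :=
  zariski_closure [set S_mx a b | a in setT & b in setT].

Definition S_hom n (G : set (entry_poly rat n)) (s : regmap R 2 n) :=
  alg_hom deligne_torus (base_change ratr G) s.

Definition S_real n (s : regmap R 2 n) (z : C) : 'M[R]_n :=
  regapp idfun s (S_mx (complex.Re z) (complex.Im z)).

(* s on S(C) = C^* x C^*, in which S(R) = C^* is the set of the (z, z^* ) *)
Definition S_cplx n (s : regmap R 2 n) (z w : C) : 'M[C]_n :=
  regapp toC s (S_mx ((z + w) / 2%:R) ((z - w) / (2%:R * 'i))).

Definition cochar n (s : regmap R 2 n) (z : C) : 'M[C]_n := S_cplx s z 1.

Definition S_conj n (g : 'M[R]_n) (s s' : regmap R 2 n) :=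
  forall z : C, z != 0 -> S_real s' z = g *m S_real s z *m invmx g.

Definition MT n (G : set (entry_poly rat n)) (s : regmap R 2 n) :
    set (entry_poly rat n) :=
  [set P | exists M, [/\ alg_group M, alg_subset M G, S_hom M s & M P]].

(* the (p, q) part of Ad o s: s(z) acts as z^(-p) (z^* )^(-q) *)
Definition Lie_piece n (G : set (entry_poly rat n)) (s : regmap R 2 n)
    (p q : int) : set 'M[C]_n :=
  [set A | Lie ratr G A /\ forall z : C, z != 0 ->
    let g := map_mx toC (S_real s z) in
    g *m A *m invmx g = (z ^ (- p) * z^* ^ (- q)) *: A].

Definition adjoint_quotient n (G : set (entry_poly rat n)) m
    (Gad : set (entry_poly rat m)) (pr : regmap rat n m) :=
  [/\ alg_group Gad, alg_hom G Gad pr,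
      (forall h, pts (ratr : rat -> C) Gad h ->
        exists2 g, pts ratr G g & regapp ratr pr g = h)
    & (forall g, pts (ratr : rat -> C) G g ->
        (regapp ratr pr g = 1%:M <->
         forall h, pts ratr G h -> g *m h = h *m g))].

(* conjugation by a defines a Cartan involution: the attached real form is
   compact *)
Definition cartan_involution m (H : set (entry_poly rat m)) (a : 'M[R]_m) :=
  compact [set g : 'M[C]_m | pts ratr H g /\
    map_mx toC a *m map_mx Num.conj g *m invmx (map_mx toC a) = g].

Definition direct_product m (H N1 N2 : set (entry_poly rat m)) :=
  [/\ alg_group N1, alg_group N2,
      (forall a b, pts (ratr : rat -> C) N1 a -> pts ratr N2 b ->
        pts ratr H (a *m b) /\ a *m b = b *m a),
      (forall g, pts (ratr : rat -> C) H g -> exists a b,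
        [/\ pts ratr N1 a, pts ratr N2 b & g = a *m b])
    & (pts ratr N1 `&` pts ratr N2 = [set (1%:M : 'M[C]_m)])].

Record shimura_datum n (G : set (entry_poly rat n))
    (X : set (regmap R 2 n)) : Prop := {
  sd_reductive : reductive G;
  sd_class : exists2 s0, S_hom G s0 &
    forall s, X s <-> S_hom G s /\ exists2 g, pts ratr G g & S_conj g s0 s;
  sd_hodge : forall s, X s -> forall A, Lie ratr G A -> exists A1 A2 A3,
    [/\ Lie_piece G s (-1) 1 A1, Lie_piece G s 0 0 A2,
        Lie_piece G s 1 (-1) A3 & A = A1 + A2 + A3];
  sd_adjoint : exists m Gad (pr : regmap rat n m),
    adjoint_quotient G Gad pr /\ forall s, X s ->
      cartan_involution Gad (regapp ratr pr (S_real s 'i)) /\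
      forall N1 N2, direct_product Gad N1 N2 ->
        (forall z : C, z != 0 -> pts ratr N2 (regapp ratr pr (S_real s z))) ->
        pts ratr N1 = [set (1%:M : 'M[C]_m)];
  sd_MT : forall M, alg_group M -> alg_subset M G ->
    (forall s, X s -> alg_subset (MT G s) M) -> alg_eq M G }.

(* E(G, X) for s in X: the field of definition of the conjugacy class of the
   cocharacter of s *)
Definition reflex_field n (G : set (entry_poly rat n)) (s : regmap R 2 n) :
    set C :=
  [set z | forall sigma : {rmorphism C -> C}, bijective sigma ->
    (exists2 g, pts ratr G g & forall w, w != 0 ->
      map_mx sigma (cochar s w) = g *m cochar s (sigma w) *m invmx g) ->
    sigma z = z].

Definition G_Af n (G : set (entry_poly rat n)) : set (adele_mx n) :=
  [set g | GL_Af g /\ forall p, pts ratr G (g p)].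

Definition open_Af n (G : set (entry_poly rat n)) : set (set (adele_mx n)) :=
  [set U | U `<=` G_Af G /\ forall g, U g -> exists2 N : nat, (0 < N)%N &
    forall u, G_Af G u -> (forall p, congr_level N (u p)) ->
      U (adele_mul g u)].

Definition open_Ql n (G : set (entry_poly rat n)) (l : primeT) :
    set (set 'M[Qp l]_n) :=
  [set U | U `<=` pts ratr G /\ forall g, U g -> exists2 N : nat, (0 < N)%N &
    forall u, pts ratr G u -> congr_level N u -> U (g *m u)].

Definition compact_open_subgroup n (G : set (entry_poly rat n))
    (K : set (adele_mx n)) :=
  [/\ is_subgroup (@adele_one n) (@adele_mul n) (@adele_inv n) K,
      open_Af G K & cover_compact (open_Af G) K].

Definition compact_open_subgroup_at n (G : set (entry_poly rat n))
    (l : primeT) (Kl : set 'M[Qp l]_n) :=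
  [/\ is_subgroup 1%:M (@mulmx _ n n n) (@invmx _ n) Kl,
      open_Ql G Kl & cover_compact (open_Ql G (l := l)) Kl].

(* K = K_l x K^l, where K^l is the projection of K away from l *)
Definition splits_at n (G : set (entry_poly rat n)) (l : primeT)
    (K : set (adele_mx n)) (Kl : set 'M[Qp l]_n) :=
  forall g, K g <->
    [/\ G_Af G g, Kl (g l)
      & exists2 h, K h & forall p, p != l -> g p = h p].

(* x lies in the subgroup of Omega^* generated by the eigenvalues of g *)
Definition eigen_group (F Omega : fieldType) (j : F -> Omega) n
    (g : 'M[F]_n) (x : Omega) :=
  exists2 s : seq (Omega * int),
    (forall a, a \in s -> eigenvalue (map_mx j g) a.1) &
    x = \prod_(a <- s) a.1 ^ a.2.

(* The condition on a root of unity zeta does not depend on the algebraically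
   closed field Omega nor on the embeddings. *)
Definition neat n (K : set (adele_mx n)) :=
  forall g, K g -> forall zeta : Qbar,
    (exists2 m : nat, (0 < m)%N & zeta ^+ m = 1) ->
    (forall p, exists (Omega : closedFieldType)
       (j : {rmorphism Qp p -> Omega}) (i : {rmorphism Qbar -> Omega}),
       eigen_group j (g p) (i zeta)) ->
    zeta = 1.

(* Ideles of E, written in a Q-basis e of E *)
Record idele d := Idele { idele_inf : 'M[R]_d; idele_fin : adele_mx d }.

Definition idele_mul d (t u : idele d) :=
  Idele (idele_inf t *m idele_inf u)
        (adele_mul (idele_fin t) (idele_fin u)).

Definition is_idele (E : set C) d (e : 'I_d -> C) (t : idele d) :=
  [/\ idele_inf t \in unitmx, GL_Af (idele_fin t)
    & forall alpha A, E alpha -> mult_matrix e alpha A ->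
      map_mx ratr A *m idele_inf t = idele_inf t *m map_mx ratr A /\
      forall p, map_mx ratr A *m idele_fin t p =
                idele_fin t p *m map_mx ratr A].

Definition trivial_on (F : set C) (sigma : Qbar -> Qbar) :=
  forall x : Qbar, F (val x) -> sigma x = x.

(* The Artin reciprocity map of E, up to the choice of liftings from E^ab to
   Qbar, normalised so that uniformizers correspond to geometric Frobenius
   elements. *)
Record artin_map (E : set C) d (e : 'I_d -> C)
    (art : idele d -> {rmorphism Qbar -> Qbar}) : Prop := {
  art_gal : forall t, is_idele E e t -> Gal E (art t);
  art_mul : forall F t u, abelian_ext E F -> is_idele E e t ->
    is_idele E e u ->
    forall x : Qbar, F (val x) -> art (idele_mul t u) x = art t (art u x);
  art_continuous : forall F, abelian_ext E F ->
    exists N : nat, exists eps : R, [/\ (0 < N)%N, 0 < eps &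
      forall t, is_idele E e t ->
        (forall i j, `|(idele_inf t - 1%:M) i j| < eps) ->
        (forall p, congr_level N (idele_fin t p)) -> trivial_on F (art t)];
  art_principal : forall F alpha A, abelian_ext E F -> E alpha ->
    alpha != 0 -> mult_matrix e alpha A ->
    trivial_on F (art (Idele (map_mx ratr A) (fun p => map_mx ratr A)));
  art_frobenius : forall F, abelian_ext E F -> exists B : nat,
    forall (p : primeT) P q alpha A t,
      (B < val p)%N -> prime_above (val p) P -> residue_card E P q ->
      local_generator E (val p) P alpha -> mult_matrix e alpha A ->
      idele_inf t = 1%:M -> idele_fin t p = map_mx ratr A ->
      (forall p', p' != p -> idele_fin t p' = 1%:M) ->
      forall y : Qbar, ringint F (val y) -> P (val (y - art t y ^+ q)) }.

(* N_{E/Q} o mu_s : Res_{E/Q} G_m -> GL_n for a cocharacter mu_s defined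
   over E; it is determined by its values on E^*. *)
Definition reciprocity_hom n (s : regmap R 2 n) (E : set C) d (e : 'I_d -> C)
    (r : regmap rat d n) :=
  forall tau : 'I_d -> {rmorphism C -> C},
    (forall i j, i != j -> exists2 x, E x & tau i x != tau j x) ->
    forall alpha A, E alpha -> alpha != 0 -> mult_matrix e alpha A ->
      map_mx ratr (regapp idfun r A) =
      \prod_(i < d) map_mx (tau i) (cochar s alpha).

(* A locally closed subset of P^N, and a map to it from X x G(A_f) written
   in homogeneous coordinates *)
Record sh_model n := ShModel {
  pdim : nat;
  zeros : set (mpoly.mpoly pdim.+1 C);
  nonzeros : set (mpoly.mpoly pdim.+1 C);
  unif : regmap R 2 n -> adele_mx n -> 'rV[C]_pdim.+1 }.

Arguments zeros [n] s _.
Arguments nonzeros [n] s _.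

Definition proj_eval N (c : 'rV[C]_N) (P : mpoly.mpoly N C) : C :=
  mpoly.mmap idfun (fun i => c 0 i) P.

Definition homogeneous N (P : mpoly.mpoly N C) :=
  exists d : nat, forall a c,
    proj_eval (a *: c) P = a ^+ d * proj_eval c P.

Definition proj_eq N (c c' : 'rV[C]_N) := exists2 a : C, a != 0 & c' = a *: c.

Definition proj_rational N (L : set C) (c : 'rV[C]_N) :=
  exists2 c', proj_eq c c' & forall i, L (c' 0 i).

(* c has algebraic homogeneous coordinates, and sigma maps c to c' *)
Definition gal_maps N (sigma : Qbar -> Qbar) (c c' : 'rV[C]_N) :=
  exists b : 'rV[Qbar]_N,
    proj_eq c (map_mx val b) /\ proj_eq c' (map_mx (val \o sigma) b).

Definition in_model n (S : sh_model n) (c : 'rV[C]_(pdim S).+1) :=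
  [/\ c != 0, forall P, zeros S P -> proj_eval c P = 0
    & exists2 P, nonzeros S P & proj_eval c P != 0].

Arguments in_model [n] S c.

Definition smooth_model n (S : sh_model n) :=
  forall c, in_model S c ->
    exists r, exists F : 'I_r -> mpoly.mpoly (pdim S).+1 C, exists h,
    [/\ homogeneous h /\ (forall i, homogeneous (F i)), proj_eval c h != 0,
        forall b, b != 0 -> proj_eval b h != 0 ->
          (in_model S b <-> forall i, proj_eval b (F i) = 0)
      & \rank (\matrix_(i < r, j < (pdim S).+1) proj_eval c (mpoly.mderiv j (F i))) = r].

(* f : X -> C is complex differentiable at s, for the complex structure on X
   for which the Hodge filtration varies holomorphically: the differential of
   g |-> f(g s) at 1 extends to a C-linear form on Lie(G)_C killing
   F^0 = Lie^{0,0} + Lie^{1,-1}. *)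
Definition complex_differentiable n (G : set (entry_poly rat n))
    (X : set (regmap R 2 n)) (f : regmap R 2 n -> C) (s : regmap R 2 n) :=
  exists D : 'M[C]_n,
    (forall A, Lie_piece G s 0 0 A \/ Lie_piece G s 1 (-1) A ->
       \tr (D *m A) = 0) /\
    forall eps : R, 0 < eps -> exists2 delta : R, 0 < delta &
      forall g s', pts ratr G g -> X s' -> S_conj g s s' ->
        (forall i j, `|(g - 1%:M) i j| < delta) ->
        `|f s' - f s - \tr (D *m map_mx toC (g - 1%:M))| <=
          toC (eps * \sum_i \sum_j `|(g - 1%:M) i j|).

(* (s, g) and (s', g') have the same class in G(Q)\X x G(A_f)/K *)
Definition same_class n (G : set (entry_poly rat n)) (K : set (adele_mx n))
    (s : regmap R 2 n) (g : adele_mx n) (s' : regmap R 2 n)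
    (g' : adele_mx n) :=
  exists gamma k,
    [/\ pts idfun G gamma, K k, S_conj (map_mx ratr gamma) s s'
      & forall p, g' p = map_mx ratr gamma *m g p *m k p].

(* S is the canonical model of Sh_K(G, X), for K neat: a smooth
   quasi-projective variety over E(G, X), whose complex points are
   biholomorphic to G(Q)\X x G(A_f)/K and on whose special points
   Gal(Qbar/E(T, s)) acts through the reciprocity law. *)
Record canonical_model_at n (G : set (entry_poly rat n))
    (X : set (regmap R 2 n)) (K : set (adele_mx n)) (S : sh_model n) :
    Prop := {
  cm_defined : forall P, zeros S P \/ nonzeros S P -> homogeneous P /\
    forall s, X s -> forall m, reflex_field G s (mpoly.mcoeff m P);
  cm_smooth : smooth_model S;
  cm_in : forall s g, X s -> G_Af G g -> in_model S (unif S s g);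
  cm_class : forall s g s' g', X s -> G_Af G g -> X s' -> G_Af G g' ->
    (proj_eq (unif S s g) (unif S s' g') <-> same_class G K s g s' g');
  cm_onto : forall c, in_model S c ->
    exists s g, [/\ X s, G_Af G g & proj_eq (unif S s g) c];
  cm_holomorphic : forall s g i j, X s -> G_Af G g -> unif S s g 0 j != 0 ->
    complex_differentiable G X
      (fun s' => unif S s' g 0 i / unif S s' g 0 j) s;
  cm_special : forall (T : set (entry_poly rat n)) s,
    torus T -> alg_subset T G -> X s -> S_hom T s ->
    let E := reflex_field T s in
    forall d (e : 'I_d -> C) art r, rat_basis E e -> artin_map E e art ->
    reciprocity_hom s E e r ->
    forall t g (sigma : {rmorphism Qbar -> Qbar}),
      is_idele E e t -> G_Af G g -> Gal E sigma ->
      (forall F, abelian_ext E F ->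
         forall x : Qbar, F (val x) -> sigma x = art t x) ->
      gal_maps sigma (unif S s g)
        (unif S s (adele_mul (fun p => regapp ratr r (idele_fin t p)) g)) }.

Definition canonical_model n (G : set (entry_poly rat n))
    (X : set (regmap R 2 n)) (Sh : set (adele_mx n) -> sh_model n) :=
  forall K, compact_open_subgroup G K -> neat K ->
    canonical_model_at G X K (Sh K).

(* rho is the homomorphism Gal(Qbar/L) -> K with sigma [s, 1] = [s, rho sigma]
   in Sh(G, X) = lim Sh_K'(G, X) *)
Definition galois_rep n (G : set (entry_poly rat n))
    (Sh : set (adele_mx n) -> sh_model n) (K : set (adele_mx n))
    (L : set C) (s : regmap R 2 n)
    (rho : {rmorphism Qbar -> Qbar} -> adele_mx n) :=
  [/\ forall sigma, Gal L sigma -> K (rho sigma),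
      forall sigma tau : {rmorphism Qbar -> Qbar}, Gal L sigma -> Gal L tau ->
        rho (sigma \o tau) = adele_mul (rho sigma) (rho tau)
    & forall K', compact_open_subgroup G K' -> K' `<=` K ->
        forall sigma, Gal L sigma ->
        gal_maps sigma (unif (Sh K') s (@adele_one n))
                       (unif (Sh K') s (rho sigma))].

Definition l_adic_image n (l : primeT) (L : set C)
    (rho : {rmorphism Qbar -> Qbar} -> adele_mx n) : set 'M[Qp l]_n :=
  [set rho sigma l | sigma in Gal L].

Arguments l_adic_image [n] l L rho _.

Record shimura_point n (G : set (entry_poly rat n)) (X : set (regmap R 2 n))
    (Sh : set (adele_mx n) -> sh_model n) (l : primeT)
    (K : set (adele_mx n)) (Kl : set 'M[Qp l]_n) (L : set C)
    (s : regmap R 2 n) (rho : {rmorphism Qbar -> Qbar} -> adele_mx n) :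
    Prop := {
  sp_datum : shimura_datum G X;
  sp_canonical : canonical_model G X Sh;
  sp_level : compact_open_subgroup G K;
  sp_neat : neat K;
  sp_level_l : compact_open_subgroup_at G Kl;
  sp_splits : splits_at G K Kl;
  sp_field : number_field L;
  sp_reflex : reflex_field G s `<=` L;
  sp_reflex_MT : reflex_field (MT G s) s `<=` L;
  sp_point : X s;
  sp_rational : proj_rational L (unif (Sh K) s (@adele_one n));
  sp_rho : galois_rep G Sh K L s rho;
  sp_connected : alg_connected (zariski_closure (l_adic_image l L rho)) }.

Definition mumford_tate_equality n (G : set (entry_poly rat n)) (l : primeT)
    (L : set C) (s : regmap R 2 n)
    (rho : {rmorphism Qbar -> Qbar} -> adele_mx n) :=
  alg_eq (neutral_component (zariski_closure (l_adic_image l L rho)))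
         (base_change ratr (MT G s)).

(* A triple (V_Z, s, rho): V_Q = Q^m, V_Z is the lattice spanned by the
   columns of lattice, and hodge is the action of S(R) = C^* on V_R (its value at 0 is irrelevant, as are the
   values of galois outside Gal(Qbar/L)). Polarisability, continuity of rho
   and the inclusion End_HS (x) Z_l in End_Gal are not part of the record: they
   are used only for the triples of Shimura type, on which the isogeny
   conjecture puts no further condition; the inclusion is one half of the
   equality in is_tate. *)
Record inf_l_structure (l : primeT) := InfL {
  vdim : nat;
  lattice : 'M[rat]_vdim;
  hodge : C -> 'M[R]_vdim;
  galois : {rmorphism Qbar -> Qbar} -> 'M[Qp l]_vdim }.

Section InfL.
Variables (l : primeT) (L : set C) (V : inf_l_structure l).
Let m := vdim V.

Definition End_HS : set 'M[rat]_m :=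
  [set phi | (forall i j,
      (invmx (lattice V) *m phi *m lattice V) i j \is a Num.int) /\
    forall z : C, z != 0 ->
      map_mx ratr phi *m hodge V z = hodge V z *m map_mx ratr phi].

Definition End_Gal : set 'M[Qp l]_m :=
  [set phi |
    Zp_mx (invmx (map_mx ratr (lattice V)) *m phi *m map_mx ratr (lattice V))
    /\ forall sigma, Gal L sigma ->
         phi *m galois V sigma = galois V sigma *m phi].

(* the image of End_HS (x) Z_l in End(V_{Q_l}) *)
Definition End_HS_l : set 'M[Qp l]_m :=
  [set phi | exists r, exists (c : 'I_r -> Qp l) (psi : 'I_r -> 'M[rat]_m),
    (forall i, Zp_in_Qp (c i) /\ End_HS (psi i)) /\
    phi = \sum_i c i *: map_mx ratr (psi i)].

Definition galois_stable (W : {vspace 'cV[Qp l]_m}) :=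
  forall sigma, Gal L sigma -> forall v, v \in W -> galois V sigma *m v \in W.

Definition semisimple := forall W, galois_stable W ->
  exists W', [/\ galois_stable W', (W + W')%VS = fullv & (W :&: W')%VS = 0%VS].

Definition is_tate := semisimple /\ End_HS_l = End_Gal.

End InfL.

Definition shimura_structure (l : primeT) n m (mu : regmap rat n m)
    (B : 'M[rat]_m) (s : regmap R 2 n)
    (rho : {rmorphism Qbar -> Qbar} -> adele_mx n) : inf_l_structure l :=
  InfL B (fun z => regapp ratr mu (S_real s z))
         (fun sigma => regapp ratr mu (rho sigma l)).

(* mu is a representation, and the lattice spanned by the columns of B is
   stable under mu(Kl) *)
Definition lattice_rep n (G : set (entry_poly rat n)) (l : primeT)
    (Kl : set 'M[Qp l]_n) m (mu : regmap rat n m) (B : 'M[rat]_m) :=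
  [/\ alg_hom G (general_linear m) mu, B \in unitmx
    & forall g, Kl g ->
      let h := invmx (map_mx ratr B) *m regapp ratr mu g *m map_mx ratr B in
      Zp_mx h /\ Zp_mx (invmx h)].

Definition shimura_type (l : primeT) (L : set C) (V : inf_l_structure l) :=
  exists n G X Sh K (Kl : set 'M[Qp l]_n) (s : regmap R 2 n) rho m (mu : regmap rat n m) B,
    [/\ shimura_point G X Sh K Kl L s rho, lattice_rep G Kl mu B
      & V = shimura_structure l mu B s rho].

Definition generalised_mumford_tate := forall n G X Sh l K Kl L s rho,
  @shimura_point n G X Sh l K Kl L s rho -> mumford_tate_equality G l L s rho.

Definition isogeny_conjecture := forall l L (V : inf_l_structure l),
  shimura_type L V -> is_tate L V.

End Shimura.

(* Main.v *)
(* Let M = MT(s), let Gamma be the image of the l-adic representation and H its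
   Zariski closure, which is connected by assumption.

   The key fact is that every rational representation of G restricts to a
   semisimple representation of M, so that M-stable subspaces have M-equivariant
   projections. The Q-algebra A spanned by M has a trace radical, and it suffices
   to find an M-equivariant rational projection e onto its kernel. The preimage
   in M(C) of the compact form of G^ad is bounded modulo the centre of G, whose
   unipotent one-parameter subgroups are trivial as G is reductive; hence it
   fixes a point of the affine space of projections onto the kernel commuting
   with the centre. Differentiating along exponential curves, this projection
   commutes with Lie(M); so does a rational component of it, which therefore
   commutes with the cocharacters of s and, by minimality of M, with M. Once the
   radical vanishes, a Casimir element averages any projection.

   If H = M, then semisimplicity, descent of commutants from Q_l to Q, and the
   saturation of the lattice of rational endomorphisms give the Tate property.
   Conversely, apply the Tate property to the polynomials of degree <= d on
   matrices under translation, with a lattice provided by compactness of K_l.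
   The equivariant projection onto the polynomials vanishing on M is rational,
   hence Galois equivariant, so Gamma is contained in M; the one onto those
   vanishing on Gamma is a combination of Hodge endomorphisms, hence
   M-equivariant, so M is contained in H. *)

Require Import Defs.
From HB Require Import structures.
From mathcomp Require Import all_boot all_order all_algebra all_field.
From mathcomp Require Import complex polydiv.
From mathcomp Require mpoly.
From mathcomp Require Import ring lra zify.
From mathcomp Require Import all_classical all_reals all_analysis.
Import -(notations) mpoly.
Set Implicit Arguments.
Unset Strict Implicit.
Unset Printing Implicit Defensive.
Import Order.TTheory GRing.Theory Num.Theory numFieldNormedType.Exports.
Local Open Scope classical_set_scope.
Local Open Scope ring_scope.

(** * Specialisation of points and rational descent *)

(** No integration over a compact group is used: the fixed point comes from minimising a strictly
    convex function on orbits, and all limits are taken along one free ultrafilter, so that no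
    subsequences have to be chosen. Compactness is known only for a real form of the adjoint group.
    Surjectivity on complex points gives lifts to [G] without any control of their size, and a Baire
    category argument supplies a uniform bound. A second constraint is that groups are compared
    through their points in every field extension. A vanishing statement over an extension [F] is
    split along coefficients linearly independent over the rationals, and each rational component is
    shown to vanish by moving an offending point to an extension of [F]. This one device gives the
    rational structure of ideals, Lie algebras and commutants, and turns a complex projection into a
    rational one. As the enveloping algebra and its Casimir element are rational, the semisimplicity
    won by analysis over the complex numbers becomes available over [Q_l]. *)

Lemma min_measure T (S : set T) (h : T -> nat) :
  (exists x, S x) -> exists2 x, S x & forall y, S y -> (h x <= h y)%N.
Proof.
move=> [x0 Sx0].
have ex : exists n, `[< exists2 x, S x & h x = n >].
  by exists (h x0); apply/asboolP; exists x0.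
case: (ex_minnP ex) => n /asboolP [x Sx hx] nmin.
exists x => // y Sy; rewrite hx; apply: nmin; apply/asboolP.
by exists y.
Qed.

(** * Extending a homomorphism to one more generator *)

Section ExtendHom.
Variables (A : comNzRingType) (K' : fieldType) (u : {rmorphism A -> K'}).
Variable x : K'.

Definition root_eval : {poly A} -> K' := fun p => (map_poly u p).[x].

Lemma root_eval_is_zmod : zmod_morphism root_eval.
Proof. by move=> p q; rewrite /root_eval rmorphB hornerD hornerN. Qed.
Lemma root_eval_is_monoid : monoid_morphism root_eval.
Proof.
split; first by rewrite /root_eval rmorph1 hornerC.
by move=> p q; rewrite /root_eval rmorphM hornerM.
Qed.
HB.instance Definition _ := GRing.isZmodMorphism.Build _ _ root_eval
  root_eval_is_zmod.
HB.instance Definition _ := GRing.isMonoidMorphism.Build _ _ root_eval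
  root_eval_is_monoid.

Lemma root_evalC a : root_eval a%:P = u a.
Proof. by rewrite /root_eval map_polyC hornerC. Qed.

Lemma root_evalX : root_eval 'X = x.
Proof. by rewrite /root_eval map_polyX hornerX. Qed.

Lemma root_evalZ a p : root_eval (a *: p) = u a * root_eval p.
Proof. by rewrite -mul_polyC rmorphM /= root_evalC. Qed.

Lemma root_evalE p q : map_poly u p = map_poly u q -> root_eval p = root_eval q.
Proof. by rewrite /root_eval => ->. Qed.

(** Truncation removes the top coefficients lying in the kernel of [u]. When the image is nonzero,
    the leading coefficient then survives under [u]; [tight] records this. *)
Definition utrunc p : {poly A} := \poly_(i < size (map_poly u p)) p`_i.

Lemma map_utrunc p : map_poly u (utrunc p) = map_poly u p.
Proof.
apply/polyP => i; rewrite !coef_map coef_poly; case: ltnP => // hi.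
by rewrite raddf0 -coef_map nth_default.
Qed.

Lemma size_utrunc p : size (utrunc p) = size (map_poly u p).
Proof.
by apply/anti_leq; rewrite size_poly /= -{1}map_utrunc; exact: size_poly.
Qed.

Definition tight (p : {poly A}) := size p = size (map_poly u p).

Lemma tight_lead p : tight p -> map_poly u p != 0 -> u (lead_coef p) != 0.
Proof.
move=> tp; rewrite -lead_coef_eq0; congr (_ != _).
by rewrite /lead_coef coef_map tp.
Qed.

(** Over the ring [A] only pseudo-division is available. Tightness of [d] ensures that the
    multiplier, a power of the leading coefficient, is not killed by [u]. *)
Lemma divide_tight d p : tight d -> map_poly u d != 0 ->
  exists k c r, lead_coef d ^+ k *: p = c * d + r /\
    (size (map_poly u r) < size (map_poly u d))%N.
Proof.
move=> td d0.
exists (Pdiv.Ring.rscalp p d), (Pdiv.Ring.rdivp p d), (Pdiv.Ring.rmodp p d).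
split; first exact: Pdiv.ComRing.rdivp_eq.
rewrite -td; apply: leq_ltn_trans (size_poly _ _) _.
apply: Pdiv.CommonRing.ltn_rmodpN0.
by apply: contraNneq d0 => ->; rewrite rmorph0.
Qed.

(** Euclid's algorithm with denominators cleared. A combination [d] of [p] and [q] of least size
    divides both, up to multipliers that survive under [u]. As [x] is not a root of [q], it is not a
    root of [d]; it is then a root of the cofactor of [p], and minimality of [p] leaves [d]
    constant. *)
Lemma bezout_minpoly p q : map_poly u p != 0 -> root_eval p = 0 ->
  (forall r, map_poly u r != 0 -> root_eval r = 0 ->
     (size (map_poly u p) <= size (map_poly u r))%N) ->
  root_eval q != 0 ->
  exists v w c, u c != 0 /\ map_poly u (v * p + w * q) = (u c)%:P.
Proof.
move=> p0 xp pmin xq.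
pose S d := [/\ tight d, map_poly u d != 0
  & exists v w, map_poly u d = map_poly u (v * p + w * q)].
have trS d v w : map_poly u d != 0 -> map_poly u d = map_poly u (v * p + w * q) ->
    S (utrunc d).
  move=> d0 e; split; rewrite /tight ?map_utrunc ?size_utrunc //.
  by exists v, w.
have [d [td d0 [v [w e]]] dmin] : exists2 d, S d &
    forall d', S d' -> (size d <= size d')%N.
  apply: min_measure; exists (utrunc p); apply: (trS p 1 0) => //.
  by rewrite mul1r mul0r addr0.
have divs p1 : (exists v w, map_poly u p1 = map_poly u (v * p + w * q)) ->
    exists a c, u a != 0 /\ map_poly u (a *: p1) = map_poly u (c * d).
  move=> [v1 [w1 e1]]; have [k [c [r [ed hr]]]] := divide_tight p1 td d0.
  set a := lead_coef d ^+ k in ed.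
  exists a, c; split; first by rewrite rmorphXn expf_neq0 ?tight_lead.
  rewrite ed rmorphD /=.
  have [->|r0] := eqVneq (map_poly u r) 0; first by rewrite addr0.
  have: S (utrunc r).
    apply: (trS r (a *: v1 - c * v) (a *: w1 - c * w)) => //.
    have -> : r = a *: p1 - c * d by rewrite ed addrC addKr.
    rewrite rmorphB /= map_polyZ /= rmorphM /= e1 e.
    rewrite -!mul_polyC !(rmorphD, rmorphB, rmorphM) /= !map_polyC /=; ring.
  by move=> /dmin; rewrite td size_utrunc leqNgt hr.
have [a [c [ua ec]]] : exists a c, u a != 0 /\
    map_poly u (a *: p) = map_poly u (c * d).
  by apply: divs; exists 1, 0; rewrite mul1r mul0r addr0.
have [a' [c' [ua' ec']]] : exists a c, u a != 0 /\
    map_poly u (a *: q) = map_poly u (c * d).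
  by apply: divs; exists 0, 1; rewrite mul1r mul0r add0r.
have xd : root_eval d != 0.
  apply: contraNneq xq => xd.
  move/eqP: (root_evalE ec').
  by rewrite root_evalZ rmorphM /= xd mulr0 mulf_eq0 (negPf ua').
have xc : root_eval c = 0.
  move/eqP: (root_evalE ec); rewrite root_evalZ xp mulr0 rmorphM /=.
  by rewrite eq_sym mulf_eq0 (negPf xd) orbF => /eqP.
have pZ0 : map_poly u (a *: p) != 0 by rewrite map_polyZ scaler_eq0 negb_or ua.
have c0 : map_poly u c != 0.
  by apply: contraNneq pZ0 => c0; rewrite ec rmorphM /= c0 mul0r.
have := pmin _ c0 xc.
have <- : size (map_poly u (c * d)) = size (map_poly u p).
  by rewrite -ec map_polyZ size_scale.
rewrite rmorphM size_mul //= => sd.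
have s1 : size (map_poly u d) = 1%N.
  move: c0 d0 sd; rewrite -!size_poly_gt0.
  by case: (size (map_poly u c)) (size (map_poly u d)) => // m [] // k; lia.
have ed : map_poly u d = (u d`_0)%:P by rewrite -coef_map; apply: size1_polyC; rewrite s1.
exists v, w, (d`_0); rewrite -e; split=> //.
by move: d0; rewrite ed polyC_eq0.
Qed.

End ExtendHom.

(* Homs from a finitely generated subring of a field to an algebraically closed
   field extend, away from the zeros of a nonzero element. *)
Definition separated (A : comNzRingType) (K' Om : fieldType) (k : fieldType)
    (io : {rmorphism k -> A}) (ph0 : {rmorphism k -> Om})
    (u : {rmorphism A -> K'}) :=
  forall a, u a != 0 -> exists phi : {rmorphism A -> Om},
    [/\ forall b, u b = 0 -> phi b = 0, phi a != 0
      & forall c, phi (io c) = ph0 c].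

(** If [x] is transcendental over the image of [A], it may be sent to any element that is not a root
    of the image of [q]. If it is algebraic, it has to go to a root of the image of a minimal
    polynomial [p], and a Bezout relation prevents [q] from vanishing there. *)
Lemma separated_poly (A : comNzRingType) (K' k : fieldType)
    (Om : closedFieldType) (io : {rmorphism k -> A})
    (ph0 : {rmorphism k -> Om}) (u : {rmorphism A -> K'}) (x : K') :
  separated io ph0 u ->
  separated (polyC \o io : {rmorphism k -> {poly A}}) ph0 (root_eval u x).
Proof.
move=> sepA q xq.
have ev0 (phi : {rmorphism A -> Om}) p : (forall b, u b = 0 -> phi b = 0) ->
    map_poly u p = 0 -> map_poly phi p = 0.
  move=> kphi /polyP e; apply/polyP => i; move: (e i).
  by rewrite !coef_map !coef0; apply: kphi.
have [[p [p0 xp]]|tr] :=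
    pselect (exists p, map_poly u p != 0 /\ root_eval u x p = 0); last first.
  have [i ui] : exists i, u q`_i != 0.
    apply/not_existsP => h; move/eqP: xq; apply.
    rewrite /= /root_eval (_ : map_poly u q = 0) ?horner0 //.
    apply/polyP => i; rewrite coef_map coef0; apply/eqP.
    by have /negP := h i; rewrite negbK.
  have [phi [kphi phiq hphi]] := sepA _ ui.
  have [z qz] : exists z, ~~ root (map_poly phi q) z.
    apply/closed_nonrootP; apply: contraNneq phiq => /polyP /(_ i).
    by rewrite coef_map coef0 => ->.
  exists (root_eval phi z); split=> // [p xp|c].
    rewrite /= /root_eval ev0 ?horner0 //.
    by apply: contra_notP tr => /eqP p0; exists p.
  by rewrite /= root_evalC hphi.
have [p1 [p10 xp1] pmin] : exists2 p, (map_poly u p != 0 /\ root_eval u x p = 0)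
    & forall r, map_poly u r != 0 /\ root_eval u x r = 0 ->
     (size (map_poly u p) <= size (map_poly u r))%N.
  by apply: min_measure; exists p.
move: p p0 xp => _ _ _.
have [p [tp p0 xp]] : exists p, [/\ tight u p, map_poly u p != 0 &
    root_eval u x p = 0 /\ forall r, map_poly u r != 0 ->
      root_eval u x r = 0 -> (size (map_poly u p) <= size (map_poly u r))%N].
  exists (utrunc u p1); split; rewrite /tight ?map_utrunc ?size_utrunc //.
  rewrite (root_evalE x (map_utrunc u p1)); split=> // *; exact: pmin.
case: xp => {p1 p10 xp1 pmin} xp pmin.
have [v [w [c [uc ebez]]]] := bezout_minpoly p0 xp pmin xq.
(* The leading coefficient must survive for the image of [p] to have a root, and [c] for the Bezout
   relation to keep [q] nonzero at that root. *)
have [phi [kphi phia hphi]] : exists phi : {rmorphism A -> Om},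
    [/\ forall b, u b = 0 -> phi b = 0, phi (lead_coef p * c) != 0
      & forall c, phi (io c) = ph0 c].
  by apply: sepA; rewrite rmorphM mulf_neq0 // tight_lead.
move: phia; rewrite rmorphM mulf_eq0 negb_or => /andP[phil phic].
have sp : (1 < size (map_poly phi p))%N.
  have -> : size (map_poly phi p) = size p.
    apply/anti_leq; rewrite size_poly /= leqNgt; apply: contra phil => h.
    rewrite /lead_coef -coef_map nth_default //; case: (size p) h => // n.
  rewrite tp ltn_neqAle size_poly_gt0 p0 andbT eq_sym.
  apply: contraNneq p0 => s1; move: xp.
  by rewrite /root_eval (size1_polyC (eq_leq s1)) hornerC => ->.
have [z /eqP pz] : exists z, root (map_poly phi p) z.
  by apply/closed_rootP; rewrite neq_ltn sp orbT.
exists (root_eval phi z); split=> [b xb||e]; first 1 last.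
- apply: contra_neq phic => qz.
  have /(congr1 (fun p => p.[z])) :
      map_poly phi (v * p + w * q) = (phi c)%:P.
    apply/eqP; rewrite -map_polyC -subr_eq0 -rmorphB /=; apply/eqP; apply: ev0 => //.
    by rewrite rmorphB /= ebez map_polyC subrr.
  rewrite hornerC => <-; rewrite rmorphD !rmorphM hornerD !hornerM pz mulr0 add0r.
  by rewrite -/(root_eval phi z q) qz mulr0.
- by rewrite /= root_evalC hphi.
- have [e [d [r [eb hr]]]] := divide_tight b tp p0.
  have r0 : map_poly u r = 0.
    apply/eqP; apply/negPn/negP => r0; move: hr; rewrite ltnNge pmin //.
    have -> : r = lead_coef p ^+ e *: b - d * p by rewrite eb addrC addKr.
    by rewrite rmorphB rmorphM /= root_evalZ xb xp !mulr0 subr0.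
  have := congr1 (root_eval phi z) eb.
  rewrite root_evalZ rmorphD rmorphM /= /root_eval pz (ev0 _ r) // horner0.
  move=> /eqP; rewrite mulr0 addr0 mulf_eq0 rmorphXn expf_eq0 (negPf phil) andbF.
  by move/eqP.
Qed.

Lemma rmorph_mmap (R S T : comNzRingType) N (g : {rmorphism S -> T})
    (f : R -> S) (h : 'I_N -> S) (P : mpoly N R) :
  g (mmap f h P) = mmap (g \o f) (g \o h) P.
Proof.
rewrite /mmap rmorph_sum; apply: eq_bigr => m _.
rewrite rmorphM /mmap1 rmorph_prod; congr (_ * _).
by apply: eq_bigr => i _; rewrite rmorphXn.
Qed.

Lemma eq_mmap (R S : nzRingType) N (f g : R -> S) (h h' : 'I_N -> S) P :
  f =1 g -> h =1 h' -> mmap f h P = mmap g h' P.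
Proof.
move=> efg ehh; rewrite /mmap; apply: eq_bigr => m _; rewrite efg.
by congr (_ * _); apply: eq_bigr => i _; rewrite ehh.
Qed.

Lemma separated_gen (k K' : fieldType) (Om : closedFieldType)
    (u0 : {rmorphism k -> K'}) (ph0 : {rmorphism k -> Om}) N (x : nat -> K') :
  exists (A : comNzRingType) (io : {rmorphism k -> A}) (v : nat -> A)
    (u : {rmorphism A -> K'}),
  [/\ forall c, u (io c) = u0 c, forall i, (i < N)%N -> u (v i) = x i
    & separated io ph0 u].
Proof.
elim: N => [|N [A [io [v [u [h1 h2 h3]]]]]].
  exists k, idfun, (fun=> 0), u0; split=> // a ua; exists ph0; split=> //.
    by move=> b /eqP; rewrite fmorph_eq0 => /eqP ->; rewrite rmorph0.
  by move: ua; rewrite !fmorph_eq0.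
exists {poly A}, (polyC \o io), (fun i => if (i < N)%N then (v i)%:P else 'X),
  (root_eval u (x N)); split.
- by move=> c; rewrite /= root_evalC.
- move=> i; rewrite ltnS leq_eqVlt => /orP[/eqP ->|hi] /=.
    by rewrite ltnn root_evalX.
  by rewrite hi root_evalC h2.
- exact: separated_poly.
Qed.

(* A point over an extension of k specialises to a point over any algebraically
   closed extension Om of k, outside a given hypersurface. *)
Lemma specialize_point (k K' : fieldType) (Om : closedFieldType)
    (u0 : {rmorphism k -> K'}) (ph0 : {rmorphism k -> Om}) N (x : 'I_N -> K')
    (P : mpoly N k) : mmap u0 x P != 0 ->
  exists2 y : 'I_N -> Om, forall Q, mmap u0 x Q = 0 -> mmap ph0 y Q = 0 &
    mmap ph0 y P != 0.
Proof.
pose x' i := if insub i is Some j then x j else 0.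
have x'E (i : 'I_N) : x' i = x i by rewrite /x' valK.
have [A [io [v [u [h1 h2 sep]]]]] := separated_gen u0 ph0 N x'.
pose T Q := mmap io (fun i : 'I_N => v i) Q.
have uT Q : u (T Q) = mmap u0 x Q.
  by rewrite /T rmorph_mmap; apply: eq_mmap => [c|i] /=; rewrite ?h1// h2 ?x'E.
move=> xP; have [|phi [kphi phiP hphi]] := sep (T P); first by rewrite uT.
have phT Q : phi (T Q) = mmap ph0 (fun i : 'I_N => phi (v i)) Q.
  by rewrite /T rmorph_mmap; apply: eq_mmap => [c|i] //=; rewrite hphi.
exists (fun i => phi (v i)); last by rewrite -phT.
by move=> Q xQ; rewrite -phT kphi // uT.
Qed.

(** Dividing [p] by its gcd with [q] leaves a nonconstant polynomial, of which a divisor [r] of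
    least size is irreducible. If [r] also divided [q], its square would divide [p], against
    separability. *)
Lemma irreducible_factor (F : fieldType) (p q : {poly F}) :
  coprimep p p^`() -> p != 0 -> ~~ (p %| q) ->
  exists2 r, irreducible_poly r & (r %| p) && ~~ (r %| q).
Proof.
move=> cop p0 npq; pose g := gcdp p q.
have gp : g %| p by exact: dvdp_gcdl.
have [p2 ep] := dvdpP _ _ gp.
have g0 : g != 0 by rewrite gcdp_eq0 negb_and p0.
have p20 : p2 != 0 by apply: contraNneq p0 => p20; rewrite ep p20 mul0r.
have s2 : (size p2 != 1)%N.
  apply: contra npq => /size_poly1P [c c0 ec].
  apply: dvdp_trans (dvdp_gcdr p q); rewrite [X in X %| _]ep ec mul_polyC.
  by rewrite dvdpZl ?dvdpp.
have [r [rp2 sr] rmin] : exists2 r, (r %| p2 /\ (size r != 1)%N) &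
    forall r', (r' %| p2 /\ (size r' != 1)%N) -> (size r <= size r')%N.
  apply: (@min_measure {poly F} (fun r => r %| p2 /\ (size r != 1)%N) (fun r => size r)).
  by exists p2; rewrite dvdpp.
have r0 : r != 0 by apply: contraNneq p20 => r0; rewrite -dvd0p -r0.
exists r.
  split; first by rewrite ltn_neqAle eq_sym sr size_poly_gt0.
  move=> d sd dr; rewrite -dvdp_size_eqp // eqn_leq dvdp_leq // rmin //.
  by split=> //; apply: dvdp_trans rp2.
apply/andP; split; first by rewrite ep dvdp_mulr.
apply: contra sr => rq.
have rg : r %| g by rewrite dvdp_gcd rq andbT ep dvdp_mulr.
have [[a ea] [b eb]] := (dvdpP _ _ rp2, dvdpP _ _ rg).
have rr : r ^+ 2 %| p by rewrite ep ea eb mulrACA expr2 dvdp_mull.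
move: cop; rewrite /coprimep => cop.
have : r %| gcdp p p^`().
  have [c ec] := dvdpP _ _ rr.
  have -> : p^`() = (c^`() * r + c * (r^`() *+ 2)) * r.
    by rewrite ec expr2 !derivM; ring.
  by rewrite dvdp_gcd {1}ep dvdp_mulr //= dvdp_mull.
move/dvdp_leq; rewrite (eqP cop) -size_poly_eq0 (eqP cop) => /(_ isT).
by move: r0; rewrite -size_poly_eq0; case: (size r) => [|[]].
Qed.

Definition lin_free (k F : fieldType) (i0 : {rmorphism k -> F}) r (c : 'I_r -> F) :=
  forall q : 'I_r -> k, \sum_j i0 (q j) * c j = 0 -> forall j, q j = 0.

Lemma coprime_minpoly (k K : fieldType) (f : {rmorphism k -> K}) (z : K) p q :
  (forall q, root (map_poly f q) z = (p %| q)) -> p != 0 -> ~~ (p %| q) ->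
  coprimep p q.
Proof.
move=> hp p0 npq; pose d := gcdp p q.
have [e ep] := dvdpP _ _ (dvdp_gcdl p q).
have : root (map_poly f p) z by rewrite hp.
rewrite {1}ep rmorphM rootM => /orP[|]; rewrite hp => pd; last first.
  by case/negP: npq; apply: dvdp_trans pd (dvdp_gcdr _ _).
have e0 : e != 0 by apply: contraNneq p0 => e0; rewrite ep e0 mul0r.
have g0 : gcdp p q != 0 by rewrite gcdp_eq0 negb_and p0.
have := dvdp_leq e0 pd; rewrite [in size p]ep size_mul //.
move: e0 g0; rewrite -!size_poly_gt0 /coprimep.
by move: (size e) (size (gcdp p q)) => [|a] [|[|b]] //=; lia.
Qed.

Lemma irreducible_root_neq0 (F : fieldType) (L : fieldType)
    (f : {rmorphism F -> L}) (r q : {poly F}) w :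
  irreducible_poly r -> root (map_poly f r) w -> ~~ (r %| q) ->
  (map_poly f q).[w] != 0.
Proof.
move=> [sr ir] rw nrq.
have : coprimep r q.
  apply/negPn/negP => h; case/negP: nrq.
  have := ir (gcdp r q) h (dvdp_gcdl _ _).
  by rewrite /eqp => /andP[_ /dvdp_trans]; apply; exact: dvdp_gcdr.
case/Bezout_eq1_coprimepP => -[a b] /= e; apply/negP => /eqP qw.
have /(congr1 (fun p => (map_poly f p).[w])) := e.
rewrite rmorphD !rmorphM rmorph1 hornerD !hornerM qw (eqP rw) !mulr0 addr0 hornerC.
by move/eqP; rewrite eq_sym oner_eq0.
Qed.

(** The coordinates of [y] are polynomials in a primitive element [z], and points over an extension
    of [F] arise by sending [z] to a root of a factor over [F] of its minimal polynomial [p].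
    Reduced modulo [p], the combination is a polynomial [R] smaller than [p], nonzero by
    independence of the [c j], so some irreducible factor of [p] over [F] does not divide it. *)
Lemma algebraic_point_extension (F : fieldType) (i0 : {rmorphism rat -> F}) N
    r (c : 'I_r -> F) (P : 'I_r -> mpoly N rat) (D : mpoly N rat)
    (y : 'I_N -> algC) j0 : lin_free i0 c ->
  mmap ratr y (P j0) != 0 -> mmap ratr y D != 0 ->
  exists (K : fieldType) (f : {rmorphism F -> K}) (y' : 'I_N -> K),
  [/\ forall Q, mmap ratr y Q = 0 -> mmap (f \o i0) y' Q = 0,
      mmap (f \o i0) y' D != 0
    & \sum_j f (c j) * mmap (f \o i0) y' (P j) != 0].
Proof.
move=> cfree yP yD.
have [z _ [ps eps]] := algC_PET [seq y i | i <- enum 'I_N].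
pose q (i : 'I_N) := ps`_i.
have yE i : y i = (map_poly ratr (q i)).[z].
  have := congr1 (fun s => s`_i) eps; rewrite (nth_map i) ?size_enum_ord //.
  rewrite nth_ord_enum => ->; rewrite (nth_map 0) //.
  by have := congr1 size eps; rewrite size_map size_enum_ord size_map => <-.
have [p [_ pmon] hp] := minCpolyP z.
have p0 : p != 0 by exact: monic_neq0.
pose T Q := mmap (@polyC rat) q Q.
have TE Q : (map_poly ratr (T Q)).[z] = mmap ratr y Q.
  rewrite -[LHS]/(root_eval (ratr : {rmorphism rat -> algC}) z (T Q)).
  rewrite /T rmorph_mmap; apply: eq_mmap => [a|i]; last by rewrite yE.
  by rewrite /= root_evalC.
have Tdvd Q : (p %| T Q) = (mmap ratr y Q == 0) by rewrite -hp /root TE.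
have sp : (1 < size p)%N.
  rewrite ltn_neqAle size_poly_gt0 p0 andbT eq_sym; apply/negP => /size_poly1P.
  move=> [a a0 ea]; have := hp p; rewrite dvdpp ea map_polyC rootC.
  by rewrite fmorph_eq0 (negPf a0).
have p'0 : p^`() != 0.
  apply/negP => /eqP/polyP /(_ (size p).-2); rewrite coef_deriv coef0.
  have -> : (size p).-2.+1 = (size p).-1 by case: (size p) sp => [|[]].
  move/eqP; rewrite mulrn_eq0 -/(lead_coef p) lead_coef_eq0 (negPf p0) orbF.
  by case: (size p) sp => [|[]].
(* Separability is inherited over [F] and yields a factor of [p] that does not divide [R]. *)
have cop : coprimep p p^`().
  apply: (coprime_minpoly hp) => //; apply/negP => /(dvdp_leq p'0).
  by rewrite leqNgt lt_size_deriv.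
pose pF := map_poly i0 p.
have copF : coprimep pF pF^`() by rewrite /pF deriv_map coprimep_map.
have pF0 : pF != 0 by rewrite map_poly_eq0.
pose R : {poly F} := \sum_j c j *: map_poly i0 (T (P j) %% p).
have nR : ~~ (pF %| R).
  have R0 : R != 0.
    apply: contra yP => /eqP/polyP R0; rewrite -Tdvd.
    apply/modp_eq0P/polyP => k; rewrite coef0.
    apply: (cfree (fun j => (T (P j) %% p)`_k)).
    have := R0 k; rewrite coef0 coef_sum => {2}<-.
    by apply: eq_bigr => j _; rewrite coefZ coef_map mulrC.
  apply/negP => /dvdp_leq => /(_ R0); rewrite leqNgt size_map_poly.
  move/negP; apply; apply: leq_ltn_trans (size_sum _ _ _) _.
  rewrite (leq_ltn_trans (n := (size p).-1)) //; last by case: (size p) sp.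
  apply/bigmax_leqP => j _; apply: leq_trans (size_scale_leq _ _) _.
  by rewrite size_map_poly -ltnS prednK ?ltn_modp // (ltn_trans _ sp).
have [s irr /andP[sp1 nsR]] := irreducible_factor copF pF0 nR.
have [L _ [w sw _]] := irredp_FAdjoin irr.
pose f : {rmorphism F -> L} := GRing.in_alg L.
exists L, f, (fun i => root_eval (f \o i0) w (q i)).
have TL Q : mmap (f \o i0) (fun i => root_eval (f \o i0) w (q i)) Q =
    root_eval (f \o i0) w (T Q).
  rewrite /T rmorph_mmap; apply: eq_mmap => [a|i] //.
  by rewrite /= root_evalC.
have rootp Q : p %| Q -> root_eval (f \o i0) w Q = 0.
  move=> pQ; have /dvdpP [a ea] : s %| map_poly i0 Q.
    by apply: dvdp_trans sp1 _; rewrite dvdp_map.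
  by rewrite /root_eval map_poly_comp /= ea rmorphM hornerM (eqP sw) mulr0.
split.
- by move=> Q yQ; rewrite TL rootp // Tdvd yQ.
- rewrite TL; apply/negP => /eqP wD.
  have /Bezout_eq1_coprimepP [[a b] /= e] : coprimep p (T D).
    by apply: (coprime_minpoly hp) => //; rewrite Tdvd.
  have := congr1 (root_eval (f \o i0) w) e.
  rewrite rmorphD !rmorphM rmorph1 /= wD (rootp p) // !mulr0 addr0 => /eqP.
  by rewrite eq_sym oner_eq0.
- under eq_bigr do rewrite TL.
  have := irreducible_root_neq0 irr sw nsR; congr (_ != 0).
  rewrite rmorph_sum horner_sum; apply: eq_bigr => j _ /=.
  rewrite map_polyZ hornerZ; congr (_ * _).
  rewrite -map_poly_comp -/(root_eval (f \o i0) w _).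
  rewrite [in RHS](divp_eq (T (P j)) p) rmorphD rmorphM /= (rootp p) //.
  by rewrite mulr0 add0r.
Qed.

(* If no [mmap f' x (P j)] is forced to vanish, neither is a combination of them
   with coefficients linearly independent over the rationals. *)
Lemma rational_descent (F : fieldType) (i0 : {rmorphism rat -> F}) N
    r (c : 'I_r -> F) (P : 'I_r -> mpoly N rat) (D : mpoly N rat)
    (K' : fieldType) (f' : {rmorphism rat -> K'}) (x : 'I_N -> K') j0 :
  lin_free i0 c -> mmap f' x (P j0) != 0 -> mmap f' x D != 0 ->
  exists (K : fieldType) (f : {rmorphism F -> K}) (y : 'I_N -> K),
  [/\ forall Q, mmap f' x Q = 0 -> mmap (f \o i0) y Q = 0,
      mmap (f \o i0) y D != 0
    & \sum_j f (c j) * mmap (f \o i0) y (P j) != 0].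
Proof.
move=> cfree xP xD.
have [|y yQ] := @specialize_point _ _ _ f' (ratr : {rmorphism rat -> algC}) _ x (P j0 * D).
  by rewrite rmorphM mulf_neq0.
rewrite rmorphM mulf_eq0 negb_or => /andP[yP yD].
have [K [f [y' [h1 h2 h3]]]] := algebraic_point_extension cfree yP yD.
by exists K, f, y'; split=> // Q /yQ; exact: h1.
Qed.

(** * Polynomials in matrix entries and base change of their zero sets *)

Section EntryEval.
Variables (k K : fieldType) (f : {rmorphism k -> K}) (n : nat) (g : 'M[K]_n).

Fact entry_eval_is_zmod : zmod_morphism (entry_eval f g).
Proof. by move=> P Q; rewrite /entry_eval rmorphB. Qed.
Fact entry_eval_is_monoid : monoid_morphism (entry_eval f g).
Proof.
by split=> [|P Q]; rewrite /entry_eval ?rmorph1 // rmorphM.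
Qed.
HB.instance Definition _ := GRing.isZmodMorphism.Build
  (entry_poly k n) K (entry_eval f g) entry_eval_is_zmod.
HB.instance Definition _ := GRing.isMonoidMorphism.Build
  (entry_poly k n) K (entry_eval f g) entry_eval_is_monoid.
End EntryEval.

Definition entry_var (k : fieldType) n (i j : 'I_n) : entry_poly k n :=
  mpolyX k (mnm1 (mxvec_index i j)).
Definition entry_cst (k : fieldType) n (c : k) : entry_poly k n :=
  mpolyC (n * n) c.
HB.instance Definition _ (k : fieldType) n := GRing.RMorphism.copy
  (@entry_cst k n) (@mpolyC (n * n) k).

Definition det_poly (k : fieldType) n : entry_poly k n :=
  \det (\matrix_(i, j) entry_var k i j).

Section EvalLemmas.
Variables (k K : fieldType) (f : {rmorphism k -> K}) (n : nat).
Implicit Types (g : 'M[K]_n) (P : entry_poly k n).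

Lemma entry_eval_var g i j : entry_eval f g (entry_var k i j) = g i j.
Proof. by rewrite /entry_eval mmapX mmap1U mxvecE. Qed.

Lemma entry_eval_cst g c : entry_eval f g (entry_cst n c) = f c.
Proof. by rewrite /entry_eval mmapC. Qed.

Lemma entry_evalZ g c P : entry_eval f g (c *: P) = f c * entry_eval f g P.
Proof. by rewrite /entry_eval mmapZ. Qed.

Lemma entry_eval_det g : entry_eval f g (det_poly k n) = \det g.
Proof.
rewrite /det_poly -det_map_mx; congr (\det _).
by apply/matrixP => i j; rewrite !mxE /= entry_eval_var.
Qed.

Lemma rmorph_entry_eval (L : fieldType) (h : {rmorphism K -> L}) g P :
  h (entry_eval f g P) = entry_eval (h \o f) (map_mx h g) P.
Proof.
rewrite /entry_eval rmorph_mmap; apply: eq_mmap => i //=.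
by rewrite -map_mxvec mxE.
Qed.

Lemma entry_eval_map (L : fieldType) (h : {rmorphism K -> L}) (g : 'M[L]_n) P :
  entry_eval h g (map_mpoly f P) = entry_eval (h \o f) g P.
Proof.
rewrite /entry_eval /map_mpoly rmorph_mmap; apply: eq_mmap => [c|i] /=.
  by rewrite mmapC.
by rewrite mmapX mmap1U.
Qed.
End EvalLemmas.

Lemma entry_eval_eq (k K : fieldType) (f h : k -> K) n (g : 'M[K]_n) P :
  f =1 h -> entry_eval f g P = entry_eval h g P.
Proof. by move=> e; apply: eq_mmap. Qed.

Lemma pts_eq (k K : fieldType) (f h : k -> K) n (E : set (entry_poly k n)) :
  f =1 h -> pts f E = pts h E.
Proof. by move=> /funext ->. Qed.

Lemma pts_base_change (k K L : fieldType) (f : {rmorphism k -> K})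
    (h : {rmorphism K -> L}) n (E : set (entry_poly k n)) :
  pts h (base_change f E) = pts (h \o f) E.
Proof.
rewrite /pts; apply/seteqP; split=> g [ug hg]; split=> // P.
  by move=> EP; rewrite -entry_eval_map hg //; exists P.
by move=> [Q EQ <-]; rewrite entry_eval_map hg.
Qed.

Lemma pts_map (k K L : fieldType) (f : {rmorphism k -> K})
    (h : {rmorphism K -> L}) n (E : set (entry_poly k n)) g :
  pts f E g -> pts (h \o f) E (map_mx h g).
Proof.
move=> [ug hg]; split; first by rewrite map_unitmx.
by move=> P /hg e; rewrite -rmorph_entry_eval e rmorph0.
Qed.

Lemma rat_morph_eq (K : fieldType) (f h : {rmorphism rat -> K}) : f =1 h.
Proof. by move=> x; rewrite !fmorph_eq_rat. Qed.

(* The first coefficient is 1, so that P_0 is a rational solution of any rational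
   affine linear system solved by the combination. *)
Lemma free_span (k F : fieldType) (i0 : {rmorphism k -> F}) (s : seq F) :
  exists r (c : 'I_r.+1 -> F), [/\ lin_free i0 c, c ord0 = 1
    & forall x, x \in s -> exists q : 'I_r.+1 -> k, x = \sum_j i0 (q j) * c j].
Proof.
suff [r [c [h1 h2 h3]]] : exists r (c : nat -> F),
    [/\ lin_free i0 (fun j : 'I_r.+1 => c j), c 0%N = 1
    & forall x, x \in s ->
       exists q : 'I_r.+1 -> k, x = \sum_(j < r.+1) i0 (q j) * c j].
  by exists r, (fun j => c j).
elim: s => [|x s [r [c [h1 h2 h3]]]].
  exists 0%N, (fun=> 1); split=> // q; rewrite big_ord1 mulr1 => /eqP.
  by rewrite fmorph_eq0 => /eqP e j; rewrite (ord1 j).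
have [[q xq]|nq] := pselect (exists q : 'I_r.+1 -> k,
    x = \sum_(j < r.+1) i0 (q j) * c j).
  exists r, c; split=> // y; rewrite inE => /predU1P[->|/h3 //].
  by exists q.
exists r.+1, (fun j => if (j < r.+1)%N then c j else x); split=> //; last first.
  move=> y; rewrite inE => /predU1P[->|/h3 [q ->]].
    exists (fun j => (j == ord_max)%:R); rewrite big_ord_recr /= ltnn eqxx.
    rewrite rmorph1 mul1r big1 ?add0r // => j _.
    by rewrite -val_eqE /= ltn_eqF ?ltn_ord // rmorph0 mul0r.
  have [qn qnE qn0] : exists2 qn : nat -> k, forall j : 'I_r.+1, qn j = q j &
      qn r.+1 = 0.
    exists (fun a => if insub a is Some j' then q j' else 0).
      by move=> j; rewrite valK.
    by rewrite insubF ?ltnn.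
  exists (fun j => qn j); rewrite [RHS]big_ord_recr /= qn0 rmorph0 mul0r addr0.
  by apply: eq_bigr => j _ /=; rewrite qnE ltn_ord.
move=> q; rewrite big_ord_recr /= ltnn.
under eq_bigr do rewrite ltn_ord.
move=> e.
have q0 : q ord_max = 0.
  apply/eqP/negPn/negP => q0; apply: nq.
  exists (fun j => - q (widen_ord (leqnSn _) j) / q ord_max).
  have i0q : i0 (q ord_max) != 0 by rewrite fmorph_eq0.
  apply: (mulfI i0q); rewrite mulr_sumr.
  apply/eqP; rewrite -subr_eq0 -sumrN addrC; apply/eqP; rewrite -[RHS]e.
  congr (_ + _); apply: eq_bigr => j _.
  by rewrite rmorphM fmorphV rmorphN /=; field.
move: e; rewrite q0 rmorph0 mul0r addr0 => /h1 e j.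
have [jr|jr] := ltnP j r.+1; last first.
  by rewrite (_ : j = ord_max) //; apply/val_inj/anti_leq; rewrite jr -ltnS ltn_ord.
by rewrite -[RHS](e (Ordinal jr)); congr q; apply: val_inj.
Qed.

Lemma free_span_poly (k F : fieldType) (i0 : {rmorphism k -> F}) N
    (P : mpoly N F) :
  exists r (c : 'I_r.+1 -> F) (Q : 'I_r.+1 -> mpoly N k),
  [/\ lin_free i0 c, c ord0 = 1 & P = \sum_j c j *: map_mpoly i0 (Q j)].
Proof.
have [r [c [h1 h2 h3]]] := free_span i0 [seq mcoeff m P | m <- msupp P].
have {}h3 (m : multinom N) : exists q : 'I_r.+1 -> k, mcoeff m P = \sum_j i0 (q j) * c j.
  have [mP|mP] := boolP (m \in msupp P); first exact/h3/map_f.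
  exists (fun=> 0); rewrite memN_msupp_eq0 // big1 // => j _.
  by rewrite rmorph0 mul0r.
have [q qE] := choice h3.
exists r, c, (fun j => \sum_(m <- msupp P) q m j *: mpolyX k m); split=> //.
rewrite [LHS]mpolyE.
under [RHS]eq_bigr do rewrite rmorph_sum scaler_sumr.
rewrite exchange_big; apply: eq_bigr => m _ /=.
rewrite qE scaler_suml; apply: eq_bigr => j _.
by rewrite map_mpolyZ map_mpolyX scalerA mulrC.
Qed.

Lemma free_span_mx (k F : fieldType) (i0 : {rmorphism k -> F}) m n
    (A : 'M[F]_(m, n)) :
  exists r (c : 'I_r.+1 -> F) (B : 'I_r.+1 -> 'M[k]_(m, n)),
  [/\ lin_free i0 c, c ord0 = 1 & A = \sum_j c j *: map_mx i0 (B j)].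
Proof.
have [r [c [h1 h2 h3]]] := free_span i0 [seq A ij.1 ij.2 | ij : 'I_m * 'I_n].
have {}h3 (ij : 'I_m * 'I_n) :
    exists q : 'I_r.+1 -> k, A ij.1 ij.2 = \sum_j i0 (q j) * c j.
  by apply: h3; apply/mapP; exists ij => //; rewrite mem_enum.
have [q qE] := choice h3.
exists r, c, (fun j => \matrix_(i, l) q (i, l) j); split=> //.
apply/matrixP => i l; rewrite summxE (qE (i, l)); apply: eq_bigr => j _.
by rewrite !mxE mulrC.
Qed.

(* [vanishing_ideal (base_change i0 E)] is the ideal of E over the extension F. *)
Lemma vanishing_ideal_baseP (F : fieldType) (i0 : {rmorphism rat -> F}) n
    (E : set (entry_poly rat n)) P :
  vanishing_ideal (base_change i0 E) P <->
  forall (K : fieldType) (f : {rmorphism F -> K}) g,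
    pts (f \o i0) E g -> entry_eval f g P = 0.
Proof.
split=> h K f g; first by rewrite -pts_base_change; exact: h.
by rewrite pts_base_change; exact: h.
Qed.

(** A point where some [P j] does not vanish would be turned by [rational_descent] into a point of
    [E] over an extension of [F] where the whole combination is nonzero. The determinant is the
    extra polynomial kept nonzero, so that the new point is invertible. *)
Lemma ideal_descent (F : fieldType) (i0 : {rmorphism rat -> F}) n
    (E : set (entry_poly rat n)) r (c : 'I_r -> F) (P : 'I_r -> entry_poly rat n) :
  lin_free i0 c ->
  vanishing_ideal (base_change i0 E) (\sum_j c j *: map_mpoly i0 (P j)) ->
  forall j, vanishing_ideal E (P j).
Proof.
move=> cfree /vanishing_ideal_baseP hP j K' f' x [ux Ex].
apply/eqP/negPn/negP => xP.
have [|K [f [y [h1 h2 h3]]]] := rational_descent (D := det_poly rat n) cfree xP.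
  change (entry_eval f' x (det_poly rat n) != 0).
  by rewrite entry_eval_det -unitfE -unitmxE.
pose g : 'M[K]_n := vec_mx (\row_k y k).
have ev Q : mmap (f \o i0) y Q = entry_eval (f \o i0) g Q.
  by apply: eq_mmap => // k; rewrite vec_mxK mxE.
have gE : pts (f \o i0) E g.
  split; last by move=> Q EQ; rewrite -ev h1 //; exact: Ex.
  by rewrite unitmxE unitfE -(entry_eval_det (f \o i0)) -ev.
move/negP: h3; apply; rewrite -[X in _ == X](hP _ _ _ gE) rmorph_sum /=.
apply/eqP/eq_bigr => k _; rewrite entry_evalZ entry_eval_map; congr (_ * _).
exact: ev.
Qed.

Lemma vanishing_ideal_span (F : fieldType) (i0 : {rmorphism rat -> F}) n
    (E : set (entry_poly rat n)) P :
  vanishing_ideal (base_change i0 E) P ->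
  exists r (c : 'I_r.+1 -> F) (Q : 'I_r.+1 -> entry_poly rat n),
    (forall j, vanishing_ideal E (Q j)) /\
    P = \sum_j c j *: map_mpoly i0 (Q j).
Proof.
move=> hP; have [r [c [Q [h1 _ h2]]]] := free_span_poly i0 P.
exists r, c, Q; split=> //; apply: (@ideal_descent _ i0); first exact: h1.
by rewrite -h2.
Qed.

(** A point over an extension where [P] is nonzero specialises to one over [Om]; keeping the product
    of [P] with the determinant nonzero makes the specialised matrix invertible. *)
Lemma closed_points_suffice (Om : closedFieldType) (i0 : {rmorphism rat -> Om})
    n (E : set (entry_poly rat n)) P :
  (forall g, pts i0 E g -> entry_eval idfun g P = 0) ->
  vanishing_ideal (base_change i0 E) P.
Proof.
move=> hP; apply/vanishing_ideal_baseP => K f g [ug Eg].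
apply/eqP/negPn/negP => gP.
have [|y yE] := @specialize_point Om K Om f idfun _ (fun k => mxvec g 0 k)
    (P * det_poly Om n).
  change (entry_eval f g (P * det_poly Om n) != 0).
  by rewrite rmorphM /= mulf_neq0 // entry_eval_det -unitfE -unitmxE.
pose h : 'M[Om]_n := vec_mx (\row_k y k).
have ev Q : mmap idfun y Q = entry_eval idfun h Q.
  by apply: eq_mmap => // k; rewrite vec_mxK mxE.
rewrite rmorphM /= mulf_eq0 negb_or !ev entry_eval_det => /andP[/eqP yP hd].
apply: yP; apply: hP; split; first by rewrite unitmxE unitfE.
move=> Q EQ.
have := yE (map_mpoly i0 Q); rewrite ev entry_eval_map; apply.
change (entry_eval f g (map_mpoly i0 Q) = 0).
by rewrite entry_eval_map Eg.
Qed.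

(** * Trace forms and Casimir elements *)

(** For a full rank factorisation [e = C R], idempotence gives [R C = 1], so the trace is that of an
    identity matrix of size the rank. *)
Lemma mxtrace_idem (F : fieldType) n (e : 'M[F]_n) :
  e *m e = e -> \tr e = (\rank e)%:R.
Proof.
move: (mulmx_base e) (row_base_free e) (col_base_full e).
move: (col_base e) (row_base e); move: (\rank e) => r C R eCR /row_freeP[D hD] /row_fullP[B hB] ee.
have RC : R *m C = 1%:M.
  have -> : R *m C = B *m (e *m e) *m D.
    by rewrite -eCR !mulmxA hB mul1mx -!mulmxA hD mulmx1.
  by rewrite ee -eCR mulmxA hB mul1mx hD.
by rewrite -eCR mxtrace_mulC RC mxtrace1.
Qed.

(** Bezout separates the root 0 of the characteristic polynomial from the others: [e] is the
    idempotent projecting onto the part where [A] is invertible. It is a polynomial in [A] without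
    constant term, so its trace vanishes, and in characteristic 0 an idempotent of trace 0 is 0. *)
Lemma nilpotent_of_traces n (A : 'M[rat]_n) :
  (forall k, (0 < k)%N -> \tr (A ^+ k) = 0) -> exists k, A ^+ k = 0.
Proof.
case: n A => [|n] A hA; first by exists 0%N; rewrite [LHS]thinmx0.
have trX w : \tr (horner_mx A ('X * w)) = 0.
  rewrite -[w]coefK poly_def mulr_sumr !raddf_sum big1 // => i _ /=.
  by rewrite -scalerAr linearZ /= -exprS rmorphXn /= horner_mx_X linearZ /= hA ?mulr0.
(* The extra factor ['X] makes 0 a root even when [A] is invertible, so that its multiplicity is
   positive. *)
have p0 : char_poly A * 'X != 0.
  by rewrite mulf_neq0 ?polyX_eq0 // monic_neq0 // char_poly_monic.
have [a [q]] := multiplicity_XsubC (char_poly A * 'X) 0.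
rewrite p0 /= subr0 => q0 ep.
case: a ep => [|a] ep.
  case/negP: q0; have -> : q = char_poly A * 'X by rewrite ep expr0 mulr1.
  by rewrite rootM rootX eqxx orbT.
have /Bezout_eq1_coprimepP[[u v] /= uv] : coprimep q 'X^(a.+1).
  by rewrite -['X]subr0 coprimep_expr // coprimep_XsubC.
have CH : horner_mx A (q * 'X^(a.+1)) = 0.
  by rewrite -ep rmorphM /= Cayley_Hamilton mul0r.
pose e := horner_mx A (v * 'X^(a.+1)).
have ee : e *m e = e.
  have : e * horner_mx A (u * q) = 0.
    rewrite -rmorphM.
    have -> : v * 'X^(a.+1) * (u * q) = v * u * (q * 'X^(a.+1)) by ring.
    by rewrite rmorphM /= CH mulr0.
  have -> : horner_mx A (u * q) = 1 - e.
    by rewrite -[1](rmorph1 (horner_mx A)) -uv rmorphD /= addrK.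
  by rewrite mulrBr mulr1 => /eqP; rewrite subr_eq0 => /eqP.
have : \tr e = 0 by rewrite /e exprS mulrCA trX.
rewrite mxtrace_idem // => /eqP; rewrite pnatr_eq0 mxrank_eq0 => /eqP e0.
exists a.+1; rewrite -[in LHS](horner_mx_X A) -rmorphXn /=.
rewrite -['X^(a.+1)]mul1r -uv mulrDl rmorphD -mulrA rmorphM /= CH mulr0 add0r.
by rewrite rmorphM /= -/e e0 mul0r.
Qed.

(** Among the subspaces contained in [S], one of maximal dimension exhausts [S], since adjoining one
    more vector of [S] stays inside [S]. *)
Lemma closed_vspace (k : fieldType) (V : vectType k) (S : set V) :
  S 0 -> (forall a x y, S x -> S y -> S (a *: x + y)) ->
  exists U : {vspace V}, forall x, S x <-> x \in U.
Proof.
move=> S0 Sl.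
have [U SU Umax] : exists2 U : {vspace V}, (forall x, x \in U -> S x) &
    forall U' : {vspace V}, (forall x, x \in U' -> S x) ->
      (dim V - \dim U <= dim V - \dim U')%N.
  apply: (@min_measure _ (fun U : {vspace V} => forall x, x \in U -> S x)
    (fun U => dim V - \dim U)%N).
  by exists 0%VS => x; rewrite memv0 => /eqP ->.
exists U => x; split=> [Sx|/SU //].
have le : (U <= U + <[x]>)%VS by exact: addvSl.
have := Umax (U + <[x]>)%VS.
have : (\dim (U + <[x]>) <= dim V)%N by rewrite -dimvf dimvS ?subvf.
have := dimvS le => d1 d2 /(_ _) d3.
have {}d3 : (\dim (U + <[x]>) <= \dim U)%N.
  suff : (dim V - \dim U <= dim V - \dim (U + <[x]>))%N by lia.
  apply: d3 => y /memv_addP[z /SU Sz [t /vlineP[c ->] ->]].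
  by rewrite addrC; apply: Sl.
have /eqP -> : U == (U + <[x]>)%VS by rewrite eqEdim le.
by rewrite memvE addvSr.
Qed.

Section RegularTrace.
Variables (m r : nat) (A : set 'M[rat]_m) (X : 'I_r -> 'M[rat]_m).
Variable cf : 'I_r -> {scalar 'M[rat]_m}.
Hypothesis A_lin : forall a x y, A x -> A y -> A (a *: x + y).
Hypothesis A1 : A 1%:M.
Hypothesis AM : forall x y, A x -> A y -> A (x *m y).
Hypothesis AX : forall i, A (X i).
Hypothesis Xcf : forall a, A a -> a = \sum_i cf i a *: X i.
Hypothesis cfX : forall i j, cf i (X j) = (i == j)%:R.

Let A0 : A 0.
Proof. by have := A_lin (-1) A1 A1; rewrite scaleN1r addNr. Qed.
Let AD x y : A x -> A y -> A (x + y).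
Proof. by move=> hx hy; rewrite -[x]scale1r; apply: A_lin. Qed.
Let AZ c x : A x -> A (c *: x).
Proof. by move=> hx; rewrite -[_ *: x]addr0; apply: A_lin. Qed.
Let A_sum I (s : seq I) F : (forall i, A (F i)) -> A (\sum_(i <- s) F i).
Proof. by move=> h; apply: big_ind => //. Qed.

Definition left_mul_mx (a : 'M[rat]_m) : 'M[rat]_r :=
  \matrix_(i, j) cf i (a *m X j).

Definition reg_trace a := \tr (left_mul_mx a).

Lemma left_mul_mxM a b : A b ->
  left_mul_mx (a *m b) = left_mul_mx a *m left_mul_mx b.
Proof.
move=> hb; apply/matrixP => i j; rewrite !mxE.
rewrite -mulmxA (Xcf (AM hb (AX j))) mulmx_sumr linear_sum.
by apply: eq_bigr => k _; rewrite !mxE -scalemxAr linearZ /= mulrC.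
Qed.

Lemma left_mul_mx0 a : A a -> left_mul_mx a = 0 -> a = 0.
Proof.
move=> ha /matrixP h; rewrite -[a]mulmx1 [1%:M](Xcf A1) mulmx_sumr big1 // => j _.
rewrite -scalemxAr (Xcf (AM ha (AX j))) big1 ?scaler0 // => i _.
by have := h i j; rewrite !mxE => ->; rewrite scale0r.
Qed.

Lemma reg_traceD a b : reg_trace (a + b) = reg_trace a + reg_trace b.
Proof.
rewrite /reg_trace -linearD /=; congr (\tr _).
by apply/matrixP => i j; rewrite !mxE mulmxDl linearD.
Qed.
Lemma reg_traceZ c a : reg_trace (c *: a) = c * reg_trace a.
Proof.
rewrite /reg_trace -linearZ /=; congr (\tr _).
by apply/matrixP => i j; rewrite !mxE -scalemxAl linearZ.
Qed.
Lemma reg_trace_sum I (s : seq I) F :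
  reg_trace (\sum_(i <- s) F i) = \sum_(i <- s) reg_trace (F i).
Proof.
elim/big_rec2: _ => [|i x y _ <-]; last exact: reg_traceD.
by rewrite -(scale0r 0) reg_traceZ mul0r.
Qed.
Lemma reg_traceC a b : A a -> A b -> reg_trace (a *m b) = reg_trace (b *m a).
Proof. by move=> ha hb; rewrite /reg_trace !left_mul_mxM // mxtrace_mulC. Qed.

(** The radical of the trace form of the regular representation; in characteristic 0 it is the
    Jacobson radical of the algebra [A]. *)
Definition trace_radical : set 'M[rat]_m :=
  [set a | A a /\ forall b, A b -> reg_trace (a *m b) = 0].

Lemma trace_radical_mul a b : trace_radical a -> A b -> trace_radical (a *m b).
Proof.
move=> [ha h] hb; split=> [|c hc]; first exact: AM.
by rewrite -mulmxA h //; exact: AM.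
Qed.

Lemma trace_radical_nil a : trace_radical a -> exists k, a ^+ k = 0.
Proof.
move=> [ha h].
have AXn k : A (a ^+ k) by elim: k => // k IH; rewrite exprS; apply: AM.
have LX k : left_mul_mx (a ^+ k.+1) = left_mul_mx a ^+ k.+1.
  by elim: k => // k IH; rewrite [a ^+ _]exprS [LHS]left_mul_mxM // IH [RHS]exprS.
have [|k hk] := @nilpotent_of_traces _ (left_mul_mx a).
  by case=> // k _; rewrite -LX exprS; apply: h.
exists k.+1; apply: left_mul_mx0 => //.
by rewrite LX exprS hk mulr0.
Qed.

(** Here [e] projects onto the common kernel of the radical, and [p] is an equivariant projection
    with the same image, so the kernel of [p] is a stable complement. If the radical is not 0, take
    [v] nonzero in that complement with the radical orbit [U v] of least dimension. Some [b] in the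
    radical has [b v] nonzero, and minimality gives [U (b v) = U v]; hence [b v = c (b v)] with [c]
    nilpotent, which is absurd. *)
Lemma trace_radical_complement (e p : 'M[rat]_m) :
  (forall a, trace_radical a -> a *m e = 0) ->
  (forall v : 'cV_m, (forall a, trace_radical a -> a *m v = 0) -> e *m v = v) ->
  p *m e = e -> e *m p = p -> (forall a, A a -> a *m p = p *m a) ->
  forall a, trace_radical a -> a = 0.
Proof.
move=> Ne kerN pe ep pA.
pose img (v : 'cV[rat]_m) : set 'cV[rat]_m :=
  [set w | exists2 a, trace_radical a & w = a *m v].
have N0 : trace_radical 0.
  by split=> // b _; rewrite mul0mx -(scale0r 0) reg_traceZ mul0r.
have Nlin c a b : trace_radical a -> trace_radical b -> trace_radical (c *: a + b).
  move=> [ha a0] [hb b0]; split=> [|d hd]; first exact: A_lin.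
  by rewrite mulmxDl -scalemxAl reg_traceD reg_traceZ a0 // b0 // mulr0 addr0.
have exU v : exists W : {vspace 'cV[rat]_m}, forall w, img v w <-> w \in W.
  apply: closed_vspace; first by exists 0; rewrite ?mul0mx.
  move=> c x y [a Na ->] [b Nb ->]; exists (c *: a + b); first exact: Nlin.
  by rewrite mulmxDl scalemxAl.
have [U UE] := boolp.choice exU.
move=> a Na; apply/eqP/negPn/negP => a0.
have ap : a *m p = 0 by rewrite -ep mulmxA Ne // mul0mx.
pose S (v : 'cV[rat]_m) := p *m v = 0 /\ v != 0.
have [v [pv v0] vmin] : exists2 v, S v &
    forall v', S v' -> (\dim (U v) <= \dim (U v'))%N.
  apply: (@min_measure _ S (fun v => \dim (U v))).
  have : a *m (1%:M - p) != 0 by rewrite mulmxBr mulmx1 ap subr0.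
  case/matrix0Pn => i [j aij]; exists ((1%:M - p) *m delta_mx j 0); split.
    rewrite mulmxA mulmxBr mulmx1 (_ : p *m p = p) ?subrr ?mul0mx //.
    by rewrite -{2}ep mulmxA pe ep.
  apply: contraNneq aij => c0.
  have -> : (a *m (1%:M - p)) i j = col j (a *m (1%:M - p)) i 0 by rewrite [RHS]mxE.
  by rewrite colE -mulmxA c0 mulmx0 mxE.
have [b Nb bv] : exists2 b, trace_radical b & b *m v != 0.
  apply: contrapT => nb; move/eqP: v0; apply.
  have ev : e *m v = v.
    by apply: kerN => c Nc; apply/eqP/negPn/negP => cv; apply: nb; exists c.
  by rewrite -ev -pe -mulmxA ev pv.
have Sbv : S (b *m v).
  by split=> //; rewrite mulmxA -pA ?mulmxA -?mulmxA ?pv ?mulmx0 //; case: Nb.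
have sub : (U (b *m v) <= U v)%VS.
  apply/subvP => w /UE [c Nc ->]; apply/UE; exists (c *m b); last by rewrite mulmxA.
  by apply: trace_radical_mul => //; case: Nb.
have /eqP eU : U (b *m v) == U v by rewrite eqEdim sub vmin.
have : b *m v \in U (b *m v) by rewrite eU; apply/UE; exists b.
move=> /UE [c Nc ec]; have [k ck] := trace_radical_nil Nc.
move/eqP: bv; apply.
have : forall k, b *m v = c ^+ k *m (b *m v).
  by elim=> [|j IH]; rewrite ?mul1mx // exprS -mulmxA -IH.
by move/(_ k); rewrite ck mul0mx.
Qed.

Hypothesis N0 : forall a, trace_radical a -> a = 0.

(** [Y] is the basis dual to [X] for the trace form, nondegenerate by [N0]. Left multiplication on
    [X] and right multiplication on [Y] have the same structure constants, which gives the
    commutation over every field. The sum of the [X i *m Y i] is exactly 1 because pairing it with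
    [b] gives the trace of left multiplication by [b]; nothing has to be divided out. *)
Lemma casimir : exists Y : 'I_r -> 'M[rat]_m, [/\ forall i, A (Y i),
    \sum_i X i *m Y i = 1%:M
  & forall (F : fieldType) (i0 : {rmorphism rat -> F}) (f : 'M[F]_m) x, A x ->
      map_mx i0 x *m (\sum_i map_mx i0 (X i) *m f *m map_mx i0 (Y i)) =
      (\sum_i map_mx i0 (X i) *m f *m map_mx i0 (Y i)) *m map_mx i0 x].
Proof.
pose G := \matrix_(i, j) reg_trace (X i *m X j).
have uG : G \in unitmx.
  rewrite -row_free_unit -kermx_eq0; apply/eqP/row_matrixP => l; rewrite row0.
  have : row l (kermx G) *m G = 0 by rewrite -row_mul mulmx_ker row0.
  move: (row l _) => v vG.
  have vGj j : \sum_i v 0 i * reg_trace (X i *m X j) = 0.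
    have e : (v *m G) 0 j = 0 by rewrite vG mxE.
    by rewrite -[RHS]e [RHS]mxE; apply: eq_bigr => i _; rewrite mxE.
  have /N0 e : trace_radical (\sum_i v 0 i *: X i).
    split=> [|b hb]; first by apply: A_sum => i; apply: AZ.
    rewrite (Xcf hb) mulmx_sumr reg_trace_sum big1 // => j _.
    rewrite -scalemxAr reg_traceZ mulmx_suml reg_trace_sum.
    under eq_bigr do rewrite -scalemxAl reg_traceZ.
    by rewrite vGj mulr0.
  apply/rowP => j; rewrite mxE; have := congr1 (cf j) e; rewrite linear0 linear_sum => <-.
  rewrite (bigD1 j) //= linearZ /= cfX eqxx mulr1 big1 ?addr0 // => i ij.
  by rewrite linearZ /= cfX eq_sym (negPf ij) mulr0.
pose Y i := \sum_j invmx G i j *: X j.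
have AY i : A (Y i) by apply: A_sum => j; apply: AZ.
have YX i j : reg_trace (Y i *m X j) = (i == j)%:R.
  rewrite mulmx_suml reg_trace_sum.
  have <- : (invmx G *m G) i j = (i == j)%:R by rewrite mulVmx // mxE.
  by rewrite [RHS]mxE; apply: eq_bigr => k _; rewrite -scalemxAl reg_traceZ mxE.
have cfE j a : A a -> cf j a = reg_trace (Y j *m a).
  move=> ha; rewrite {2}(Xcf ha) mulmx_sumr reg_trace_sum (bigD1 j) //=.
  rewrite -scalemxAr reg_traceZ YX eqxx mulr1 big1 ?addr0 // => i ij.
  by rewrite -scalemxAr reg_traceZ YX eq_sym (negPf ij) mulr0.
have dualY b : A b -> b = \sum_i reg_trace (b *m X i) *: Y i.
  move=> hb; apply/eqP; rewrite -subr_eq0; apply/eqP/N0.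
  have hd : A (b - \sum_i reg_trace (b *m X i) *: Y i).
    rewrite -scaleN1r addrC; apply: A_lin => //; apply: A_sum => i.
    exact: AZ.
  split=> // c hc; rewrite (Xcf hc) mulmx_sumr reg_trace_sum big1 // => j _.
  rewrite -scalemxAr reg_traceZ mulmxBl -scaleN1r reg_traceD reg_traceZ.
  rewrite mulmx_suml reg_trace_sum (bigD1 j) //= -scalemxAl reg_traceZ YX eqxx mulr1.
  rewrite big1 ?addr0 ?mulN1r ?subrr ?mulr0 // => i ij.
  by rewrite -scalemxAl reg_traceZ YX (negPf ij) mulr0.
exists Y; split=> //.
  have hz : A (\sum_i X i *m Y i) by apply: A_sum => i; apply: AM.
  apply/eqP; rewrite -subr_eq0; apply/eqP/N0; split.
    by rewrite -scaleN1r addrC; apply: A_lin.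
  move=> b hb; rewrite mulmxBl mul1mx -scaleN1r reg_traceD reg_traceZ.
  rewrite mulmx_suml reg_trace_sum.
  under eq_bigr => i _.
    rewrite -mulmxA reg_traceC //; last exact: AM.
    rewrite -mulmxA -cfE; last exact: AM.
    over.
  by rewrite /reg_trace /mxtrace mulN1r; under [X in _ - X]eq_bigr do rewrite mxE; rewrite subrr.
move=> F i0 f x hx; rewrite mulmx_sumr mulmx_suml.
have e1 i : x *m X i = \sum_j reg_trace (Y j *m x *m X i) *: X j.
  rewrite {1}[x *m X i]Xcf; last exact: AM.
  by apply: eq_bigr => j _; rewrite cfE ?mulmxA //; apply: AM.
have e2 j : Y j *m x = \sum_i reg_trace (Y j *m x *m X i) *: Y i.
  by apply: dualY; apply: AM.
under eq_bigr => i _.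
  rewrite !mulmxA -map_mxM e1 raddf_sum !mulmx_suml /=.
  under eq_bigr do rewrite map_mxZ -!scalemxAl.
  over.
rewrite exchange_big; apply: eq_bigr => j _ /=.
rewrite -[RHS]mulmxA -map_mxM (congr1 (map_mx i0) (e2 j)) raddf_sum mulmx_sumr /=.
by apply: eq_bigr => i _; rewrite map_mxZ -scalemxAr.
Qed.
End RegularTrace.

(** * Bounded groups of complex matrices *)

Lemma invmx_eq (F : fieldType) n (A B : 'M[F]_n) : A *m B = 1%:M -> invmx A = B.
Proof.
move=> e; have [uA _] := mulmx1_unit e.
by rewrite -[invmx A]mulmx1 -e mulmxA mulVmx // mul1mx.
Qed.

Lemma invmx_mul (F : fieldType) n (A B : 'M[F]_n) :
  A \in unitmx -> B \in unitmx -> invmx (A *m B) = invmx B *m invmx A.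
Proof.
move=> uA uB; apply: invmx_eq.
by rewrite mulmxA mulmxK // mulmxV.
Qed.

(** * Limits along a free ultrafilter *)

Section Ulim.
Variable R : realType.
Local Notation C := (CC R).
Local Notation Re := complex.Re.
Local Notation Im := complex.Im.

Lemma CC_eq (x y : C) : Re x = Re y -> Im x = Im y -> x = y.
Proof. by case: x => a b; case: y => c d /= -> ->. Qed.

(** The squared modulus, taken with values in [R] so that real order and real limits apply. *)
Definition n2 (z : C) : R := Re z ^+ 2 + Im z ^+ 2.

Lemma n2M x y : n2 (x * y) = n2 x * n2 y.
Proof. by rewrite /n2; case: x => a b; case: y => c d /=; ring. Qed.
Lemma n2_ge0 x : 0 <= n2 x.
Proof. by rewrite addr_ge0 // sqr_ge0. Qed.
Lemma n2_eq0 x : n2 x = 0 -> x = 0.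
Proof.
move=> /eqP; rewrite paddr_eq0 ?sqr_ge0 // !sqrf_eq0 => /andP[/eqP h1 /eqP h2].
exact: CC_eq.
Qed.
Lemma n2_0 : n2 0 = 0. Proof. by rewrite /n2 /= expr0n addr0. Qed.
Lemma n2N x : n2 (- x) = n2 x.
Proof. by case: x => a b; rewrite /n2 /= !sqrrN. Qed.
Lemma n2D x y : n2 (x + y) <= 2 * (n2 x + n2 y).
Proof.
case: x => a b; case: y => c d; rewrite /n2 /= -subr_ge0.
by rewrite (_ : _ - _ = (a - c) ^+ 2 + (b - d) ^+ 2) ?addr_ge0 ?sqr_ge0 //; ring.
Qed.
Lemma n2_toC (a : R) (x : C) : n2 (toC a * x) = a ^+ 2 * n2 x.
Proof. by case: x => c d; rewrite /n2 /=; ring. Qed.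
(* A free ultrafilter on the integers makes every bounded complex sequence
   converge, compatibly with the ring operations. *)
Variable U : set_system nat.
Hypothesis U_ultra : UltraFilter U.
Hypothesis U_free : \oo `<=` U.

Let U_proper : ProperFilter U. Proof. exact: ultra_proper. Qed.
#[local] Existing Instance U_proper.

Definition ulim (x : nat -> C) (y : C) :=
  ((fun k => Re (x k)) @ U --> Re y) /\ ((fun k => Im (x k)) @ U --> Im y).

Lemma ulim_unique x y z : ulim x y -> ulim x z -> y = z.
Proof.
move=> [h1 h2] [h3 h4]; apply: CC_eq.
  exact: (cvg_unique _ h1 h3).
exact: (cvg_unique _ h2 h4).
Qed.

Lemma ulim_cst y : ulim (fun=> y) y.
Proof. by split; exact: cvg_cst. Qed.

Lemma ulimD x y a b : ulim x a -> ulim y b -> ulim (fun k => x k + y k) (a + b).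
Proof.
move=> [h1 h2] [h3 h4]; split.
  rewrite (_ : Re (a + b) = Re a + Re b); last by case: a {h1 h2}; case: b {h3 h4}.
  rewrite (_ : (fun k => _) = (fun k => Re (x k) + Re (y k))); first exact: cvgD.
  by apply/funext => k; case: (x k); case: (y k).
rewrite (_ : Im (a + b) = Im a + Im b); last by case: a {h1 h2}; case: b {h3 h4}.
rewrite (_ : (fun k => _) = (fun k => Im (x k) + Im (y k))); first exact: cvgD.
by apply/funext => k; case: (x k); case: (y k).
Qed.

Lemma ulimM x y a b : ulim x a -> ulim y b -> ulim (fun k => x k * y k) (a * b).
Proof.
move=> [h1 h2] [h3 h4]; split.
  rewrite (_ : Re (a * b) = Re a * Re b - Im a * Im b); last by case: a {h1 h2}; case: b {h3 h4}.
  rewrite (_ : (fun k => _) = (fun k => Re (x k) * Re (y k) - Im (x k) * Im (y k))).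
    by apply: cvgB; apply: cvgM.
  by apply/funext => k; case: (x k); case: (y k).
rewrite (_ : Im (a * b) = Re a * Im b + Im a * Re b); last by case: a {h1 h2}; case: b {h3 h4}.
rewrite (_ : (fun k => _) = (fun k => Re (x k) * Im (y k) + Im (x k) * Re (y k))).
  by apply: cvgD; apply: cvgM.
by apply/funext => k; case: (x k); case: (y k).
Qed.

Lemma ulim_conj x a : ulim x a -> ulim (fun k => Num.conj (x k)) (Num.conj a).
Proof.
move=> [h1 h2]; split.
  rewrite (_ : Re _ = Re a); last by case: a {h1 h2}.
  by rewrite (_ : (fun k => _) = (fun k => Re (x k))) //; apply/funext => k; case: (x k).
rewrite (_ : Im _ = - Im a); last by case: a {h1 h2}.
rewrite (_ : (fun k => _) = (fun k => - Im (x k))); first exact: cvgN.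
by apply/funext => k; case: (x k).
Qed.

Lemma ulim_sum I (s : seq I) (x : I -> nat -> C) a : (forall i, ulim (x i) (a i)) ->
  ulim (fun k => \sum_(i <- s) x i k) (\sum_(i <- s) a i).
Proof.
move=> h; elim: s => [|i s IH].
  by rewrite big_nil; under eq_fun do rewrite big_nil; exact: ulim_cst.
by rewrite big_cons; under eq_fun do rewrite big_cons; exact: ulimD.
Qed.

Lemma ulim_prod I (s : seq I) (x : I -> nat -> C) a : (forall i, ulim (x i) (a i)) ->
  ulim (fun k => \prod_(i <- s) x i k) (\prod_(i <- s) a i).
Proof.
move=> h; elim: s => [|i s IH].
  by rewrite big_nil; under eq_fun do rewrite big_nil; exact: ulim_cst.
by rewrite big_cons; under eq_fun do rewrite big_cons; exact: ulimM.
Qed.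

Lemma ulimX x a n : ulim x a -> ulim (fun k => x k ^+ n) (a ^+ n).
Proof.
move=> h; elim: n => [|n IH]; first exact: ulim_cst.
by rewrite exprS; under eq_fun do rewrite exprS; exact: ulimM.
Qed.

Lemma ulim_mmap (k : nzRingType) N (f : k -> C) (x : 'I_N -> nat -> C) a P :
  (forall i, ulim (x i) (a i)) ->
  ulim (fun j => mmap f (fun i => x i j) P) (mmap f a P).
Proof.
move=> h; rewrite /mmap; apply: ulim_sum => m; apply: ulimM; first exact: ulim_cst.
by rewrite /mmap1; apply: ulim_prod => i; apply: ulimX.
Qed.

(** Compactness gives a cluster point, and an ultrafilter converges to each of its cluster
    points. *)
Lemma ultra_cvg_compact (T : topologicalType) (A : set T) (x : nat -> T) :
  compact A -> (forall k, A (x k)) -> exists2 p, A p & x @ U --> p.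
Proof.
move=> cA xA; have [|p [Ap cp]] := cA (x @ U) _.
  by rewrite /fmap /=; apply: filterS filterT => k _; exact: xA.
exists p => // B nB; have [//|hB] := in_ultra_setVsetC (x @^-1` B) U_ultra.
have [q [qB Bq]] := cp (~` B) B hB nB.
by [].
Qed.

Lemma ulim_exists (x : nat -> C) B : (forall k, n2 (x k) <= B) -> exists y, ulim x y.
Proof.
move=> xB.
have bd (a b : R) : a ^+ 2 + b ^+ 2 <= B -> - (B + 1) <= a <= B + 1.
  move=> h; have b2 := sqr_ge0 b; have a2 := sqr_ge0 a.
  have a1 : 0 <= (a - 1) ^+ 2 by exact: sqr_ge0.
  have a1' : 0 <= (a + 1) ^+ 2 by exact: sqr_ge0.
  by apply/andP; split; nra.
have [a _ ha] := @ultra_cvg_compact R _ (fun k => Re (x k)) (@segment_compact _ _ _)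
   (fun k => bd _ _ (xB k)).
have xB' k : Im (x k) ^+ 2 + Re (x k) ^+ 2 <= B by rewrite addrC; exact: xB.
have [b _ hb] := @ultra_cvg_compact R _ (fun k => Im (x k)) (@segment_compact _ _ _)
   (fun k => bd _ _ (xB' k)).
by exists (Complex a b); split.
Qed.

Lemma ulim_n2 x y : ulim x y -> (fun k => n2 (x k)) @ U --> n2 y.
Proof. by move=> [h1 h2]; apply: cvgD; rewrite /=; apply: cvgM. Qed.

Lemma ulim_tail (S : set nat) N : U S -> exists2 k, (N <= k)%N & S k.
Proof.
move=> US; have UN : U [set k | (N <= k)%N] by apply: U_free; exists N.
by have [k [Sk Nk]] := filter_ex (filterI US UN); exists k.
Qed.

Lemma ulim_n2_le x y B N : ulim x y -> (forall k, (N <= k)%N -> n2 (x k) <= B) ->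
  n2 y <= B.
Proof.
move=> /ulim_n2 xy h; rewrite leNgt; apply/negP => /(cvgr_gt _ xy) near.
have [k Nk] := ulim_tail N near.
by rewrite /= ltNge h.
Qed.

Lemma ulim_squeeze x y B : (forall k, n2 (x k - y) <= B) ->
  (forall e, 0 < e -> exists N, forall k, (N <= k)%N -> n2 (x k - y) <= e) ->
  ulim x y.
Proof.
move=> bd h; have [z hz] := ulim_exists bd.
have z0 : z = 0.
  apply: n2_eq0; apply/eqP; rewrite eq_le n2_ge0 andbT; apply/ler_addgt0Pr => e e0.
  have [N hN] := h _ e0; rewrite add0r; exact: ulim_n2_le hz hN.
rewrite (_ : x = fun k => (x k - y) + y); last by apply/funext => k; rewrite subrK.
by rewrite -[y in ulim _ y]add0r -z0; apply: ulimD => //; exact: ulim_cst.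
Qed.

Definition mxlim m n (x : nat -> 'M[C]_(m, n)) (y : 'M[C]_(m, n)) :=
  forall i j, ulim (fun k => x k i j) (y i j).

Lemma mxlim_compact m n (A : set 'M[C]_(m, n)) (x : nat -> 'M[C]_(m, n)) :
  compact A -> (forall k, A (x k)) -> exists2 y, A y & mxlim x y.
Proof.
move=> cA xA; have [y Ay xy] := ultra_cvg_compact cA xA; exists y => // i j.
have xyij : (fun k => x k i j) @ U --> y i j.
  exact: (continuous_cvg _ (@coord_continuous C m n i j y) xy).
have near (e : R) : 0 < e -> \forall k \near U, `|y i j - x k i j| < toC e.
  move=> e0; have e0' : 0 < toC e by rewrite ltcR.
  have FU : Filter U by exact: filter_filter.
  exact: (@cvgr_dist_lt _ _ _ _ FU _ _ xyij _ e0').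
split; apply/cvgrPdist_lt => e /near; apply: filterS => k h.
  rewrite -ltcR; apply: le_lt_trans h.
  by rewrite -(_ : Re (y i j - x k i j) = Re (y i j) - Re (x k i j)) ?normc_ge_Re //;
    case: (y i j); case: (x k i j).
rewrite -ltcR; apply: le_lt_trans h.
(* The imaginary part is the opposite of the real part of the product by ['i], so the same estimate
   applies. *)
rewrite (_ : _ - _ = - Re ((y i j - x k i j) * 'i%C)); last first.
  by case: (y i j); case: (x k i j) => * /=; ring.
rewrite normrN; apply: le_trans (normc_ge_Re _) _.
by rewrite normrM (_ : `|'i%C| = 1 :> C) ?mulr1 // normc_def /= expr0n expr1n add0r sqrtr1.
Qed.

Definition N2 m n (A : 'M[C]_(m, n)) : R := \sum_(p : 'I_m * 'I_n) n2 (A p.1 p.2).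

Lemma N2_ge0 m n (A : 'M[C]_(m, n)) : 0 <= N2 A.
Proof. by apply: sumr_ge0 => *; exact: n2_ge0. Qed.

Lemma n2_le_N2 m n (A : 'M[C]_(m, n)) i j : n2 (A i j) <= N2 A.
Proof.
rewrite /N2 (bigD1 (i, j)) //= lerDl.
by apply: sumr_ge0 => *; exact: n2_ge0.
Qed.

Lemma N2_eq0 m n (A : 'M[C]_(m, n)) : N2 A = 0 -> A = 0.
Proof.
move=> h; apply/matrixP => i j; rewrite mxE; apply: n2_eq0; apply/eqP.
by rewrite eq_le n2_ge0 andbT -h n2_le_N2.
Qed.

Lemma N2_0 m n : N2 (0 : 'M[C]_(m, n)) = 0.
Proof. by rewrite /N2 big1 // => p _; rewrite mxE n2_0. Qed.

Lemma N2D m n (A B : 'M[C]_(m, n)) : N2 (A + B) <= 2 * (N2 A + N2 B).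
Proof.
rewrite -big_split mulr_sumr; apply: ler_sum => p _.
by rewrite mxE n2D.
Qed.

(** The parallelogram law at a midpoint, the source of strict convexity. *)
Lemma N2_parallelogram m n (A B : 'M[C]_(m, n)) :
  N2 (toC 2^-1 *: (A + B)) = (N2 A + N2 B) / 2 - N2 (A - B) / 4.
Proof.
rewrite /N2 -big_split !mulr_suml -sumrB; apply: eq_bigr => p _.
rewrite !mxE n2_toC /=; case: (A _ _) => a b; case: (B _ _) => c d.
by rewrite /n2 /=; field.
Qed.

Lemma n2_sum I (s : seq I) (x : I -> C) :
  n2 (\sum_(i <- s) x i) <= 2 ^+ size s * \sum_(i <- s) n2 (x i).
Proof.
elim: s => [|i s IH]; first by rewrite !big_nil n2_0 mulr0.
rewrite !big_cons; apply: le_trans (n2D _ _) _; rewrite exprS -mulrA ler_pM2l //.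
rewrite mulrDr; apply: lerD => //; rewrite ler_peMl ?n2_ge0 // exprn_ege1 //.
by rewrite ler1n.
Qed.

Lemma N2M m n p (A : 'M[C]_(m, n)) (B : 'M[C]_(n, p)) :
  N2 (A *m B) <= 2 ^+ n * (N2 A * N2 B).
Proof.
rewrite /N2.
have h i k : n2 ((A *m B) i k) <= 2 ^+ n * \sum_j n2 (A i j) * n2 (B j k).
  rewrite mxE; apply: le_trans (n2_sum _ _) _.
  rewrite (_ : size (index_enum 'I_n) = n); last by rewrite [index_enum _]unlock -enumT size_enum_ord.
  by under eq_bigr do rewrite n2M.
apply: le_trans (ler_sum _ (fun ik _ => h ik.1 ik.2)) _.
rewrite -mulr_sumr ler_pM2l ?exprn_gt0 ?ltr0n //.
rewrite -(pair_bigA _ (fun i k => \sum_j n2 (A i j) * n2 (B j k))) /=.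
rewrite -(pair_bigA _ (fun i j => n2 (A i j))) -(pair_bigA _ (fun j k => n2 (B j k))) /=.
rewrite mulr_suml; apply: ler_sum => i _.
rewrite exchange_big mulr_suml; apply: ler_sum => j _ /=.
rewrite -mulr_sumr ler_wpM2l ?n2_ge0 // (bigD1 j) //= lerDl.
by apply: sumr_ge0 => j' _; apply: sumr_ge0 => *; exact: n2_ge0.
Qed.

Lemma mxlim_unique m n (x : nat -> 'M[C]_(m, n)) a b : mxlim x a -> mxlim x b -> a = b.
Proof. by move=> h1 h2; apply/matrixP => i j; apply: ulim_unique (h1 i j) (h2 i j). Qed.

Lemma mxlim_cst m n (a : 'M[C]_(m, n)) : mxlim (fun=> a) a.
Proof. by move=> i j; exact: ulim_cst. Qed.

Lemma mxlimM m n p (x : nat -> 'M[C]_(m, n)) (y : nat -> 'M[C]_(n, p)) a b :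
  mxlim x a -> mxlim y b -> mxlim (fun k => x k *m y k) (a *m b).
Proof.
move=> h1 h2 i j; rewrite mxE; under eq_fun do rewrite mxE.
by apply: ulim_sum => k; apply: ulimM.
Qed.

Lemma mxlimD m n (x y : nat -> 'M[C]_(m, n)) a b :
  mxlim x a -> mxlim y b -> mxlim (fun k => x k + y k) (a + b).
Proof.
move=> h1 h2 i j; rewrite mxE; under eq_fun do rewrite mxE.
exact: ulimD.
Qed.

Lemma mxlim_exists m n (x : nat -> 'M[C]_(m, n)) B : (forall k, N2 (x k) <= B) ->
  exists y, mxlim x y.
Proof.
move=> h.
have ex (p : 'I_m * 'I_n) : exists y, ulim (fun k => x k p.1 p.2) y.
  by apply: (@ulim_exists _ B) => k; apply: le_trans (n2_le_N2 _ _ _) _.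
have [y yP] := boolp.choice ex; exists (\matrix_(i, j) y (i, j)) => i j.
by rewrite mxE; exact: (yP (i, j)).
Qed.

Lemma mxlim_N2 m n (x : nat -> 'M[C]_(m, n)) a :
  mxlim x a -> (fun k => N2 (x k)) @ U --> N2 a.
Proof.
move=> h; rewrite /N2.
elim: (index_enum _) => [|p s IH].
  by rewrite big_nil; under eq_fun do rewrite big_nil; exact: cvg_cst.
rewrite big_cons; under eq_fun do rewrite big_cons.
by apply: cvgD => //; apply: ulim_n2.
Qed.

Lemma mxlim_N2_le m n (x : nat -> 'M[C]_(m, n)) a B N :
  mxlim x a -> (forall k, (N <= k)%N -> N2 (x k) <= B) -> N2 a <= B.
Proof.
move=> /mxlim_N2 xy h; rewrite leNgt; apply/negP => /(cvgr_gt _ xy) near.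
have [k Nk] := ulim_tail N near.
by rewrite /= ltNge h.
Qed.

Lemma mxlim_near m n (x : nat -> 'M[C]_(m, n)) a e : mxlim x a -> 0 < e ->
  U [set k | N2 (x k - a) < e].
Proof.
move=> xa e0; have /mxlim_N2 h : mxlim (fun k => x k - a) 0.
  by rewrite -(subrr a); apply: mxlimD => //; exact: mxlim_cst.
by move: h; rewrite N2_0 => /cvgr_lt; apply.
Qed.

Lemma mxlim_squeeze m n (x : nat -> 'M[C]_(m, n)) a B :
  (forall k, N2 (x k - a) <= B) ->
  (forall e, 0 < e -> exists N, forall k, (N <= k)%N -> N2 (x k - a) <= e) ->
  mxlim x a.
Proof.
move=> bd h i j; apply: (@ulim_squeeze _ _ B) => [k|e /h [N hN]].
  by have := n2_le_N2 (x k - a) i j; rewrite !mxE => /le_trans; apply.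
exists N => k /hN; apply: le_trans.
by have := n2_le_N2 (x k - a) i j; rewrite !mxE.
Qed.

Lemma inv_nat_small (e : R) : 0 < e ->
  exists N, forall k, (N <= k)%N -> (k.+1%:R)^-1 <= e.
Proof.
move=> e0; exists (Num.bound e^-1) => k Nk.
rewrite -[e]invrK lef_pV2 ?posrE ?invr_gt0 ?ltr0n //.
apply/ltW/(lt_le_trans (archi_boundP (ltW (_ : 0 < e^-1)))); first by rewrite invr_gt0.
by rewrite ler_nat ltnW.
Qed.

(* The orbit map x |-> sup_g N2 (g x g^-1) is strictly convex, so that its
   minimiser on the convex set S is unique, hence fixed. *)
Lemma bounded_group_fixed_point m (Gam S : set 'M[C]_m) B :
  Gam 1%:M -> (forall g, Gam g -> g \in unitmx) ->
  (forall g h, Gam g -> Gam h -> Gam (g *m h)) ->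
  (forall g, Gam g -> Gam (invmx g)) ->
  (exists x, S x) ->
  (forall x y, S x -> S y -> S (toC 2^-1 *: (x + y))) ->
  (forall g x, Gam g -> S x -> S (g *m x *m invmx g)) ->
  (forall x y, (forall k, S (x k)) -> mxlim x y -> S y) ->
  (forall g x, Gam g -> S x -> N2 (g *m x *m invmx g) <= B * N2 x) ->
  (forall g x y, Gam g -> S x -> S y ->
     N2 (g *m (x - y) *m invmx g) <= B * N2 (x - y)) ->
  exists2 x, S x & forall g, Gam g -> g *m x = x *m g.
Proof.
move=> G1 Gu GM GV [x0 Sx0] Smid SG Slim bd1 bd2.
pose act (g x : 'M[C]_m) := g *m x *m invmx g.
have actM g h x : Gam g -> Gam h -> act (g *m h) x = act g (act h x).
  by move=> Gg Gh; rewrite /act invmx_mul ?Gu // !mulmxA.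
pose B' := 1 + `|B|.
have B'0 : 0 < B' by rewrite ltr_pwDl.
have BB' z : 0 <= z -> B * z <= B' * z.
  by move=> z0; apply: ler_wpM2r => //; rewrite (le_trans (ler_norm _)) // lerDr.
pose vals x : set R := [set N2 (act g x) | g in Gam].
have has_sup_vals x : S x -> has_sup (vals x).
  move=> Sx; split; first by exists (N2 (act 1%:M x)); exists 1%:M.
  by exists (B * N2 x) => _ [g Gg <-]; exact: bd1.
pose Phi x := sup (vals x).
have Phi_ge x g : S x -> Gam g -> N2 (act g x) <= Phi x.
  by move=> Sx Gg; apply: ub_le_sup; [case: (has_sup_vals _ Sx) | exists g].
have Phi_le x c : (forall g, Gam g -> N2 (act g x) <= c) -> Phi x <= c.
  move=> h; apply: ge_sup; first by exists (N2 (act 1%:M x)); exists 1%:M.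
  by move=> _ [g Gg <-]; exact: h.
pose Img : set R := [set Phi x | x in S].
have Img_inf : has_inf Img.
  split; first by exists (Phi x0); exists x0.
  exists 0 => _ [x Sx <-]; apply: le_trans (Phi_ge _ _ Sx G1); exact: N2_ge0.
pose d := inf Img.
have d_le x : S x -> d <= Phi x by move=> Sx; apply: ge_inf; [case: Img_inf | exists x].
(* The orbit supremum at the midpoint is at least [d], and below [c] by a fixed multiple of
   [N2 (x - y)]; points that nearly minimise are therefore close. *)
have convex x y c : S x -> S y -> Phi x <= c -> Phi y <= c ->
    N2 (x - y) <= 4 * B' * (c - d).
  move=> Sx Sy xc yc.
  have key : Phi (toC 2^-1 *: (x + y)) <= c - N2 (x - y) / (4 * B').
    apply: Phi_le => g Gg; rewrite /act -scalemxAr -scalemxAl mulmxDr mulmxDl.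
    rewrite N2_parallelogram -mulmxBl -mulmxBr.
    have h1 := le_trans (Phi_ge _ _ Sx Gg) xc.
    have h2 := le_trans (Phi_ge _ _ Sy Gg) yc.
    (* The upper bound for conjugation by the inverse of [g] is a lower bound for conjugation by
       [g]. *)
    have h3 : N2 (x - y) <= B' * N2 (g *m (x - y) *m invmx g).
      have Sgx := SG _ _ Gg Sx; have Sgy := SG _ _ Gg Sy.
      have := bd2 _ _ _ (GV _ Gg) Sgx Sgy.
      rewrite -mulmxBl -mulmxBr invmxK !mulmxA mulVmx ?Gu // mul1mx.
      rewrite -[X in N2 X <= _]mulmxA mulVmx ?Gu // mulmx1 => /le_trans; apply.
      by apply: BB'; exact: N2_ge0.
    have : N2 (x - y) / (4 * B') <= N2 (g *m (x - y) *m invmx g) / 4.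
      rewrite [4 * B']mulrC invfM mulrA ler_pM2r ?invr_gt0 //.
      by rewrite ler_pdivrMr // mulrC.
    by move: h1 h2; rewrite /act; lra.
  have := d_le _ (Smid _ _ Sx Sy) => h; have {key} := le_trans h key.
  rewrite lerBrDl -lerBrDr => {}h.
  by rewrite -ler_pdivrMl ?mulr_gt0 // mulrC.
have seqx k : exists x, S x /\ Phi x <= d + k.+1%:R^-1.
  have k0 : 0 < k.+1%:R^-1 :> R by rewrite invr_gt0 ltr0Sn.
  have [_ [x Sx <-] hx] := inf_adherent k0 Img_inf.
  by exists x; split => //; exact: ltW.
have [x xP] := boolp.choice seqx.
have bdx k : N2 (x k) <= d + 1.
  have [Sx hx] := xP k; have := Phi_ge _ _ Sx G1.
  rewrite /act mul1mx invmx1 mulmx1 => /le_trans; apply; apply: le_trans hx _.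
  by rewrite lerD2l invf_le1 ?ler1n.
have [y xy] := mxlim_exists bdx.
have Sy : S y by apply: Slim xy => k; case: (xP k).
have Phiy : Phi y <= d.
  apply: Phi_le => g Gg; apply/ler_addgt0Pr => e e0.
  have [N hN] := inv_nat_small e0.
  apply: (@mxlim_N2_le _ _ (fun k => act g (x k)) _ _ N).
    by apply: mxlimM; [apply: mxlimM => //|]; exact: mxlim_cst.
  move=> k /hN h; have [Sx hx] := xP k.
  by apply: le_trans (Phi_ge _ _ Sx Gg) _; apply: le_trans hx _; rewrite lerD2l.
exists y => // g Gg.
have Sgy := SG _ _ Gg Sy.
have Phigy : Phi (act g y) <= d.
  by apply: Phi_le => h Gh; rewrite -actM //; apply: le_trans Phiy; apply: Phi_ge => //; exact: GM.
(* [y] and its conjugate are both minimisers, so the estimate is used with [c = d]. *)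
have := convex _ _ _ Sgy Sy Phigy Phiy; rewrite subrr mulr0 => h.
have /N2_eq0/eqP : N2 (act g y - y) = 0 by apply/eqP; rewrite eq_le h N2_ge0.
by rewrite subr_eq0 => /eqP e; rewrite -{2}e /act mulmxKV ?Gu.
Qed.
End Ulim.

(** * A Baire category argument on a compact group *)

Section Baire.
Variable R : realType.
Local Notation C := (CC R).
Variable U : set_system nat.
Hypothesis U_ultra : UltraFilter U.
Hypothesis U_free : \oo `<=` U.
Variables (b : nat) (Uc : set 'M[C]_b) (F : nat -> set 'M[C]_b).
Hypothesis Uc_compact : compact Uc.
Hypothesis Uc_unit : forall u, Uc u -> u \in unitmx.
Hypothesis UcM : forall u v, Uc u -> Uc v -> Uc (u *m v).
Hypothesis UcV : forall u, Uc u -> Uc (invmx u).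
Hypothesis Uc1 : Uc 1%:M.
Hypothesis F_cover : forall u, Uc u -> exists B, F B u.
Hypothesis F_mono : forall B B' u, (B <= B')%N -> F B u -> F B' u.
Hypothesis F_closed : forall B u v,
  (forall k, F B (u k)) -> mxlim U u v -> F B v.
Hypothesis F_mul : forall B B', exists B'', forall u v, F B u -> F B' v -> F B'' (u *m v).

Let F_avoid B v : ~ F B v ->
  exists2 e, 0 < e & forall u, N2 (u - v) <= e -> ~ F B u.
Proof.
move=> nF; apply: contrapT => h; apply: nF.
have ex k : exists u, N2 (u - v) <= k.+1%:R^-1 /\ F B u.
  apply: contrapT => h'; apply: h; exists k.+1%:R^-1; first by rewrite invr_gt0.
  by move=> u hu Fu; apply: h'; exists u.
have [u uP] := boolp.choice ex.
apply: (F_closed (u := u)) => [k|]; first by case: (uP k).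
apply: (@mxlim_squeeze _ _ U_ultra U_free _ _ _ _ 1) => [k|e /inv_nat_small [N hN]].
  by case: (uP k) => /le_trans h' _; apply: h'; rewrite invf_le1 ?ler1n.
by exists N => k /hN; case: (uP k) => /le_trans h' _; apply: h'.
Qed.

(* Baire category: nested closed balls avoiding F 0, F 1, ... in turn. *)
Lemma interior_bounded_lifts : exists N u0 e,
  [/\ Uc u0, 0 < e & forall v, Uc v -> N2 (v - u0) < e -> F N v].
Proof.
apply: contrapT => none.
pose ok (s : 'M[C]_b * R) := Uc s.1 /\ 0 < s.2.
have step N (s : {s | ok s}) : exists s' : {s | ok s},
    (forall v, N2 (v - (sval s').1) <= (sval s').2 -> N2 (v - (sval s).1) <= (sval s).2) /\
    (forall v, N2 (v - (sval s').1) <= (sval s').2 -> ~ F N v).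
  case: s => -[u e] /= [Uu e0].
  (* [N2] satisfies the triangle inequality only up to a factor 2, so radii are divided by 4 to keep
     the balls nested. *)
  have [v [Uv uv nF]] : exists v, [/\ Uc v, N2 (v - u) < e / 4 & ~ F N v].
    apply: contrapT => h; apply: none; exists N, u, (e / 4); split=> //=.
      by rewrite divr_gt0.
    by move=> v Uv uv; apply: contrapT => nF; apply: h; exists v.
  have [e' e'0 he'] := F_avoid nF.
  have ok' : ok (v, Num.min e' (e / 4)) by split=> //=; rewrite lt_min e'0 divr_gt0.
  exists (exist _ _ ok') => /=; split=> w; rewrite le_min => /andP[h1 h2].
    rewrite -(subrKA v); apply: le_trans (N2D _ _) _.
    move: uv h2 => /=; lra.
  exact: he'.
have [nxt nxtP] := boolp.choice (fun s : nat * {s | ok s} => step s.1 s.2).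
have ok0 : ok (1%:M, 1) by split=> //=.
pose fix sq k := if k is k'.+1 then nxt (k', sq k') else exist _ _ ok0.
pose u k := (sval (sq k)).1.
have nested k j v : N2 (v - u (j + k)%N) <= (sval (sq (j + k)%N)).2 ->
    N2 (v - u k) <= (sval (sq k)).2.
  elim: j => // j IH h; apply: IH; exact: (nxtP (_, _)).1 h.
have Uu k : Uc (u k) by rewrite /u; case: (sval (sq k)) (svalP (sq k)) => ? ? [].
have [p Up lp] := mxlim_compact U_ultra Uc_compact Uu.
have near k : N2 (p - u k) <= (sval (sq k)).2.
  apply: (@mxlim_N2_le _ _ U_ultra U_free _ _ (fun j => u j - u k) _ _ k).
    by apply: mxlimD => //; exact: mxlim_cst.
  move=> j kj; apply: (nested _ (j - k)%N); rewrite subnK // subrr N2_0.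
  by case: (sval (sq j)) (svalP (sq j)) => ? ? [_ /ltW].
have [B FB] := F_cover Up.
exact: (nxtP (B, sq B)).2 _ (near B.+1) FB.
Qed.

(** The bound near [u0] is spread by translation. If [u k] escaped every bound and tended to [p],
    the elements [u k *m (invmx p *m u0)] would come close to [u0], and [u k] would be recovered
    from them by multiplication with one fixed element. *)
Lemma uniformly_bounded_lifts : exists B, forall u, Uc u -> F B u.
Proof.
have [N [u0 [e [Uu0 e0 hN]]]] := interior_bounded_lifts.
apply: contrapT => none.
have ex B : exists u, Uc u /\ ~ F B u.
  apply: contrapT => h; apply: none; exists B => u Uu; apply: contrapT => nF.
  by apply: h; exists u.
have [u uP] := boolp.choice ex.
have Uu k : Uc (u k) by case: (uP k).
have [p Up lp] := mxlim_compact U_ultra Uc_compact Uu.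
have Uq : Uc (invmx p *m u0) by apply: UcM => //; exact: UcV.
have Uq' : Uc (invmx u0 *m p) by apply: UcM => //; exact: UcV.
have lw : mxlim U (fun k => u k *m (invmx p *m u0)) u0.
  rewrite -[u0 in mxlim _ _ u0](mulKVmx (Uc_unit Up)).
  by apply: mxlimM => //; exact: mxlim_cst.
have [B0 FB0] := F_cover Uq'.
have [B1 hB1] := F_mul N B0.
have [k Bk hk] := ulim_tail U_ultra U_free B1 (mxlim_near U_ultra lw e0).
have [_] := uP k; apply; apply: (F_mono Bk).
have -> : u k = (u k *m (invmx p *m u0)) *m (invmx u0 *m p).
  by rewrite !mulmxA mulmxK ?Uc_unit // mulmxKV ?Uc_unit.
by apply: hB1 => //; apply: hN => //; apply: UcM.
Qed.
End Baire.

(** * Derivations and exponential curves *)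

Lemma mpoly_ring_ind (k : comNzRingType) N (Pr : mpoly N k -> Prop) :
  (forall c, Pr (mpolyC N c)) -> (forall i, Pr (mpolyX k (mnm1 i))) ->
  (forall p q, Pr p -> Pr q -> Pr (p + q)) ->
  (forall p q, Pr p -> Pr q -> Pr (p * q)) -> forall p, Pr p.
Proof.
move=> hC hX hD hM; elim/mpolyind => [|c m p _ _ IH].
  by rewrite -(mpolyC0 N k); apply: (hC).
apply: (hD) => //; rewrite -mul_mpolyC; apply: (hM) => //.
rewrite mpolyXE_id; apply: (big_ind Pr) => [|p' q'|i _].
- by rewrite -mpolyC1; apply: (hC).
- exact: hM.
elim: (m i) => [|e IHe]; first by rewrite expr0 -mpolyC1; apply: (hC).
by rewrite exprS; apply: (hM).
Qed.

Lemma mderiv_var (k : comNzRingType) N (v i : 'I_N) :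
  mderiv v (mpolyX k (mnm1 i)) = (v == i)%:R.
Proof.
rewrite mderivX mnm1E eq_sym; case: eqVneq => [->|_]; last by rewrite scale0r.
rewrite scale1r (_ : mnm_sub _ _ = mnm0) ?mpolyX0 //.
by apply/mnmP => j; rewrite !mnmE subnn.
Qed.

Lemma deriv_mmap (k K : comNzRingType) (f : {rmorphism k -> {poly K}}) N
    (h : 'I_N -> {poly K}) P : (forall c, (f c)^`() = 0) ->
  (mmap f h P)^`() = \sum_v mmap f h (mderiv v P) * (h v)^`().
Proof.
move=> f0; elim/mpoly_ring_ind: P => [c|i|p q IHp IHq|p q IHp IHq].
- by rewrite mmapC f0 big1 // => v _; rewrite mderivC rmorph0 mul0r.
- rewrite mmapX mmap1U (bigD1 i) //= mderiv_var eqxx rmorph1 mul1r big1 ?addr0 //.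
  by move=> v vi; rewrite mderiv_var (negPf vi) rmorph0 mul0r.
- rewrite rmorphD /= derivD IHp IHq -big_split; apply: eq_bigr => v _ /=.
  by rewrite mderivD rmorphD mulrDl.
- rewrite rmorphM /= derivM IHp IHq mulr_suml mulr_sumr -big_split.
  apply: eq_bigr => v _ /=; rewrite mderivM rmorphD !rmorphM /=; ring.
Qed.

Section DirectionalDerivative.
Variables (k : fieldType) (n : nat).

Definition generic_mx : 'M[entry_poly k n]_n := \matrix_(i, j) entry_var k i j.

(* the left-invariant derivation P |-> d/dt P(g (1 + t X)) *)
Definition lderiv (X : 'M[k]_n) (P : entry_poly k n) : entry_poly k n :=
  \sum_v mxvec (generic_mx *m map_mx (@entry_cst k n) X) 0 v * mderiv v P.

Lemma entry_eval_mxvec (K : fieldType) (f : {rmorphism k -> K}) (g : 'M[K]_n)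
    m (A : 'M[entry_poly k n]_m) v :
  entry_eval f g (mxvec A 0 v) = mxvec (map_mx (entry_eval f g) A) 0 v.
Proof. by rewrite -map_mxvec mxE. Qed.

Lemma map_generic_mx (K : fieldType) (f : {rmorphism k -> K}) (g : 'M[K]_n) :
  map_mx (entry_eval f g) generic_mx = g.
Proof. by apply/matrixP => i j; rewrite !mxE entry_eval_var. Qed.

Lemma entry_eval_lderiv (K : fieldType) (f : {rmorphism k -> K}) (g : 'M[K]_n)
    X P :
  entry_eval f g (lderiv X P) =
  \sum_v mxvec (g *m map_mx f X) 0 v * entry_eval f g (mderiv v P).
Proof.
rewrite /lderiv rmorph_sum; apply: eq_bigr => v _.
rewrite rmorphM /= entry_eval_mxvec map_mxM /= map_generic_mx.
by congr (mxvec (g *m _) 0 v * _); apply/matrixP => i j; rewrite !mxE entry_eval_cst.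
Qed.

Lemma lderiv_linear X P Q : lderiv X (P + Q) = lderiv X P + lderiv X Q.
Proof.
by rewrite -big_split; apply: eq_bigr => v _; rewrite mderivD mulrDr.
Qed.
End DirectionalDerivative.

(** * Truncated exponentials and their limit *)

Section Majorants.
Variable C : numClosedFieldType.

Definition majorized (p s : {poly C}) := forall i, `|p`_i| <= s`_i.

Lemma majorizedD p q s t : majorized p s -> majorized q t -> majorized (p + q) (s + t).
Proof.
by move=> h1 h2 i; rewrite !coefD (le_trans (ler_normD _ _)) // lerD.
Qed.

Lemma majorizedM p q s t : majorized p s -> majorized q t -> majorized (p * q) (s * t).
Proof.
move=> h1 h2 i; rewrite !coefM; apply: le_trans (ler_norm_sum _ _ _) _.
by apply: ler_sum => j _; rewrite normrM ler_pM.
Qed.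

Lemma majorized_horner p s (t : C) j : majorized p s -> `|t| <= 1 ->
  `|p.[t] - \sum_(i < j) p`_i * t ^+ i| <= `|t| ^+ j * s.[1].
Proof.
move=> ps t1; pose M := maxn j (maxn (size p) (size s)).
have jM : (j <= M)%N by rewrite leq_maxl.
have pM : (size p <= M)%N by rewrite !leq_max leqnn orbT.
have sM : (size s <= M)%N by rewrite !leq_max leqnn !orbT.
rewrite (horner_coef_wide _ pM) (horner_coef_wide _ sM).
rewrite -(big_mkord xpredT (fun i => p`_i * t ^+ i)).
rewrite -(big_mkord xpredT (fun i => p`_i * t ^+ i)).
rewrite (big_cat_nat _ jM) //= addrAC subrr add0r.
apply: le_trans (ler_norm_sum _ _ _) _.
rewrite -(big_mkord xpredT (fun i => s`_i * 1 ^+ i)).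
rewrite [X in _ <= _ * X](big_cat_nat (leq0n j) jM) /=.
have s0 i : 0 <= s`_i by apply: le_trans (ps i).
rewrite mulrDr; apply: ler_wpDl.
  by rewrite mulr_ge0 ?exprn_ge0 // sumr_ge0 // => i _; rewrite mulr_ge0 ?exprn_ge0.
rewrite mulr_sumr; apply: ler_sum_nat => i /andP[ji _].
rewrite expr1n mulr1 normrM normrX mulrC ler_pM ?exprn_ge0 //.
exact: ler_wiXn2l.
Qed.
End Majorants.

Section TruncatedExp.
Variables (C : numClosedFieldType) (n : nat) (X : 'M[C]_n).

(** The exponential series cut at degree [N], kept as a matrix of polynomials in the time variable
    so that formal derivatives are available. *)
Definition texp N : 'M[{poly C}]_n :=
  \matrix_(i, j) \sum_(k < N.+1) ((X ^+ k) i j / k`!%:R) *: 'X^k.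

Definition texp_eval N (P : entry_poly C n) : {poly C} :=
  mmap (@polyC C) (fun v => mxvec (texp N) 0 v) P.

Lemma coef_texp N i j k : (texp N i j)`_k =
  if (k <= N)%N then (X ^+ k) i j / k`!%:R else 0.
Proof.
rewrite mxE -(poly_def N.+1 (fun k => (X ^+ k) i j / k`!%:R)) coef_poly ltnS.
by [].
Qed.

Lemma deriv_texp N i j : (texp N i j)^`() =
  (texp N *m map_mx (@polyC C) X) i j - ((X ^+ N.+1) i j / N`!%:R) *: 'X^N.
Proof.
apply/polyP => k; rewrite coef_deriv coefB coefZ coefXn coef_texp mxE coef_sum.
under eq_bigr do rewrite [map_mx _ _ _ _]mxE coefMC coef_texp.
have fk : (k.+1`!%:R : C) != 0 by rewrite pnatr_eq0 -lt0n fact_gt0.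
have step : (X ^+ k.+1) i j / k.+1`!%:R *+ k.+1 = (X ^+ k.+1) i j / k`!%:R.
  rewrite -mulr_natr factS natrM.
  have k0 : (k.+1%:R : C) != 0 by rewrite pnatr_eq0.
  have fk0 : (k`!%:R : C) != 0 by rewrite pnatr_eq0 -lt0n fact_gt0.
  by field; rewrite fk0 addrC natr1 k0.
have sumE : \sum_l (X ^+ k) i l / k`!%:R * X l j = (X ^+ k.+1) i j / k`!%:R.
  rewrite exprSr mxE mulr_suml; apply: eq_bigr => l _; by rewrite mulrAC.
have [kN|kN|kN] := ltngtP k N.
- by rewrite mulr0 subr0 sumE step.
- by rewrite big1 ?mul0rn ?mulr0 ?subr0 // => l _; rewrite mul0r.
- by rewrite mulr1 sumE mul0rn -kN subrr.
Qed.

(** Along the exponential curve the time derivative is the derivation [lderiv X]. Truncation spoils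
    this only by a multiple of ['X^N], invisible to coefficients of index below [N]. *)
Lemma deriv_texp_eval N P :
  exists Q, (texp_eval N P)^`() = texp_eval N (lderiv X P) + 'X^N * Q.
Proof.
exists (- \sum_v (mxvec (X ^+ N.+1) 0 v / N`!%:R) *: texp_eval N (mderiv v P)).
rewrite /texp_eval deriv_mmap; last by move=> c; rewrite derivC.
rewrite /lderiv rmorph_sum mulrN mulr_sumr -sumrB; apply: eq_bigr => v _.
rewrite rmorphM /=.
case/mxvec_indexP: v => i j; rewrite !mxvecE deriv_texp.
rewrite mulrBr; congr (_ - _); last first.
  by rewrite -!scalerAr; congr (_ *: _); rewrite mulrC.
rewrite mulrC; congr (_ * _); rewrite !mxE rmorph_sum; apply: eq_bigr => l _ /=.
rewrite [map_mx _ _ _ _]mxE [generic_mx _ _ _ _]mxE [map_mx _ _ _ _]mxE rmorphM /=.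
by rewrite mmapX mmap1U mxvecE mmapC.
Qed.

Lemma texp_eval0 N P : (texp_eval N P)`_0 = entry_eval idfun 1%:M P.
Proof.
rewrite -horner_coef0 /texp_eval.
rewrite -[LHS]/(horner_eval 0 (mmap (@polyC C) _ P)) rmorph_mmap.
apply: eq_mmap => [c|v] /=; first by rewrite /horner_eval hornerC.
case/mxvec_indexP: v => i j; rewrite !mxvecE /horner_eval horner_coef0 coef_texp.
by rewrite expr0 fact0 divr1.
Qed.

Lemma texp_eval1 N P :
  (texp_eval N.+1 P)`_1 = entry_eval idfun 1%:M (lderiv X P).
Proof.
have [Q] := deriv_texp_eval N.+1 P.
move/(congr1 (fun p : {poly C} => p`_0)); rewrite coef_deriv mulr1n => ->.
by rewrite coefD coefXnM texp_eval0 addr0.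
Qed.

(** Up to factorials the Taylor coefficients are the values at 1 of the iterated derivatives of [P],
    all of which stay in [J]. *)
Lemma texp_eval_vanish (J : set (entry_poly C n)) :
  (forall P, J P -> J (lderiv X P)) ->
  (forall P, J P -> entry_eval idfun 1%:M P = 0) ->
  forall N P i, J P -> (i <= N)%N -> (texp_eval N P)`_i = 0.
Proof.
move=> JD J1 N P i; elim: i P => [|i IH] P JP iN; first by rewrite texp_eval0 J1.
have [Q] := deriv_texp_eval N P.
move/(congr1 (fun p : {poly C} => p`_i)); rewrite coef_deriv coefD coefXnM iN addr0.
rewrite IH ?(ltnW iN) //; last exact: JD.
by move/eqP; rewrite mulrn_eq0 => /eqP.
Qed.

Hypothesis X_small : forall k i j, `|(X ^+ k) i j| <= 1.

(** Since [k!] is at least [2 ^ k / 2], a geometric series dominates the exponential one; its sum at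
    1 stays below 4 for every [N]. *)
Definition exp_majorant N : {poly C} := \poly_(k < N.+1) (2 / 2 ^+ k).

Lemma exp_majorant1 N : (exp_majorant N).[1] <= 4.
Proof.
rewrite horner_poly; under eq_bigr do rewrite expr1n mulr1.
suff -> : \sum_(k < N.+1) 2 / 2 ^+ k = 4 - 2 / 2 ^+ N :> C.
  by rewrite gerBl divr_ge0 ?exprn_ge0 ?ler0n.
elim: N => [|N IH]; first by rewrite big_ord1 expr0; field.
have h : (2 ^+ N : C) != 0 by rewrite expf_neq0 ?pnatr_eq0.
by rewrite big_ord_recr /= IH exprS; field.
Qed.

Lemma two_pow_fact k : (2 ^ k <= 2 * k`!)%N.
Proof.
elim: k => // k IH; rewrite expnS factS; case: k IH => // k IH.
by rewrite mulnCA leq_mul.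
Qed.

Lemma texp_majorized N i j : majorized (texp N i j) (exp_majorant N).
Proof.
move=> k; rewrite coef_texp coef_poly ltnS; case: leqP => // _; last by rewrite normr0.
rewrite normrM normfV normr_nat.
apply: le_trans (_ : 1 / k`!%:R <= _); first by rewrite ler_wpM2r ?invr_ge0 ?ler0n.
rewrite ler_pdivrMr ?ltr0n ?fact_gt0 // mulrAC ler_pdivlMr ?exprn_gt0 ?ltr0n //.
by rewrite mul1r -natrX -natrM ler_nat two_pow_fact.
Qed.

(** The bound depends on [P] but not on the degree of truncation, which lets the estimates pass to
    the limit. *)
Lemma texp_eval_majorized P : exists2 B : C, 0 <= B &
  forall N, exists2 s, majorized (texp_eval N P) s & s.[1] <= B.
Proof.
elim/mpoly_ring_ind: P => [c|v|p q|p q].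
- exists `|c| => // N; exists (`|c|%:P); last by rewrite hornerC.
  by move=> i; rewrite /texp_eval mmapC !coefC; case: eqP => //; rewrite normr0.
- exists 4 => // N; exists (exp_majorant N); last exact: exp_majorant1.
  rewrite /texp_eval mmapX mmap1U; case/mxvec_indexP: v => i j; rewrite mxvecE.
  exact: texp_majorized.
- move=> [B B0 hB] [B' B'0 hB']; exists (B + B'); first exact: addr_ge0.
  move=> N; have [s h1 h2] := hB N; have [s' h1' h2'] := hB' N.
  exists (s + s'); last by rewrite hornerD lerD.
  by rewrite /texp_eval rmorphD; apply: majorizedD.
- move=> [B B0 hB] [B' B'0 hB']; exists (B * B'); first exact: mulr_ge0.
  move=> N; have [s h1 h2] := hB N; have [s' h1' h2'] := hB' N.
  have pos (r p1 : {poly C}) : majorized p1 r -> 0 <= r.[1].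
    move=> h; rewrite horner_coef sumr_ge0 // => i _.
    by rewrite expr1n mulr1 (le_trans _ (h i)).
  exists (s * s'); last by rewrite hornerM ler_pM // ?(pos _ _ h1) ?(pos _ _ h1').
  by rewrite /texp_eval rmorphM; apply: majorizedM.
Qed.
End TruncatedExp.

Lemma horner_mmap_polyC (C : comNzRingType) N (h : 'I_N -> {poly C}) P t :
  (mmap (@polyC C) h P).[t] = mmap idfun (fun v => (h v).[t]) P.
Proof.
rewrite -[LHS]/(horner_eval t (mmap (@polyC C) h P)) rmorph_mmap.
by apply: eq_mmap => [c|v] //=; rewrite /horner_eval hornerC.
Qed.

Lemma conj_toC (R : realType) (t : R) : Num.conj (toC t : CC R) = toC t.
Proof. by apply: CC_eq; rewrite /= ?oppr0. Qed.

Section ExpCurve.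
Variable R : realType.
Local Notation C := (CC R).
Variable U : set_system nat.
Hypothesis U_ultra : UltraFilter U.
Hypothesis U_free : \oo `<=` U.
Variables (n : nat) (X : 'M[C]_n).
Hypothesis X_small : forall k i j, `|(X ^+ k) i j| <= 1.

Lemma n2_norm (z : C) : toC (n2 z) = `|z| ^+ 2.
Proof. exact: add_Re2_Im2. Qed.

Lemma n2_le (z : C) (b : R) : 0 <= b -> (n2 z <= b ^+ 2) = (`|z| <= toC b).
Proof.
move=> b0; rewrite -lecR -/toC n2_norm /toC rmorphXn ler_pXn2r ?nnegrE //=.
by rewrite ler0c.
Qed.

Definition texp_at N (t : R) : 'M[C]_n := map_mx (horner_eval (toC t)) (texp X N).

Lemma texp_at_eval N t P :
  (texp_eval X N P).[toC t] = entry_eval idfun (texp_at N t) P.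
Proof.
rewrite /texp_eval horner_mmap_polyC; apply: eq_mmap => // v.
by rewrite /texp_at -map_mxvec mxE.
Qed.

Lemma real_bound (B : C) : 0 <= B -> exists2 b : R, 0 <= b & B = toC b.
Proof.
case: B => a b; rewrite lecE /= => /andP[/eqP -> h].
by exists a.
Qed.

Lemma texp_at_bound P : exists2 b : R, 0 <= b &
  forall j N t, `|t| <= 1 ->
    n2 (entry_eval idfun (texp_at N t) P -
        \sum_(i < j) (texp_eval X N P)`_i * toC t ^+ i) <= (t ^+ j) ^+ 2 * b.
Proof.
have [B B0 hB] := texp_eval_majorized X_small P.
have [b b0 eb] := real_bound B0.
exists (b ^+ 2); first by rewrite exprn_ge0.
move=> j N t t1; have [s hs s1] := hB N.
have nt : `|toC t| = toC `|t| by rewrite normc_def /= expr0n addr0 sqrtr_sqr.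
have t1' : `|toC t| <= 1 by rewrite nt lecR.
have := majorized_horner j hs t1'; rewrite texp_at_eval => h.
rewrite -[(t ^+ j) ^+ 2](real_normK (num_real _)) normrX -exprMn n2_le ?mulr_ge0 ?exprn_ge0 //.
apply: le_trans h _; rewrite nt /toC rmorphM rmorphXn ler_wpM2l ?exprn_ge0 ?ler0c //.
by move: s1; rewrite eb.
Qed.

Lemma exp_exists t : exists g, `|t| <= 1 -> mxlim U (fun N => texp_at N t) g.
Proof.
have [t1|] := boolP (`|t| <= 1); last by exists 0.
have bd (p : 'I_n * 'I_n) : exists y, ulim U (fun N => texp_at N t p.1 p.2) y.
  have [b b0 hb] := texp_at_bound (entry_var C p.1 p.2).
  apply: (@ulim_exists _ _ U_ultra _ b) => N; have := hb 0%N N t t1.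
  by rewrite big_ord0 subr0 entry_eval_var expr0 expr1n mul1r.
have [y yP] := boolp.choice bd.
by exists (\matrix_(i, j) y (i, j)) => _ i j; rewrite mxE; apply: (yP (i, j)).
Qed.

(** A limit of truncations along [U]; the value carries no information when [|t| > 1]. *)
Definition exp_mx t := projT1 (cid (exp_exists t)).

Lemma exp_lim t : `|t| <= 1 -> mxlim U (fun N => texp_at N t) (exp_mx t).
Proof. by rewrite /exp_mx; case: cid. Qed.

Lemma entry_eval_lim (k : fieldType) m (f : k -> C) (x : nat -> 'M[C]_m) g (P : entry_poly k m) :
  mxlim U x g -> ulim U (fun N => entry_eval f (x N) P) (entry_eval f g P).
Proof.
move=> h; apply: ulim_mmap => v; case/mxvec_indexP: v => i j.
by rewrite mxvecE; under eq_fun do rewrite mxvecE; apply: h.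
Qed.

(** The Taylor coefficients of the truncated curve vanish up to degree [N], and for [|t| <= 2^-1]
    the remainder, of order [t ^ (N + 1)] uniformly in the truncation, tends to 0. *)
Lemma exp_vanish (J : set (entry_poly C n)) :
  (forall P, J P -> J (lderiv X P)) ->
  (forall P, J P -> entry_eval idfun 1%:M P = 0) ->
  forall P t, J P -> `|t| <= 2^-1 -> entry_eval idfun (exp_mx t) P = 0.
Proof.
move=> JD J1 P t JP t2.
have t1 : `|t| <= 1 by apply: le_trans t2 _; rewrite invf_le1 ?ler1n.
have [b b0 hb] := texp_at_bound P.
have lim := entry_eval_lim idfun P (exp_lim t1).
apply: n2_eq0; apply/eqP; rewrite eq_le n2_ge0 andbT; apply/ler_addgt0Pr => e e0.
have eb : 0 < e / (b + 1) by rewrite divr_gt0 // ltr_wpDl.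
have [N hN] := inv_nat_small eb.
rewrite add0r; apply: (@ulim_n2_le _ _ U_ultra U_free _ _ _ N lim) => k Nk.
have := hb k.+1 k t t1; rewrite big1 ?subr0; last first.
  by move=> i _; rewrite (texp_eval_vanish JD J1) // ?mul0r // -ltnS.
move=> /le_trans; apply.
apply: (@le_trans _ _ (k.+1%:R^-1 * b)).
  rewrite ler_wpM2r // -[(t ^+ _) ^+ 2](real_normK (num_real _)) normrX -exprM.
  apply: le_trans (_ : 2^-1 ^+ (k.+1 * 2) <= _); first by rewrite lerXn2r ?nnegrE.
  rewrite exprVn lef_pV2 ?posrE ?exprn_gt0 ?ltr0n // -natrX ler_nat.
  by rewrite ltnW // (leq_ltn_trans (leq_pmulr _ (isT : 0 < 2)%N)) // ltn_expl.
have := hN k Nk; rewrite ler_pdivlMr ?ltr_wpDl // => h.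
apply: le_trans h; rewrite ler_wpM2l ?invr_ge0 ?ler0n // lerDl //.
Qed.

Lemma exp_taylor P : exists b : R, forall t, `|t| <= 1 ->
  n2 (entry_eval idfun (exp_mx t) P - entry_eval idfun 1%:M P
      - toC t * entry_eval idfun 1%:M (lderiv X P)) <= t ^+ 4 * b.
Proof.
have [b b0 hb] := texp_at_bound P; exists b => t t1.
have lim := entry_eval_lim idfun P (exp_lim t1).
have lim2 : ulim U (fun N => entry_eval idfun (texp_at N t) P +
    - (entry_eval idfun 1%:M P + toC t * entry_eval idfun 1%:M (lderiv X P)))
  (entry_eval idfun (exp_mx t) P - entry_eval idfun 1%:M P
      - toC t * entry_eval idfun 1%:M (lderiv X P)).
  by rewrite -[X in ulim _ _ X]addrA -opprD; apply: ulimD => //; exact: ulim_cst.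
apply: (@ulim_n2_le _ _ U_ultra U_free _ _ _ 1 lim2) => -[//|k _].
have := hb 2%N k.+1 t t1; rewrite !big_ord_recl big_ord0 addr0 /= texp_eval0.
by rewrite texp_eval1 expr0 mulr1 expr1 -exprM [toC t * _]mulrC.
Qed.

(** A converse at first order: the Taylor formula at order 2 bounds the derivative by a multiple of
    [t] for every small positive [t]. *)
Lemma exp_tangent P (t0 : R) : 0 < t0 ->
  (forall t, `|t| <= t0 -> entry_eval idfun (exp_mx t) P = 0) ->
  entry_eval idfun 1%:M P = 0 -> entry_eval idfun 1%:M (lderiv X P) = 0.
Proof.
move=> t00 h0 h1; have [b hb] := exp_taylor P.
set z := entry_eval _ _ (lderiv X P) in hb *.
have h (t : R) : 0 < t -> t <= t0 -> t <= 1 -> n2 z <= t * (`|b| + 1).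
  move=> t_gt0 tt0 t1; have nt : `|t| = t by rewrite gtr0_norm.
  have := hb t; rewrite nt h0 ?nt // h1 subrr sub0r n2N n2_toC => /(_ t1) h.
  have {}h : n2 z <= t ^+ 2 * b.
    rewrite -(@ler_pM2l _ (t ^+ 2)) ?exprn_gt0 //.
    by rewrite mulrA -exprD.
  apply: le_trans h _; rewrite expr2 -mulrA ler_pM2l //.
  apply: le_trans (_ : `|b| <= _); last by rewrite lerDl.
  apply: le_trans (ler_norm _) _; rewrite normrM nt ler_piMl //.
apply: n2_eq0; apply/eqP; rewrite eq_le n2_ge0 andbT; apply/ler_addgt0Pr => e e0.
rewrite add0r; pose t := Num.min 1 (Num.min t0 (e / (`|b| + 1))).
have b1 : 0 < `|b| + 1 by rewrite ltr_wpDl.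
have t_gt0 : 0 < t by rewrite !lt_min ltr01 t00 divr_gt0.
apply: le_trans (h t t_gt0 _ _) _; rewrite ?ge_min ?lexx ?orbT //.
by rewrite -ler_pdivlMr // !ge_min lexx !orbT.
Qed.

(** The Taylor expansion of the determinant around 1 keeps it away from 0; no inverse of the
    exponential has to be exhibited. *)
Lemma exp_unit : exists2 t0 : R, 0 < t0 & forall t, `|t| <= t0 -> exp_mx t \in unitmx.
Proof.
have [b hb] := exp_taylor (det_poly C n).
set z := entry_eval _ _ (lderiv X _) in hb.
(* With [|t| <= (4 * c)^-1] the two error terms add up to less than [4^-1], whereas a zero
   determinant would force them to reach [2^-1]. *)
pose c := `|b| + n2 z + 1.
have c0 : 0 < c by rewrite ltr_wpDl // addr_ge0 // n2_ge0.
have c1 : 1 <= c by rewrite lerDr addr_ge0 // n2_ge0.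
exists (4 * c)^-1 => [|t ht]; first by rewrite invr_gt0 mulr_gt0.
have nt1 : `|t| <= 1.
  by apply: le_trans ht _; rewrite invf_le1 ?mulr_gt0 //; lra.
rewrite unitmxE unitfE -(entry_eval_det idfun); apply/negP => /eqP d0.
have := hb t nt1; rewrite d0 entry_eval_det det1 sub0r -opprD n2N => h.
have h1 : 1 <= 2 * (n2 (1 + toC t * z) + n2 (toC t * z)).
  have e1 : n2 (1 + toC t * z + - (toC t * z)) = 1.
    by rewrite addrK /n2 /= expr1n expr0n addr0.
  by rewrite -[X in X <= _]e1; apply: le_trans (n2D _ _) _; rewrite n2N.
rewrite n2_toC in h1.
have t2 : t ^+ 2 <= (4 * c)^-1.
  rewrite -(real_normK (num_real t)) expr2; apply: le_trans ht.
  by rewrite ler_piMl.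
have t4 : t ^+ 4 * b <= (4 * c)^-1 * `|b|.
  apply: le_trans (_ : t ^+ 4 * `|b| <= _).
    by rewrite ler_wpM2l ?ler_norm // (_ : t ^+ 4 = (t ^+ 2) ^+ 2) ?sqr_ge0 // -exprM.
  rewrite ler_wpM2r //; apply: le_trans t2; rewrite [t ^+ 4](exprD t 2 2).
  by rewrite ler_piMl ?sqr_ge0 // -(real_normK (num_real t)) exprn_ile1.
have tz : t ^+ 2 * n2 z <= (4 * c)^-1 * n2 z by rewrite ler_wpM2r ?n2_ge0.
have : (4 * c)^-1 * (`|b| + n2 z) < 4^-1.
  by rewrite invfM -mulrA gtr_pMr // mulrC ltr_pdivrMr // mul1r ltrDl.
by rewrite mulrDr; lra.
Qed.

(** The twist is multiplicative, hence fixes all powers of [X], and the coefficients [t ^ k / k!]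
    are real. *)
Lemma exp_twisted (a : 'M[C]_n) t : a \in unitmx ->
  a *m map_mx Num.conj X *m invmx a = X -> `|t| <= 1 ->
  a *m map_mx Num.conj (exp_mx t) *m invmx a = exp_mx t.
Proof.
move=> ua aX t1; have lim := exp_lim t1.
have Xk k : a *m map_mx Num.conj (X ^+ k) *m invmx a = X ^+ k.
  elim: k => [|k IH]; first by rewrite map_mx1 mulmx1 mulmxV.
  rewrite exprS -[X * X ^+ k]/(X *m X ^+ k).
  transitivity (a *m map_mx Num.conj X *m invmx a *m
    (a *m map_mx Num.conj (X ^+ k) *m invmx a)); last by rewrite aX IH.
  by rewrite map_mxM !mulmxA mulmxKV.
have tw N : a *m map_mx Num.conj (texp_at N t) *m invmx a = texp_at N t.
  have E : texp_at N t = \sum_(k < N.+1) (toC t ^+ k / k`!%:R) *: X ^+ k.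
    apply/matrixP => i j; rewrite !mxE summxE /horner_eval horner_sum.
    by apply: eq_bigr => k _; rewrite hornerZ hornerXn mxE mulrC mulrA mulrAC.
  rewrite E raddf_sum mulmx_sumr mulmx_suml; apply: eq_bigr => k _ /=.
  rewrite map_mxZ -scalemxAr -scalemxAl Xk; congr (_ *: _).
  by rewrite rmorphM fmorphV rmorph_nat rmorphXn /= conj_toC.
apply: (mxlim_unique U_ultra _ lim).
under [X in mxlim _ X]eq_fun do rewrite -tw.
apply: mxlimM; [apply: mxlimM|]; try exact: mxlim_cst.
move=> i j; rewrite mxE; under eq_fun do rewrite mxE.
exact: ulim_conj.
Qed.
End ExpCurve.

(** * Semisimplicity of the centre *)

Section Idempotents.
Variable C : closedFieldType.

Lemma coprime_pow_prod (rs : seq C) (x : C) M : x \notin rs ->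
  coprimep (('X - x%:P) ^+ M) (\prod_(y <- rs) ('X - y%:P) ^+ M).
Proof.
elim: rs => [|y rs IH]; first by rewrite big_nil coprimep1.
rewrite inE negb_or big_cons => /andP[xy xr].
rewrite coprimepMr IH // andbT coprimep_expl // coprimep_expr //.
by rewrite coprimep_XsubC root_XsubC eq_sym.
Qed.

Lemma dvd_pow_prod (rs : seq C) M (p : {poly C}) : uniq rs ->
  (forall x, x \in rs -> ('X - x%:P) ^+ M %| p) ->
  \prod_(y <- rs) ('X - y%:P) ^+ M %| p.
Proof.
elim: rs => [|y rs IH]; first by rewrite big_nil dvd1p.
rewrite big_cons /= => /andP[yr ur] h.
rewrite Gauss_dvdp ?coprime_pow_prod // h ?mem_head //=.
by apply: IH => // x xr; apply: h; rewrite inE xr orbT.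
Qed.

Lemma crt_idempotents (rs : seq C) M : uniq rs ->
  exists e : C -> {poly C}, forall x y, x \in rs -> y \in rs ->
    ('X - y%:P) ^+ M %| e x - (x == y)%:R.
Proof.
move=> ur.
have ex x : exists e : {poly C}, x \in rs -> forall y, y \in rs ->
    ('X - y%:P) ^+ M %| e - (x == y)%:R.
  have [xr|] := boolP (x \in rs); last by exists 0.
  have nx : x \notin [seq y <- rs | y != x] by rewrite mem_filter eqxx.
  have /Bezout_eq1_coprimepP[[a b] /= ab] := coprime_pow_prod M nx.
  exists (b * \prod_(y <- [seq y <- rs | y != x]) ('X - y%:P) ^+ M) => _ y yr.
  have [<-|xy] := eqVneq x y.
    rewrite mulr1n; move: ab; set P := \prod_(_ <- _) _ => ab.
    have -> : b * P - 1 = - a * ('X - x%:P) ^+ M by rewrite -ab; ring.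
    by rewrite dvdp_mull.
  rewrite subr0 dvdp_mull //.
  rewrite (big_rem y) ?dvdp_mulr //.
  by rewrite mem_filter eq_sym xy.
have [e eP] := boolp.choice ex; exists e => x y xr yr; exact: eP.
Qed.

(* Jordan decomposition A = (sum_i lam i *: E i) (1 + N) *)
Lemma jordan_idempotents n (A : 'M[C]_n) : A \in unitmx ->
  exists r (lam : 'I_r -> C) (E : 'I_r -> 'M[C]_n) (N : 'M[C]_n),
  [/\ forall i, lam i != 0, \sum_i E i = 1%:M,
      forall i j, E i *m E j = if i == j then E i else 0,
      forall i, A *m E i = lam i *: ((1%:M + N) *m E i)
    & N ^+ n = 0 /\ forall (B : 'M[C]_n), A *m B = B *m A ->
       N *m B = B *m N /\ forall i, E i *m B = B *m E i] /\
  (forall (F : 'M[C]_n), F *m F = F -> A *m F = F *m A *m F -> forall i, E i *m F = F *m E i *m F).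
Proof.
case: n A => [|n] A uA.
  exists 0%N, (fun=> 0), (fun=> 0), 0; split; last by move=> F _ _ [].
  by split=> [[]||[]|[]|] //; [rewrite [LHS]thinmx0 [RHS]thinmx0|
    split; [rewrite [LHS]thinmx0 [RHS]thinmx0|move=> B _; split=> [|[]//];
    rewrite [LHS]thinmx0 [RHS]thinmx0]].
have [ts ets] := closed_field_poly_normal (char_poly A).
rewrite (monicP (char_poly_monic A)) scale1r in ets.
(* [M] is the degree of the characteristic polynomial, hence bounds every multiplicity. *)
pose rs := undup ts; pose M := size ts.
have urs : uniq rs by exact: undup_uniq.
have [e eP] := crt_idempotents M urs.
have CH p : (forall x, x \in rs -> ('X - x%:P) ^+ M %| p) -> horner_mx A p = 0.
  move=> hp; suff /dvdpP[q ->] : char_poly A %| p.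
    by rewrite rmorphM /= Cayley_Hamilton mulr0.
  apply: dvdp_trans (dvd_pow_prod urs hp); rewrite ets.
  rewrite -big_undup_iterop_count; elim/big_rec2: _ => [|y p1 p2 _ h].
    by rewrite dvd1p.
  apply: dvdp_mul => //.
  rewrite (_ : iterop _ _ _ _ = ('X - y%:P) ^+ count_mem y ts) //.
  by rewrite dvdp_exp2l // /M count_size.
pose lam (i : 'I_(size rs)) := rs`_i.
have lam_in i : lam i \in rs by exact: mem_nth.
have lam_eq i j : (lam i == lam j) = (i == j).
  by rewrite nth_uniq.
pose E i := horner_mx A (e (lam i)).
have lam0 i : lam i != 0.
  have : root (char_poly A) (lam i).
    by rewrite ets root_prod_XsubC -mem_undup.
  apply: contraTneq => ->; rewrite /root horner_coef0 char_poly_det.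
  rewrite mulf_eq0 signr_eq0 /= -unitfE.
  by rewrite -unitmxE.
have EE i j : E i *m E j = if i == j then E i else 0.
  rewrite /E -[_ *m _]/(_ * _) -rmorphM; apply/eqP; rewrite -subr_eq0.
  have -> : (if i == j then horner_mx A (e (lam i)) else 0) =
      horner_mx A ((i == j)%:R * e (lam i)).
    by case: eqP => _; rewrite ?mul1r // mul0r rmorph0.
  rewrite -rmorphB; apply/eqP/CH => x xr.
  have /dvdpP[q1 h1] := eP _ _ (lam_in i) xr.
  have /dvdpP[q2 h2] := eP _ _ (lam_in j) xr.
  rewrite (_ : e (lam i) * e (lam j) - _ = e (lam i) * (e (lam j) - (lam j == x)%:R) +
     e (lam i) * ((lam j == x)%:R - (i == j)%:R)); last first.
    by move: (e _) (e _) (_%:R) (_%:R) => p1 p2 p3 p4; ring.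
  rewrite dvdp_addr; last by rewrite h2 mulrA dvdp_mull.
  case: (eqVneq (lam j) x) => [jx|jx] in h2 *; last first.
    rewrite sub0r mulrN dvdpNr; case: (eqVneq i j) => [ij|ij]; last by rewrite mulr0.
    by move: h1; rewrite ij (negPf jx) subr0 mulr1 => ->; rewrite dvdp_mull.
  rewrite -jx in h1 *; move: h1; rewrite lam_eq; case: (i == j).
    by rewrite subrr mulr0 dvdp0.
  by rewrite !subr0 mulr1 => ->; rewrite dvdp_mull.
have E1 : \sum_i E i = 1%:M.
  have -> : \sum_i E i = horner_mx A (\sum_(y <- rs) e y).
    by rewrite rmorph_sum (big_nth 0) big_mkord.
  rewrite -[1%:M](rmorph1 (horner_mx A)); apply/eqP; rewrite -subr_eq0 -rmorphB.
  apply/eqP/CH => x xr; rewrite (bigD1_seq x) //= addrAC.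
  rewrite dvdp_add //; first by have := eP _ _ xr xr; rewrite eqxx.
  rewrite big_seq_cond; apply: (big_ind (fun p => _ %| p)) => [|p q|y].
  - by rewrite dvdp0.
  - exact: dvdp_add.
  - by move=> /andP[yr yx]; have := eP _ _ yr xr; rewrite (negPf yx) subr0.
have nilE i : ((lam i)^-1 *: A - 1%:M) ^+ M *m E i = 0.
  have -> : (lam i)^-1 *: A - 1%:M = (lam i)^-1 *: horner_mx A ('X - (lam i)%:P).
    rewrite rmorphB /= horner_mx_X horner_mx_C scalerBr scale_scalar_mx.
    by rewrite mulVf.
  have h p : horner_mx A p ^+ M *m E i = horner_mx A (p ^+ M * e (lam i)).
    by rewrite rmorphM rmorphXn.
  rewrite exprZn -scalemxAl h CH ?scaler0 // => x xr.
  have [ix|ix] := eqVneq (lam i) x; first by rewrite ix dvdp_mulr.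
  have := eP _ _ (lam_in i) xr; rewrite (negPf ix) subr0 => hx.
  by rewrite dvdp_mull.
pose N := \sum_i ((lam i)^-1 *: A - 1%:M) *m E i.
have comA B p : A *m B = B *m A -> horner_mx A p *m B = B *m horner_mx A p.
  exact: comm_horner_mx.
have XE i : ((lam i)^-1 *: A - 1%:M) *m E i = E i *m ((lam i)^-1 *: A - 1%:M).
  rewrite mulmxBl mulmxBr mul1mx mulmx1 -scalemxAl -scalemxAr; congr (_ *: _ - _).
  by rewrite /E comA.
have NE i : N *m E i = ((lam i)^-1 *: A - 1%:M) *m E i.
  rewrite /N mulmx_suml (bigD1 i) //= -mulmxA EE eqxx big1 ?addr0 // => j ji.
  by rewrite -mulmxA EE (negPf ji) mulmx0.
have NkE k i : N ^+ k *m E i = ((lam i)^-1 *: A - 1%:M) ^+ k *m E i.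
  elim: k => [|k IH]; first by rewrite !expr0.
  rewrite !exprSr -[N ^+ k * N]/(N ^+ k *m N) -mulmxA NE XE mulmxA IH -mulmxA -XE.
  by rewrite mulmxA.
exists (size rs), lam, E, N; split; last first.
  (* Each [E i] is a polynomial in [A], so it preserves the image of [F] as soon as [A] does. *)
  move=> F FF AF i; rewrite /E; elim/poly_ind: (e _) => [|p c IH].
    by rewrite rmorph0 mulmx0 !mul0mx.
  rewrite rmorphD rmorphM /= horner_mx_X horner_mx_C.
  rewrite -[_ * A]/(_ *m A); set hp := horner_mx A p in IH *.
  have e1 : hp *m A *m F = F *m (hp *m A) *m F.
    by rewrite -mulmxA {1}AF !mulmxA IH -!mulmxA [F *m (A *m F)]mulmxA -AF.
  rewrite mulmxDl mulmxDr mulmxDl e1; congr (_ + _).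
  by rewrite mul_scalar_mx mul_mx_scalar -scalemxAl FF.
split=> //.
- move=> i; rewrite mulmxDl mul1mx NE mulmxBl mul1mx addrCA subrr addr0.
  by rewrite -scalemxAl scalerA mulfV ?scale1r.
- split=> [|B AB].
    have NM : N ^+ M = 0.
      rewrite -[N ^+ M]mulmx1 -E1 mulmx_sumr big1 // => i _.
      by rewrite NkE nilE.
    have eM : M = n.+1.
      by have := size_char_poly A; rewrite ets size_prod_XsubC => -[].
    by move: NM; rewrite eM.
  split=> [|i]; last exact: comA.
  rewrite /N mulmx_suml mulmx_sumr; apply: eq_bigr => i _.
  rewrite -mulmxA (comA B) // !mulmxA; congr (_ *m _).
  by rewrite mulmxBl mulmxBr mul1mx mulmx1 -scalemxAl -scalemxAr AB.
Qed.
End Idempotents.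

(** * Exponential polynomials in an integer variable *)

Section ExponentialPolynomials.
Variable C : numClosedFieldType.

Lemma poly_nat_eq0 (p : {poly C}) : (forall k : nat, p.[k%:R] = 0) -> p = 0.
Proof.
move=> h; apply/eqP/negPn/negP => p0.
pose s := [seq k%:R : C | k <- iota 0 (size p)].
have us : uniq s by rewrite map_inj_uniq ?iota_uniq // => i j /eqP; rewrite eqr_nat => /eqP.
have rs : all (root p) s by apply/allP => _ /mapP[k _ ->]; apply/eqP; exact: h.
by have := max_poly_roots p0 rs us; rewrite size_map size_iota ltnn.
Qed.

Lemma size_shift_sub (p : {poly C}) : p != 0 ->
  (size (p \Po ('X + 1) - p)%R < size p)%N.
Proof.
move=> p0.
have sX : size ('X + 1 : {poly C}) = 2%N by rewrite -[1]opprK -polyCN size_XsubC.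
have s1 : size (p \Po ('X + 1)) = size p by rewrite size_comp_poly2.
have lt : (size (p \Po ('X + 1) - p)%R <= size p)%N.
  by rewrite (leq_trans (size_polyD _ _)) // size_polyN s1 maxnn.
rewrite ltn_neqAle lt andbT; apply/negP => /eqP e.
have : lead_coef (p \Po ('X + 1) - p) = 0.
  rewrite /lead_coef e coefB.
  have -> : (p \Po ('X + 1))`_(size p).-1 = lead_coef (p \Po ('X + 1)).
    by rewrite /lead_coef s1.
  rewrite lead_coef_comp ?sX // -[1]opprK -polyCN lead_coefXsubC expr1n mulr1.
  by rewrite subrr.
by move/eqP; rewrite lead_coef_eq0 -size_poly_eq0 e size_poly_eq0 (negPf p0).
Qed.

(** Induction on the total size. Passing from [f k] to [f k.+1 - l0 * f k] shrinks the coefficient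
    of [l0] and enlarges none, so all new coefficients vanish by induction; comparing leading terms
    then kills every [q l] with [l] different from [l0], and the remaining term vanishes at all
    integers. *)
Lemma exponentials_independent (ls : seq C) (q : C -> {poly C}) : uniq ls ->
  (forall l, l \in ls -> l != 0) ->
  (forall k : nat, \sum_(l <- ls) l ^+ k * (q l).[k%:R] = 0) ->
  forall l, l \in ls -> q l = 0.
Proof.
move=> uls ls0.
have [m] := ubnP (\sum_(l <- ls) size (q l)).
elim: m q => // m IH q hm hq l0 l0s; apply/eqP/negPn/negP => q0.
pose q' l := l *: (q l \Po ('X + 1)) - l0 *: q l.
have sX : size ('X + 1 : {poly C}) = 2%N by rewrite -[1]opprK -polyCN size_XsubC.
have sq' l : (size (q' l) <= size (q l))%N.
  rewrite (leq_trans (size_polyD _ _)) // size_polyN geq_max.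
  by apply/andP; split; apply: leq_trans (size_scale_leq _ _) _; rewrite ?size_comp_poly2.
have q'0 : forall l, l \in ls -> q' l = 0.
  apply: IH => [|k].
    rewrite -ltnS; apply: leq_trans hm; rewrite ltnS (big_rem l0) //= (big_rem l0 l0s) /=.
    rewrite -addSn leq_add //; last exact: leq_sum.
    rewrite /q' -scalerBr; apply: leq_ltn_trans (size_scale_leq _ _) _.
    exact: size_shift_sub.
  transitivity (\sum_(l <- ls) l ^+ k.+1 * (q l).[k.+1%:R] -
     l0 * \sum_(l <- ls) l ^+ k * (q l).[k%:R]); last by rewrite !hq mulr0 subr0.
  rewrite mulr_sumr -sumrB; apply: eq_bigr => l _.
  rewrite /q' hornerD hornerN !hornerZ horner_comp hornerD hornerX hornerC natr1.
  by rewrite exprS; ring.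
have ql0 l : l \in ls -> l != l0 -> q l = 0.
  move=> ll ll0; apply/eqP/negPn/negP => ql.
  have := q'0 _ ll => /eqP; rewrite subr_eq0 => /eqP /(congr1 lead_coef).
  rewrite !lead_coefZ lead_coef_comp ?sX // -[1]opprK -polyCN lead_coefXsubC expr1n mulr1.
  by move/mulIf => /(_ _)/eqP; rewrite lead_coef_eq0 (negPf ql) (negPf ll0) => /(_ isT).
case/eqP: q0; apply: poly_nat_eq0 => k.
have := hq k; rewrite (bigD1_seq l0) //= big_seq_cond big1 ?addr0.
  by move=> /eqP; rewrite mulf_eq0 expf_eq0 (negPf (ls0 _ l0s)) andbF => /eqP.
by move=> l /andP[ll ll0]; rewrite ql0 // horner0 mulr0.
Qed.

(* phi k = sum of lam^k q(k), and psi is the sum of the q: the part of phi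
   coming from the unipotent factors *)
Definition expoly (phi : nat -> C) (psi : {poly C}) :=
  exists L : seq (C * {poly C}), [/\ forall x, x \in L -> x.1 != 0,
    forall k, phi k = \sum_(x <- L) x.1 ^+ k * x.2.[k%:R]
  & psi = \sum_(x <- L) x.2].

Lemma expoly_eq0 phi psi : expoly phi psi -> (forall k, phi k = 0) -> psi = 0.
Proof.
move=> [L [L0 hphi ->]] phi0.
pose ls := undup [seq x.1 | x <- L]; pose q l := \sum_(x <- L | x.1 == l) x.2.
have group (T : zmodType) (F : C * {poly C} -> T) :
    \sum_(x <- L) F x = \sum_(l <- ls) \sum_(x <- L | x.1 == l) F x.
  rewrite (exchange_big_dep xpredT) //= [LHS]big_seq [RHS]big_seq; apply: eq_bigr => x xL.
  have xls : x.1 \in ls by rewrite mem_undup map_f.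
  rewrite big_mkcond (bigD1_seq x.1) ?undup_uniq //= eqxx big1 ?addr0 // => l lx.
  by rewrite eq_sym (negPf lx).
rewrite group big_seq big1 // => l lls.
apply: (@exponentials_independent ls q) => //; first exact: undup_uniq.
  by move=> l' ; rewrite mem_undup => /mapP[x /L0 x0 ->].
move=> k; rewrite -[RHS](phi0 k) hphi group; apply: eq_bigr => l' _.
rewrite horner_sum mulr_sumr; apply: eq_bigr => x /eqP -> //.
Qed.

Lemma expoly_cst c : expoly (fun=> c) c%:P.
Proof.
exists [:: (1, c%:P)]; split=> [x|k|]; last by rewrite big_seq1.
  by rewrite inE => /eqP -> /=; exact: oner_neq0.
by rewrite big_seq1 expr1n mul1r hornerC.
Qed.

Lemma expolyD f p g q : expoly f p -> expoly g q -> expoly (fun k => f k + g k) (p + q).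
Proof.
move=> [L [h1 h2 ->]] [L' [h1' h2' ->]]; exists (L ++ L'); split.
- by move=> x; rewrite mem_cat => /orP[/h1|/h1'].
- by move=> k; rewrite big_cat h2 h2'.
- by rewrite big_cat.
Qed.

Lemma expolyM f p g q : expoly f p -> expoly g q -> expoly (fun k => f k * g k) (p * q).
Proof.
move=> [L [h1 h2 ->]] [L' [h1' h2' ->]].
exists [seq (x.1 * y.1, x.2 * y.2) | x <- L, y <- L']; split.
- by move=> _ /allpairsP[[x y] /= [/h1 x0 /h1' y0 ->]]; exact: mulf_neq0.
- move=> k; rewrite big_allpairs_dep h2 h2' mulr_suml; apply: eq_bigr => x _.
  rewrite mulr_sumr; apply: eq_bigr => y _ /=.
  by rewrite exprMn hornerM mulrACA.
- rewrite big_allpairs_dep mulr_suml; apply: eq_bigr => x _.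
  by rewrite mulr_sumr.
Qed.

Lemma expoly_sum I (s : seq I) f p : (forall i, expoly (f i) (p i)) ->
  expoly (fun k => \sum_(i <- s) f i k) (\sum_(i <- s) p i).
Proof.
move=> h; elim: s => [|i s IH].
  by rewrite big_nil; under eq_fun do rewrite big_nil; exact: expoly_cst.
by rewrite big_cons; under eq_fun do rewrite big_cons; exact: expolyD.
Qed.

Lemma expoly_term l (q : {poly C}) : l != 0 -> expoly (fun k => l ^+ k * q.[k%:R]) q.
Proof.
move=> l0; exists [:: (l, q)]; split=> [x|k|]; rewrite ?big_seq1 //.
by rewrite inE => /eqP ->.
Qed.

(** Both components are compatible with sums and products, so the values of a polynomial along
    powers of a matrix have, as unipotent part, its value on the unipotent parts of the entries. *)
Lemma expoly_mmap (k0 : fieldType) (f : {rmorphism k0 -> C}) N (h : 'I_N -> nat -> C)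
    (p : 'I_N -> {poly C}) P : (forall i, expoly (h i) (p i)) ->
  expoly (fun k => mmap f (fun i => h i k) P) (mmap (@polyC C \o f) p P).
Proof.
move=> hp; elim/mpoly_ring_ind: P => [c|i|P Q IHP IHQ|P Q IHP IHQ].
- by rewrite mmapC; under eq_fun do rewrite mmapC; exact: expoly_cst.
- by rewrite mmapX mmap1U; under eq_fun do rewrite mmapX mmap1U; exact: hp.
- by rewrite rmorphD; under eq_fun do rewrite rmorphD; exact: expolyD.
- by rewrite rmorphM; under eq_fun do rewrite rmorphM; exact: expolyM.
Qed.

Lemma binomial_poly j : exists B : {poly C}, forall k : nat, B.[k%:R] = 'C(k, j)%:R.
Proof.
elim: j => [|j [B hB]]; first by exists 1 => k; rewrite hornerC bin0.
exists (j.+1%:R^-1 *: (B * ('X - j%:R%:P))) => k.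
rewrite hornerZ hornerM hB hornerXsubC.
have j0 : (j.+1%:R : C) != 0 by rewrite pnatr_eq0.
apply: (mulfI j0); rewrite mulVKf // -natrM mul_bin_left natrM mulrC.
have [jk|kj] := leqP j k; first by rewrite natrB.
by rewrite bin_small // !mulr0.
Qed.

(** The binomial expansion stops because [N] is nilpotent, so the powers are interpolated by
    polynomials in the exponent. *)
Lemma unipotent_poly n (N : 'M[C]_n) M : N ^+ M = 0 ->
  exists Q : 'M[{poly C}]_n,
    forall k : nat, map_mx (horner_eval k%:R) Q = (1%:M + N) ^+ k.
Proof.
move=> NM; have [B hB] := boolp.choice binomial_poly.
exists (\sum_(j < M) B j *: map_mx (@polyC C) (N ^+ j)) => k.
have -> : (1%:M + N) ^+ k = \sum_(j < M) 'C(k, j)%:R *: N ^+ j.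
  rewrite addrC exprD1n.
  have wide m (F : nat -> 'M[C]_n) : (m <= maxn M k.+1)%N ->
      (forall j, (m <= j)%N -> F j = 0) ->
      \sum_(j < m) F j = \sum_(j < maxn M k.+1) F j.
    move=> mle F0; rewrite -!(big_mkord xpredT) [RHS](big_cat_nat (leq0n m) mle) /=.
    rewrite -[LHS]addr0; congr (_ + _); rewrite big_nat_cond big1 // => j.
    by move=> /andP[/andP[/F0]].
  rewrite (wide k.+1 (fun j => N ^+ j *+ 'C(k, j))) ?leq_maxr //; last first.
    by move=> j kj; rewrite bin_small ?mulr0n.
  rewrite (wide M (fun j => 'C(k, j)%:R *: N ^+ j)) ?leq_maxl //; last first.
    by move=> j Mj; rewrite -(subnK Mj) exprD NM mulr0 scaler0.
  by apply: eq_bigr => j _; rewrite scaler_nat.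
apply/matrixP => a b; rewrite !mxE !summxE /horner_eval horner_sum.
by apply: eq_bigr => j _; rewrite !mxE hornerM hB hornerC.
Qed.
End ExponentialPolynomials.

Lemma map_mx_exp (A B : nzRingType) (f : {rmorphism A -> B}) n (M : 'M[A]_n) k :
  map_mx f (M ^+ k) = map_mx f M ^+ k.
Proof.
elim: k => [|k IH]; first exact: map_mx1.
by rewrite !exprS -IH; exact: map_mxM.
Qed.

Lemma map_mx_idfun (F : nzRingType) m n (M : 'M[F]_(m, n)) :
  map_mx (idfun : {rmorphism F -> F}) M = M.
Proof. by apply/matrixP => i j; rewrite mxE. Qed.

Section Pullback.
Variables (k : fieldType).

Lemma regmap_pullback a b (phi : regmap k a b) (P : entry_poly k b) :
  exists (P' : entry_poly k a) D, forall (K : fieldType) (f : {rmorphism k -> K}) g,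
    g \in unitmx ->
    entry_eval f g P' = \det g ^+ D * entry_eval f (regapp f phi g) P.
Proof.
elim/mpoly_ring_ind: P => [c|v|P Q [P1 [D1 h1]] [P2 [D2 h2]]|P Q [P1 [D1 h1]] [P2 [D2 h2]]].
- exists (entry_cst a c), 0%N => K f g _.
  by rewrite mul1r -/(entry_cst b c) !entry_eval_cst.
- case/mxvec_indexP: v => i j; exists (numer phi i j), (denom phi) => K f g ug.
  rewrite -/(entry_var k i j) entry_eval_var !mxE mulVKf //.
  by rewrite expf_neq0 // -unitfE -unitmxE.
- exists (det_poly k a ^+ D2 * P1 + det_poly k a ^+ D1 * P2), (D1 + D2)%N => K f g ug.
  rewrite !rmorphD !rmorphM !rmorphXn /= entry_eval_det h1 // h2 // exprD; ring.
- exists (P1 * P2), (D1 + D2)%N => K f g ug.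
  by rewrite !rmorphM /= h1 // h2 // exprD mulrACA.
Qed.

Definition poly_subst (K : fieldType) (f : k -> K) n m (A : 'M[entry_poly K n]_m)
    (P : entry_poly k m) : entry_poly K n :=
  mmap (@entry_cst K n \o f) (fun v => mxvec A 0 v) P.

Lemma entry_eval_subst (K L : fieldType) (f : {rmorphism k -> K})
    (h : {rmorphism K -> L}) n m (A : 'M[entry_poly K n]_m) P g :
  entry_eval h g (poly_subst f A P) = entry_eval (h \o f) (map_mx (entry_eval h g) A) P.
Proof.
rewrite /poly_subst rmorph_mmap; apply: eq_mmap => [c|v] /=.
  by rewrite entry_eval_cst.
by rewrite entry_eval_mxvec.
Qed.

Lemma map_entry_cst (K L : fieldType) (h : {rmorphism K -> L}) n m p (g : 'M[L]_n)
    (A : 'M[K]_(m, p)) :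
  map_mx (entry_eval h g) (map_mx (@entry_cst K n) A) = map_mx h A.
Proof. by apply/matrixP => i j; rewrite !mxE entry_eval_cst. Qed.

Definition inv_regmap n : regmap k n n := RegMap (\adj (generic_mx k n)) 1.

Lemma inv_regmapE (K : fieldType) (f : {rmorphism k -> K}) n (g : 'M[K]_n) :
  g \in unitmx -> regapp f (inv_regmap n) g = invmx g.
Proof.
move=> ug; rewrite /regapp /invmx ug expr1; congr (_ *: _).
rewrite -[in RHS](map_generic_mx f g) -map_mx_adj.
by apply/matrixP => i j; rewrite !mxE.
Qed.

(** For products, one factor is freed at a time. Left translation by an element of [S] preserves the
    equations over [k]; right translation by a point over [K] does not, and the translated equation
    is decomposed along coefficients free over [k], each part vanishing on [S]. Inverses are pulled
    back through the adjugate, clearing the determinant. *)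
Lemma closure_group n (S : set 'M[k]_n) : (forall g, S g -> g \in unitmx) ->
  is_subgroup 1%:M (@mulmx k n n n) (@invmx k n) S -> alg_group (zariski_closure S).
Proof.
move=> Su [S1 SM SV] K f.
have left P g h : zariski_closure S P -> S g -> pts f (zariski_closure S) h ->
    entry_eval f (map_mx f g *m h) P = 0.
  move=> SP Sg [uh Sh].
  pose P' := poly_subst idfun (map_mx (@entry_cst k n) g *m generic_mx k n) P.
  have evP (L : fieldType) (e : {rmorphism k -> L}) x :
      entry_eval e x P' = entry_eval e (map_mx e g *m x) P.
    by rewrite entry_eval_subst map_mxM map_entry_cst map_generic_mx.
  rewrite -evP; apply: Sh => x Sx; rewrite evP map_mx_id //; exact: (SP _ (SM _ _ Sg Sx)).
split.
- split=> [|P SP]; first exact: unitmx1.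
  by rewrite -(map_mx1 f) -[LHS](rmorph_entry_eval idfun f) SP ?rmorph0.
- move=> g h [ug Sg] hh; have [uh Sh] := hh; split; first by rewrite unitmx_mul ug.
  move=> P SP.
  pose P' := poly_subst f (generic_mx K n *m map_mx (@entry_cst K n) h) P.
  have evP x : entry_eval idfun x P' = entry_eval f (x *m h) P.
    by rewrite entry_eval_subst map_mxM map_entry_cst map_generic_mx map_mx_id.
  rewrite -evP; have [r [c [Q [cfree _ eP]]]] := free_span_poly f P'.
  have SQ j : zariski_closure S (Q j).
    move=> x Sx; apply: (cfree (fun j => entry_eval idfun x (Q j))).
    have := left P x h SP Sx hh; rewrite -evP eP rmorph_sum /= => e.
    rewrite -[RHS]e; apply: eq_bigr => i _; rewrite entry_evalZ entry_eval_map mulrC; congr (_ * _).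
    exact: (rmorph_entry_eval (idfun : {rmorphism k -> k}) f).
  rewrite eP rmorph_sum big1 // => j _ /=; rewrite entry_evalZ entry_eval_map.
  by rewrite [entry_eval _ _ _](Sg _ (SQ j)) mulr0.
- move=> g [ug Sg]; split; first by rewrite unitmx_inv.
  move=> P SP; have [P' [D hP]] := regmap_pullback (inv_regmap n) P.
  have /Sg : zariski_closure S P'.
    move=> x Sx; have ux := Su _ Sx.
    by rewrite hP // inv_regmapE // SP ?mulr0 //; exact: SV.
  rewrite hP // inv_regmapE // => /eqP; rewrite mulf_eq0 expf_eq0.
  by move: ug; rewrite unitmxE unitfE => /negPf ->; rewrite andbF => /eqP.
Qed.
End Pullback.

(** * Unipotent one-parameter groups *)

Section OneParameter.
Variable C : numClosedFieldType.
Variables (n : nat) (N : 'M[C]_n) (Q : 'M[{poly C}]_n).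
Hypothesis Nn : N ^+ n = 0.
Hypothesis QN : forall k : nat, map_mx (horner_eval k%:R) Q = (1%:M + N) ^+ k.

Definition upar (b : C) := map_mx (horner_eval b) Q.

Lemma uparE b P : entry_eval idfun (upar b) P =
  (mmap (@polyC C) (fun v => mxvec Q 0 v) P).[b].
Proof.
rewrite horner_mmap_polyC; apply: eq_mmap => // v.
by rewrite /upar -map_mxvec mxE.
Qed.

Lemma upar_vanish P : (forall k : nat, entry_eval idfun (upar k%:R) P = 0) ->
  forall b, entry_eval idfun (upar b) P = 0.
Proof.
move=> h b; rewrite uparE (_ : mmap _ _ _ = 0) ?horner0 //.
apply: poly_nat_eq0 => k.
by rewrite -uparE.
Qed.

(** The identity holds for natural exponents and extends in one variable at a time, a polynomial
    vanishing on the naturals being 0. *)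
Lemma uparD a b : upar a *m upar b = upar (a + b).
Proof.
have nat_nat (k j : nat) : upar k%:R *m upar j%:R = upar (k%:R + j%:R).
  by rewrite /upar -natrD !QN exprD.
have nat_left (k : nat) y : upar k%:R *m upar y = upar (k%:R + y).
  apply/matrixP => i j; apply/eqP; rewrite -subr_eq0; apply/eqP.
  pose p := (map_mx (@polyC C) (upar k%:R) *m Q) i j - (Q i j \Po ('X + k%:R%:P)).
  have pE z : p.[z] = (upar k%:R *m upar z) i j - upar (k%:R + z) i j.
    rewrite /p hornerD hornerN horner_comp hornerD hornerX hornerC addrC.
    rewrite addrC [z + _]addrC !mxE horner_sum; congr (_ - _).
    by apply: eq_bigr => l _; rewrite hornerM !mxE hornerC.
  rewrite -pE (_ : p = 0) ?horner0 //; apply: poly_nat_eq0 => l.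
  by rewrite pE nat_nat subrr.
apply/matrixP => i j; apply/eqP; rewrite -subr_eq0; apply/eqP.
pose p := (Q *m map_mx (@polyC C) (upar b)) i j - (Q i j \Po ('X + b%:P)).
have pE z : p.[z] = (upar z *m upar b) i j - upar (z + b) i j.
  rewrite /p hornerD hornerN horner_comp hornerD hornerX hornerC.
  rewrite !mxE horner_sum; congr (_ - _).
  by apply: eq_bigr => l _; rewrite hornerM !mxE hornerC.
rewrite -pE (_ : p = 0) ?horner0 //; apply: poly_nat_eq0 => l.
by rewrite pE nat_left subrr.
Qed.

Lemma upar0 : upar 0 = 1%:M.
Proof. exact: (QN 0). Qed.

Lemma upar_unit b : upar b \in unitmx.
Proof. by have /mulmx1_unit[] : upar b *m upar (- b) = 1%:M by rewrite uparD subrr upar0. Qed.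

Definition unipotent_closure := zariski_closure (range upar).

Lemma unipotent_closure_group : alg_group unipotent_closure.
Proof.
apply: closure_group => [_ [b _ <-]|]; first exact: upar_unit.
split.
- by exists 0; rewrite ?upar0.
- by move=> _ _ [a _ <-] [b _ <-]; exists (a + b); rewrite ?uparD.
- move=> _ [b _ <-]; exists (- b) => //.
  by apply/esym/invmx_eq; rewrite uparD subrr upar0.
Qed.

Lemma upar_in_closure b : pts idfun unipotent_closure (upar b).
Proof. by split=> [|P hP]; [exact: upar_unit|apply: hP; exists b]. Qed.

Lemma closure_of_upar (A : set (entry_poly C n)) :
  (forall P b, A P -> entry_eval idfun (upar b) P = 0) ->
  forall (K : fieldType) (f : {rmorphism C -> K}), pts f unipotent_closure `<=` pts f A.
Proof.
move=> h K f g [ug hg]; split=> // P AP; apply: hg => _ [b _ <-]; exact: h.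
Qed.

(** If neither piece contained the whole line, some equation of each would be nonzero along it; a
    parameter where both are nonzero gives a point in neither piece. *)
Lemma unipotent_closure_connected : alg_connected unipotent_closure.
Proof.
move=> A B part.
have [AU|nA] := pselect (forall P b, A P -> entry_eval idfun (upar b) P = 0).
  right=> K f; have [e1 e2] := part K f; apply/seteqP; split=> // g Bg.
  have : (pts f A `&` pts f B) g.
    by split=> //; apply: closure_of_upar => //; rewrite e1; right.
  by rewrite e2.
have [BU|nB] := pselect (forall P b, B P -> entry_eval idfun (upar b) P = 0).
  left=> K f; have [e1 e2] := part K f; apply/seteqP; split=> // g Ag.
  have : (pts f A `&` pts f B) g.
    by split=> //; apply: closure_of_upar => //; rewrite e1; left.
  by rewrite e2.
exfalso; have [P [a [AP nP]]] : exists P a, A P /\ entry_eval idfun (upar a) P <> 0.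
  apply: contrapT => h; apply: nA => P b AP; apply: contrapT => h'.
  by apply: h; exists P, b.
rewrite uparE in nP.
have [P' [b [BP nP']]] : exists P a, B P /\ entry_eval idfun (upar a) P <> 0.
  apply: contrapT => h; apply: nB => P' b BP; apply: contrapT => h'.
  by apply: h; exists P', b.
rewrite uparE in nP'.
set p := mmap _ _ P in nP *; set p' := mmap _ _ P' in nP' *.
have : p * p' != 0.
  by rewrite mulf_neq0 //; apply/negP => /eqP e; [apply: nP|apply: nP']; rewrite e horner0.
move/closed_nonrootP => [c]; rewrite rootM negb_or => /andP[pc p'c].
have [e1 _] := part C idfun.
have : (pts idfun A `|` pts idfun B) (upar c) by rewrite -e1; exact: upar_in_closure.
by case=> -[_ h]; [move/eqP: pc|move/eqP: p'c]; apply; rewrite -uparE h.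
Qed.

Lemma unipotent_closure_unipotent g : pts idfun unipotent_closure g -> (g - 1%:M) ^+ n = 0.
Proof.
move=> [ug hg].
pose A : 'M[entry_poly C n]_n := (generic_mx C n - 1%:M) ^+ n.
have AE x : map_mx (entry_eval idfun x) A = (x - 1%:M) ^+ n.
  by rewrite map_mx_exp map_mxB map_generic_mx map_mx1.
rewrite -AE; apply/matrixP => i j; rewrite !mxE; apply: hg => _ [b _ <-].
apply: upar_vanish => k; have := congr1 (fun B : 'M[C]_n => B i j) (AE (upar k%:R)).
rewrite mxE => ->; rewrite /upar QN -[1%:M]/(1 : 'M[C]_n) subrX1 addrC addKr.
rewrite exprMn_comm ?Nn ?mul0r ?mxE //.
apply: commr_sum => a _; apply: commrX; apply: commrD => //; exact: commr1.
Qed.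

Lemma unipotent_closure_commute (h u : 'M[C]_n) : N *m h = h *m N ->
  pts idfun unipotent_closure u -> h *m u = u *m h.
Proof.
move=> Nh [uu hu].
pose A := map_mx (@entry_cst C n) h *m generic_mx C n -
          generic_mx C n *m map_mx (@entry_cst C n) h.
have AE x : map_mx (entry_eval idfun x) A = h *m x - x *m h.
  by rewrite map_mxB !map_mxM /= !map_entry_cst map_generic_mx !map_mx_idfun.
apply/eqP; rewrite -subr_eq0 -AE; apply/eqP/matrixP => i j; rewrite mxE [RHS]mxE.
apply: hu => _ [b _ <-]; apply: upar_vanish => k.
have := congr1 (fun B : 'M[C]_n => B i j) (AE (upar k%:R)); rewrite mxE => ->.
have NGh : GRing.comm h (1%:M + N).
  by rewrite /GRing.comm -[h * _]/(h *m _) -[_ * h]/(_ *m h) mulmxDl mulmxDr mul1mx mulmx1 Nh.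
rewrite /upar QN (_ : h *m _ = (1%:M + N) ^+ k *m h) ?subrr ?mxE //.
exact: (commrX k NGh).
Qed.
End OneParameter.

Lemma expoly_jordan (C : numClosedFieldType) m (A : 'M[C]_m) r (lam : 'I_r -> C) E N Q :
  (forall i, lam i != 0) -> \sum_i E i = 1%:M ->
  (forall i, A *m E i = lam i *: ((1%:M + N) *m E i)) ->
  (forall i, N *m E i = E i *m N) ->
  (forall k : nat, map_mx (horner_eval k%:R) Q = (1%:M + N) ^+ k) ->
  forall i j, expoly (fun k => (A ^+ k) i j) (Q i j).
Proof.
move=> l0 E1 AE NE QN i j.
have NE' k a : (1%:M + N) ^+ k *m E a = E a *m (1%:M + N) ^+ k.
  have h : GRing.comm (E a) (1%:M + N).
    by rewrite /GRing.comm -[E a * _]/(E a *m _) -[_ * E a]/(_ *m E a) mulmxDl mulmxDr mul1mx mulmx1 NE.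
  exact/esym/(commrX k h).
have AkE k a : A ^+ k *m E a = lam a ^+ k *: ((1%:M + N) ^+ k *m E a).
  elim: k => [|k IH]; first by rewrite !expr0 scale1r.
  rewrite exprSr -[A ^+ k * A]/(A ^+ k *m A) -mulmxA AE -scalemxAr.
  have := NE' 1%N a; rewrite expr1 => ->; rewrite mulmxA IH -scalemxAl scalerA -exprS.
  congr (_ *: _); rewrite -mulmxA -(expr1 (1%:M + N)) -(NE' 1%N a) mulmxA expr1.
  by rewrite [in RHS]exprSr.
have -> : Q i j = \sum_a \sum_l (E a l j) *: Q i l.
  rewrite exchange_big /=.
  under eq_bigr => l _ do rewrite -scaler_suml -summxE E1 mxE.
  by rewrite (bigD1 j) //= eqxx scale1r big1 ?addr0 // => l lj; rewrite (negPf lj) scale0r.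
rewrite (_ : (fun k => _) = fun k => \sum_a lam a ^+ k * (\sum_l (E a l j) *: Q i l).[k%:R]).
  by apply: expoly_sum => a; apply: expoly_term.
apply/funext => k; rewrite -[A ^+ k]mulmx1 -E1 mulmx_sumr summxE; apply: eq_bigr => a _.
rewrite AkE mxE horner_sum mxE; congr (_ * _); apply: eq_bigr => l _.
by rewrite hornerZ mulrC -QN mxE.
Qed.

Section JordanRelation.
Variables (C : numClosedFieldType) (k0 : fieldType) (f : {rmorphism k0 -> C}).
Variables (n m : nat) (z : 'M[C]_n) (w : 'M[C]_m).
Variables (Q1 : 'M[{poly C}]_n) (Q2 : 'M[{poly C}]_m).
Hypothesis h1 : forall i j, expoly (fun k => (z ^+ k) i j) (Q1 i j).
Hypothesis h2 : forall i j, expoly (fun k => (w ^+ k) i j) (Q2 i j).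

Let psi (P : entry_poly k0 n) := mmap (@polyC C \o f) (fun v => mxvec Q1 0 v) P.

Let psiE P b : (psi P).[b] = entry_eval f (upar Q1 b) P.
Proof.
rewrite -[LHS]/(horner_eval b (psi P)) rmorph_mmap; apply: eq_mmap => [c|v] /=.
  by rewrite /horner_eval hornerC.
by rewrite /upar -map_mxvec [RHS]mxE.
Qed.

Let psi_expoly P : expoly (fun k => entry_eval f (z ^+ k) P) (psi P).
Proof.
apply: (expoly_mmap f (h := fun v k => mxvec (z ^+ k) 0 v)) => v.
case/mxvec_indexP: v => i j; rewrite mxvecE.
by under eq_fun do rewrite mxvecE; exact: h1.
Qed.

(** The sequence of values on powers of [z] is identically 0, hence so is its unipotent part: the
    unipotent factor of [z] satisfies every equation that the powers of [z] satisfy. *)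
Lemma jordan_vanish P : (forall k, entry_eval f (z ^+ k) P = 0) ->
  forall b, entry_eval f (upar Q1 b) P = 0.
Proof.
by move=> h b; rewrite -psiE (expoly_eq0 (psi_expoly P) h) horner0.
Qed.

(** A polynomial representation respects Jordan decompositions: both sides are unipotent parts of
    the same sequence of powers of [w]. *)
Lemma jordan_rep (Nu : 'M[entry_poly k0 n]_m) :
  (forall k, map_mx (entry_eval f (z ^+ k)) Nu = w ^+ k) ->
  forall b, map_mx (entry_eval f (upar Q1 b)) Nu = upar Q2 b.
Proof.
move=> h b; apply/matrixP => i j; rewrite mxE [RHS]mxE -psiE /horner_eval.
apply/eqP; rewrite -subr_eq0 -hornerN -hornerD; apply/eqP.
have e : expoly (fun k => entry_eval f (z ^+ k) (Nu i j) + (-1) * (w ^+ k) i j)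
    (psi (Nu i j) + (-1)%:P * Q2 i j).
  by apply: expolyD; [exact: psi_expoly|apply: expolyM; [exact: expoly_cst|exact: h2]].
rewrite -[_ + _](_ : psi (Nu i j) + (-1)%:P * Q2 i j = _); last first.
  by rewrite polyCN mulN1r.
rewrite (expoly_eq0 e) ?horner0 // => k.
by have := congr1 (fun B : 'M[C]_m => B i j) (h k); rewrite mxE => ->; rewrite mulN1r subrr.
Qed.
End JordanRelation.

(** * The centre of a reductive group acts diagonalisably *)

Section CenterPoints.
Variables (K : fieldType) (f : rat -> K) (n : nat) (G : set (entry_poly rat n)).
Definition center_pts : set 'M[K]_n :=
  [set z | pts f G z /\ forall h, pts f G h -> z *m h = h *m z].
Definition rep_eval m (Nu : 'M[entry_poly rat n]_m) (g : 'M[K]_n) : 'M[K]_m :=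
  map_mx (entry_eval f g) Nu.
End CenterPoints.

Section CenterSemisimple.
Variable R : realType.
Local Notation C := (CC R).
Variables (n : nat) (G : set (entry_poly rat n)).
Hypothesis G_red : reductive R G.

(** The closure of the one-parameter group is connected, unipotent and normal, being centralised by
    [G]; reductivity makes it trivial. *)
Lemma no_central_unipotent (N : 'M[C]_n) (Q : 'M[{poly C}]_n) :
  N ^+ n = 0 ->
  (forall k : nat, map_mx (horner_eval k%:R) Q = (1%:M + N) ^+ k) ->
  (forall h, pts ratr G h -> N *m h = h *m N) ->
  (forall P b, G P -> entry_eval ratr (upar Q b) P = 0) -> N = 0.
Proof.
move=> Nn QN NG hG; case: G_red => _ _ /(_ (unipotent_closure Q)) red.
have U1 : pts idfun (unipotent_closure Q) = [set 1%:M].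
  apply: red.
  - exact: unipotent_closure_group QN.
  - exact: unipotent_closure_connected QN.
  - move=> K f; apply: closure_of_upar => _ b [P GP <-].
    by rewrite entry_eval_map -[RHS](hG P b GP); apply: entry_eval_eq.
  - move=> g u Gg Uu; rewrite (unipotent_closure_commute QN (NG g Gg) Uu) mulmxK //.
    by case: Gg.
  - by move=> g; apply: unipotent_closure_unipotent Nn QN g.
have : pts idfun (unipotent_closure Q) (upar Q 1%:R) by exact: upar_in_closure QN _.
rewrite U1 /upar (QN 1%N) expr1 => /eqP; rewrite -subr_eq0 addrC addKr.
by move/eqP.
Qed.

End CenterSemisimple.

Section CenterProjection.
Variables (C : numClosedFieldType) (f : {rmorphism rat -> C}).
Variables (n : nat) (G : set (entry_poly rat n)) (m : nat).
Variable Nu : 'M[entry_poly rat n]_m.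
Hypothesis G_grp : alg_group G.
Hypothesis no_unip : forall (N : 'M[C]_n) (Q : 'M[{poly C}]_n),
  N ^+ n = 0 ->
  (forall k : nat, map_mx (horner_eval k%:R) Q = (1%:M + N) ^+ k) ->
  (forall h, pts f G h -> N *m h = h *m N) ->
  (forall P b, G P -> entry_eval f (upar Q b) P = 0) -> N = 0.
Hypothesis rep1 : rep_eval f Nu (1%:M : 'M[C]_n) = 1%:M.
Hypothesis repM : forall g h : 'M[C]_n, pts f G g -> pts f G h ->
  rep_eval f Nu (g *m h) = rep_eval f Nu g *m rep_eval f Nu h.

(** The unipotent factor of a central [z] commutes with [G] and satisfies its equations, so it is 1.
    As the representation respects Jordan decompositions, the image of [z] has no nilpotent part
    either. *)
Lemma center_diagonalizable z : center_pts f G z ->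
  exists r (lam : 'I_r -> C) (E : 'I_r -> 'M[C]_m),
  [/\ rep_eval f Nu z = \sum_i lam i *: E i, \sum_i E i = 1%:M,
     forall i j, E i *m E j = if i == j then E i else 0,
     (forall B : 'M[C]_m, rep_eval f Nu z *m B = B *m rep_eval f Nu z ->
        forall i, E i *m B = B *m E i)
   & (forall (F : 'M[C]_m), F *m F = F ->
        rep_eval f Nu z *m F = F *m rep_eval f Nu z *m F ->
        forall i, E i *m F = F *m E i *m F)].
Proof.
move=> [Gz zG]; have [uz _] := Gz.
have [G1 GM GV] := G_grp f.
have Gzk k : pts f G (z ^+ k).
  by elim: k => [|k IH]; [exact: G1|rewrite exprS; exact: GM].
have repX k : rep_eval f Nu (z ^+ k) = rep_eval f Nu z ^+ k.
  elim: k => [|k IH]; first exact: rep1.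
  by rewrite !exprS -IH; exact: repM.
have uw : rep_eval f Nu z \in unitmx.
  have /mulmx1_unit[] // : rep_eval f Nu z *m rep_eval f Nu (invmx z) = 1%:M.
  by rewrite -repM ?mulmxV //; exact: GV.
have [r1 [lam1 [E1 [N1 [[l1 s1 _ a1 [n1 c1]] _]]]]] := jordan_idempotents uz.
have [r2 [lam2 [E2 [N2 [[l2 s2 o2 a2 [n2' c2]] st2]]]]] := jordan_idempotents uw.
have [Q1 q1] := unipotent_poly n1.
have [Q2 q2] := unipotent_poly n2'.
have N1E i : N1 *m E1 i = E1 i *m N1.
  by have [h _] := c1 z erefl; have [_ /(_ i) ->] := c1 N1 (esym h).
have N2E i : N2 *m E2 i = E2 i *m N2.
  by have [h _] := c2 _ erefl; have [_ /(_ i) ->] := c2 N2 (esym h).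
have x1 := expoly_jordan l1 s1 a1 N1E q1.
have x2 := expoly_jordan l2 s2 a2 N2E q2.
have N10 : N1 = 0.
  apply: (no_unip n1 q1) => [h Gh|P b GP].
    by have [] := c1 h (zG h Gh).
  apply: (jordan_vanish x1) => k.
  by case: (Gzk k) => _; apply.
have N20 : N2 = 0.
  have := jordan_rep (f := f) x1 x2 repX 1.
  have u1 : upar Q1 1 = 1%:M by rewrite /upar (q1 1%N) N10 addr0 expr1.
  have u2 : upar Q2 1 = 1%:M + N2 by rewrite /upar (q2 1%N) expr1.
  rewrite u1 u2 => e; move: rep1; rewrite /rep_eval e => /eqP.
  by rewrite -subr_eq0 addrC addKr => /eqP.
exists r2, lam2, E2; split=> // [|B hB i].
  rewrite -[LHS]mulmx1 -s2 mulmx_sumr; apply: eq_bigr => i _.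
  by rewrite a2 N20 addr0 mul1mx.
by have [_ ->] := c2 B hB.
Qed.

(* Averaging a projection over the eigenspaces of the centre. *)
Lemma center_projection (e : 'M[C]_m) : e *m e = e ->
  (forall z, center_pts f G z -> rep_eval f Nu z *m e = e *m rep_eval f Nu z *m e) ->
  exists p : 'M[C]_m, [/\ e *m p = p, p *m e = e
    & forall z, center_pts f G z -> rep_eval f Nu z *m p = p *m rep_eval f Nu z].
Proof.
move=> ee est.
have zc z h : center_pts f G z -> center_pts f G h ->
    rep_eval f Nu z *m rep_eval f Nu h = rep_eval f Nu h *m rep_eval f Nu z.
  by move=> [Gz zG] [Gh hG]; rewrite -!repM // zG.
have fin (s : seq 'M[C]_n) : (forall z, z \in s -> center_pts f G z) ->
    exists p : 'M[C]_m, [/\ e *m p = p, p *m e = e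
    & forall z, z \in s -> rep_eval f Nu z *m p = p *m rep_eval f Nu z].
  elim: s => [|z s IH] hs; first by exists e; split.
  have [|p [ep pe hp]] := IH; first by move=> y ys; apply: hs; rewrite inE ys orbT.
  have cz : center_pts f G z by apply: hs; rewrite mem_head.
  have [r [lam [E [zE E1 EE Ec Est]]]] := center_diagonalizable cz.
  have Ee i : E i *m e = e *m E i *m e by apply: Est => //; exact: est.
  exists (\sum_i E i *m p *m E i); split.
  - rewrite mulmx_sumr; apply: eq_bigr => i _.
    have Ep : E i *m p = e *m (E i *m p).
      by rewrite -{1}ep mulmxA Ee -!mulmxA ep.
    by rewrite mulmxA -Ep.
  - rewrite mulmx_suml -[RHS]mul1mx -E1 mulmx_suml; apply: eq_bigr => i _.
    rewrite -mulmxA Ee -!mulmxA (mulmxA p) pe (mulmxA e) -Ee mulmxA EE eqxx.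
    by [].
  - move=> y; rewrite inE => /predU1P[->|ys].
      rewrite mulmx_sumr mulmx_suml; apply: eq_bigr => i _.
      have zEi : rep_eval f Nu z *m E i = lam i *: E i.
        rewrite zE mulmx_suml (bigD1 i) //= -scalemxAl EE eqxx big1 ?addr0 // => j ji.
        by rewrite -scalemxAl EE (negPf ji) scaler0.
      have Ez : E i *m rep_eval f Nu z = lam i *: E i by rewrite Ec.
      by rewrite !mulmxA zEi -[RHS]mulmxA Ez -scalemxAr -!scalemxAl.
    have cy : center_pts f G y by apply: hs; rewrite inE ys orbT.
    rewrite mulmx_sumr mulmx_suml; apply: eq_bigr => i _.
    have Ey : E i *m rep_eval f Nu y = rep_eval f Nu y *m E i by apply: Ec; exact: zc.
    by rewrite -[RHS]mulmxA Ey !mulmxA -Ey -[E i *m _ *m p]mulmxA hp // !mulmxA.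
pose S (s : seq 'M[C]_n) := forall z, z \in s -> center_pts f G z.
pose sp (s : seq 'M[C]_n) := <<[seq rep_eval f Nu z | z <- s]>>%VS.
(* Finitely many central elements suffice: their images are chosen to span a subspace of maximal
   dimension, which then contains the image of every other central element. *)
have [s Ss smax] : exists2 s, S s & forall t, S t ->
    (dim 'M[C]_m - \dim (sp s) <= dim 'M[C]_m - \dim (sp t))%N.
  apply: (@min_measure _ S (fun s => dim 'M[C]_m - \dim (sp s))%N).
  by exists [::].
have [p [ep pe hp]] := fin s Ss; exists p; split=> // z cz.
have St : S (z :: s) by move=> y; rewrite inE => /predU1P[->|/Ss].
have sub : (sp s <= sp (z :: s))%VS by rewrite /sp /= span_cons addvSr.
have dimz : (\dim (sp (z :: s)) <= dim 'M[C]_m)%N by rewrite -dimvf dimvS ?subvf.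
have d2 := smax _ St.
have eqsp : sp s = sp (z :: s).
  by apply/eqP; rewrite eqEdim sub -(leq_sub2lE _ dimz).
have : rep_eval f Nu z \in sp s by rewrite eqsp memv_span //= mem_head.
move=> zs; rewrite (@coord_span _ _ _ (in_tuple [seq rep_eval f Nu z | z <- s]) _ zs).
rewrite mulmx_sumr mulmx_suml; apply: eq_bigr => i _.
rewrite -scalemxAl -scalemxAr; congr (_ *: _).
have /mapP[y ys ->] : (in_tuple [seq rep_eval f Nu z | z <- s])`_i \in [seq rep_eval f Nu z | z <- s].
  by rewrite mem_nth //= ltn_ord.
exact: hp.
Qed.
End CenterProjection.

(** * Lie algebras *)

Section Jets.
Variables (k : fieldType) (n : nat).

Lemma lderivM (X : 'M[k]_n) (P Q : entry_poly k n) :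
  lderiv X (P * Q) = lderiv X P * Q + P * lderiv X Q.
Proof.
rewrite /lderiv mulr_suml mulr_sumr -big_split; apply: eq_bigr => v _ /=.
by rewrite mderivM; ring.
Qed.

Lemma lderiv_cst (X : 'M[k]_n) c : lderiv X (entry_cst n c) = 0.
Proof. by rewrite /lderiv big1 // => v _; rewrite mderivC mulr0. Qed.

Lemma lderivZ (X : 'M[k]_n) c P : lderiv X (c *: P) = c *: lderiv X P.
Proof.
by rewrite /lderiv scaler_sumr; apply: eq_bigr => v _; rewrite mderivZ scalerAr.
Qed.

Lemma lderiv_sum (X : 'M[k]_n) I (s : seq I) (F : I -> entry_poly k n) :
  lderiv X (\sum_(i <- s) F i) = \sum_(i <- s) lderiv X (F i).
Proof.
elim: s => [|i s IH]; last by rewrite !big_cons lderiv_linear IH.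
by rewrite !big_nil -[X in lderiv _ X](scale0r 0) lderivZ scale0r.
Qed.

Lemma lderiv_coef (X : 'M[k]_n) a b :
  mxvec (generic_mx k n *m map_mx (@entry_cst k n) X) 0 (mxvec_index a b) =
  \sum_l X l b *: entry_var k a l.
Proof.
rewrite mxvecE mxE; apply: eq_bigr => l _.
by rewrite [generic_mx _ _ _ _]mxE [map_mx _ _ _ _]mxE mulrC mul_mpolyC.
Qed.

Lemma lderiv_comb I (s : seq I) (c : I -> k) (X : I -> 'M[k]_n) P :
  lderiv (\sum_(i <- s) c i *: X i) P = \sum_(i <- s) c i *: lderiv (X i) P.
Proof.
rewrite /lderiv.
under [RHS]eq_bigr do rewrite scaler_sumr.
rewrite exchange_big; apply: eq_bigr => v _ /=.
case/mxvec_indexP: v => a b; rewrite lderiv_coef.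
under [RHS]eq_bigr do rewrite lderiv_coef scalerAl.
rewrite -mulr_suml; congr (_ * _).
under [RHS]eq_bigr do rewrite scaler_sumr.
rewrite exchange_big; apply: eq_bigr => l _ /=.
rewrite summxE scaler_suml; apply: eq_bigr => i _.
by rewrite [(c i *: X i) _ _]mxE scalerA.
Qed.

Lemma lderivDl (c : k) (X Y Z : 'M[k]_n) P :
  (forall i j, Z i j = c * X i j + Y i j) ->
  lderiv Z P = c *: lderiv X P + lderiv Y P.
Proof.
move=> ZE; rewrite /lderiv scaler_sumr -big_split; apply: eq_bigr => v _ /=.
case/mxvec_indexP: v => a b; rewrite !lderiv_coef.
rewrite [X in _ = X + _]scalerAl -[RHS]mulrDl.
congr (_ * _); rewrite scaler_sumr -big_split; apply: eq_bigr => l _ /=.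
by rewrite ZE scalerDl scalerA.
Qed.

Lemma entry_eval_lderivX (K : fieldType) (f : {rmorphism k -> K}) (g : 'M[K]_n)
    X i j : entry_eval f g (lderiv X (entry_var k i j)) = (g *m map_mx f X) i j.
Proof.
rewrite entry_eval_lderiv (bigD1 (mxvec_index i j)) //= big1 ?addr0.
  by rewrite /entry_var mderiv_var eqxx rmorph1 mulr1 mxvecE.
move=> v vij; rewrite /entry_var mderiv_var (negPf vij).
by rewrite rmorph0 mulr0.
Qed.

End Jets.

Section LieAlgebra.

Lemma mderiv_map (k K : nzRingType) N (f : {rmorphism k -> K}) v (P : mpoly N k) :
  mderiv v (map_mpoly f P) = map_mpoly f (mderiv v P).
Proof.
apply/mpolyP => u.
by rewrite mcoeff_deriv !mcoeff_map_mpoly /= mcoeff_deriv rmorphMn.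
Qed.

Lemma lderiv_map (k K : fieldType) n (f : {rmorphism k -> K}) (X : 'M[k]_n) P :
  lderiv (map_mx f X) (map_mpoly f P) = map_mpoly f (lderiv X P).
Proof.
elim/mpoly_ring_ind: P => [c|v|P Q IHP IHQ|P Q IHP IHQ].
- by rewrite map_mpolyC !lderiv_cst rmorph0.
- case/mxvec_indexP: v => i j; rewrite map_mpolyX.
  rewrite /lderiv rmorph_sum; apply: eq_bigr => v _; rewrite rmorphM /=; congr (_ * _).
    case/mxvec_indexP: v => a b; rewrite !lderiv_coef rmorph_sum; apply: eq_bigr => l _.
    by rewrite [map_mx _ _ _ _]mxE /= map_mpolyZ /entry_var map_mpolyX.
  by rewrite !mderiv_var rmorph_nat.
- by rewrite rmorphD !lderiv_linear rmorphD IHP IHQ.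
- by rewrite rmorphM !lderivM rmorphD !rmorphM /= IHP IHQ.
Qed.

Variables (n : nat) (M : set (entry_poly rat n)).

(** Left-invariant derivations preserving the ideal, rather than tangent vectors at 1: they can be
    iterated, as vanishing along exponential curves requires. *)
Definition lie_rat : set 'M[rat]_n :=
  [set X | forall P, vanishing_ideal M P -> vanishing_ideal M (lderiv X P)].

Definition lie_alg (F : fieldType) (i0 : rat -> F) : set 'M[F]_n :=
  [set X | forall P, vanishing_ideal M P ->
    vanishing_ideal (base_change i0 M) (lderiv X (map_mpoly i0 P))].

Section LieOver.
Variables (F : fieldType) (i0 : {rmorphism rat -> F}).

Lemma vanishing_ideal_map P : vanishing_ideal M P ->
  vanishing_ideal (base_change i0 M) (map_mpoly i0 P).
Proof.
move=> IP; apply/vanishing_ideal_baseP => K f g Mg.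
by rewrite entry_eval_map; exact: IP.
Qed.

Lemma lie_ratP X : lie_rat X -> lie_alg i0 (map_mx i0 X).
Proof.
by move=> LX P IP; rewrite lderiv_map; apply: vanishing_ideal_map; exact: LX.
Qed.

(** Comparing the coefficients of the independent [c j] shows that the Lie algebra over [F] is
    spanned by rational elements. *)
Lemma lie_alg_free r (c : 'I_r -> F) (X : 'I_r -> 'M[rat]_n) :
  lin_free i0 c -> lie_alg i0 (\sum_j c j *: map_mx i0 (X j)) ->
  forall j, lie_rat (X j).
Proof.
move=> cfree LX j P IP; move: (LX P IP); rewrite lderiv_comb.
under eq_bigr do rewrite lderiv_map.
by move/(ideal_descent cfree)/(_ j).
Qed.

Lemma lie_alg_ideal X P : lie_alg i0 X ->
  vanishing_ideal (base_change i0 M) P ->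
  vanishing_ideal (base_change i0 M) (lderiv X P).
Proof.
move=> LX /vanishing_ideal_span[r [c [Q [IQ ->]]]].
rewrite lderiv_sum => K f g Mg; rewrite rmorph_sum big1 //= => j _.
by rewrite lderivZ entry_evalZ (LX _ (IQ j)) // mulr0.
Qed.

Lemma lie_algD c X Y : lie_alg i0 X -> lie_alg i0 Y -> lie_alg i0 (c *: X + Y).
Proof.
move=> LX LY P IP K f g Mg.
have -> : lderiv (c *: X + Y) (map_mpoly i0 P) =
    c *: lderiv X (map_mpoly i0 P) + lderiv Y (map_mpoly i0 P).
  by apply: lderivDl => i j; rewrite !mxE.
have eX : entry_eval f g (lderiv X (map_mpoly i0 P)) = 0 := LX P IP K f g Mg.
have eY : entry_eval f g (lderiv Y (map_mpoly i0 P)) = 0 := LY P IP K f g Mg.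
have eZ := entry_evalZ f g c (lderiv X (map_mpoly i0 P)).
by rewrite [LHS]rmorphD; apply: etrans (congr2 +%R eZ eY) _; rewrite eX mulr0 addr0.
Qed.

Lemma lie_alg_map (F' : fieldType) (h : {rmorphism F -> F'})
    (i1 : {rmorphism rat -> F'}) X :
  lie_alg i0 X -> lie_alg i1 (map_mx h X).
Proof.
move=> LX P IP; have -> : map_mpoly i1 P = map_mpoly h (map_mpoly i0 P).
  by apply/mpolyP => u; rewrite !mcoeff_map_mpoly /= (rat_morph_eq i1 (h \o i0)).
rewrite lderiv_map; apply/vanishing_ideal_baseP => K f g Mg.
rewrite entry_eval_map; move/vanishing_ideal_baseP: (LX P IP); apply.
by rewrite (pts_eq _ (rat_morph_eq _ (f \o i1))).
Qed.

(** Differentiating at [h] along [g X g^-1] is the same as differentiating at [h g] along [X] the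
    polynomial translated by the inverse of [g]. *)
Lemma eval_lderiv_conj (K : fieldType) (f : {rmorphism F -> K}) (g X : 'M[F]_n) h P :
  g \in unitmx ->
  entry_eval f (h *m map_mx f g)
    (lderiv X (poly_subst idfun (generic_mx F n *m map_mx (@entry_cst F n) (invmx g)) P)) =
  entry_eval f h (lderiv (g *m X *m invmx g) P).
Proof.
move=> ug; set A := _ *m map_mx (@entry_cst F n) _.
have eA : map_mx (entry_eval f (h *m map_mx f g)) A = h.
  rewrite map_mxM map_generic_mx map_entry_cst -mulmxA -map_mxM mulmxV //.
  by rewrite map_mx1 mulmx1.
have e0 Q : entry_eval f (h *m map_mx f g) (poly_subst idfun A Q) = entry_eval f h Q.
  by rewrite (entry_eval_subst (idfun : {rmorphism F -> F})) eA.
elim/mpoly_ring_ind: P => [c|v|P Q IHP IHQ|P Q IHP IHQ].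
- by rewrite /poly_subst mmapC !lderiv_cst !rmorph0.
- case/mxvec_indexP: v => i j; rewrite entry_eval_lderivX /poly_subst mmapX mmap1U mxvecE.
  have -> : A i j = \sum_l invmx g l j *: entry_var F i l.
    rewrite mxE; apply: eq_bigr => l _.
    by rewrite [generic_mx _ _ _ _]mxE [map_mx _ _ _ _]mxE mulrC mul_mpolyC.
  rewrite lderiv_sum rmorph_sum !map_mxM !mulmxA [RHS]mxE; apply: eq_bigr => l _ /=.
  by rewrite lderivZ entry_evalZ entry_eval_lderivX mulrC [map_mx f (invmx g) _ _]mxE.
- have -> : poly_subst idfun A (P + Q) = poly_subst idfun A P + poly_subst idfun A Q.
    exact: rmorphD.
  by rewrite 2!lderiv_linear 2!rmorphD /= IHP IHQ.
- have -> : poly_subst idfun A (P * Q) = poly_subst idfun A P * poly_subst idfun A Q.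
    exact: rmorphM.
  by rewrite !lderivM 2!rmorphD 4!rmorphM /= IHP IHQ !e0.
Qed.

Lemma lie_alg_conj g X : alg_group M -> pts i0 M g -> lie_alg i0 X ->
  lie_alg i0 (g *m X *m invmx g).
Proof.
move=> grpM Mg LX P IP; apply/vanishing_ideal_baseP => K f h Mh.
have ug := Mg.1; rewrite -eval_lderiv_conj //.
have Mg' : pts (f \o i0) M (map_mx f g) by exact: pts_map.
have [_ MM MV] := grpM K (f \o i0).
have [_ _ MV0] := grpM F i0.
move: (_ *m map_mx _ g) (MM _ _ Mh Mg') => h' Mh'.
apply: (proj1 (vanishing_ideal_baseP i0 M _) _ K f h' Mh').
apply: lie_alg_ideal LX _; apply/vanishing_ideal_baseP => L f' {}h' {}Mh'.
rewrite (entry_eval_subst (idfun : {rmorphism F -> F})) map_mxM map_generic_mx.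
rewrite map_entry_cst; move/vanishing_ideal_baseP: (vanishing_ideal_map IP); apply.
have [_ MM' _] := grpM L (f' \o i0).
by apply: MM' => //; apply: pts_map; exact: MV0.
Qed.

(** Evaluating the derivation at 1 gives a tangent vector, which brings the Lie algebra of [M] under
    the Hodge decomposition, stated for [Lie]. *)
Lemma lie_alg_Lie (G : set (entry_poly rat n)) X : alg_group M ->
  alg_subset M G -> lie_alg i0 X -> Lie i0 G X.
Proof.
move=> grpM sMG LX P IP; have M1 : pts i0 M 1%:M by case: (grpM F i0).
have IMP : vanishing_ideal M P by move=> K f g Mg; apply: IP; exact: sMG.
have/vanishing_ideal_baseP/(_ F idfun 1%:M M1) := LX P IMP.
rewrite entry_eval_lderiv mul1mx map_mx_idfun => e; rewrite -[RHS]e.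
apply: eq_bigr => v _; rewrite mulrC; congr (_ * _).
by rewrite mderiv_map entry_eval_map.
Qed.

End LieOver.
End LieAlgebra.

(** * Cocharacters and Mumford-Tate groups *)

Lemma poly_nat_vanish (K : fieldType) (f : {rmorphism rat -> K}) (p : {poly K}) :
  (forall k : nat, p.[k.+1%:R] = 0) -> p = 0.
Proof.
have fnat k : k%:R = f k%:R by rewrite rmorph_nat.
move=> p0; apply: (@roots_geq_poly_eq0 _ p [seq k.+1%:R | k <- iota 0 (size p)]).
- by apply/allP => x /mapP[k _ ->]; rewrite /root p0.
- rewrite map_inj_uniq ?iota_uniq // => i j; rewrite !fnat => /fmorph_inj /eqP.
  by rewrite eqr_nat => /eqP[].
- by rewrite size_map size_iota.
Qed.

Lemma rat_morph_nat_neq0 (K : fieldType) (f : {rmorphism rat -> K}) k :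
  k.+1%:R != 0 :> K.
Proof. by rewrite -(rmorph_nat f) fmorph_eq0 pnatr_eq0. Qed.

Lemma poly_unit_vanish (K : fieldType) (f : {rmorphism rat -> K}) (p : {poly K}) :
  (forall z, z != 0 -> p.[z] = 0) -> p = 0.
Proof.
by move=> p0; apply: (poly_nat_vanish f) => k; rewrite p0 // (rat_morph_nat_neq0 f).
Qed.

Lemma curve_eval (k K : fieldType) (f : {rmorphism k -> K}) n (A : 'M[{poly K}]_n)
    (P : entry_poly k n) : exists p : {poly K},
  forall t, p.[t] = entry_eval f (map_mx (horner_eval t) A) P.
Proof.
exists (mmap (@polyC K \o f) (fun v => mxvec A 0 v) P) => t.
rewrite -[LHS]/(horner_eval t (mmap _ _ P)) rmorph_mmap.
apply: eq_mmap => [c|v] /=; first by rewrite /horner_eval hornerC.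
by rewrite -map_mxvec [RHS]mxE.
Qed.

Section LaurentCurves.
Variables (F : fieldType) (n : nat) (T : 'M[{poly F}]_n) (d : nat).
Hypothesis T1 : map_mx (horner_eval 1) T = 1%:M.

(** The derivative at 1 of the Laurent curve [z ^- d *: T z], as [T] takes the value 1 at 1. *)
Definition curve_tangent : 'M[F]_n :=
  map_mx (fun p : {poly F} => p^`().[1]) T - d%:R%:M.

(** The factor [z ^ N] clears the denominators of the curve, and the formula is the product rule at
    1. Allowing every large [N] lets two polynomials share a common exponent. *)
Lemma curve_pullback (K : fieldType) (f : {rmorphism F -> K}) (h : 'M[K]_n)
    (P : entry_poly F n) :
  exists N0, forall N, (N0 <= N)%N -> exists p : {poly K},
    (forall z, z != 0 -> p.[z] = z ^+ N *
       entry_eval f (h *m (z ^- d *: map_mx (horner_eval z \o map_poly f) T)) P) /\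
    p^`().[1] = N%:R * entry_eval f h P + entry_eval f h (lderiv curve_tangent P).
Proof.
have s1 : h *m (1 ^- d *: map_mx (horner_eval 1 \o map_poly f) T) = h.
  rewrite expr1n invr1 scale1r -[RHS]mulmx1 -[in RHS](map_mx1 f) -T1.
  congr (_ *m _); apply/matrixP => i j; rewrite !mxE /= /horner_eval.
  by rewrite -[in LHS](rmorph1 f) horner_map.
elim/mpoly_ring_ind: P => [c|v|P Q [N1 IHP] [N2 IHQ]|P Q [N1 IHP] [N2 IHQ]].
- exists 0%N => N _; exists ('X^N * (f c)%:P); split=> [z _|].
    by rewrite hornerM hornerXn hornerC (entry_eval_cst f _ c).
  rewrite derivM derivC mulr0 addr0 derivXn hornerM hornerMn hornerXn expr1n hornerC.
  by rewrite (entry_eval_cst f _ c) lderiv_cst rmorph0 addr0.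
- case/mxvec_indexP: v => i j; exists d => N dN.
  pose q : {poly K} := \sum_l (h i l)%:P * map_poly f (T l j).
  have q1 : q.[1] = h i j.
    rewrite /q horner_sum -[in RHS]s1 mxE; apply: eq_bigr => l _.
    rewrite hornerM hornerC; congr (_ * _).
    by rewrite [(_ *: _ : 'M[K]_n) l j]mxE expr1n invr1 mul1r mxE.
  exists ('X^(N - d) * q); split=> [z z0|].
    rewrite entry_eval_var hornerM hornerXn /q horner_sum mxE !mulr_sumr.
    apply: eq_bigr => l _; rewrite hornerM hornerC.
    rewrite [(_ *: _ : 'M[K]_n) l j]mxE [map_mx _ _ _ _]mxE /= /horner_eval.
    rewrite -{2}(subnK dN) exprD -!mulrA; congr (_ * _).
    by rewrite mulrCA; congr (_ * _); rewrite mulrA mulfV ?mul1r // expf_neq0.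
  rewrite derivM hornerD !hornerM derivXn hornerMn !hornerXn !expr1n q1.
  rewrite entry_eval_var entry_eval_lderivX mul1r.
  have -> : q^`().[1] = (h *m map_mx f curve_tangent) i j + d%:R * h i j.
    rewrite /q raddf_sum horner_sum /curve_tangent map_mxB mulmxBr.
    rewrite map_scalar_mx mul_mx_scalar.
    rewrite [(_ - _ : 'M[K]_n) i j]mxE [(- _ : 'M[K]_n) i j]mxE [(_ *: h) i j]mxE.
    rewrite rmorph_nat subrK mxE; apply: eq_bigr => l _.
    rewrite /= derivM derivC mul0r add0r hornerM hornerC; congr (_ * _).
    by rewrite !mxE deriv_map -[in LHS](rmorph1 f) horner_map.
  by rewrite natrB // -mulr_natl mulr1; ring.
- exists (maxn N1 N2) => N; rewrite geq_max => /andP[le1 le2].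
  have [p [pE p1]] := IHP _ le1; have [q [qE q1]] := IHQ _ le2.
  exists (p + q); split=> [z z0|]; first by rewrite hornerD pE // qE // rmorphD mulrDr.
  by rewrite derivD hornerD p1 q1 lderiv_linear !rmorphD; ring.
- exists (N1 + N2)%N => N leN.
  have [p [pE p1]] := IHP _ (leqnn N1).
  have le2 : (N2 <= N - N1)%N by rewrite leq_subRL ?(leq_trans _ leN) ?leq_addr.
  have [q [qE q1]] := IHQ _ le2.
  have eN : (N = N1 + (N - N1))%N by rewrite subnKC // (leq_trans _ leN) ?leq_addr.
  exists (p * q); split=> [z z0|].
    by rewrite hornerM pE // qE // rmorphM /= [in RHS]eN exprD; ring.
  rewrite derivM hornerD !hornerM p1 q1 !pE ?oner_eq0 // !qE ?oner_eq0 //.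
  rewrite !s1 !expr1n !mul1r lderivM rmorphD !rmorphM /= [in RHS]eN natrD.
  ring.
Qed.
End LaurentCurves.

Section Cocharacter.
Variables (C : numFieldType) (m : nat) (B : 'M[{poly C}]_m).
Let Bev z := map_mx (horner_eval z) B.
Hypothesis BM : forall z w, z != 0 -> w != 0 -> Bev (z * w) = Bev z *m Bev w.
Hypothesis B1 : Bev 1 = 1%:M.

(* the weight spaces of z |-> B(z) are the images of the coefficients of B *)
Lemma cochar_commute (pi : 'M[C]_m) :
  pi *m map_mx (fun p : {poly C} => p^`().[1]) B =
    map_mx (fun p : {poly C} => p^`().[1]) B *m pi ->
  forall z, z != 0 -> pi *m Bev z = Bev z *m pi.
Proof.
pose E k : 'M[C]_m := map_mx (coefp k) B.
pose K := \max_(ij : 'I_m * 'I_m) size (B ij.1 ij.2).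
have sB i j : (size (B i j) <= K)%N by exact: (@leq_bigmax _ (fun ij => size (B ij.1 ij.2)) (i, j)).
have BE z : Bev z = \sum_(k < K) z ^+ k *: E k.
  apply/matrixP => i j; rewrite mxE /horner_eval (horner_coef_wide _ (sB i j)) summxE.
  by apply: eq_bigr => k _; rewrite !mxE mulrC.
have BEj z j : z != 0 -> Bev z *m E j = z ^+ j *: E j.
  move=> z0; apply/matrixP => a b.
  have p0 : \sum_l (horner_eval z (B a l))%:P * B l b - (B a b \Po (z *: 'X)) = 0.
    apply: (poly_unit_vanish ratr) => w w0; rewrite hornerD hornerN horner_sum horner_comp hornerZ hornerX.
    have /matrixP/(_ a b) := BM z0 w0; rewrite !mxE /horner_eval => ->.
    apply/eqP; rewrite subr_eq0; apply/eqP; apply: eq_bigr => l _.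
    by rewrite hornerM hornerC !mxE.
  move/(congr1 (coefp j)): p0; rewrite /= coefB coef0 => /eqP; rewrite subr_eq0 => /eqP.
  rewrite coef_sum comp_polyE coef_sum !mxE => e; transitivity (\sum_i ((horner_eval z (B a i))%:P * B i b)`_j).
    by apply: eq_bigr => l _; rewrite coefCM !mxE.
  rewrite e; have [lj|gj] := ltnP j (size (B a b)).
    rewrite (bigD1 (Ordinal lj)) //= big1 ?addr0; last first.
      move=> i /eqP ij; rewrite coefZ exprZn coefZ coefXn.
      by case: eqP => [e'|_]; rewrite ?mulr0 //; case: ij; apply: val_inj.
    by rewrite coefZ exprZn coefZ coefXn eqxx mulr1 mulrC.
  rewrite /= (nth_default _ gj) mulr0 big1 // => i _.
  rewrite coefZ exprZn coefZ coefXn; case: eqP => [e'|_]; last by rewrite !mulr0.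
  by move: gj; rewrite e' leqNgt ltn_ord.
have EE (k j : 'I_K) : E k *m E j = (k == j)%:R *: E j.
  apply/matrixP => a b.
  have p0 : \sum_(i < K) ((E i *m E j) a b) *: 'X^i - (E j a b) *: 'X^j = 0.
    apply: (poly_unit_vanish ratr) => z z0; rewrite hornerD hornerN hornerZ hornerXn horner_sum.
    have /matrixP/(_ a b) := BEj z j z0; rewrite BE mulmx_suml summxE => e.
    rewrite -[X in _ - X]mulrC -[z ^+ j * _]/(z ^+ j * E j a b).
    rewrite [(z ^+ j *: E j) a b]mxE in e; rewrite -e; apply/eqP; rewrite subr_eq0; apply/eqP.
    apply: eq_bigr => i _; rewrite hornerZ hornerXn -scalemxAl.
    by rewrite [(_ *: (_ *m _)) a b]mxE mulrC.
  move/(congr1 (coefp k)): p0; rewrite /= coefB coef0 coefZ coefXn coef_sum => /eqP.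
  rewrite subr_eq0 => /eqP; rewrite (bigD1 k) //= big1 ?addr0; last first.
    move=> i ik; rewrite coefZ coefXn; case: eqP => [e|]; rewrite ?mulr0 //.
    by case/eqP: ik; apply: val_inj.
  rewrite coefZ coefXn eqxx mulr1 => ->.
  by rewrite [(_ *: E j) a b]mxE mulrC.
set D := map_mx _ B => piD.
have DE : D = \sum_(k < K) k%:R *: E k.
  apply/matrixP => i j; rewrite mxE summxE; have -> : B i j = \sum_(k < K) (B i j)`_k *: 'X^k.
    apply/polyP => a; rewrite coef_sum.
    have [aK|Ka] := ltnP a K.
      rewrite (bigD1 (Ordinal aK)) //= big1 ?addr0 ?coefZ ?coefXn ?eqxx ?mulr1 //.
      move=> b ba; rewrite coefZ coefXn; case: eqP => [e|]; rewrite ?mulr0 //.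
      by case/eqP: ba; apply: val_inj.
    rewrite big1 ?nth_default ?(leq_trans (sB i j)) // => b _.
    rewrite coefZ coefXn; case: eqP => [e|]; rewrite ?mulr0 //.
    by move: Ka; rewrite e leqNgt ltn_ord.
  rewrite raddf_sum horner_sum; apply: eq_bigr => k _ /=.
  rewrite derivZ derivXn hornerZ hornerMn hornerXn expr1n !mxE /= mulrC.
  by rewrite mulr_natl.
(* [D] acts on the image of [E k] as the integer [k], so commutation with [D] kills the blocks
   between distinct weights. *)
have piE (j k : 'I_K) : j != k -> E j *m pi *m E k = 0.
  have EjD : E j *m D = j%:R *: E j.
    rewrite DE mulmx_sumr (bigD1 j) //= big1 ?addr0; last first.
      by move=> i ij; rewrite -scalemxAr EE eq_sym (negPf ij) scale0r scaler0.
    by rewrite -scalemxAr EE eqxx scale1r.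
  have DEk : D *m E k = k%:R *: E k.
    rewrite DE mulmx_suml (bigD1 k) //= big1 ?addr0; last first.
      by move=> i ik; rewrite -scalemxAl EE (negPf ik) scale0r scaler0.
    by rewrite -scalemxAl EE eqxx scale1r.
  move=> jk; have : j%:R *: (E j *m pi *m E k) = k%:R *: (E j *m pi *m E k).
    transitivity (E j *m D *m pi *m E k); first by rewrite EjD -!scalemxAl.
    by rewrite -(mulmxA (E j)) -piD mulmxA -mulmxA DEk -scalemxAr.
  move/eqP; rewrite -subr_eq0 -scalerBl scaler_eq0 subr_eq0 eqr_nat.
  by rewrite (negPf jk : (j == k :> nat) = false) /= => /eqP.
have sumE : \sum_(k < K) E k = 1%:M.
  by rewrite -B1 BE; apply: eq_bigr => k _; rewrite expr1n scale1r.
have com (k : 'I_K) : pi *m E k = E k *m pi.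
  transitivity (E k *m pi *m E k).
    rewrite -[LHS]mul1mx -sumE mulmx_suml (bigD1 k) //= big1 ?addr0 ?mulmxA //.
    by move=> j jk; rewrite mulmxA piE.
  rewrite -[RHS]mulmx1 -sumE mulmx_sumr (bigD1 k) //= big1 ?addr0 //.
  by move=> j jk; rewrite piE // eq_sym.
move=> z z0; rewrite BE mulmx_sumr mulmx_suml; apply: eq_bigr => k _.
by rewrite -scalemxAr -scalemxAl com.
Qed.
End Cocharacter.

(** Denominators are dropped: multiplying by a power of the determinant changes neither commutants
    nor stable subspaces, and leaves a matrix of polynomials. *)
Definition is_rep n (G : set (entry_poly rat n)) m (Nu : 'M[entry_poly rat n]_m) :=
  forall (K : fieldType) (f : {rmorphism rat -> K}),
    rep_eval f Nu (1%:M : 'M[K]_n) = 1%:M /\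
    forall g h : 'M[K]_n, pts f G g -> pts f G h ->
      rep_eval f Nu (g *m h) = rep_eval f Nu g *m rep_eval f Nu h.

Definition rep_tangent (F : fieldType) (i0 : rat -> F) n m
    (Nu : 'M[entry_poly rat n]_m) (X : 'M[F]_n) : 'M[F]_m :=
  map_mx (fun P => entry_eval idfun 1%:M (lderiv X (map_mpoly i0 P))) Nu.

Lemma rep_eval_map (K L : fieldType) (f : {rmorphism rat -> K}) (h : {rmorphism K -> L})
    (f' : {rmorphism rat -> L}) n m (Nu : 'M[entry_poly rat n]_m) g :
  rep_eval f' Nu (map_mx h g) = map_mx h (rep_eval f Nu g).
Proof.
apply/matrixP => i j; rewrite [LHS]mxE [RHS]mxE [rep_eval _ _ _ _ _]mxE rmorph_entry_eval.
exact/entry_eval_eq/rat_morph_eq.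
Qed.

Lemma regapp_map (k K L : fieldType) (f : {rmorphism k -> K}) (h : {rmorphism K -> L})
    a b (phi : regmap k a b) g :
  regapp (h \o f) phi (map_mx h g) = map_mx h (regapp f phi g).
Proof.
rewrite /regapp map_mxZ det_map_mx -rmorphXn -fmorphV; congr (_ *: _).
by apply/matrixP => i j; rewrite !mxE rmorph_entry_eval.
Qed.

Lemma rep_tangentD (F : fieldType) (i0 : {rmorphism rat -> F}) n m
    (Nu : 'M[entry_poly rat n]_m) I (r : seq I) c (X : I -> 'M[F]_n) :
  rep_tangent i0 Nu (\sum_(i <- r) c i *: X i) =
  \sum_(i <- r) c i *: rep_tangent i0 Nu (X i).
Proof.
apply/matrixP => i j; rewrite mxE lderiv_comb rmorph_sum summxE.
by apply: eq_bigr => l _; rewrite /= entry_evalZ !mxE.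
Qed.

Lemma rep_tangent_map (F : fieldType) (i0 : {rmorphism rat -> F}) n m
    (Nu : 'M[entry_poly rat n]_m) (X : 'M[rat]_n) :
  rep_tangent i0 Nu (map_mx i0 X) = map_mx i0 (rep_tangent idfun Nu X).
Proof.
apply/matrixP => i j; rewrite !mxE lderiv_map entry_eval_map rmorph_entry_eval map_mx1.
congr entry_eval; congr lderiv.
by apply/mpolyP => u; rewrite mcoeff_map_mpoly.
Qed.

Section SMatrix.
Variable K : fieldType.

Lemma S_mxM (a b c d : K) :
  S_mx a b *m S_mx c d = S_mx (a * c - b * d) (a * d + b * c).
Proof.
apply/matrixP => -[[|[|//]] ?] -[[|[|//]] ?];
  rewrite !mxE big_ord_recl big_ord1 !mxE /=; ring.
Qed.

Lemma S_mx1 : S_mx (1 : K) 0 = 1%:M.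
Proof. by apply/matrixP => -[[|[|//]] ?] -[[|[|//]] ?]; rewrite !mxE //= oppr0. Qed.

Lemma det_S_mx (a b : K) : \det (S_mx a b) = a ^+ 2 + b ^+ 2.
Proof.
rewrite (expand_det_row _ ord0) big_ord_recl big_ord1 /cofactor !det_mx11 !mxE /=.
by ring.
Qed.

Lemma map_S_mx (L : fieldType) (f : {rmorphism K -> L}) a b :
  map_mx f (S_mx a b) = S_mx (f a) (f b).
Proof. by apply/matrixP => -[[|[|//]] ?] -[[|[|//]] ?]; rewrite !mxE //= rmorphN. Qed.

Definition S_poly (al be : {poly K}) : 'M[{poly K}]_2 :=
  \matrix_(i, j) (if i == j then al else if (i < j)%N then - be else be).

Lemma S_polyE al be z : map_mx (horner_eval z) (S_poly al be) = S_mx al.[z] be.[z].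
Proof.
by apply/matrixP => -[[|[|//]] ?] -[[|[|//]] ?]; rewrite !mxE //= /horner_eval hornerN.
Qed.

End SMatrix.

(** A polynomial vanishing on all real [S_mx a b] vanishes on those with entries in an extension:
    the two entries are freed in turn, each time by vanishing at infinitely many integers. *)
Lemma torus_pts (R : realType) (K : fieldType) (f : {rmorphism R -> K}) (a b : K) :
  a ^+ 2 + b ^+ 2 != 0 -> pts f (@deligne_torus R) (S_mx a b).
Proof.
move=> ab0; split=> [|P JP]; first by rewrite unitmxE det_S_mx unitfE.
pose q : {rmorphism rat -> K} := f \o ratr.
have [p pE] := curve_eval f (S_poly 'X b%:P) P.
suff p0 : p = 0 by move: (pE a); rewrite p0 horner0 S_polyE hornerX hornerC => <-.
apply: (poly_nat_vanish q) => k; rewrite pE S_polyE hornerX hornerC.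
have [r rE] := curve_eval idfun (S_poly (k.+1%:R)%:P 'X) P.
have r0 : r = 0.
  apply: (poly_unit_vanish ratr) => z _; rewrite rE S_polyE hornerX hornerC.
  by apply: JP; exists k.+1%:R => //; exists z.
have [r' r'E] := curve_eval f (S_poly (k.+1%:R)%:P 'X) P.
have r'0 : r' = 0.
  apply: (poly_nat_vanish q) => j; rewrite r'E S_polyE hornerX hornerC.
  have := rE j.+1%:R; rewrite r0 horner0 S_polyE hornerX hornerC => /(congr1 f).
  by rewrite rmorph_entry_eval map_S_mx !rmorph_nat rmorph0 => <-.
by move: (r'E b); rewrite r'0 horner0 S_polyE hornerX hornerC => <-.
Qed.

Section Cocharacters.
Variables (R0 : fieldType) (C0 : numFieldType) (tau : {rmorphism R0 -> C0}).
Variables (iR : {rmorphism rat -> R0}) (iC : {rmorphism rat -> C0}).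
Variables (n : nat) (M : set (entry_poly rat n)) (s : regmap R0 2 n).
Variables (al be : {poly C0}).
Hypothesis grpM : alg_group M.
Hypothesis sM : forall (K : fieldType) (f : {rmorphism R0 -> K}) a b,
  a ^+ 2 + b ^+ 2 != 0 -> pts (f \o iR) M (regapp f s (S_mx a b)).
Hypothesis smul : forall (K : fieldType) (f : {rmorphism R0 -> K}) a b c d,
  a ^+ 2 + b ^+ 2 != 0 -> c ^+ 2 + d ^+ 2 != 0 ->
  regapp f s (S_mx a b *m S_mx c d) = regapp f s (S_mx a b) *m regapp f s (S_mx c d).
Hypothesis ab_norm : al ^+ 2 + be ^+ 2 = 'X.
Hypothesis abM : forall z w, S_mx al.[z] be.[z] *m S_mx al.[w] be.[w] =
  S_mx al.[z * w] be.[z * w].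
Hypothesis ab1 : S_mx al.[1] be.[1] = 1%:M.

Let T : 'M[{poly C0}]_n :=
  \matrix_(i, j) projT1 (cid (curve_eval tau (S_poly al be) (numer s i j))).
Let d := denom s.

Let normE (K : fieldType) (f : {rmorphism C0 -> K}) z :
  (map_poly f al).[z] ^+ 2 + (map_poly f be).[z] ^+ 2 = z.
Proof. by rewrite -!horner_exp -hornerD -!rmorphXn -rmorphD /= ab_norm map_polyX hornerX. Qed.

Let Tev (K : fieldType) (f : {rmorphism C0 -> K}) z :
  z ^- d *: map_mx (horner_eval z \o map_poly f) T =
  regapp (f \o tau) s (S_mx (map_poly f al).[z] (map_poly f be).[z]).
Proof.
rewrite /regapp det_S_mx normE; congr (_ *: _); apply/matrixP => i j; rewrite !mxE /=.
case: cid => p /= pE.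
have [p' p'E] := curve_eval (f \o tau) (S_poly (map_poly f al) (map_poly f be)) (numer s i j).
rewrite /horner_eval; transitivity p'.[z]; last by rewrite p'E S_polyE.
congr (_.[z]); apply/eqP; rewrite -subr_eq0; apply/eqP.
apply: (poly_nat_vanish (f \o iC)) => k.
rewrite hornerD hornerN p'E S_polyE -[k.+1%:R](rmorph_nat f) !horner_map pE S_polyE.
by rewrite rmorph_entry_eval map_S_mx subrr.
Qed.

Let s1 (K : fieldType) (f : {rmorphism R0 -> K}) : regapp f s 1%:M = 1%:M.
Proof.
have n1 : 1 ^+ 2 + 0 ^+ 2 != 0 :> K by rewrite expr1n expr0n addr0 oner_neq0.
have := smul f n1 n1; rewrite S_mx1 mulmx1 => e.
have [u _] := sM f n1; rewrite S_mx1 in u.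
by rewrite -[RHS](mulVmx u) {3}e mulKmx.
Qed.

Let T1 : map_mx (horner_eval 1) T = 1%:M.
Proof.
have := Tev idfun 1; rewrite expr1n invr1 scale1r !map_poly_id // ab1 => e.
rewrite -[RHS](s1 (idfun \o tau)) -e.
by apply/matrixP => i j; rewrite !mxE /= map_poly_id.
Qed.

(** The cocharacter translated by a point [h] of [M] stays in [M], so polynomials of the ideal
    vanish identically along it, and the derivative at 1 is the value of the derivation at [h]. *)
Lemma cochar_lie : lie_alg M iC (curve_tangent T d).
Proof.
move=> P IP; apply/vanishing_ideal_baseP => K f h Mh.
have [N0 /(_ N0 (leqnn _))[p [pE p1]]] := curve_pullback d T1 f h (map_mpoly iC P).
have P0 g : pts (f \o iC) M g -> entry_eval f g (map_mpoly iC P) = 0.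
  by move=> Mg; rewrite entry_eval_map; apply: (IP _ (f \o iC)).
have p0 : p = 0.
  apply: (poly_unit_vanish (f \o iC)) => z z0; rewrite pE // Tev P0 ?mulr0 //.
  have [_ MM _] := grpM (f \o iC); apply: MM => //.
  have := sM (f \o tau) (a := (map_poly f al).[z]) (b := (map_poly f be).[z]).
  by rewrite normE => /(_ z0); rewrite (pts_eq _ (rat_morph_eq _ (f \o iC))).
by move: p1; rewrite p0 deriv0 horner0 P0 // mulr0 add0r => <-.
Qed.

Section CocharRep.
Variables (m : nat) (Nu : 'M[entry_poly rat n]_m).
Hypothesis repNu : is_rep M Nu.

(** Up to a power of [z] the representation along the cocharacter is a polynomial matrix, whose
    derivative at 1 is a scalar plus the image of one element of the Lie algebra. Commuting with
    that derivative means respecting the weight spaces. *)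
Lemma cochar_rep_commute (phi : 'M[C0]_m) :
  (forall X, lie_alg M iC X ->
     phi *m rep_tangent iC Nu X = rep_tangent iC Nu X *m phi) ->
  forall z, z != 0 ->
    phi *m rep_eval iC Nu (regapp tau s (S_mx al.[z] be.[z])) =
    rep_eval iC Nu (regapp tau s (S_mx al.[z] be.[z])) *m phi.
Proof.
move=> comm.
have [N0 N0P] := boolp.choice (fun ij : 'I_m * 'I_m =>
  curve_pullback d T1 idfun 1%:M (map_mpoly iC (Nu ij.1 ij.2))).
pose N := \max_ij N0 ij.
have [B BP] := boolp.choice (fun ij => N0P ij N (leq_bigmax ij)).
pose Bm : 'M[{poly C0}]_m := \matrix_(i, j) B (i, j).
have sz z : regapp tau s (S_mx al.[z] be.[z]) =
    z ^- d *: map_mx (horner_eval z \o map_poly idfun) T.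
  by rewrite (Tev idfun) !map_poly_id.
have BE z : z != 0 -> map_mx (horner_eval z) Bm =
    z ^+ N *: rep_eval iC Nu (regapp tau s (S_mx al.[z] be.[z])).
  move=> z0; apply/matrixP => i j; rewrite !mxE /horner_eval.
  have [-> // _] := BP (i, j); congr (_ * _).
  by rewrite mul1mx -sz entry_eval_map.
have pz z : z != 0 -> pts iC M (regapp tau s (S_mx al.[z] be.[z])).
  move=> z0; rewrite -(pts_eq _ (rat_morph_eq (tau \o iR) iC)); apply: sM.
  by have := normE idfun z; rewrite !map_poly_id // => ->.
have BM z w : z != 0 -> w != 0 ->
    map_mx (horner_eval (z * w)) Bm = map_mx (horner_eval z) Bm *m map_mx (horner_eval w) Bm.
  move=> z0 w0; rewrite !BE ?mulf_neq0 // -abM smul; last 2 first.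
  - by have := normE idfun z; rewrite !map_poly_id // => ->.
  - by have := normE idfun w; rewrite !map_poly_id // => ->.
  have [_ ->] := repNu iC; try exact: pz.
  by rewrite exprMn -scalemxAl -scalemxAr scalerA.
have B1 : map_mx (horner_eval 1) Bm = 1%:M.
  rewrite BE ?oner_neq0 // ab1 expr1n scale1r (s1 tau).
  by have [] := repNu iC.
have BD : map_mx (fun p : {poly C0} => p^`().[1]) Bm =
    N%:R%:M + rep_tangent iC Nu (curve_tangent T d).
  apply/matrixP => i j; rewrite [LHS]mxE [Bm _ _]mxE; have [_ ->] := BP (i, j).
  rewrite [RHS]mxE [rep_tangent _ _ _ _ _]mxE; congr (_ + _).
  rewrite entry_eval_map.
  have [r1 _] := repNu iC; move/matrixP/(_ i j): r1; rewrite mxE => ->.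
  by rewrite !mxE; case: eqP => _; rewrite ?mulr1 ?mulr0.
move=> z z0; have := cochar_commute BM B1 _ z0.
move/(_ phi); rewrite BD mulmxDr mulmxDl comm; last exact: cochar_lie.
rewrite -scalar_mxC => /(_ erefl); rewrite BE // -scalemxAr -scalemxAl.
by move/(congr1 ( *:%R (z ^- N))); rewrite !scalerA mulVf ?expf_neq0 // !scale1r.
Qed.
End CocharRep.
End Cocharacters.

Section HodgeCocharacters.
Variable C0 : numClosedFieldType.
Variable e : C0.
Hypothesis e2 : e ^+ 2 = 1.

(** In the coordinates [(z, w)] of the Deligne torus over the complex numbers, [hodge_re] and
    [hodge_im e] describe the cocharacter [(z, 1)] for [e = 1] and [(1, z)] for [e = -1]; together
    they generate the torus. *)
Definition hodge_re : {poly C0} := 2^-1 *: ('X + 1%:P).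
Definition hodge_im : {poly C0} := (e / (2 * 'i)) *: ('X - 1%:P).

Let two0 : 2 != 0 :> C0. Proof. by rewrite pnatr_eq0. Qed.
Let c2 : (e / (2 * 'i)) ^+ 2 = - (2^-1 ^+ 2).
Proof.
transitivity (e ^+ 2 * ('i ^+ 2)^-1 * 2^-1 ^+ 2); first by field; rewrite neq0Ci.
by rewrite e2 sqrCi invrN1 mul1r mulN1r.
Qed.

Lemma hodge_norm : hodge_re ^+ 2 + hodge_im ^+ 2 = 'X.
Proof.
rewrite /hodge_re /hodge_im [X in X + _]exprZn [X in _ + X]exprZn c2 scaleNr -scalerBr.
have -> : ('X + 1%:P) ^+ 2 - ('X - 1%:P) ^+ 2 = (2 ^+ 2 : C0) *: 'X :> {poly C0}.
  by rewrite -mul_polyC rmorphXn /= polyCMn; ring.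
by rewrite scalerA -exprMn mulVf // expr1n scale1r.
Qed.

Lemma hodgeM z w : S_mx hodge_re.[z] hodge_im.[z] *m S_mx hodge_re.[w] hodge_im.[w] =
  S_mx hodge_re.[z * w] hodge_im.[z * w].
Proof.
rewrite /hodge_re /hodge_im S_mxM !hornerZ !hornerD !hornerN !hornerX !hornerC; congr S_mx.
  transitivity (2^-1 ^+ 2 * (z + 1) * (w + 1) - (e / (2 * 'i)) ^+ 2 * (z - 1) * (w - 1)).
    by ring.
  by rewrite c2; field.
by field; rewrite neq0Ci.
Qed.

Lemma hodge1 : S_mx hodge_re.[1] hodge_im.[1] = 1%:M.
Proof.
rewrite /hodge_re /hodge_im !hornerZ !hornerD !hornerN !hornerX !hornerC subrr mulr0 -[X in S_mx X](_ : 1 = _) ?S_mx1 //.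
by field.
Qed.

End HodgeCocharacters.

Lemma hodge_factor (C0 : numClosedFieldType) (z w : C0) :
  S_mx (hodge_re C0).[z] (hodge_im 1).[z] *m S_mx (hodge_re C0).[w] (hodge_im (-1)).[w] =
  S_mx ((z + w) / 2) ((z - w) / (2 * 'i)).
Proof.
rewrite /hodge_re /hodge_im S_mxM !hornerZ !hornerD !hornerN !hornerX !hornerC; congr S_mx.
  have i2 : 'i^-1 ^+ 2 = -1 :> C0 by rewrite exprVn sqrCi invrN1.
  transitivity (2^-1 ^+ 2 * (z + 1) * (w + 1) + 2^-1 ^+ 2 * ('i^-1) ^+ 2 * (z - 1) * (w - 1)).
    by rewrite !invfM; ring.
  by rewrite i2; field.
by field; rewrite neq0Ci.
Qed.

Lemma mulmx_commute (F : fieldType) m (A B D : 'M[F]_m) :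
  A *m B = B *m A -> A *m D = D *m A -> A *m (B *m D) = B *m D *m A.
Proof. by move=> AB AD; rewrite mulmxA AB -mulmxA AD mulmxA. Qed.

(** * Mumford-Tate groups and centralisers *)

Section MumfordTate.
Variables (R : realType) (n : nat) (G : set (entry_poly rat n)) (s : regmap R 2 n).
Local Notation C := (CC R).
Hypothesis grpG : alg_group G.
Hypothesis sG : S_hom G s.
Local Notation M := (MT G s).

Lemma MT_min (H : set (entry_poly rat n)) :
  alg_group H -> alg_subset H G -> S_hom H s -> alg_subset M H.
Proof.
move=> grpH sHG sH K f g [ug Mg]; split=> // P HP; apply: Mg; by exists H.
Qed.

Lemma MT_sub : alg_subset M G.
Proof. by apply: MT_min => // K f g. Qed.

Lemma MT_group : alg_group M.
Proof.
move=> K f; split=> [|g h Mg Mh|g Mg].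
- split=> [|P [H [grpH _ _ HP]]]; first exact: unitmx1.
  by have [[_ h1] _ _] := grpH K f; exact: h1.
- split=> [|P [H [grpH sHG sH HP]]]; first by rewrite unitmx_mul Mg.1 Mh.1.
  have [_ hM _] := grpH K f.
  by have [_ hP] := hM g h (MT_min grpH sHG sH Mg) (MT_min grpH sHG sH Mh); exact: hP.
- split=> [|P [H [grpH sHG sH HP]]]; first by rewrite unitmx_inv Mg.1.
  have [_ _ hV] := grpH K f.
  by have [_ hP] := hV g (MT_min grpH sHG sH Mg); exact: hP.
Qed.

Lemma MT_hom : S_hom M s.
Proof.
move=> K f; have [sp sm] := sG f; split=> // g Dg; split=> [|_ [P [H [_ _ sH HP]] <-]].
  by have [] := sp g Dg.
have [sHp _] := sH K f; have [_ hP] := sHp g Dg.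
by apply: hP; exists P.
Qed.

Section Centralizer.
Variables (m : nat) (Nu : 'M[entry_poly rat n]_m) (phi : 'M[rat]_m).
Hypothesis repNu : is_rep G Nu.

Let Q : 'M[entry_poly rat n]_m :=
  map_mx (@entry_cst rat n) phi *m Nu - Nu *m map_mx (@entry_cst rat n) phi.
Let E : set (entry_poly rat n) := [set P | G P \/ exists i j, P = Q i j].

Let QE (K : fieldType) (f : {rmorphism rat -> K}) g :
  map_mx (entry_eval f g) Q =
  map_mx f phi *m rep_eval f Nu g - rep_eval f Nu g *m map_mx f phi.
Proof. by rewrite map_mxB !map_mxM map_entry_cst. Qed.

Let ptsE (K : fieldType) (f : {rmorphism rat -> K}) g : pts f E g <->
  pts f G g /\ map_mx f phi *m rep_eval f Nu g = rep_eval f Nu g *m map_mx f phi.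
Proof.
split=> [[ug Eg]|[[ug Gg] com]].
  split; first by split=> // P GP; apply: Eg; left.
  apply/eqP; rewrite -subr_eq0 -QE; apply/eqP/matrixP => i j; rewrite mxE [RHS]mxE.
  by apply: Eg; right; exists i, j.
split=> // P [/Gg //|[i [j ->]]].
have /matrixP/(_ i j) : map_mx (entry_eval f g) Q = 0 by rewrite QE com subrr.
by rewrite mxE [RHS]mxE.
Qed.

(** The elements of [G] commuting with [phi] form an algebraic group over the rationals because
    [phi] is rational. It contains the image of the torus, whose equations are tested at real
    points, so minimality applies. *)
Lemma centralizer_MT :
  (forall z : C, z != 0 -> map_mx ratr phi *m rep_eval ratr Nu (S_real s z) =
     rep_eval ratr Nu (S_real s z) *m map_mx ratr phi) ->
  forall (K : fieldType) (f : {rmorphism rat -> K}) g, pts f M g ->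
    map_mx f phi *m rep_eval f Nu g = rep_eval f Nu g *m map_mx f phi.
Proof.
move=> com K f g Mg; have/ptsE[] // : pts f E g.
apply: MT_min Mg => {K f g} [K f|K f g /ptsE[]//|K f].
  have [G1 GM GV] := grpG f; have [r1 rM] := repNu f.
  split=> [|g h /ptsE[Gg cg] /ptsE[Gh ch]|g /ptsE[Gg cg]]; apply/ptsE.
  - by split=> //; rewrite r1 mulmx1 mul1mx.
  - by split; [exact: GM|rewrite rM // mulmxA cg -mulmxA ch mulmxA].
  - split; first exact: GV.
    have e1 : rep_eval f Nu g *m rep_eval f Nu (invmx g) = 1%:M.
      by rewrite -rM ?mulmxV ?Gg.1 //; exact: GV.
    have e2 := mulmx1C e1.
    by rewrite -[LHS]mul1mx -e2 -mulmxA (mulmxA _ (map_mx f phi)) -cg -!mulmxA e1 mulmx1.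
have [sp sm] := sG f; split=> // g Dg; have [usg Gsg] := sp g Dg.
split=> // _ [P [GP|[i [j ->]]] <-]; first by apply: Gsg; exists P.
have [P' [D P'E]] := regmap_pullback s (map_mpoly ratr (Q i j)).
have ug := Dg.1.
suff : entry_eval f g (P' * det_poly R 2) = 0.
  rewrite rmorphM /= P'E // entry_eval_det => /eqP; rewrite !mulf_eq0 expf_eq0.
  by move: ug; rewrite unitmxE unitfE => /negPf ->; rewrite andbF orbF => /eqP.
apply: Dg.2 => _ [a _ [b _ <-]]; rewrite rmorphM /= entry_eval_det det_S_mx.
have [->|ab0] := eqVneq (a ^+ 2 + b ^+ 2) 0; first by rewrite mulr0.
rewrite P'E ?unitmxE ?det_S_mx ?unitfE // entry_eval_map.
pose z : C := (a +i* b)%C.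
have z0 : z != 0.
  by apply: contra ab0 => /eqP[-> ->]; rewrite expr0n addr0.
have/matrixP/(_ i j) : map_mx (entry_eval ratr (S_real s z)) Q = 0.
  by rewrite QE com // subrr.
rewrite mxE [RHS]mxE; move=> e; rewrite -[X in _ * X * _]/(entry_eval ratr (S_real s z) (Q i j)).
by rewrite e mulr0 mul0r.
Qed.

(** Commutation with rational elements of the Lie algebra extends to the complex Lie algebra, hence
    to both Hodge cocharacters. Their product at [z] and its conjugate is [s z], and the centraliser
    of [phi] then contains the Mumford-Tate group. *)
Lemma tangent_commute_MT :
  (forall X, lie_rat M X -> phi *m rep_tangent idfun Nu X = rep_tangent idfun Nu X *m phi) ->
  forall (K : fieldType) (f : {rmorphism rat -> K}) g, pts f M g ->
    map_mx f phi *m rep_eval f Nu g = rep_eval f Nu g *m map_mx f phi.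
Proof.
move=> com; apply: centralizer_MT => z z0.
pose iR : {rmorphism rat -> R} := ratr.
pose tau : {rmorphism R -> C} := real_complex R.
pose iC : {rmorphism rat -> C} := ratr.
have repM : is_rep M Nu.
  move=> K f; have [r1 rM] := repNu f; split=> // g h Mg Mh.
  by apply: rM; exact: MT_sub.
have sM (K : fieldType) (f : {rmorphism R -> K}) a b :
    a ^+ 2 + b ^+ 2 != 0 -> pts (f \o iR) M (regapp f s (S_mx a b)).
  move=> ab0; have [sp _] := MT_hom f; have := sp _ (torus_pts f ab0).
  by rewrite (pts_base_change iR).
have smul (K : fieldType) (f : {rmorphism R -> K}) a b c d :
    a ^+ 2 + b ^+ 2 != 0 -> c ^+ 2 + d ^+ 2 != 0 ->
    regapp f s (S_mx a b *m S_mx c d) = regapp f s (S_mx a b) *m regapp f s (S_mx c d).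
  by move=> ab0 cd0; have [_ ->] := sG f; try exact: torus_pts.
have comC X : lie_alg M iC X ->
    map_mx iC phi *m rep_tangent iC Nu X = rep_tangent iC Nu X *m map_mx iC phi.
  have [r [c [Y [cfree _ ->]]]] := free_span_mx iC X => LX.
  rewrite rep_tangentD mulmx_sumr mulmx_suml; apply: eq_bigr => j _.
  rewrite -scalemxAr -scalemxAl rep_tangent_map -!map_mxM com //.
  exact: lie_alg_free LX j.
have key (e : C) : e ^+ 2 = 1 -> forall w, w != 0 ->
    let A := S_mx (hodge_re C).[w] (hodge_im e).[w] in
    map_mx iC phi *m rep_eval iC Nu (regapp tau s A) =
    rep_eval iC Nu (regapp tau s A) *m map_mx iC phi.
  move=> e2 w w0 /=.
  apply: (@cochar_rep_commute _ _ tau iR iC n M s (hodge_re C) (hodge_im e)) => //.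
  - exact: MT_group.
  - exact: hodge_norm.
  - exact: hodgeM.
  - exact: hodge1.
have e1 : 1 ^+ 2 = 1 :> C by rewrite expr1n.
have eN : (-1) ^+ 2 = 1 :> C by rewrite sqrrN.
have zc0 : z^* != 0 by rewrite conjC_eq0.
set A := S_mx (complex.Re z) (complex.Im z).
suff com2 : map_mx iC phi *m rep_eval iC Nu (regapp tau s (map_mx tau A)) =
    rep_eval iC Nu (regapp tau s (map_mx tau A)) *m map_mx iC phi.
  have eA : regapp tau s (map_mx tau A) = map_mx tau (S_real s z).
    exact: (regapp_map idfun tau).
  have ephi : map_mx iC phi = map_mx tau (map_mx iR phi).
    by rewrite -map_mx_comp; apply/matrixP => i j; rewrite !mxE; exact: rat_morph_eq.
  move: com2; rewrite eA (rep_eval_map iR tau) ephi -!map_mxM.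
  exact: map_mx_inj.
have -> : map_mx tau A =
    S_mx (hodge_re C).[z] (hodge_im 1).[z] *m S_mx (hodge_re C).[z^*] (hodge_im (-1)).[z^*].
  rewrite hodge_factor map_S_mx; congr S_mx.
    apply: (mulIf (_ : 2 != 0)); first by rewrite pnatr_eq0.
    rewrite mulfVK ?pnatr_eq0 //; case: (z) => a b.
    by apply: CC_eq => /=; ring.
  apply: (mulIf (_ : 2 * 'i != 0)); first by rewrite mulf_neq0 ?pnatr_eq0 ?neq0Ci.
  rewrite mulfVK ?mulf_neq0 ?pnatr_eq0 ?neq0Ci //; case: (z) => a b.
  by rewrite -complexiE; apply: CC_eq => /=; ring.
have nz e w : e ^+ 2 = 1 -> w != 0 -> (hodge_re C).[w] ^+ 2 + (hodge_im e).[w] ^+ 2 != 0.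
  by move=> e2 w0; rewrite -!horner_exp -hornerD hodge_norm // hornerX.
have pz e w : e ^+ 2 = 1 -> w != 0 ->
    pts iC G (regapp tau s (S_mx (hodge_re C).[w] (hodge_im e).[w])).
  move=> e2 w0; apply: MT_sub; rewrite -(pts_eq _ (rat_morph_eq (tau \o iR) iC)).
  by apply: sM; exact: nz.
have [_ rM] := repNu iC.
rewrite smul ?nz // rM; try exact: pz.
by apply: mulmx_commute; exact: key.
Qed.

End Centralizer.
End MumfordTate.

(** * Equivariant projections *)

Lemma lin_free_mx (F : fieldType) (i0 : {rmorphism rat -> F}) r (c : 'I_r -> F)
    a b (A : 'I_r -> 'M[rat]_(a, b)) : lin_free i0 c ->
  \sum_j c j *: map_mx i0 (A j) = 0 -> forall j, A j = 0.
Proof.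
move=> cfree A0 j; apply/matrixP => p q; rewrite [RHS]mxE.
apply: (cfree (fun j => A j p q)); have /matrixP/(_ p q) := A0.
by rewrite summxE [RHS]mxE => e; rewrite -[RHS]e; apply: eq_bigr => i _; rewrite !mxE mulrC.
Qed.

Section PolynomialBounds.
Variable R : realType.
Local Notation C := (CC R).

Lemma entry_eval_bounded n (P : entry_poly rat n) (B : R) :
  exists2 c : R, 0 <= c & forall k : 'M[C]_n, N2 k <= B ->
    n2 (entry_eval (ratr : rat -> C) k P) <= c.
Proof.
elim/mpoly_ring_ind: P => [c|v|P Q [c c0 IHP] [c' c'0 IHQ]|P Q [c c0 IHP] [c' c'0 IHQ]].
- exists (n2 (ratr c : C)) => [|k _]; first exact: n2_ge0.
  by rewrite -[mpolyC _ c]/(entry_cst n c) entry_eval_cst.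
- case/mxvec_indexP: v => i j; exists (`|B|) => // k kB.
  rewrite -/(entry_var rat i j) entry_eval_var.
  by apply: le_trans (n2_le_N2 k i j) (le_trans kB _); exact: ler_norm.
- exists (2 * (c + c')) => [|k kB]; first by rewrite mulr_ge0 ?addr_ge0.
  rewrite rmorphD; apply: le_trans (n2D _ _) _.
  by rewrite ler_wpM2l // lerD ?IHP ?IHQ.
- exists (c * c') => [|k kB]; first exact: mulr_ge0.
  by rewrite rmorphM n2M ler_pM ?n2_ge0 ?IHP ?IHQ.
Qed.

Lemma rep_eval_bounded n m (Nu : 'M[entry_poly rat n]_m) (B : R) :
  exists2 c : R, 0 <= c & forall k : 'M[C]_n, N2 k <= B ->
    N2 (rep_eval (ratr : rat -> C) Nu k) <= c.
Proof.
have h (ij : 'I_m * 'I_m) : exists c : R, 0 <= c /\ forall k : 'M[C]_n, N2 k <= B ->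
    n2 (entry_eval (ratr : rat -> C) k (Nu ij.1 ij.2)) <= c.
  by have [c c0 cP] := entry_eval_bounded (Nu ij.1 ij.2) B; exists c.
have [c cP] := boolp.choice h.
exists (\sum_ij c ij) => [|k kB]; first by rewrite sumr_ge0 // => ij _; have [] := cP ij.
by rewrite /N2; apply: ler_sum => ij _; rewrite mxE; have [_ ->] := cP ij.
Qed.

End PolynomialBounds.

Section BoundedLifts.
Variable R : realType.
Local Notation C := (CC R).
Local Notation iC := (ratr : {rmorphism rat -> C}).
Variable U : set_system nat.
Hypothesis U_ultra : UltraFilter U.
Hypothesis U_free : \oo `<=` U.
Variables (n b : nat) (G : set (entry_poly rat n)) (Gad : set (entry_poly rat b)).
Variable pr : regmap rat n b.
Hypothesis grpG : alg_group G.
Hypothesis pr_hom : alg_hom G Gad pr.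
Variable Uc : set 'M[C]_b.
Hypothesis Uc_lift : forall u, Uc u -> exists2 g, pts iC G g & regapp iC pr g = u.
Hypothesis Uc_compact : compact Uc.
Hypothesis Uc_grp : is_subgroup 1%:M (@mulmx C b b b) (@invmx C b) Uc.

(** Bounding the inverse as well keeps limits of lifts invertible. *)
Definition lifts_bounded (B : R) (u : 'M[C]_b) := exists k : 'M[C]_n,
  [/\ pts iC G k, regapp iC pr k = u, N2 k <= B & N2 (invmx k) <= B].

(** The elements with a lift of size at most [B] form a closed set, by passing to the limit in the
    lifts and in their inverses; these sets cover [Uc] and multiply into one another, as the Baire
    argument requires. *)
Lemma bounded_lifts : exists B : R, forall u, Uc u -> lifts_bounded B u.
Proof.
have [G1 GM GV] := grpG iC; have [prG prM] := pr_hom iC.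
have [Uc1 UcM UcV] := Uc_grp.
suff [B BP] : exists B : nat, forall u, Uc u -> lifts_bounded B%:R u.
  by exists B%:R.
apply: (uniformly_bounded_lifts U_ultra U_free Uc_compact _ UcM UcV Uc1).
- by move=> u Uu; have [g Gg <-] := Uc_lift Uu; exact: (prG g Gg).1.
- move=> u Uu; have [g Gg gu] := Uc_lift Uu.
  exists (maxn (Num.bound (N2 g)) (Num.bound (N2 (invmx g)))), g.
  have le1 := ltW (archi_boundP (N2_ge0 g)); have le2 := ltW (archi_boundP (N2_ge0 (invmx g))).
  split=> //; first by apply: le_trans le1 _; rewrite ler_nat leq_maxl.
  by apply: le_trans le2 _; rewrite ler_nat leq_maxr.
- move=> B B' u BB' [k [Gk ku k1 k2]]; exists k; split=> //.
    by apply: le_trans k1 _; rewrite ler_nat.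
  by apply: le_trans k2 _; rewrite ler_nat.
- move=> B u v uF uv; have [k kP] := boolp.choice uF.
  have [k1 lim1] : exists y, mxlim U k y.
    by apply: (mxlim_exists U_ultra) => j; have [_ _ h _] := kP j; exact: h.
  have [k2 lim2] : exists y, mxlim U (fun j => invmx (k j)) y.
    by apply: (mxlim_exists U_ultra) => j; have [_ _ _ h] := kP j; exact: h.
  have e12 : k1 *m k2 = 1%:M.
    apply: (mxlim_unique U_ultra (mxlimM U_ultra lim1 lim2)).
    have -> : (fun j => k j *m invmx (k j)) = fun=> 1%:M.
      by apply/funext => j; rewrite mulmxV //; have [[]] := kP j.
    exact: mxlim_cst.
  have [u1 _] := mulmx1_unit e12.
  have k2E : k2 = invmx k1 by rewrite (invmx_eq e12).
  exists k1; split.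
  - split=> // P GP; apply: (ulim_unique U_ultra (entry_eval_lim U_ultra iC P lim1)).
    have -> : (fun j => entry_eval iC (k j) P) = fun=> 0.
      by apply/funext => j; have [[_ h] _ _ _] := kP j; exact: h.
    exact: ulim_cst.
  - apply: (mxlim_unique U_ultra _ uv) => i j.
    have -> : (fun l => u l i j) = fun l => (entry_eval iC (invmx (k l)) (det_poly rat n)) ^+ denom pr *
        entry_eval iC (k l) (numer pr i j).
      apply/funext => l; have [_ <- _ _] := kP l.
      by rewrite /regapp !mxE entry_eval_det det_inv exprVn.
    rewrite /regapp !mxE.
    have -> : (\det k1) ^- denom pr = (entry_eval iC k2 (det_poly rat n)) ^+ denom pr.
      by rewrite entry_eval_det k2E det_inv exprVn.
    apply: (ulimM U_ultra); last exact: (entry_eval_lim U_ultra).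
    by apply: (ulimX U_ultra); exact: (entry_eval_lim U_ultra).
  - by apply: (mxlim_N2_le U_ultra U_free (N := 0) lim1) => j _; have [] := kP j.
  - rewrite -k2E.
    by apply: (mxlim_N2_le U_ultra U_free (N := 0) lim2) => j _; have [] := kP j.
- move=> B B'; exists (2 ^ n * (B * B'))%N => u v [k [Gk ku k1 k2]] [l [Gl lv l1 l2]].
  exists (k *m l); split; first exact: GM.
  - by rewrite prM // ku lv.
  - apply: le_trans (N2M _ _) _; rewrite natrM natrX natrM ler_wpM2l ?exprn_ge0 //.
    by rewrite ler_pM ?N2_ge0.
  - rewrite invmx_mul; [|exact: Gk.1|exact: Gl.1].
    apply: le_trans (N2M _ _) _; rewrite natrM natrX natrM ler_wpM2l ?exprn_ge0 //.
    by rewrite mulrC ler_pM ?N2_ge0.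
Qed.
End BoundedLifts.

Lemma triple_product_le (R : realDomainType) (t a b a' c p q : R) :
  0 <= t -> 0 <= a -> 0 <= b -> 0 <= a' -> a <= c -> a' <= c -> 0 <= p ->
  p <= t * (a * b) -> q <= t * (p * a') -> q <= t * (t * c * c) * b.
Proof.
move=> t0 a0 b0 a'0 ac a'c p0 pe qe; apply: le_trans qe _.
rewrite -mulrA ler_wpM2l //; apply: le_trans (_ : t * (c * b) * c <= _); last first.
  by rewrite le_eqVlt; apply/orP; left; apply/eqP; ring.
apply: ler_pM => //; apply: le_trans pe _.
by rewrite ler_wpM2l // ler_wpM2r.
Qed.

Lemma N2_conj_le (R : realType) m (A B A' : 'M[CC R]_m) c : N2 A <= c -> N2 A' <= c ->
  N2 (A *m B *m A') <= 2 ^+ m * (2 ^+ m * c * c) * N2 B.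
Proof.
move=> Ac A'c; have t0 : 0 <= 2 ^+ m :> R by exact: exprn_ge0.
exact: (triple_product_le t0 (N2_ge0 A) (N2_ge0 B) (N2_ge0 A') Ac A'c (N2_ge0 _)
  (N2M _ _) (N2M _ _)).
Qed.

Lemma projection_conj (F : fieldType) m (e x g g' : 'M[F]_m) :
  g *m g' = 1%:M -> g *m e = e *m g *m e -> g' *m e = e *m g' *m e ->
  e *m x = x -> x *m e = e ->
  e *m (g *m x *m g') = g *m x *m g' /\ (g *m x *m g') *m e = e.
Proof.
move=> gg' ge g'e ex xe; split.
  have gx : g *m x = e *m (g *m x) by rewrite -{1}ex mulmxA ge -2!mulmxA ex.
  by rewrite mulmxA -gx.
rewrite -mulmxA g'e -!mulmxA (mulmxA x) xe (mulmxA e) -g'e mulmxA gg' mul1mx.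
by [].
Qed.

Lemma commute_conj (F : fieldType) m (z x g g' : 'M[F]_m) :
  z *m g = g *m z -> z *m g' = g' *m z -> z *m x = x *m z ->
  z *m (g *m x *m g') = (g *m x *m g') *m z.
Proof.
by move=> zg zg' zx; rewrite !mulmxA zg -(mulmxA g) zx mulmxA -(mulmxA _ z) zg' !mulmxA.
Qed.

Lemma lin_conj (F : fieldType) m (e x y : 'M[F]_m) c : 2 * c = 1 ->
  e *m x = x -> x *m e = e -> e *m y = y -> y *m e = e ->
  e *m (c *: (x + y)) = c *: (x + y) /\ (c *: (x + y)) *m e = e.
Proof.
move=> c2 ex xe ey ye; rewrite -scalemxAr mulmxDr ex ey; split=> //.
by rewrite -scalemxAl mulmxDl xe ye -mulr2n -scaler_nat scalerA mulrC c2 scale1r.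
Qed.

Lemma lin_commute (F : fieldType) m (z x y : 'M[F]_m) c :
  z *m x = x *m z -> z *m y = y *m z -> z *m (c *: (x + y)) = (c *: (x + y)) *m z.
Proof. by move=> zx zy; rewrite -scalemxAr -scalemxAl mulmxDr mulmxDl zx zy. Qed.

(** * Averaging modulo the centre *)

Section AlgebraicHomomorphisms.
Variables (F : fieldType) (f : {rmorphism rat -> F}) (n b : nat).
Variables (G : set (entry_poly rat n)) (Gad : set (entry_poly rat b)).
Variable pr : regmap rat n b.
Hypothesis grpG : alg_group G.
Hypothesis pr_hom : alg_hom G Gad pr.

Lemma alg_hom1 : regapp f pr 1%:M = 1%:M.
Proof.
have [G1 _ _] := grpG f; have [prG prM] := pr_hom f.
have G11 := prM _ _ G1 G1; rewrite mulmx1 in G11.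
have [u1 _] := prG _ G1.
by rewrite -[RHS](mulVmx u1) {3}G11 mulKmx.
Qed.

Lemma alg_homV g : pts f G g -> regapp f pr (invmx g) = invmx (regapp f pr g).
Proof.
move=> Gg; have [_ _ GV] := grpG f; have [_ prM] := pr_hom f.
symmetry; apply: invmx_eq.
by rewrite -prM ?mulmxV ?Gg.1 ?alg_hom1 //; exact: GV.
Qed.

Variables (m : nat) (Nu : 'M[entry_poly rat n]_m).
Local Notation nu := (rep_eval f Nu).
Hypothesis rep1 : nu 1%:M = 1%:M.
Hypothesis repM : forall g h, pts f G g -> pts f G h -> nu (g *m h) = nu g *m nu h.

Lemma repV g : pts f G g -> nu g *m nu (invmx g) = 1%:M.
Proof.
move=> Gg; have [_ _ GV] := grpG f.
by rewrite -repM ?mulmxV ?Gg.1 //; exact: GV.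
Qed.

Lemma repV_inv g : pts f G g -> invmx (nu g) = nu (invmx g).
Proof. by move/repV/invmx_eq. Qed.

Lemma rep_center z g : center_pts f G z -> pts f G g -> nu z *m nu g = nu g *m nu z.
Proof. by move=> [Gz zc] Gg; rewrite -!repM // zc. Qed.

Hypothesis pr_ker : forall g, pts f G g -> regapp f pr g = 1%:M -> center_pts f G g.

(** Two lifts of one element of the adjoint group differ by a central element, which drops out when
    [x] commutes with the centre. An arbitrary [g] may thus be replaced by a bounded lift. *)
Lemma rep_conj_lift g k x : pts f G g -> pts f G k ->
  regapp f pr k = regapp f pr g ->
  (forall z, center_pts f G z -> nu z *m x = x *m nu z) ->
  nu g *m x *m invmx (nu g) = nu k *m x *m nu (invmx k).
Proof.
move=> Gg Gk kg xz; have [_ GM GV] := grpG f; have [_ prM] := pr_hom f.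
have GVk := GV _ Gk.
pose z := invmx k *m g; have Gz : pts f G z by exact: GM.
have zc : center_pts f G z.
  by apply: pr_ker => //; rewrite prM // -kg -prM // mulVmx ?Gk.1 // alg_hom1.
have gkz : g = k *m z by rewrite mulKVmx ?Gk.1.
have nz : nu z *m x *m nu (invmx z) = x by rewrite xz // -mulmxA repV // mulmx1.
rewrite repV_inv // gkz invmx_mul ?Gk.1 ?Gz.1 //.
rewrite (repM Gk Gz) (repM (GV _ Gz) GVk) -[in RHS]nz.
by rewrite !mulmxA.
Qed.

Variables (H : set 'M[F]_n) (Uc : set 'M[F]_b).
Hypothesis H_sub : H `<=` pts f G.
Hypothesis H_grp : is_subgroup 1%:M (@mulmx F n n n) (@invmx F n) H.
Hypothesis Uc_grp : is_subgroup 1%:M (@mulmx F b b b) (@invmx F b) Uc.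

Definition rep_image : set 'M[F]_m :=
  [set nu g | g in [set g | H g /\ Uc (regapp f pr g)]].

Lemma rep_image_group : is_subgroup 1%:M (@mulmx F m m m) (@invmx F m) rep_image.
Proof.
have [H1 HM HV] := H_grp; have [Uc1 UcM UcV] := Uc_grp; have [_ prM] := pr_hom f.
split=> [|_ _ [g [Hg Ug] <-] [h [Hh Uh] <-]|_ [g [Hg Ug] <-]].
- by exists 1%:M => //=; split=> //; rewrite alg_hom1.
- exists (g *m h).
    by split; [exact: HM|rewrite prM; [exact: UcM|exact: H_sub|exact: H_sub]].
  by rewrite repM //; exact: H_sub.
- exists (invmx g).
    by split; [exact: HV|rewrite alg_homV; [exact: UcV|exact: H_sub]].
  by rewrite repV_inv //; exact: H_sub.
Qed.

Lemma rep_image_unit g : rep_image g -> g \in unitmx.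
Proof. by case=> h [Hh _] <-; have [] := mulmx1_unit (repV (H_sub Hh)). Qed.

Variable e : 'M[F]_m.
Hypothesis He : forall g, H g -> nu g *m e = e *m nu g *m e.

(** The two equations with [e] say that [x] is idempotent with the image of [e]; written in this way
    they are affine in [x], so the set is convex. *)
Definition center_projections : set 'M[F]_m := [set x | [/\ e *m x = x, x *m e = e
  & forall z, center_pts f G z -> nu z *m x = x *m nu z]].

Lemma center_projections_conj g x : rep_image g -> center_projections x ->
  center_projections (g *m x *m invmx g).
Proof.
case=> h [Hh _] <- [ex xe xz]; have Gh := H_sub Hh; rewrite repV_inv //.
have [_ _ HV] := H_grp.
have [h1 h2] := projection_conj (repV Gh) (He Hh) (He (HV _ Hh)) ex xe.
split=> // z zc; apply: commute_conj; last exact: xz.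
  exact: rep_center.
by apply: rep_center => //; apply: H_sub; exact: HV.
Qed.

Lemma center_projections_convex c x y : 2 * c = 1 :> F ->
  center_projections x -> center_projections y -> center_projections (c *: (x + y)).
Proof.
move=> c2 [ex xe xz] [ey ye yz]; have [h1 h2] := lin_conj c2 ex xe ey ye.
by split=> // z zc; apply: lin_commute; [exact: xz|exact: yz].
Qed.

Lemma center_projections_sub x y z : center_projections x -> center_projections y ->
  center_pts f G z -> nu z *m (x - y) = (x - y) *m nu z.
Proof. by move=> [_ _ xz] [_ _ yz] zc; rewrite mulmxBr mulmxBl xz // yz. Qed.

End AlgebraicHomomorphisms.

Section FixedProjection.
Variable R : realType.
Local Notation C := (CC R).
Local Notation iC := (ratr : {rmorphism rat -> C}).
Variable U : set_system nat.
Hypothesis U_ultra : UltraFilter U.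
Hypothesis U_free : \oo `<=` U.
Variables (n b : nat) (G : set (entry_poly rat n)) (Gad : set (entry_poly rat b)).
Variable pr : regmap rat n b.
Hypothesis G_red : reductive R G.
Hypothesis pr_hom : alg_hom G Gad pr.
Hypothesis pr_ker : forall g, pts iC G g -> regapp iC pr g = 1%:M -> center_pts iC G g.
Variable Uc : set 'M[C]_b.
Hypothesis Uc_lift : forall u, Uc u -> exists2 g, pts iC G g & regapp iC pr g = u.
Hypothesis Uc_compact : compact Uc.
Hypothesis Uc_grp : is_subgroup 1%:M (@mulmx C b b b) (@invmx C b) Uc.
Variable H : set 'M[C]_n.
Hypothesis H_sub : H `<=` pts iC G.
Hypothesis H_grp : is_subgroup 1%:M (@mulmx C n n n) (@invmx C n) H.
Variables (m : nat) (Nu : 'M[entry_poly rat n]_m) (e : 'M[C]_m).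
Local Notation nu := (rep_eval iC Nu).
Hypothesis rep1 : nu 1%:M = 1%:M.
Hypothesis repM : forall g h, pts iC G g -> pts iC G h -> nu (g *m h) = nu g *m nu h.
Hypothesis ee : e *m e = e.
Hypothesis He : forall g, H g -> nu g *m e = e *m nu g *m e.
Hypothesis Ze : forall z, center_pts iC G z -> nu z *m e = e *m nu z *m e.

Let grpG : alg_group G. Proof. by case: G_red. Qed.

Local Notation Gam := (rep_image iC pr Nu H Uc).
Local Notation S := (center_projections iC G Nu e).

Let conj_bound : exists B, forall g x, Gam g ->
  (forall z, center_pts iC G z -> nu z *m x = x *m nu z) ->
  N2 (g *m x *m invmx g) <= B * N2 x.
Proof.
have [B BP] := bounded_lifts U_ultra U_free grpG pr_hom Uc_lift Uc_compact Uc_grp.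
have [c c0 cP] := rep_eval_bounded Nu B.
exists (2 ^+ m * (2 ^+ m * c * c)) => _ x [g [Hg Ug] <-] xz.
have [k [Gk kg k1 k2]] := BP _ Ug.
rewrite (rep_conj_lift grpG pr_hom rep1 repM pr_ker (H_sub Hg) Gk kg xz).
by apply: N2_conj_le; exact: cP.
Qed.

(** The convex set is nonempty because the centre acts diagonalisably, and the orbits are bounded
    because conjugation on it only depends on the image in the adjoint group. *)
Lemma fixed_projection : exists x, [/\ e *m x = x, x *m e = e &
  forall g, H g -> Uc (regapp iC pr g) -> nu g *m x = x *m nu g].
Proof.
have [B BP] := conj_bound.
have [Gam1 GamM GamV] := rep_image_group grpG pr_hom rep1 repM H_sub H_grp Uc_grp.
suff [x [ex xe _] xP] : exists2 x, S x & forall g, Gam g -> g *m x = x *m g.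
  by exists x; split=> // g Hg Ug; apply: xP; exists g.
apply: (bounded_group_fixed_point U_ultra U_free (B := B)) => //.
- by move=> g; exact: (rep_image_unit grpG rep1 repM H_sub).
- have [p [ep pe pz]] := center_projection grpG (no_central_unipotent G_red) rep1 repM ee Ze.
  by exists p.
- move=> x y; apply: center_projections_convex.
  by rewrite -[2](rmorph_nat (real_complex R)) -rmorphM mulfV ?rmorph1 // pnatr_eq0.
- by move=> g x; exact: (center_projections_conj grpG rep1 repM H_sub H_grp He).
- move=> x y xS xy.
  have limL (A : 'M[C]_m) : mxlim U (fun k => A *m x k) (A *m y).
    by apply: (mxlimM U_ultra _ xy); exact: mxlim_cst.
  have limR (A : 'M[C]_m) : mxlim U (fun k => x k *m A) (y *m A).
    by apply: (mxlimM U_ultra xy); exact: mxlim_cst.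
  split=> [||z zc].
  - apply: (mxlim_unique U_ultra (limL e)).
    by rewrite (_ : (fun k => e *m x k) = x) //; apply/funext => k; have [] := xS k.
  - apply: (mxlim_unique U_ultra (limR e)).
    rewrite (_ : (fun k => x k *m e) = fun=> e); first exact: mxlim_cst.
    by apply/funext => k; have [] := xS k.
  - apply: (mxlim_unique U_ultra (limL (nu z))).
    rewrite (_ : (fun k => nu z *m x k) = fun k => x k *m nu z); first exact: limR.
    by apply/funext => k; have [_ _ h] := xS k; exact: h.
- by move=> g x Gg [_ _ xz]; exact: BP.
- by move=> g x y Gg Sx Sy; apply: BP => // z zc; exact: (center_projections_sub Sx Sy zc).
Qed.
End FixedProjection.

(** After the rescaling every row has absolute sum at most 1, so entries of powers stay bounded by
    1. *)
Lemma small_powers (C : numFieldType) n (X : 'M[C]_n) k i j :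
  `|(((1 + \sum_a \sum_b `|X a b|)^-1 *: X) ^+ k) i j| <= 1.
Proof.
set S := \sum_a _; have S0 : 0 <= S by apply: sumr_ge0 => a _; apply: sumr_ge0.
have S1 : 0 < 1 + S by rewrite ltr_pwDl.
elim: k i => [|k IH] i; first by rewrite expr0 mxE; case: eqP; rewrite ?normr1 ?normr0.
rewrite exprS mxE; apply: le_trans (ler_norm_sum _ _ _) _.
apply: (@le_trans _ _ (\sum_l (1 + S)^-1 * `|X i l|)).
  apply: ler_sum => l _; rewrite normrM mxE normrM gtr0_norm ?invr_gt0 //.
  by rewrite ler_piMr // mulr_ge0 // invr_ge0 ltW.
rewrite -mulr_sumr mulrC ler_pdivrMr // mul1r; apply: (@le_trans _ _ S).
  rewrite /S [leRHS](bigD1 i) //= lerDl; apply: sumr_ge0 => a _; exact: sumr_ge0.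
by rewrite lerDr.
Qed.

Lemma eval_lderiv_lin (F : fieldType) n (g X : 'M[F]_n) c d (P Q : entry_poly F n) :
  entry_eval idfun g (lderiv X (c *: P + d *: Q)) =
  c * entry_eval idfun g (lderiv X P) + d * entry_eval idfun g (lderiv X Q).
Proof. by rewrite lderiv_linear 2!lderivZ rmorphD /= 2!entry_evalZ. Qed.

Lemma eval_lin (F : fieldType) n (g : 'M[F]_n) c (P Q : entry_poly F n) :
  entry_eval idfun g (c *: P + Q) = c * entry_eval idfun g P + entry_eval idfun g Q.
Proof. by rewrite rmorphD /= entry_evalZ. Qed.

Section CommutatorPolynomial.
Variables (F : fieldType) (i0 : {rmorphism rat -> F}) (n m : nat).
Variables (Nu : 'M[entry_poly rat n]_m) (x : 'M[F]_m).

Definition commutator_poly i j : entry_poly F n :=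
  \sum_l (x i l *: map_mpoly i0 (Nu l j) + (- x l j) *: map_mpoly i0 (Nu i l)).

Lemma commutator_polyE g i j : entry_eval idfun g (commutator_poly i j) =
  (x *m rep_eval i0 Nu g - rep_eval i0 Nu g *m x) i j.
Proof.
rewrite rmorph_sum [RHS]mxE [X in _ = _ + X]mxE [X in _ = X - _]mxE [X in _ = _ - X]mxE -sumrB; apply: eq_bigr => l _.
by rewrite rmorphD /= !entry_evalZ !entry_eval_map !mxE mulNr [in RHS](mulrC _ (x l j)).
Qed.

Lemma commutator_poly_lderiv X i j : entry_eval idfun 1%:M (lderiv X (commutator_poly i j)) =
  (x *m rep_tangent i0 Nu X - rep_tangent i0 Nu X *m x) i j.
Proof.
rewrite lderiv_sum rmorph_sum [RHS]mxE [X in _ = _ + X]mxE [X in _ = X - _]mxE [X in _ = _ - X]mxE -sumrB; apply: eq_bigr => l _.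
rewrite /= eval_lderiv_lin [rep_tangent _ _ _ l j]mxE [rep_tangent _ _ _ i l]mxE mulNr.
by rewrite [in RHS](mulrC _ (x l j)).
Qed.

Lemma rep_tangentE X i j : rep_tangent i0 Nu X i j =
  entry_eval idfun 1%:M (lderiv X (map_mpoly i0 (Nu i j))).
Proof. by rewrite mxE. Qed.

Lemma rep_tangentZ c X : rep_tangent i0 Nu (c *: X) = c *: rep_tangent i0 Nu X.
Proof.
have := rep_tangentD i0 Nu (index_enum 'I_1) (fun=> c) (fun=> X).
by rewrite !big_ord1.
Qed.

Lemma rep_tangent_add c X Y :
  rep_tangent i0 Nu (X + c *: Y) = rep_tangent i0 Nu X + c *: rep_tangent i0 Nu Y.
Proof.
apply/matrixP => i j; set Z := X + _.
have ZE p q : Z p q = c * Y p q + X p q by rewrite [LHS]mxE [X in _ + X = _]mxE addrC.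
have e : rep_tangent i0 Nu Z i j = c * rep_tangent i0 Nu Y i j + rep_tangent i0 Nu X i j.
  exact: etrans (rep_tangentE Z i j) (etrans (congr1 _ (lderivDl _ ZE))
    (etrans (eval_lin _ _ _ _) (congr2 (fun u v => c * u + v)
      (esym (rep_tangentE Y i j)) (esym (rep_tangentE X i j))))).
by rewrite e addrC [RHS]mxE [X in _ = _ + X]mxE.
Qed.
End CommutatorPolynomial.

Section Twist.
Variables (C : fieldType) (kappa : {rmorphism C -> C}) (n : nat) (a : 'M[C]_n).
Hypothesis ua : a \in unitmx.
Let theta (X : 'M[C]_n) := a *m map_mx kappa X *m invmx a.

Lemma twist_lin c X Y : theta (c *: (X + Y)) = kappa c *: (theta X + theta Y).
Proof. by rewrite /theta map_mxZ map_mxD -scalemxAr -scalemxAl mulmxDr mulmxDl. Qed.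

(** Real and imaginary parts for an antilinear involution. Their explicit forms are returned so that
    membership in a Lie algebra can be read off. *)
Lemma twist_decomposition (i : C) X : 2 != 0 :> C -> i != 0 -> kappa i = - i ->
  theta (theta X) = X ->
  exists X1 X2, [/\ theta X1 = X1, theta X2 = X2, X = X1 + i *: X2,
    X1 = 2^-1 *: (X + theta X) & X2 = (2 * i)^-1 *: (X + (-1) *: theta X)].
Proof.
move=> n20 i0 ki tt.
have thN Y : theta ((-1) *: Y) = (-1) *: theta Y.
  by rewrite -[Y in LHS]addr0 twist_lin rmorphN1 /theta map_mx0 mulmx0 mul0mx addr0.
exists (2^-1 *: (X + theta X)), ((2 * i)^-1 *: (X + (-1) *: theta X)); split=> //.
- by rewrite twist_lin tt fmorphV rmorph_nat addrC.
- rewrite twist_lin thN tt fmorphV rmorphM rmorph_nat ki mulrN invrN.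
  by rewrite scaleNr -scalerN opprD !scaleN1r opprK addrC.
- have ic : i * (2 * i)^-1 = 2^-1 by rewrite invfM mulrCA mulfV // mulr1.
  rewrite scalerA ic scaleN1r -scalerDr addrACA subrr addr0.
  by rewrite -mulr2n -scaler_nat scalerA mulVf ?scale1r.
Qed.

Lemma twist_group (P : set 'M[C]_n) : is_subgroup 1%:M (@mulmx C n n n) (@invmx C n) P ->
  (forall g, P g -> g \in unitmx) ->
  is_subgroup 1%:M (@mulmx C n n n) (@invmx C n)
    [set g | P g /\ a *m map_mx kappa g *m invmx a = g].
Proof.
move=> [P1 PM PV] Pu; split=> [|g h [Pg tg] [Ph th]|g [Pg tg]].
- by split=> //; rewrite map_mx1 mulmx1 mulmxV.
- split; first exact: PM.
  by rewrite -[in RHS]tg -[in RHS]th map_mxM !mulmxA mulmxKV.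
- split; first exact: PV.
  symmetry; apply: invmx_eq; apply: mulmx1C; rewrite -[X in _ *m X]tg.
  rewrite !mulmxA mulmxKV // -(mulmxA a) -map_mxM mulVmx ?Pu //.
  by rewrite map_mx1 mulmx1 mulmxV.
Qed.

End Twist.

Lemma regapp_eq (k K : fieldType) (f h : k -> K) a b (phi : regmap k a b) g :
  f =1 h -> regapp f phi g = regapp h phi g.
Proof. by move=> /funext ->. Qed.

(** This sends the points of [G] fixed by the twist into the compact form of the adjoint group. *)
Lemma twist_hom (F : fieldType) (f : {rmorphism rat -> F}) (kappa : {rmorphism F -> F})
    n b (G : set (entry_poly rat n)) (Gad : set (entry_poly rat b)) (pr : regmap rat n b) a g :
  alg_group G -> alg_hom G Gad pr -> pts f G a -> pts f G g ->
  a *m map_mx kappa g *m invmx a = g ->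
  regapp f pr a *m map_mx kappa (regapp f pr g) *m invmx (regapp f pr a) = regapp f pr g.
Proof.
move=> grpG prh Ga Gg tg; have [_ GM GV] := grpG F f; have [_ prM] := prh F f.
have Gk : pts f G (map_mx kappa g).
  by rewrite -(pts_eq _ (rat_morph_eq (kappa \o f : {rmorphism rat -> F}) f)); exact: pts_map.
have -> : map_mx kappa (regapp f pr g) = regapp f pr (map_mx kappa g).
  by rewrite -(regapp_map f kappa); exact/regapp_eq/rat_morph_eq.
rewrite -(alg_homV grpG prh Ga) -prM // -prM ?tg //; [exact: GM|exact: GV].
Qed.

Lemma scale_commute (F : fieldType) m (A B : 'M[F]_m) c :
  A *m B = B *m A -> A *m (c *: B) = (c *: B) *m A.
Proof. by move=> AB; rewrite -scalemxAr -scalemxAl AB. Qed.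

Section RealTangent.
Variable R : realType.
Local Notation C := (CC R).
Local Notation iC := (ratr : {rmorphism rat -> C}).
Variable U : set_system nat.
Hypothesis U_ultra : UltraFilter U.
Hypothesis U_free : \oo `<=` U.
Variables (n m : nat) (M : set (entry_poly rat n)) (Nu : 'M[entry_poly rat n]_m).
Hypothesis grpM : alg_group M.
Variables (a : 'M[C]_n) (x : 'M[C]_m).
Hypothesis ua : a \in unitmx.
Hypothesis x_fix : forall g, pts iC M g -> a *m map_mx Num.conj g *m invmx a = g ->
  rep_eval iC Nu g *m x = x *m rep_eval iC Nu g.

(** The exponential curve of a rescaled [X] stays in [M] and among the fixed points of the twist,
    where [x] commutes with the representation; the commutator is then differentiated at time 0. *)
Lemma real_tangent_commute X : lie_alg M iC X ->
  a *m map_mx Num.conj X *m invmx a = X ->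
  x *m rep_tangent iC Nu X = rep_tangent iC Nu X *m x.
Proof.
move=> LX tX; set S := 1 + \sum_p \sum_q `|X p q|.
have S0 : 0 < S by rewrite ltr_pwDl // sumr_ge0 // => p _; rewrite sumr_ge0.
have [c c0 cE] : exists2 c : R, 0 <= c & S^-1 = toC c.
  by apply: real_bound; rewrite invr_ge0 ltW.
pose Y := S^-1 *: X; have Ysmall k i j : `|(Y ^+ k) i j| <= 1 by exact: small_powers.
have XY : X = S *: Y by rewrite scalerA mulfV ?scale1r // gt_eqF.
have LY : lie_alg M iC Y.
  have -> : Y = (S^-1 - 1) *: X + X by rewrite scalerBl scale1r subrK.
  exact: lie_algD.
have tY : a *m map_mx Num.conj Y *m invmx a = Y.
  by rewrite map_mxZ /= cE conj_toC -scalemxAr -scalemxAl tX /Y cE.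
suff comY : x *m rep_tangent iC Nu Y = rep_tangent iC Nu Y *m x.
  have -> : rep_tangent iC Nu X = S *: rep_tangent iC Nu Y by rewrite -rep_tangentZ -XY.
  exact: scale_commute.
have [t0 t00 expU] := exp_unit U_ultra U_free Ysmall.
(* [t0] keeps the exponential invertible, and [2^-1] makes the Taylor remainders tend to 0. *)
pose t1 := Num.min t0 2^-1.
have t10 : 0 < t1 by rewrite lt_min t00 invr_gt0 ltr0n.
apply/eqP; rewrite -subr_eq0; apply/eqP/matrixP => i j.
rewrite -commutator_poly_lderiv [RHS]mxE.
refine (@exp_tangent R U U_ultra U_free n Y Ysmall (commutator_poly iC Nu x i j) t1 t10 _ _) => [t tt1|].
  have tt0 : `|t| <= t0 by apply: le_trans tt1 _; rewrite ge_min lexx.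
  have tt2 : `|t| <= 2^-1 by apply: le_trans tt1 _; rewrite ge_min lexx orbT.
  have tt3 : `|t| <= 1 by apply: le_trans tt2 _; rewrite invf_le1 ?ltr0n // ler1n.
  have tg := @exp_twisted R U U_ultra n Y Ysmall a t ua tY tt3.
  move: (exp_mx _ _ _) (expU t tt0) (fun P J JD J1 JP =>
    @exp_vanish R U U_ultra U_free n Y Ysmall J JD J1 P t JP tt2) tg.
  move=> g ug vanish tg; rewrite commutator_polyE x_fix ?subrr ?mxE //.
  split=> // P MP; rewrite -[LHS](entry_eval_map iC (idfun : {rmorphism C -> C})).
  apply: (vanish _ (vanishing_ideal (base_change iC M))).
  - by move=> Q; exact: lie_alg_ideal.
  - move=> Q /vanishing_ideal_baseP; apply.
    by rewrite (pts_eq _ (rat_morph_eq _ iC)); have [] := grpM iC.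
  - by apply: vanishing_ideal_map => K f h [_ Mh]; exact: Mh.
rewrite commutator_polyE x_fix ?subrr ?mxE //; first by have [] := grpM iC.
by rewrite map_mx1 mulmx1 mulmxV.
Qed.
End RealTangent.

Lemma lie_alg_comb (F : fieldType) (i0 : {rmorphism rat -> F}) n
    (M : set (entry_poly rat n)) c d X Y :
  lie_alg M i0 X -> lie_alg M i0 Y -> lie_alg M i0 (c *: (X + d *: Y)).
Proof.
move=> LX LY; have LZ : lie_alg M i0 (d *: Y + X) := lie_algD d LY LX.
have := lie_algD (c - 1) LZ LZ.
by rewrite scalerBl scale1r subrK [d *: Y + X]addrC.
Qed.

Lemma lie_alg_half (F : fieldType) (i0 : {rmorphism rat -> F}) n
    (M : set (entry_poly rat n)) c X Y :
  lie_alg M i0 X -> lie_alg M i0 Y -> lie_alg M i0 (c *: (X + Y)).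
Proof. by move=> LX LY; have := lie_alg_comb c 1 LX LY; rewrite scale1r. Qed.

Lemma commute_add (F : fieldType) m (A B D : 'M[F]_m) c :
  A *m B = B *m A -> A *m D = D *m A -> A *m (B + c *: D) = (B + c *: D) *m A.
Proof. by move=> AB AD; rewrite mulmxDr mulmxDl scale_commute // AB. Qed.

Section RationalComponent.
Variables (F : fieldType) (i0 : {rmorphism rat -> F}) (m r : nat).
Variables (c : 'I_r.+1 -> F) (xj : 'I_r.+1 -> 'M[rat]_m) (x : 'M[F]_m).
Hypothesis cfree : lin_free i0 c.
Hypothesis xE : x = \sum_j c j *: map_mx i0 (xj j).

Lemma component_commute (B : 'M[rat]_m) : x *m map_mx i0 B = map_mx i0 B *m x ->
  forall j, xj j *m B = B *m xj j.
Proof.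
move=> xB j; apply/eqP; rewrite -subr_eq0; apply/eqP.
apply: (lin_free_mx (A := fun j => xj j *m B - B *m xj j) cfree).
transitivity (x *m map_mx i0 B - map_mx i0 B *m x); last by rewrite xB subrr.
rewrite xE mulmx_suml mulmx_sumr -sumrB; apply: eq_bigr => l _.
by rewrite map_mxB !map_mxM scalerBr scalemxAl scalemxAr.
Qed.

Lemma component_fix (e : 'M[rat]_m) : map_mx i0 e *m x = x ->
  forall j, e *m xj j = xj j.
Proof.
move=> ex j; apply/eqP; rewrite -subr_eq0; apply/eqP.
apply: (lin_free_mx (A := fun j => e *m xj j - xj j) cfree).
transitivity (map_mx i0 e *m x - x); last by rewrite ex subrr.
rewrite xE mulmx_sumr -sumrB; apply: eq_bigr => l _.
by rewrite map_mxB map_mxM scalerBr scalemxAr.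
Qed.

(** As [c ord0 = 1], the right-hand side lies entirely in the component of index 0, and comparing
    coefficients makes that component a rational retraction. *)
Lemma component_retract (e : 'M[rat]_m) : c ord0 = 1 ->
  x *m map_mx i0 e = map_mx i0 e -> xj ord0 *m e = e.
Proof.
move=> c0 xe; apply/eqP; rewrite -subr_eq0; apply/eqP.
pose A j := xj j *m e - (j == ord0)%:R *: e.
suff : A ord0 = 0 by rewrite /A eqxx scale1r.
apply: (lin_free_mx cfree).
transitivity (x *m map_mx i0 e - map_mx i0 e); last by rewrite xe subrr.
have sumeE : map_mx i0 e = \sum_j (c j * (j == ord0)%:R) *: map_mx i0 e.
  rewrite (bigD1 ord0) //= big1 ?addr0 ?eqxx ?mulr1 ?c0 ?scale1r //.
  by move=> l /negPf ->; rewrite mulr0 scale0r.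
transitivity (\sum_j c j *: map_mx i0 (xj j *m e) -
    \sum_j (c j * (j == ord0)%:R) *: map_mx i0 e).
  rewrite -sumrB; apply: eq_bigr => l _.
  by rewrite -scalerA -scalerBr map_mxB map_mxZ rmorph_nat.
rewrite -sumeE; congr (_ - _); rewrite xE mulmx_suml; apply: eq_bigr => l _.
by rewrite map_mxM scalemxAl.
Qed.
End RationalComponent.

Section EquivariantProjection.
Variables (R : realType) (n : nat) (G : set (entry_poly rat n)) (X : set (regmap R 2 n)).
Variable s : regmap R 2 n.
Local Notation C := (CC R).
Local Notation iC := (ratr : {rmorphism rat -> C}).
Hypothesis datum : shimura_datum G X.
Hypothesis Xs : X s.
Local Notation M := (MT G s).

Lemma datum_group : alg_group G.
Proof. by have [] := sd_reductive datum. Qed.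

Lemma datum_hom : S_hom G s.
Proof. by have [s0 _ /(_ s)[/(_ Xs)[]]] := sd_class datum. Qed.

Let tau : {rmorphism R -> C} := real_complex R.
Let iR : {rmorphism rat -> R} := ratr.
Let aR := S_real s 'i.
Let a : 'M[C]_n := map_mx tau aR.

Let Re_i : S_mx (complex.Re ('i : C)) (complex.Im ('i : C)) = S_mx 0 1.
Proof. by rewrite -complexiE. Qed.

Let aR_pts : pts iR M aR.
Proof.
have [sp _] := MT_hom datum_hom (idfun : {rmorphism R -> R}).
have Di : pts idfun (@deligne_torus R) (S_mx (complex.Re ('i : C)) (complex.Im ('i : C))).
  rewrite Re_i; apply: (torus_pts idfun).
  by rewrite expr0n add0r expr1n oner_neq0.
by have := sp _ Di; rewrite (pts_base_change iR (idfun : {rmorphism R -> R})).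
Qed.

Let a_pts : pts iC M a.
Proof.
have := pts_map tau aR_pts.
by rewrite (pts_eq _ (rat_morph_eq (tau \o iR) iC)).
Qed.

Let conj_a : map_mx Num.conj a = a.
Proof. by rewrite -map_mx_comp; apply/matrixP => i j; rewrite !mxE /= conj_toC. Qed.

Let aa : a *m a = map_mx tau (S_real s (-1)).
Proof.
have [_ sm] := datum_hom (idfun : {rmorphism R -> R}).
have Di : pts idfun (@deligne_torus R) (S_mx 0 1).
  by apply: (torus_pts idfun); rewrite expr0n add0r expr1n oner_neq0.
rewrite -map_mxM; congr map_mx; rewrite /aR /S_real Re_i -sm //.
rewrite S_mxM; congr (regapp _ _ (S_mx _ _)) => /=; ring.
Qed.

(** The square of the antilinear twist is conjugation by the value of [s] at -1, which is trivial on
    the Lie algebra because every Hodge type occurring there has [p + q = 0]. *)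
Let twist2 Y : lie_alg M iC Y ->
  a *m map_mx Num.conj (a *m map_mx Num.conj Y *m invmx a) *m invmx a = Y.
Proof.
move=> LY; have GY := lie_alg_Lie (MT_group G s) (MT_sub datum_group datum_hom) LY.
have ua : a \in unitmx := a_pts.1.
have cc : map_mx Num.conj (map_mx Num.conj Y) = Y.
  by apply/matrixP => i j; rewrite !mxE conjCK.
have -> : a *m map_mx Num.conj (a *m map_mx Num.conj Y *m invmx a) *m invmx a =
    (a *m a) *m Y *m invmx (a *m a).
  by rewrite !map_mxM map_invmx conj_a cc invmx_mul // !mulmxA.
have [A1 [A2 [A3 [[_ h1] [_ h2] [_ h3] ->]]]] := sd_hodge datum Xs GY.
have N1 : (-1 : C) != 0 by rewrite oppr_eq0 oner_neq0.
have conjN1 : (-1 : C)^* = -1 by rewrite rmorphN1.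
move: (h1 _ N1) (h2 _ N1) (h3 _ N1); rewrite aa conjN1 /=.
have -> : (-1 : C) ^ (- -1) * (-1) ^ (- (1 : int)) = 1.
  by rewrite opprK exprN1 expr1z mulfV.
have -> : (-1 : C) ^ (- 0 : int) * (-1) ^ (- 0 : int) = 1 by rewrite oppr0 expr0z mulr1.
have -> : (-1 : C) ^ (- (1 : int)) * (-1) ^ (- -1) = 1.
  by rewrite opprK exprN1 expr1z mulVf.
rewrite !scale1r => e1 e2 e3.
have lin (F : fieldType) (g g' B1 B2 B3 : 'M[F]_n) : g *m B1 *m g' = B1 ->
    g *m B2 *m g' = B2 -> g *m B3 *m g' = B3 -> g *m (B1 + B2 + B3) *m g' = B1 + B2 + B3.
  by move=> f1 f2 f3; rewrite !mulmxDr !mulmxDl f1 f2 f3.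
exact: lin.
Qed.

(** Stability under the centre of [G] is required besides stability under [M], since the averaging
    takes place modulo that centre. The complex projection commutes with the real tangent vectors of
    the twist, hence with the whole Lie algebra, and so does its rational component of index 0. *)
Lemma rational_projection m (Nu : 'M[entry_poly rat n]_m) (e : 'M[rat]_m) :
  is_rep G Nu -> e *m e = e ->
  (forall g, pts iC M g ->
     rep_eval iC Nu g *m map_mx iC e = map_mx iC e *m rep_eval iC Nu g *m map_mx iC e) ->
  (forall z, center_pts iC G z ->
     rep_eval iC Nu z *m map_mx iC e = map_mx iC e *m rep_eval iC Nu z *m map_mx iC e) ->
  exists p : 'M[rat]_m, [/\ e *m p = p, p *m e = e
    & forall (K : fieldType) (f : {rmorphism rat -> K}) g, pts f M g ->
        map_mx f p *m rep_eval f Nu g = rep_eval f Nu g *m map_mx f p].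
Proof.
move=> repNu ee Me Ze.
have [U [U_ultra U_free]] : exists U : set_system nat, UltraFilter U /\ \oo `<=` U.
  exact: (@ultraFilterLemma nat \oo eventually_filter).
have [b [Gad [pr [[grpAd prh prs prk] cart]]]] := sd_adjoint datum.
have [Uc_compact _] := cart s Xs.
have grpG := datum_group; have sMG := MT_sub datum_group datum_hom.
have grpM := MT_group G s.
pose pa := regapp iC pr a.
have paE : map_mx toC (regapp ratr pr aR) = pa.
  by rewrite -(regapp_map iR tau); exact/regapp_eq/rat_morph_eq.
have Ga : pts iC G a by apply: sMG.
have upa : pa \in unitmx by have [/(_ a Ga)[]] := prh _ iC.
pose Uc := [set u : 'M[C]_b | pts iC Gad u /\ pa *m map_mx Num.conj u *m invmx pa = u].
have Uc_cpt : compact Uc by rewrite /Uc -paE; exact: Uc_compact.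
have Uc_grp : is_subgroup 1%:M (@mulmx C b b b) (@invmx C b) Uc.
  by apply: (twist_group (Num.conj : {rmorphism C -> C}) upa (grpAd _ iC)) => g [].
have ker g : pts iC G g -> regapp iC pr g = 1%:M -> center_pts iC G g.
  by move=> Gg e1; split=> //; apply/(prk g Gg).
have lift u : Uc u -> exists2 g, pts iC G g & regapp iC pr g = u.
  by case=> Gu _; exact: prs.
have [r1 rM] := repNu _ iC.
have ee' : map_mx iC e *m map_mx iC e = map_mx iC e by rewrite -map_mxM ee.
have [x [ex xe xc]] := fixed_projection U_ultra U_free (sd_reductive datum) prh ker
  lift Uc_cpt Uc_grp (sMG _ iC) (grpM _ iC) r1 rM ee' Me Ze.
have x_fix g : pts iC M g -> a *m map_mx Num.conj g *m invmx a = g ->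
    rep_eval iC Nu g *m x = x *m rep_eval iC Nu g.
  move=> Mg tg; have Gg : pts iC G g by exact: sMG.
  refine (xc g Mg _); split; first exact: ((prh _ iC).1 g Gg).
  exact: (twist_hom (kappa := (Num.conj : {rmorphism C -> C})) grpG prh Ga Gg tg).
have x_real := real_tangent_commute U_ultra U_free grpM a_pts.1 x_fix.
have x_lie Y : lie_alg M iC Y -> x *m rep_tangent iC Nu Y = rep_tangent iC Nu Y *m x.
  move=> LY; have ua : a \in unitmx := a_pts.1.
  pose kappa : {rmorphism C -> C} := Num.conj.
  have LcY : lie_alg M iC (map_mx kappa Y) by exact: (@lie_alg_map _ _ _ iC _ kappa iC Y LY).
  have LtY := lie_alg_conj grpM a_pts LcY.
  have [] := twist_decomposition (kappa := kappa) (a := a) (i := 'i) (X := Y) _ _ _ (twist2 LY).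
  - by rewrite pnatr_eq0.
  - exact: neq0Ci.
  - exact: conjCi.
  move=> Y1 [Y2 [t1 t2 YE Y1E Y2E]].
  have LY1 : lie_alg M iC Y1 by rewrite Y1E; exact: (lie_alg_half _ LY LtY).
  have LY2 : lie_alg M iC Y2 by rewrite Y2E; exact: (lie_alg_comb _ _ LY LtY).
  have c1 := x_real _ LY1 t1.
  have c2 := x_real _ LY2 t2.
  rewrite YE rep_tangent_add.
  exact: commute_add c1 c2.
have [r [c [xj [cfree c0 xE]]]] := free_span_mx iC x.
exists (xj ord0); split.
- exact: (component_fix cfree xE).
- exact: (component_retract cfree xE).
- apply: (tangent_commute_MT datum_group datum_hom repNu) => Y LY.
  apply: (component_commute cfree xE).
  rewrite -rep_tangent_map; apply: x_lie; exact: lie_ratP.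
Qed.
End EquivariantProjection.

(** * The enveloping algebra of a representation *)

Section Envelope.
Variables (n m : nat) (M : set (entry_poly rat n)) (Nu : 'M[entry_poly rat n]_m).
Hypothesis grpM : alg_group M.
Hypothesis repM : is_rep M Nu.

Definition form_poly (k : fieldType) (i0 : rat -> k) (l : 'M[k]_m) : entry_poly k n :=
  \sum_ij l ij.1 ij.2 *: map_mpoly i0 (Nu ij.1 ij.2).

Definition form_val (k : fieldType) (l x : 'M[k]_m) : k := \sum_ij l ij.1 ij.2 * x ij.1 ij.2.

(** The rational span of the image of [M], encoded as a double orthogonal: [M] is known through its
    points over all extensions, and the rational ones alone need not span. *)
Definition envelope : set 'M[rat]_m :=
  [set a | forall l, vanishing_ideal M (form_poly idfun l) -> form_val l a = 0].

Lemma form_polyE (k K : fieldType) (i0 : {rmorphism rat -> k}) (f : {rmorphism k -> K}) l g :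
  entry_eval f g (form_poly i0 l) = form_val (map_mx f l) (rep_eval (f \o i0) Nu g).
Proof.
rewrite rmorph_sum; apply: eq_bigr => ij _ /=.
by rewrite entry_evalZ entry_eval_map !mxE.
Qed.

Lemma map_mpoly_idfun N (P : mpoly N rat) : map_mpoly (idfun : {rmorphism rat -> rat}) P = P.
Proof. by apply/mpolyP => u; rewrite mcoeff_map_mpoly. Qed.

Lemma form_val_sum (k : fieldType) I (s : seq I) (c : I -> k) (l : I -> 'M[k]_m) x :
  form_val (\sum_(i <- s) c i *: l i) x = \sum_(i <- s) c i * form_val (l i) x.
Proof.
rewrite /form_val; under [RHS]eq_bigr do rewrite mulr_sumr.
rewrite exchange_big; apply: eq_bigr => ij _ /=.
by rewrite summxE mulr_suml; apply: eq_bigr => i _; rewrite mxE mulrA.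
Qed.

Lemma form_valC (k : fieldType) (l x : 'M[k]_m) : form_val l x = form_val x l.
Proof. by apply: eq_bigr => ij _; rewrite mulrC. Qed.

Lemma form_val_map (k K : fieldType) (f : {rmorphism k -> K}) (l x : 'M[k]_m) :
  form_val (map_mx f l) (map_mx f x) = f (form_val l x).
Proof. by rewrite rmorph_sum; apply: eq_bigr => ij _; rewrite !mxE rmorphM. Qed.

Section Over.
Variables (F : fieldType) (i0 : {rmorphism rat -> F}).

Lemma form_poly_span r (c : 'I_r -> F) (l : 'I_r -> 'M[rat]_m) :
  form_poly i0 (\sum_j c j *: map_mx i0 (l j)) =
  \sum_j c j *: map_mpoly i0 (form_poly idfun (l j)).
Proof.
rewrite /form_poly; under [RHS]eq_bigr do rewrite rmorph_sum scaler_sumr.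
rewrite exchange_big; apply: eq_bigr => ij _ /=.
rewrite summxE scaler_suml; apply: eq_bigr => j _.
by rewrite map_mpolyZ map_mpoly_idfun !mxE scalerA.
Qed.

Lemma envelope_form (l : 'M[F]_m) a : envelope a ->
  vanishing_ideal (base_change i0 M) (form_poly i0 l) -> form_val l (map_mx i0 a) = 0.
Proof.
move=> Aa; have [r [c [lj [cfree _ ->]]]] := free_span_mx i0 l.
rewrite form_poly_span => /(ideal_descent cfree) Ij.
rewrite form_val_sum big1 // => j _.
by rewrite form_val_map (Aa _ (Ij j)) rmorph0 mulr0.
Qed.

Lemma envelope_span g : pts i0 M g -> exists r (c : 'I_r.+1 -> F) A,
  [/\ lin_free i0 c, forall j, envelope (A j)
    & rep_eval i0 Nu g = \sum_j c j *: map_mx i0 (A j)].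
Proof.
move=> Mg; have [r [c [A [cfree _ gE]]]] := free_span_mx i0 (rep_eval i0 Nu g).
exists r, c, A; split=> // j l Il.
apply: (cfree (fun j => form_val l (A j))).
have : entry_eval i0 g (form_poly idfun l) = 0 by exact: Il.
rewrite (form_polyE idfun) gE form_valC form_val_sum => e; rewrite -[RHS]e.
by apply: eq_bigr => i _; rewrite mulrC -(form_val_map i0) form_valC.
Qed.

(** Each entry of the relation is a linear form in the matrix of [h], so it passes from the points
    of [M] to their span. *)
Lemma envelope_relation r (B D : 'I_r -> 'M[F]_m) :
  (forall (K : fieldType) (f : {rmorphism F -> K}) h, pts (f \o i0) M h ->
     \sum_k map_mx f (B k) *m rep_eval (f \o i0) Nu h *m map_mx f (D k) = 0) ->
  forall a, envelope a -> \sum_k B k *m map_mx i0 a *m D k = 0.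
Proof.
move=> rel a Aa; apply/matrixP => p q; rewrite [RHS]mxE.
pose l : 'M[F]_m := \matrix_(i, j) \sum_k B k p i * D k j q.
have entry (K : fieldType) (f : {rmorphism F -> K}) x :
    form_val (map_mx f l) x = (\sum_k map_mx f (B k) *m x *m map_mx f (D k)) p q.
  rewrite /form_val -(pair_bigA _ (fun i j => map_mx f l i j * x i j)) /= exchange_big /=.
  rewrite summxE; under [RHS]eq_bigr do rewrite mxE.
  rewrite [RHS]exchange_big; apply: eq_bigr => j _ /=.
  under [RHS]eq_bigr do rewrite mxE mulr_suml.
  rewrite [RHS]exchange_big; apply: eq_bigr => i _ /=.
  rewrite !mxE rmorph_sum mulr_suml; apply: eq_bigr => k _.
  by rewrite !mxE rmorphM /=; ring.
have := entry F idfun (map_mx i0 a).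
rewrite map_mx_idfun envelope_form // => [e|].
  by rewrite [RHS]e; congr fun_of_matrix; apply: eq_bigr => k _; rewrite !map_mx_idfun.
apply/vanishing_ideal_baseP => K f h Mh; rewrite form_polyE entry.
by rewrite rel // mxE.
Qed.

Lemma envelope_commute (phi : 'M[F]_m) :
  (forall (K : fieldType) (f : {rmorphism F -> K}) h, pts (f \o i0) M h ->
     map_mx f phi *m rep_eval (f \o i0) Nu h = rep_eval (f \o i0) Nu h *m map_mx f phi) ->
  forall a, envelope a -> phi *m map_mx i0 a = map_mx i0 a *m phi.
Proof.
move=> com a Aa; apply/eqP; rewrite -subr_eq0; apply/eqP.
have := @envelope_relation 2 (fun k => if k == ord0 then phi else - 1%:M)
  (fun k => if k == ord0 then 1%:M else phi) _ a Aa.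
rewrite !big_ord_recl big_ord0 /= mulmx1 mulNmx mul1mx mulNmx addr0; apply.
move=> K f h Mh; rewrite !big_ord_recl big_ord0 /= map_mxN !map_mx1.
by rewrite mulmx1 mulNmx mul1mx mulNmx addr0 com // subrr.
Qed.

Lemma envelope_stable (e : 'M[F]_m) :
  (forall (K : fieldType) (f : {rmorphism F -> K}) h, pts (f \o i0) M h ->
     rep_eval (f \o i0) Nu h *m map_mx f e = map_mx f e *m rep_eval (f \o i0) Nu h *m map_mx f e) ->
  forall a, envelope a -> map_mx i0 a *m e = e *m map_mx i0 a *m e.
Proof.
move=> st a Aa; apply/eqP; rewrite -subr_eq0; apply/eqP.
have := @envelope_relation 2 (fun k => if k == ord0 then 1%:M else - e)
  (fun k => e) _ a Aa.
rewrite !big_ord_recl big_ord0 /= mul1mx 2!mulNmx addr0; apply.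
move=> K f h Mh; rewrite !big_ord_recl big_ord0 /= map_mxN !map_mx1.
by rewrite mul1mx 2!mulNmx addr0 st // subrr.
Qed.

Lemma commute_envelope (phi : 'M[F]_m) :
  (forall a, envelope a -> phi *m map_mx i0 a = map_mx i0 a *m phi) ->
  forall g, pts i0 M g -> phi *m rep_eval i0 Nu g = rep_eval i0 Nu g *m phi.
Proof.
move=> com g /envelope_span[r [c [A [_ AA ->]]]].
rewrite mulmx_sumr mulmx_suml; apply: eq_bigr => j _.
by rewrite -scalemxAr -scalemxAl com.
Qed.
End Over.

Lemma envelope1 : envelope 1%:M.
Proof.
move=> l Il; have [M1 _ _] := grpM (idfun : {rmorphism rat -> rat}).
have := Il _ idfun _ M1; rewrite (form_polyE idfun idfun) map_mx_idfun.
by have [-> _] := repM (idfun : {rmorphism rat -> rat}).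
Qed.

Lemma envelope_lin c x y : envelope x -> envelope y -> envelope (c *: x + y).
Proof.
move=> Ax Ay l Il; have := Ax l Il; have := Ay l Il => ly lx.
transitivity (c * form_val l x + form_val l y); last by rewrite lx ly mulr0 addr0.
rewrite /form_val mulr_sumr -big_split; apply: eq_bigr => ij _ /=.
by rewrite !mxE mulrDr mulrCA.
Qed.

Lemma envelope0 : envelope 0.
Proof. by move=> l _; rewrite /form_val big1 // => ij _; rewrite mxE mulr0. Qed.

Lemma form_val2 (k : fieldType) (l x : 'M[k]_m) :
  form_val l x = \sum_i \sum_j l i j * x i j.
Proof. by rewrite (pair_bigA _ (fun i j => l i j * x i j)). Qed.

Lemma form_val_mull (k : fieldType) (l g x : 'M[k]_m) :
  form_val l (g *m x) = form_val (g^T *m l) x.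
Proof.
rewrite !form_val2.
under eq_bigr do under eq_bigr do rewrite mxE mulr_sumr.
under [RHS]eq_bigr do under eq_bigr do rewrite mxE mulr_suml.
under eq_bigr do rewrite exchange_big.
rewrite exchange_big; apply: eq_bigr => i _ /=.
rewrite exchange_big; apply: eq_bigr => j _ /=.
by apply: eq_bigr => p _; rewrite mxE; ring.
Qed.

Lemma form_val_mulr (k : fieldType) (l g x : 'M[k]_m) :
  form_val l (x *m g) = form_val (l *m g^T) x.
Proof.
rewrite !form_val2; apply: eq_bigr => i _.
under eq_bigr do rewrite mxE mulr_sumr.
under [RHS]eq_bigr do rewrite mxE mulr_suml.
rewrite exchange_big; apply: eq_bigr => j _ /=.
by apply: eq_bigr => p _; rewrite mxE; ring.
Qed.

(** A form vanishing on products of two points of [M] is extended to the span in one factor at a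
    time; the intermediate form has coefficients in an extension field. *)
Lemma envelopeM a b : envelope a -> envelope b -> envelope (a *m b).
Proof.
move=> Aa Ab l Il; rewrite form_val_mulr; apply: Aa => K f g Mg.
rewrite (form_polyE idfun) map_mxM -map_trmx -form_val_mulr form_val_mull.
apply: (envelope_form Ab); apply/vanishing_ideal_baseP => L h u Mu.
rewrite form_polyE map_mxM -map_trmx -form_val_mull.
have Mg' : pts (h \o f) M (map_mx h g) by exact: pts_map.
rewrite -(rep_eval_map f h (h \o f)).
have [_ <- //] := repM (h \o f).
have [_ MM _] := grpM (h \o f).
have := Il _ (h \o f) _ (MM _ _ Mg' Mu); rewrite (form_polyE idfun (h \o f)) => e.
by rewrite -map_mx_comp.
Qed.

End Envelope.

Lemma kernel_idempotent m (S : set 'M[rat]_m) :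
  exists e : 'M[rat]_m, [/\ e *m e = e, forall a, S a -> a *m e = 0
    & forall k (v : 'M[rat]_(m, k)), (forall a, S a -> a *m v = 0) -> e *m v = v].
Proof.
pose W := [set w : 'rV[rat]_m | forall a, S a -> w *m a^T = 0].
have [|c x y Wx Wy|U UP] := closed_vspace (S := W).
- by move=> a _; rewrite mul0mx.
- by move=> a Sa; rewrite mulmxDl -scalemxAl Wx // Wy // scaler0 addr0.
(* Row vectors are used for the linear map [projv], hence the transposes. *)
pose P := lin1_mx (projv U); have PE w : w *m P = projv U w by rewrite mul_rV_lin1.
have fixP (v : 'cV[rat]_m) : (forall a, S a -> a *m v = 0) -> P^T *m v = v.
  move=> v0; apply: trmx_inj; rewrite trmx_mul trmxK PE projv_id //.
  by apply/UP => a Sa; rewrite -trmx_mul v0 // trmx0.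
have killP a : S a -> a *m P^T = 0.
  move=> Sa; apply: trmx_inj; rewrite trmx_mul trmxK trmx0; apply/row_matrixP => i.
  rewrite row_mul row0 rowE PE.
  by have/UP : projv U (delta_mx 0 i) \in U := memv_proj _ _; apply.
have fixM k (v : 'M[rat]_(m, k)) : (forall a, S a -> a *m v = 0) -> P^T *m v = v.
  move=> v0; apply/matrixP => i j.
  have cv : forall a, S a -> a *m col j v = 0.
    by move=> a Sa; rewrite colE mulmxA v0 // mul0mx.
  have /matrixP/(_ i 0) := fixP (col j v) cv.
  by rewrite [in LHS]colE mulmxA -colE [LHS]mxE [RHS]mxE.
by exists P^T; split=> //; exact: fixM.
Qed.

Lemma commutator_poly_eval (F K : fieldType) (i0 : {rmorphism rat -> F})
    (f : {rmorphism F -> K}) n m (Nu : 'M[entry_poly rat n]_m) (x : 'M[F]_m) h i j :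
  entry_eval f h (commutator_poly i0 Nu x i j) =
  (map_mx f x *m rep_eval (f \o i0) Nu h - rep_eval (f \o i0) Nu h *m map_mx f x) i j.
Proof.
rewrite rmorph_sum [RHS]mxE [X in _ = _ + X]mxE [X in _ = X - _]mxE [X in _ = _ - X]mxE.
rewrite -sumrB; apply: eq_bigr => l _.
rewrite rmorphD /= 2!entry_evalZ 2!entry_eval_map.
rewrite [map_mx f x i l]mxE [map_mx f x l j]mxE.
rewrite [rep_eval _ _ _ l j]mxE [rep_eval _ _ _ i l]mxE rmorphN mulNr.
by rewrite [in RHS](mulrC _ (f (x l j))).
Qed.

(** * Rational semisimplicity for the Mumford-Tate group *)

Section Semisimplicity.
Variables (R : realType) (n : nat) (G : set (entry_poly rat n)) (X : set (regmap R 2 n)).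
Variable s : regmap R 2 n.
Local Notation C := (CC R).
Local Notation iC := (ratr : {rmorphism rat -> C}).
Hypothesis datum : shimura_datum G X.
Hypothesis Xs : X s.
Local Notation M := (MT G s).
Variables (m : nat) (Nu : 'M[entry_poly rat n]_m).
Hypothesis repNu : is_rep G Nu.
Local Notation A := (envelope M Nu).

Let grpM : alg_group M := MT_group G s.
Let sMG : alg_subset M G := MT_sub (datum_group datum) (datum_hom datum Xs).

Lemma rep_MT : is_rep M Nu.
Proof.
move=> K f; have [r1 rM] := repNu f; split=> // g h Mg Mh.
by apply: rM; exact: sMG.
Qed.

(** Commutation with [z] is known at complex points of [M]; these suffice to put the commutator in
    the ideal, and hence to reach the whole envelope. *)
Lemma center_envelope z : center_pts iC G z ->
  forall a, A a -> rep_eval iC Nu z *m map_mx iC a = map_mx iC a *m rep_eval iC Nu z.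
Proof.
move=> zc; apply: envelope_commute => K f h Mh.
apply/eqP; rewrite -subr_eq0; apply/eqP/matrixP => i j; rewrite [RHS]mxE.
have [r1 rM] := repNu iC.
have : vanishing_ideal (base_change iC M) (commutator_poly iC Nu (rep_eval iC Nu z) i j).
  apply: closed_points_suffice => g Mg; rewrite commutator_polyE.
  by rewrite (rep_center rM zc (sMG Mg)) subrr mxE.
move/vanishing_ideal_baseP/(_ K f h Mh) => e; rewrite -[RHS]e.
by rewrite commutator_poly_eval.
Qed.

(** The common kernel of the radical is stable under [A], since the radical absorbs right
    multiplication, and under the centre of [G], which commutes with [A]. The rational equivariant
    projection onto it makes the radical vanish. *)
Lemma casimir_envelope : exists r (Xi Y : 'I_r -> 'M[rat]_m),
  [/\ forall i, A (Xi i), forall i, A (Y i), \sum_i Xi i *m Y i = 1%:M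
   & forall (F : fieldType) (i0 : {rmorphism rat -> F}) (f : 'M[F]_m) x, A x ->
      map_mx i0 x *m (\sum_i map_mx i0 (Xi i) *m f *m map_mx i0 (Y i)) =
      (\sum_i map_mx i0 (Xi i) *m f *m map_mx i0 (Y i)) *m map_mx i0 x].
Proof.
have Alin c x y : A x -> A y -> A (c *: x + y) by exact: envelope_lin.
have A1 : A 1%:M := envelope1 grpM rep_MT.
have AM x y : A x -> A y -> A (x *m y) := envelopeM grpM rep_MT (a := x) (b := y).
have [U UP] := closed_vspace (@envelope0 n m M Nu) Alin.
pose Xi (i : 'I_(\dim U)) : 'M[rat]_m := (vbasis U)`_i.
pose cf (i : 'I_(\dim U)) : {scalar 'M[rat]_m} := coord (vbasis U) i.
have AX i : A (Xi i) by apply/UP; rewrite vbasis_mem // mem_nth // size_tuple.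
have Xcf a : A a -> a = \sum_i cf i a *: Xi i by move/UP => /coord_vbasis.
have cfX i j : cf i (Xi j) = (i == j)%:R.
  by rewrite eq_sym; exact: coord_free (basis_free (vbasisP U)).
pose rad := trace_radical A Xi cf.
have [e [ee re ve]] := kernel_idempotent rad.
have radM a b : rad a -> A b -> rad (a *m b) by exact: (trace_radical_mul AM).
have stab (x : 'M[C]_m) : (forall r (c : 'I_r.+1 -> C) xj, lin_free iC c ->
      x = \sum_j c j *: map_mx iC (xj j) -> forall j a, rad a -> a *m (xj j) *m e = 0) ->
    x *m map_mx iC e = map_mx iC e *m x *m map_mx iC e.
  move=> xr; have [r [c [xj [cfree _ xE]]]] := free_span_mx iC x.
  rewrite xE mulmx_sumr !mulmx_suml; apply: eq_bigr => j _.
  rewrite -scalemxAr -!scalemxAl; congr (_ *: _); rewrite -!map_mxM -mulmxA; congr map_mx.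
  by rewrite ve // => a ra; rewrite mulmxA (xr _ _ _ cfree xE).
have [p [ep pe pM]] : exists p : 'M[rat]_m, [/\ e *m p = p, p *m e = e
    & forall (K : fieldType) (f : {rmorphism rat -> K}) g, pts f M g ->
        map_mx f p *m rep_eval f Nu g = rep_eval f Nu g *m map_mx f p].
  apply: (rational_projection datum Xs repNu ee) => [g Mg|z zc].
    have [r [c [Aj [cfree AA ->]]]] := envelope_span Nu Mg.
    rewrite mulmx_sumr !mulmx_suml; apply: eq_bigr => j _.
    rewrite -scalemxAr -!scalemxAl; congr (_ *: _); rewrite -!map_mxM -mulmxA; congr map_mx.
    by rewrite ve // => a ra; rewrite mulmxA re //; exact: radM.
  apply: stab => r c xj cfree xE j a [Aa ra].
  have -> : a *m xj j = xj j *m a.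
    by symmetry; apply: (component_commute cfree xE); exact: center_envelope.
  by rewrite -mulmxA re ?mulmx0.
have pA a : A a -> a *m p = p *m a.
  move=> Aa; symmetry; rewrite -[a](map_mx_idfun).
  apply: (envelope_commute (i0 := (idfun : {rmorphism rat -> rat})) _ Aa) => K f h Mh.
  exact: pM.
have rad0 : forall a, rad a -> a = 0.
  exact: (trace_radical_complement Alin A1 AM AX Xcf re (ve 1%N) pe ep pA).
have [Y [AY XY1 cas]] := casimir Alin A1 AM AX Xcf cfX rad0.
by exists (\dim U), Xi, Y.
Qed.

(** The sum of [Xi e0 Y] over dual bases has its image in that of [e0], which [A] preserves, and is
    the identity there because the sum of [Xi Y] is 1. The Casimir data being rational, this works
    over any [F]. *)
Lemma invariant_projection (F : fieldType) (i0 : {rmorphism rat -> F}) (e0 : 'M[F]_m) :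
  e0 *m e0 = e0 ->
  (forall (K : fieldType) (f : {rmorphism F -> K}) h, pts (f \o i0) M h ->
     rep_eval (f \o i0) Nu h *m map_mx f e0 = map_mx f e0 *m rep_eval (f \o i0) Nu h *m map_mx f e0) ->
  exists pi : 'M[F]_m, [/\ e0 *m pi = pi, pi *m e0 = e0
    & forall a, A a -> map_mx i0 a *m pi = pi *m map_mx i0 a].
Proof.
move=> ee st; have [r [Xi [Y [AX AY XY cas]]]] := casimir_envelope.
have stA := envelope_stable st.
exists (\sum_i map_mx i0 (Xi i) *m e0 *m map_mx i0 (Y i)); split.
- rewrite mulmx_sumr; apply: eq_bigr => i _.
  by rewrite (stA _ (AX i)) !mulmxA ee.
- rewrite mulmx_suml; transitivity (\sum_i map_mx i0 (Xi i *m Y i) *m e0).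
    apply: eq_bigr => i _; rewrite map_mxM -2!mulmxA -[RHS]mulmxA; congr (_ *m _).
    by rewrite [RHS](stA _ (AY i)) mulmxA.
  by rewrite -mulmx_suml -map_mx_sum XY map_mx1 mul1mx.
- by move=> a Aa; exact: cas.
Qed.
End Semisimplicity.

(** * p-adic numbers and lattices *)

Section RatMorphism.
Variable F : fieldType.
Hypothesis char0 : forall k, k.+1%:R != 0 :> F.

Lemma intr_eq0_char0 (z : int) : z%:~R = 0 :> F -> z = 0.
Proof.
case: z => [[|k]|k] //; rewrite ?NegzE ?mulrNz.
  by move/eqP; rewrite -pmulrn (negPf (char0 k)).
by move/eqP; rewrite oppr_eq0 -pmulrn (negPf (char0 k)).
Qed.

Let den0 (x : rat) : (denq x)%:~R != 0 :> F.
Proof. by apply/eqP => /intr_eq0_char0 /eqP; rewrite denq_eq0. Qed.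

Let numden (x : rat) : x = (numq x)%:~R / (denq x)%:~R.
Proof. by rewrite divq_num_den. Qed.

Let denr0 (x : rat) : (denq x)%:~R != 0 :> rat.
Proof. by rewrite intr_eq0 denq_eq0. Qed.

(** The target is not assumed ordered: additivity rests on characteristic 0 alone, by clearing
    denominators and comparing integers. *)
Lemma ratr_zmod : zmod_morphism (ratr : rat -> F).
Proof.
move=> x y; rewrite /ratr; apply/eqP.
rewrite -mulNr addf_div ?den0 // eqr_div ?mulf_neq0 ?den0 //.
have /(congr1 (intr : int -> F)) : (numq (x - y) * (denq x * denq y) =
    (numq x * denq y + (- numq y) * denq x) * denq (x - y))%R.
  apply: (@intr_inj rat); rewrite !(rmorphM, rmorphD, rmorphN) /=.
  have e1 := numden x; have e2 := numden y; have e3 := numden (x - y).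
  have -> : (numq (x - y))%:~R = (x - y) * (denq (x - y))%:~R :> rat.
    by rewrite {2}e3 mulfVK ?denr0.
  have -> : (numq x)%:~R = x * (denq x)%:~R :> rat by rewrite {2}e1 mulfVK ?denr0.
  have -> : (numq y)%:~R = y * (denq y)%:~R :> rat by rewrite {2}e2 mulfVK ?denr0.
  ring.
by rewrite !(rmorphM, rmorphD, rmorphN) /= => ->.
Qed.

Lemma ratr_monoid : monoid_morphism (ratr : rat -> F).
Proof.
split=> [|x y]; first by rewrite /ratr (_ : numq 1 = 1) // (_ : denq 1 = 1) // divr1.
rewrite /ratr; apply/eqP; rewrite mulf_div eqr_div ?mulf_neq0 ?den0 //.
have /(congr1 (intr : int -> F)) : (numq (x * y) * (denq x * denq y) =
    numq x * numq y * denq (x * y))%R.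
  apply: (@intr_inj rat); rewrite !rmorphM /=.
  have e1 := numden x; have e2 := numden y; have e3 := numden (x * y).
  have -> : (numq (x * y))%:~R = (x * y) * (denq (x * y))%:~R :> rat.
    by rewrite {2}e3 mulfVK ?denr0.
  have -> : (numq x)%:~R = x * (denq x)%:~R :> rat by rewrite {2}e1 mulfVK ?denr0.
  have -> : (numq y)%:~R = y * (denq y)%:~R :> rat by rewrite {2}e2 mulfVK ?denr0.
  ring.
by rewrite !rmorphM /= => ->.
Qed.
End RatMorphism.

Section Padic.
Variable p : primeT.
Local Notation q n := (((val p) ^ n)%N%:Z).
Local Notation Zl := (padic_int p).
Local Notation Q := (Qp p).

Let p_gt1 : (1 < val p)%N := prime_gt1 (valP p).
Let q_gt0 n : (0 < val p ^ n)%N. Proof. by rewrite expn_gt0 prime_gt0 // (valP p). Qed.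

Lemma residue_modS (x : Zl) n k : (x (n + k)%N = x n %[mod q n])%Z.
Proof.
elim: k => [|k IH]; first by rewrite addn0.
rewrite addnS -IH -[LHS](@modz_dvd (q (n + k)%N)); last first.
  by rewrite dvdzE /= dvdn_exp2l ?leq_addr.
by rewrite residueP.
Qed.

Lemma residueD (x y : Zl) n : ((x + y)%R n = x n + y n %[mod q n])%Z.
Proof. by rewrite /= modz_mod. Qed.

Lemma residueM (x y : Zl) n : ((x * y)%R n = x n * y n %[mod q n])%Z.
Proof. by rewrite /= modz_mod. Qed.

Lemma residue_nat k n : ((k%:R : Zl) n = k%:Z %[mod q n])%Z.
Proof.
elim: k => [|k IH]; first by rewrite mulr0n /= modz_mod.
rewrite -addn1 natrD residueD -modzDml IH modzDml PoszD.
by rewrite -[in LHS]modzDmr /= modz_mod modzDmr.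
Qed.

Lemma residue_small (x : Zl) n : (0 <= x n < q n)%R.
Proof.
have q0 : (q n != 0 :> int) by rewrite eqz_nat -lt0n.
rewrite -residueP modz_ge0 //=; have := ltz_pmod (x n.+1) (_ : 0 < q n).
by apply; rewrite ltz_nat.
Qed.

Lemma padic_nat_neq0 k : (k.+1)%:R != 0 :> Zl.
Proof.
apply/eqP => /(congr1 (fun x : Zl => (x k.+1 %% q k.+1)%Z)).
rewrite residue_nat /= mod0z modz_small ?mod0z // ltz_nat.
by rewrite (leq_trans (ltn_expl k.+1 p_gt1)).
Qed.

Lemma padic_char0 k : k.+1%:R != 0 :> Q.
Proof.
have -> : k.+1%:R = (tofrac (k.+1%:R : Zl) : Q) by rewrite rmorph_nat.
by rewrite tofrac_eq0 padic_nat_neq0.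
Qed.

(** [ratr] under a name of its own, to which the ring morphism structure is attached. *)
Definition padic_of_rat : rat -> Q := ratr.
HB.instance Definition _ := GRing.isZmodMorphism.Build rat Q padic_of_rat
  (ratr_zmod padic_char0).
HB.instance Definition _ := GRing.isMonoidMorphism.Build rat Q padic_of_rat
  (ratr_monoid padic_char0).

Lemma Zint_tofrac (x : Zl) : Zp_in_Qp (tofrac x : Q).
Proof. by exists x. Qed.

Lemma Zint_nat k : Zp_in_Qp (k%:R : Q).
Proof. by exists k%:R => //; rewrite rmorph_nat. Qed.

Lemma Zint_int (z : int) : Zp_in_Qp (z%:~R : Q).
Proof. by exists z%:~R => //; rewrite rmorph_int. Qed.

Lemma Zint_add (x y : Q) : Zp_in_Qp x -> Zp_in_Qp y -> Zp_in_Qp (x + y).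
Proof. by move=> [a _ <-] [b _ <-]; exists (a + b) => //; rewrite rmorphD. Qed.

Lemma Zint_mul (x y : Q) : Zp_in_Qp x -> Zp_in_Qp y -> Zp_in_Qp (x * y).
Proof. by move=> [a _ <-] [b _ <-]; exists (a * b) => //; rewrite rmorphM. Qed.

Lemma Zint_opp (x : Q) : Zp_in_Qp x -> Zp_in_Qp (- x).
Proof. by move=> [a _ <-]; exists (- a) => //; rewrite rmorphN. Qed.

Lemma Zint_sum I (s : seq I) (P : pred I) (F : I -> Q) :
  (forall i, P i -> Zp_in_Qp (F i)) -> Zp_in_Qp (\sum_(i <- s | P i) F i).
Proof.
move=> h; apply: (big_ind (fun x => Zp_in_Qp x)) => //; last exact: Zint_add.
exact: (Zint_nat 0).
Qed.

Lemma padic_divide (x : Zl) n : (x n = 0 %[mod q n])%Z ->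
  exists y : Zl, x = (val p ^ n)%:R * y.
Proof.
move=> xn; have h k : exists z : int, x (n + k)%N = (q n * z)%R.
  have /dvdzP[z e] : (q n %| x (n + k)%N)%Z.
    by apply/dvdz_mod0P; rewrite residue_modS xn mod0z.
  by exists z; rewrite e mulrC.
have [z zE] := boolp.choice h.
have zP k : (z k.+1 = z k %[mod q k])%Z.
  have := residue_modS x (n + k) 1; rewrite addn1 -addnS !zE => /eqP.
  rewrite eqz_mod_dvd -mulrBr expnD PoszM dvdz_mul2l; last by rewrite eqz_nat -lt0n.
  by rewrite -eqz_mod_dvd => /eqP.
exists (of_residues zP); apply: padic_int_eq => k.
rewrite residueM -modzMml residue_nat modzMml -modzMmr /= modz_mod modzMmr.
by rewrite -[in LHS](residue_modS x k n) addnC zE.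
Qed.

Lemma padic_split (x : Q) k : Zp_in_Qp x ->
  exists (a : int) (d : Q),
    [/\ Zp_in_Qp d, x = a%:~R + (val p ^ k)%:R * d & (0 <= a < q k)%R].
Proof.
move=> [y _ <-]; have [|d dE] := @padic_divide (y - (`|y k|%N)%:R) k.
  have [y0 _] := andP (residue_small y k).
  rewrite residueD -modzDmr /= modz_mod -modzNm residue_nat modzNm modzDmr.
  by rewrite gez0_abs // subrr.
exists (`|y k|%N : int), (tofrac d); split; first exact: Zint_tofrac; last first.
  by have := residue_small y k; case/andP=> y0 y1; rewrite gez0_abs // y0.
rewrite -[RHS]/(_ + _) -pmulrn.
have -> : ((val p ^ k)%:R : Q) = tofrac ((val p ^ k)%:R : Zl) by rewrite rmorph_nat.
rewrite -rmorphM -dE rmorphB rmorph_nat /=.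
by rewrite addrC subrK.
Qed.

Let dvd_cofactor (b d : int) n k : ~~ (q n %| b)%Z -> (q (n + k) %| d * b)%Z -> (q k %| d)%Z.
Proof.
have pp := valP p; move=> nb; rewrite !dvdzE /= abszM => h.
have b0 : (0 < `|b|)%N by rewrite lt0n; apply: contra nb => /eqP e; rewrite dvdzE e dvdn0.
have [->|d0] := posnP `|d|%N; first by rewrite dvdn0.
move: nb h; rewrite dvdzE /= !pfactor_dvdn ?muln_gt0 ?d0 ?b0 // lognM //.
by move=> h1 h2; lia.
Qed.

(** Modulo [p ^ (n + k)] the gcd of [b] with the modulus divides [p ^ n], so Bezout solves
    [z * b = p ^ n]. The solutions are unique, hence compatible, only modulo [p ^ k]: up to [n]
    digits are lost to the valuation of [b]. *)
Lemma padic_divides_power (b : Zl) : b != 0 -> exists n y, y * b = (val p ^ n)%:R.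
Proof.
move=> b0; have [n bn] : exists n, ~~ (q n %| b n)%Z.
  apply/not_existsP => h; case/eqP: b0; apply: padic_int_eq => n.
  move/negP: (h n); rewrite negbK => /dvdz_mod0P /= ->.
  by rewrite !mod0z.
exists n; have bk k : ~~ (q n %| b (n + k)%N)%Z.
  by apply: contra bn => /dvdz_mod0P h; apply/dvdz_mod0P; rewrite -(residue_modS b n k).
have h k : exists z : int, (z * b (n + k)%N = q n %[mod q (n + k)])%Z.
  have [u [v uv]] := Bezoutz (b (n + k)%N) (q (n + k)).
  have gd : (gcdz (b (n + k)%N) (q (n + k)) %| q n)%Z.
    have := dvdn_gcdr `|b (n + k)%N| (val p ^ (n + k)).
    rewrite dvdzE /= -/(gcdz _ _) => /dvdn_pfactor -/(_ (valP p))[j _ jE].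
    have jb := dvdn_gcdl `|b (n + k)%N| (val p ^ (n + k)).
    rewrite jE in jb; rewrite /gcdz /= jE dvdn_exp2l //.
    rewrite leqNgt; apply/negP => nj; move/negP: (bk k); apply.
    by rewrite dvdzE /=; apply: dvdn_trans jb; rewrite dvdn_exp2l // ltnW.
  have /dvdzP[c cE] := gd.
  exists (c * u); rewrite [in RHS]cE -uv mulrDr mulrA; apply/eqP.
  by rewrite eqz_mod_dvd opprD addrA subrr add0r dvdzE abszN abszM abszM dvdn_mull // dvdn_mull.
have [z zE] := boolp.choice h.
have zP k : (z k.+1 = z k %[mod q k])%Z.
  apply/eqP; rewrite eqz_mod_dvd; apply: dvd_cofactor (bk k) _.
  rewrite mulrBl -eqz_mod_dvd zE.
  rewrite -modzMmr -[X in (_ * X)%Z](residue_modS b (n + k) 1) modzMmr addn1 -addnS.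
  have := zE k.+1 => /(congr1 (fun t => (t %% q (n + k))%Z)).
  by rewrite !modz_dvd ?dvdzE /= ?dvdn_exp2l ?leq_add2l // => ->.
exists (of_residues zP); apply: padic_int_eq => k.
rewrite residueM residue_nat -modzMml /= modz_mod modzMml.
rewrite -modzMmr -[X in (_ * X)%Z](residue_modS b k n) modzMmr addnC.
have := zE k => /(congr1 (fun t => (t %% q k)%Z)).
by rewrite !modz_dvd ?dvdzE /= ?dvdn_exp2l ?leq_addl.
Qed.

Lemma fraction_split (D : idomainType) (x : {fraction D}) :
  exists a b, b != 0 /\ x * FracField.tofrac b = FracField.tofrac a.
Proof.
rewrite -(generic_quotient.reprK x); set r := generic_quotient.repr x.
exists (frac r).1, (frac r).2; split; first exact: denom_ratioP.
unlock FracField.tofrac; rewrite -[LHS]FracField.pi_mul.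
apply/eqP; rewrite FracField.equivf_def.
rewrite /FracField.mulf !numden_Ratio ?mulf_neq0 ?oner_eq0 ?denom_ratioP //.
by rewrite !mulr1 mulrC.
Qed.

Lemma padic_bounded_denominator (x : Q) : exists k, Zp_in_Qp ((val p ^ k)%:R * x).
Proof.
have [a [b [b0 xb]]] := fraction_split x.
have [n [y yb]] := padic_divides_power b0; exists n, (y * a) => //.
rewrite rmorphM /= -xb mulrCA -rmorphM yb rmorph_nat mulrC.
by [].
Qed.

Lemma padic_integer (a : int) k (y : Q) : Zp_in_Qp y ->
  a%:~R = (val p ^ k)%:R * y -> (q k %| a)%Z.
Proof.
move=> [z _ <-] e; have {}e : a%:~R = (val p ^ k)%:R * z :> Zl.
  apply/eqP; rewrite -subr_eq0 -(@tofrac_eq0 Zl) rmorphB rmorphM rmorph_int rmorph_nat.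
  by rewrite e subrr.
have ak : ((a%:~R : Zl) k = a %[mod q k])%Z.
  case: a {e} => j; first by rewrite -pmulrn residue_nat.
  by rewrite NegzE mulrNz /= modz_mod -modzNm residue_nat modzNm.
apply/dvdz_mod0P; rewrite -ak e residueM -modzMml residue_nat modzMml.
by rewrite modzMr.
Qed.
End Padic.

(** * Rational bases of l-adic lattices *)

Section PadicLattice.
Variables (p : primeT) (m : nat).
Local Notation Q := (Qp p).
Local Notation integral v := (forall i, Zp_in_Qp (v i 0)).
Variable L : set 'cV[Q]_m.
Hypothesis L_add : forall v w, L v -> L w -> L (v + w).
Hypothesis L_scale : forall (c : Q) v, Zp_in_Qp c -> L v -> L (c *: v).
Hypothesis L_integral : forall v, L v -> integral v.
Variable k0 : nat.
Hypothesis L_full : forall j, L ((val p ^ k0)%:R *: delta_mx j 0).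

Hypothesis L0 : L 0.

Lemma lattice_comb (A : 'M[Q]_m) (w v0 : 'cV[Q]_m) : L v0 -> (forall j, L (col j A)) -> integral w ->
  L (v0 + A *m w).
Proof.
move=> Lv LA Zw; have -> : A *m w = \sum_j w j 0 *: col j A.
  apply/matrixP => i j; rewrite mxE summxE; apply: eq_bigr => l _.
  by rewrite !mxE (ord1 j) mulrC.
elim: (index_enum _) => [|j s IH]; first by rewrite big_nil addr0.
by rewrite big_cons addrCA; apply: L_add => //; exact: L_scale.
Qed.

Let Lbasis : set 'M[int]_m := [set A | \det A != 0 /\
  forall j, L (map_mx (intr : int -> Q) (col j A))].

Lemma det_column_replace (F : fieldType) (j : 'I_m) (c : 'cV[F]_m) :
  \det (\matrix_(a, b) (if b == j then c a 0 else (a == b)%:R)) = c j 0.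
Proof.
rewrite (expand_det_row _ j) (bigD1 j) //= big1 ?addr0; last first.
  by move=> b bj; rewrite mxE (negPf bj) eq_sym (negPf bj) mul0r.
rewrite mxE eqxx /cofactor [X in \det X](_ : _ = 1%:M) ?det1 ?mulr1.
  by rewrite -signr_odd oddD addbb expr0 mulr1.
apply/matrixP => a b; rewrite !mxE eq_sym (negPf (neq_lift _ _)).
by rewrite (inj_eq (@lift_inj _ _)).
Qed.

(* An integral basis in L of minimal |det|: a vector of L with a coordinate outside
   Z_p yields, after reducing its coordinates, a basis with a smaller |det|. *)
Lemma lattice_basis : exists B : 'M[rat]_m, B \in unitmx /\
  forall v, L v <-> integral (invmx (map_mx (@padic_of_rat p) B) *m v).
Proof.
have intrE (z : int) : padic_of_rat p z%:~R = z%:~R by rewrite rmorph_int.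
have Binit : exists A, Lbasis A.
  exists ((val p ^ k0)%:R%:M); split.
    by rewrite det_scalar expf_neq0 // pnatr_eq0 -lt0n expn_gt0 prime_gt0 ?(valP p).
  move=> j; have -> : map_mx intr (col j (((val p ^ k0)%:R : int)%:M)) =
      (val p ^ k0)%:R *: delta_mx j 0 :> 'cV[Q]_m; last exact: L_full.
  apply/matrixP => a b; rewrite !mxE (ord1 b) andbT.
  by case: eqP => _; rewrite /= ?mulr1n ?mulr1 ?mulr0n ?mulr0 ?rmorph_nat.
have [A [dA LA] minA] := min_measure (fun A => `|\det A|%N) Binit.
pose B : 'M[rat]_m := map_mx intr A; exists B.
have dB : \det B = (\det A)%:~R by rewrite det_map_mx.
have uB : B \in unitmx by rewrite unitmxE dB unitfE intr_eq0.
pose Bp := map_mx (@padic_of_rat p) B.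
have uBp : Bp \in unitmx by rewrite map_unitmx.
have BpE : Bp = map_mx intr A by apply/matrixP => i j; rewrite !mxE intrE.
have colB j : L (col j Bp) by rewrite BpE -map_col.
have int_comb v0 (w : 'cV[Q]_m) : L v0 -> integral w -> L (v0 + Bp *m w).
  by move=> Lv Zw; exact: lattice_comb.
split=> // v; split=> [Lv|Zc]; last first.
  by have := int_comb 0 _ L0 Zc; rewrite add0r mulKVmx.
have Bc : Bp *m (invmx Bp *m v) = v by rewrite mulKVmx.
move: (invmx Bp *m v) Bc => c Bc j; apply: contrapT => cj.
have [t tP] : exists t, forall i, Zp_in_Qp ((val p ^ t)%:R * c i 0).
  have [k kP] := boolp.choice (fun i => padic_bounded_denominator (c i 0)).
  exists (\max_i k i) => i; have ki : (k i <= \max_i k i)%N := leq_bigmax i.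
  have -> : (val p ^ (\max_i k i))%:R * c i 0 =
      (val p ^ (\max_i k i - k i))%:R * ((val p ^ k i)%:R * c i 0) :> Q.
    by rewrite mulrA -natrM -expnD subnK.
  exact: Zint_mul (Zint_nat _ _) (kP i).
have h i : exists ad : int * Q, [/\ Zp_in_Qp ad.2,
    (val p ^ t)%:R * c i 0 = ad.1%:~R + (val p ^ t)%:R * ad.2 & (0 <= ad.1 < (val p ^ t)%N%:Z)%R].
  by have [a [d [h1 h2 h3]]] := padic_split t (tP i); exists (a, d).
have [ad adP] := boolp.choice h.
pose av : 'cV[int]_m := \col_i (ad i).1; pose dv : 'cV[Q]_m := \col_i (ad i).2.
have pt0 : (val p ^ t)%:R != 0 :> Q.
  have := prime_gt0 (valP p); case: (val p) => // q _.
  by rewrite natrX expf_neq0 // padic_char0.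
have pt : (0 < val p ^ t)%N by rewrite expn_gt0 prime_gt0 ?(valP p).
have cE : c - dv = (val p ^ t)%:R^-1 *: map_mx intr av.
  apply/matrixP => i q; rewrite !mxE (ord1 q); have [_ e _] := adP i.
  apply: (mulfI pt0); rewrite mulrBr e addrK.
  by rewrite mulrA mulfV // mul1r.
(* Subtracting integral multiples of the columns leaves coordinates [av / p ^ t] with reduced
   numerators; the resulting vector has integer entries, so it can serve as a column. *)
pose v' := v + Bp *m (- dv).
have Lv' : L v' by apply: int_comb => // i; rewrite !mxE; apply: Zint_opp; have [] := adP i.
have v'E : (val p ^ t)%:R *: v' = map_mx intr (A *m av).
  have -> : v' = Bp *m (c - dv) by rewrite mulmxBr Bc /v' mulmxN.
  by rewrite cE -scalemxAr scalerA mulfV // scale1r BpE map_mxM.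
have wP i : exists z : int, (A *m av) i 0 = ((val p ^ t)%N%:Z * z)%R.
  have e : ((A *m av) i 0)%:~R = (val p ^ t)%:R * v' i 0 :> Q.
    by have /matrixP/(_ i 0) := v'E; rewrite [LHS]mxE [RHS]mxE => ->.
  have /dvdzP[z zE] := padic_integer (L_integral Lv' i) e.
  by exists z; rewrite zE mulrC.
have [w wE] := boolp.choice wP.
have v'w : v' = map_mx intr (\col_i w i).
  apply/matrixP => i q; rewrite (ord1 q); apply: (mulfI pt0).
  have /matrixP/(_ i 0) := v'E; rewrite [LHS]mxE [RHS]mxE wE => ->.
  by rewrite rmorphM /= !mxE -pmulrn.
pose A' : 'M[int]_m := \matrix_(a, b) (if b == j then w a else A a b).
pose E : 'M[rat]_m := \matrix_(a, b)
  (if b == j then (((val p ^ t)%:R)^-1 *: map_mx intr av : 'cV[rat]_m) a 0 else (a == b)%:R).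
have pt0r : (val p ^ t)%:R != 0 :> rat by rewrite pnatr_eq0 -lt0n.
have A'E : map_mx intr A' = B *m E.
  apply/matrixP => a b; rewrite [LHS]mxE [A' _ _]mxE [RHS]mxE.
  under eq_bigr do rewrite [E _ _]mxE.
  case: eqP => [_|_].
    have : (\sum_l B a l * (map_mx intr av : 'cV[rat]_m) l 0) = (val p ^ t)%:R * (w a)%:~R.
      transitivity (((A *m av) a 0)%:~R : rat).
        by rewrite mxE rmorph_sum; apply: eq_bigr => l _; rewrite !mxE rmorphM.
      by rewrite wE rmorphM /= -pmulrn.
    move=> e; apply: (mulfI pt0r); rewrite -e mulr_sumr; apply: eq_bigr => l _.
    by rewrite [((_ *: _) : 'cV[rat]_m) l 0]mxE mulrCA [_%:R * (_ * _)]mulrA mulfV // mul1r.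
  rewrite (bigD1 b) //= eqxx mulr1 big1 ?addr0; first by rewrite mxE.
  by move=> l /negPf ->; rewrite mulr0.
(* Replacing column [j] multiplies the determinant by the reduced coordinate [j], which lies
   strictly between 0 and 1 because that coordinate was not integral. *)
have detA' : (\det A')%:~R * (val p ^ t)%:R = (\det A)%:~R * (ad j).1%:~R :> rat.
  rewrite -det_map_mx A'E det_mulmx dB det_column_replace !mxE -mulrA; congr (_ * _).
  by rewrite mulrAC mulVf // mul1r.
have {detA'} detA' : (\det A' * (val p ^ t)%N%:Z = \det A * (ad j).1)%R.
  by apply: (@intr_inj rat); rewrite !rmorphM /= -detA' -pmulrn.
have [dj ej /andP[a0 alt]] := adP j.
have aj0 : (ad j).1 != 0.
  apply/eqP => aj; apply: cj; rewrite aj add0r in ej.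
  by rewrite (mulfI pt0 ej).
have dA' : \det A' != 0.
  apply/eqP => e; move: detA'; rewrite e mul0r => /esym/eqP.
  by rewrite mulf_eq0 (negPf dA) (negPf aj0).
have : (`|\det A| <= `|\det A'|)%N.
  apply: minA; split=> // q; have [->|qj] := eqVneq q j.
    have -> : map_mx intr (col j A') = v' :> 'cV[Q]_m; last by [].
    by rewrite v'w; apply/matrixP => a b; rewrite !mxE eqxx.
  have -> : col q A' = col q A; last exact: LA.
  by apply/matrixP => a b; rewrite !mxE (negPf qj).
rewrite leqNgt => /negP; apply.
have := congr1 absz detA'; rewrite !abszM /= => e.
have lt1 : (`|(ad j).1| < val p ^ t)%N by rewrite -ltz_nat gez0_abs.
have d0 : (0 < `|\det A|)%N by rewrite absz_gt0.
rewrite -(ltn_pmul2r pt) e.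
by rewrite ltn_pmul2l.
Qed.
End PadicLattice.

(** * Polynomials under translation *)

Lemma mx_col_eq (K : fieldType) m (A B : 'M[K]_m) : (forall v : 'cV[K]_m, A *m v = B *m v) -> A = B.
Proof.
move=> h; apply/matrixP => i j; have /matrixP/(_ i 0) := h (delta_mx j 0).
by rewrite -!colE !mxE.
Qed.

Section Translation.
Variable n : nat.
Local Notation N := (n * n)%N.

Definition deg_le (F : nzRingType) (a : nat) (P : mpoly N F) :=
  forall u, (a < mdeg u)%N -> mcoeff u P = 0.

Lemma deg_leM (F : nzRingType) a b (P Q : mpoly N F) :
  deg_le a P -> deg_le b Q -> deg_le (a + b) (P * Q).
Proof.
move=> hP hQ u hu; rewrite mcoeffM big1 // => k /eqP uE.
have [ka|ka] := ltnP a (mdeg k.1); first by rewrite hP ?mul0r.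
rewrite [X in _ * X]hQ ?mulr0 // -(ltn_add2l (mdeg k.1)) -mdegD -uE.
by apply: leq_ltn_trans hu; rewrite leq_add2r.
Qed.

Lemma deg_le_sum (F : nzRingType) a I (s : seq I) (P : I -> mpoly N F) :
  (forall i, deg_le a (P i)) -> deg_le a (\sum_(i <- s) P i).
Proof. by move=> h u hu; rewrite raddf_sum big1 // => i _; exact: h. Qed.

Lemma deg_le_mmap1 (F : comNzRingType) (h : 'I_N -> mpoly N F) u :
  (forall v, deg_le 1 (h v)) -> deg_le (mdeg u) (mmap1 h u).
Proof.
move=> h1; have h0 : deg_le 0 (1 : mpoly N F).
  move=> w w0; rewrite -[1]/(mpolyC N 1) mcoeffC; case: eqP => [e|]; last by rewrite mulr0.
  by rewrite e mdeg0 in w0.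
have hX v k : deg_le k (h v ^+ k).
  by elim: k => [|k IH]; [rewrite expr0|rewrite exprS -add1n; exact: deg_leM].
rewrite mdegE /mmap1; elim: (index_enum _) => [|v s IH]; first by rewrite !big_nil.
by rewrite !big_cons; exact: deg_leM.
Qed.

Section OverField.
Variable K : fieldType.

Definition translate (g : 'M[K]_n) (P : entry_poly K n) : entry_poly K n :=
  poly_subst idfun (generic_mx K n *m map_mx (@entry_cst K n) g) P.

Lemma translateD g P Q : translate g (P + Q) = translate g P + translate g Q.
Proof. exact: rmorphD. Qed.

Lemma translateM g P Q : translate g (P * Q) = translate g P * translate g Q.
Proof. exact: rmorphM. Qed.

Lemma translateC g c : translate g (mpolyC N c) = mpolyC N c.
Proof. by rewrite /translate /poly_subst mmapC. Qed.

Lemma translateZ g c P : translate g (c *: P) = c *: translate g P.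
Proof. by rewrite -mul_mpolyC translateM translateC mul_mpolyC. Qed.

Lemma translate_sum g I (s : seq I) (P : I -> entry_poly K n) :
  translate g (\sum_(i <- s) P i) = \sum_(i <- s) translate g (P i).
Proof. exact: rmorph_sum. Qed.

Lemma translate_var g i j : translate g (entry_var K i j) = \sum_l g l j *: entry_var K i l.
Proof.
rewrite /translate /poly_subst /entry_var mmapX mmap1U mxvecE mxE; apply: eq_bigr => l _.
by rewrite [generic_mx _ _ _ _]mxE [map_mx _ _ _ _]mxE mulrC mul_mpolyC.
Qed.

Lemma translate_eval (L : fieldType) (h : {rmorphism K -> L}) x g P :
  entry_eval h x (translate g P) = entry_eval h (x *m map_mx h g) P.
Proof.
rewrite /translate (entry_eval_subst (idfun : {rmorphism K -> K})) map_mxM.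
by rewrite map_generic_mx map_entry_cst.
Qed.

Lemma translate1 P : translate 1%:M P = P.
Proof.
elim/mpoly_ring_ind: P => [c|v|P Q IHP IHQ|P Q IHP IHQ].
- exact: translateC.
- case/mxvec_indexP: v => i j; rewrite -/(entry_var K i j) translate_var.
  rewrite (bigD1 j) //= big1 ?addr0; first by rewrite mxE eqxx scale1r.
  by move=> l /negPf lj; rewrite mxE lj scale0r.
- by rewrite translateD IHP IHQ.
- by rewrite translateM IHP IHQ.
Qed.

Lemma translate_mul g h P : translate (g *m h) P = translate g (translate h P).
Proof.
elim/mpoly_ring_ind: P => [c|v|P Q IHP IHQ|P Q IHP IHQ].
- by rewrite !translateC.
- case/mxvec_indexP: v => i j; rewrite -/(entry_var K i j) !translate_var translate_sum.
  under [RHS]eq_bigr do rewrite translateZ translate_var scaler_sumr.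
  rewrite exchange_big; apply: eq_bigr => l _ /=.
  rewrite mxE scaler_suml; apply: eq_bigr => q _.
  by rewrite scalerA mulrC.
- by rewrite !translateD IHP IHQ.
- by rewrite !translateM IHP IHQ.
Qed.

End OverField.

Variable d : nat.
Local Notation I := (bmultinom N d).
(** [bmultinom] bounds degrees strictly: the space is that of polynomials of degree less than [d],
    and [d = msize P] is enough to contain [P]. *)
Definition rep_dim := #|{: I}|.
Local Notation m := rep_dim.
Definition rep_mon (j : 'I_m) : multinom N := bmnm (enum_val j : I).

Lemma rep_mon_inj : injective rep_mon.
Proof. by move=> i j e; apply: enum_val_inj; apply: val_inj. Qed.

Section Coordinates.
Variable K : fieldType.

Definition vec_poly (v : 'cV[K]_m) : entry_poly K n := \sum_j v j 0 *: mpolyX K (rep_mon j).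
Definition poly_vec (P : entry_poly K n) : 'cV[K]_m := \col_j mcoeff (rep_mon j) P.

Lemma vec_polyK v : poly_vec (vec_poly v) = v.
Proof.
apply/matrixP => i j; rewrite (ord1 j) mxE raddf_sum (bigD1 i) //= big1 ?addr0.
  by rewrite mcoeffZ mcoeffX eqxx mulr1.
by move=> l li; rewrite mcoeffZ mcoeffX (inj_eq rep_mon_inj) (negPf li) mulr0.
Qed.

Lemma poly_vecK P : (msize P <= d)%N -> vec_poly (poly_vec P) = P.
Proof.
move=> /mpolywE e; rewrite [RHS]e (reindex _ (onW_bij _ (enum_val_bij I))).
by apply: eq_bigr => j _; rewrite mxE.
Qed.

Lemma vec_poly_sum J (s : seq J) (c : J -> K) v :
  vec_poly (\sum_(i <- s) c i *: v i) = \sum_(i <- s) c i *: vec_poly (v i).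
Proof.
rewrite /vec_poly; under [RHS]eq_bigr do rewrite scaler_sumr.
rewrite exchange_big; apply: eq_bigr => j _ /=.
rewrite summxE scaler_suml; apply: eq_bigr => i _.
by rewrite mxE scalerA.
Qed.

Lemma deg_le_vec_poly P : (forall u, (d <= mdeg u)%N -> mcoeff u P = 0) ->
  vec_poly (poly_vec P) = P.
Proof.
move=> P0; apply: poly_vecK; rewrite msizeE; apply/bigmax_leqP_seq => u uP _.
rewrite ltnNge; apply/negP => du; move: uP; rewrite mcoeff_msupp P0 //.
by rewrite eqxx.
Qed.

End Coordinates.

Let T : 'M[mpoly N (entry_poly rat n)]_n :=
  \matrix_(i, j) \sum_l mpolyC N (entry_var rat l j) * mpolyX _ (mnm1 (mxvec_index i l)).

Definition translation_mx : 'M[entry_poly rat n]_m :=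
  \matrix_(i, j) mcoeff (rep_mon i) (mmap1 (fun v => mxvec T 0 v) (rep_mon j)).

Lemma translation_col (K : fieldType) (f : {rmorphism rat -> K}) (g : 'M[K]_n) i j :
  rep_eval f translation_mx g i j =
  mcoeff (rep_mon i) (translate g (mpolyX K (rep_mon j))).
Proof.
rewrite !mxE; pose ev : {rmorphism entry_poly rat n -> K} := entry_eval f g.
rewrite -[LHS]/(ev _) -(mcoeff_map_mpoly ev) /translate /poly_subst mmapX; congr mcoeff.
rewrite /mmap1 rmorph_prod; apply: eq_bigr => v _; rewrite rmorphXn; congr (_ ^+ _).
case/mxvec_indexP: v => a b; rewrite !mxvecE !mxE rmorph_sum; apply: eq_bigr => l _.
rewrite rmorphM /= map_mpolyC map_mpolyX [generic_mx _ _ _ _]mxE [map_mx _ _ _ _]mxE.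
rewrite [RHS]mulrC; congr (_ * _); congr mpolyC; exact: entry_eval_var.
Qed.

Lemma translate_deg (K : fieldType) (g : 'M[K]_n) u :
  deg_le (mdeg u) (translate g (mpolyX K u)).
Proof.
rewrite /translate /poly_subst mmapX; apply: deg_le_mmap1 => v.
case/mxvec_indexP: v => i j; rewrite mxvecE mxE; apply: deg_le_sum => l w w1.
rewrite [generic_mx _ _ _ _]mxE [map_mx _ _ _ _]mxE mulrC mcoeffCM mcoeffX.
by case: eqP => [e|]; rewrite ?mulr0 //; move: w1; rewrite -e mdeg1.
Qed.

Section Action.
Variables (K : fieldType) (f : {rmorphism rat -> K}).
Local Notation nu := (rep_eval f translation_mx).

Lemma translation_action g (v : 'cV[K]_m) : vec_poly (nu g *m v) = translate g (vec_poly v).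
Proof.
have -> : nu g *m v = \sum_j v j 0 *: poly_vec (translate g (mpolyX K (rep_mon j))).
  apply/matrixP => i q; rewrite (ord1 q) mxE summxE; apply: eq_bigr => j _.
  by rewrite translation_col !mxE mulrC.
rewrite vec_poly_sum translate_sum; apply: eq_bigr => j _.
rewrite translateZ deg_le_vec_poly // => u du; apply: (translate_deg g (u := rep_mon j)).
by apply: leq_trans du; exact: bmdeg.
Qed.

Lemma vec_poly_inj : injective (@vec_poly K).
Proof. exact: can_inj (@vec_polyK K). Qed.

Lemma translation1 : nu 1%:M = 1%:M.
Proof.
by apply: mx_col_eq => v; apply: vec_poly_inj; rewrite translation_action translate1 mul1mx.
Qed.

Lemma translationM g h : nu (g *m h) = nu g *m nu h.
Proof.
apply: mx_col_eq => v; apply: vec_poly_inj.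
by rewrite -mulmxA !translation_action translate_mul.
Qed.
End Action.

Lemma translation_rep G : is_rep G translation_mx.
Proof. by move=> K f; split=> [|g h _ _]; rewrite ?translation1 ?translationM. Qed.

Section Integral.
Variable p : primeT.
Local Notation Q := (Qp p).
Let Zcoef (P : entry_poly Q n) := forall u, Zp_in_Qp (mcoeff u P).

Lemma translation_integral (g : 'M[Q]_n) : Zp_mx g ->
  Zp_mx (rep_eval (@padic_of_rat p) translation_mx g).
Proof.
move=> Zg i j; rewrite translation_col; move: (rep_mon i).
rewrite -/(Zcoef _) /translate /poly_subst mmapX.
have Z1 : Zcoef 1.
  by move=> u; rewrite -[1]/(mpolyC N 1) mcoeffC mul1r; exact: Zint_nat.
have ZM P P' : Zcoef P -> Zcoef P' -> Zcoef (P * P').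
  by move=> h h' u; rewrite mcoeffM; apply: Zint_sum => k _; exact: Zint_mul.
rewrite /mmap1; elim/big_ind: _ => // v _; elim: (rep_mon j v) => [|k IH].
  by rewrite expr0.
rewrite exprS; apply: ZM => // {k IH}.
case/mxvec_indexP: v => a b; rewrite mxvecE mxE => u; rewrite raddf_sum; apply: Zint_sum => l _.
rewrite [generic_mx _ _ _ _]mxE [map_mx _ _ _ _]mxE mulrC /= mcoeffCM mcoeffX.
by apply: Zint_mul => //; exact: Zint_nat.
Qed.
End Integral.
End Translation.

Lemma regapp_rep (k K : fieldType) (f : k -> K) a b (phi : regmap k a b) g :
  regapp f phi g = (\det g) ^- denom phi *: map_mx (entry_eval f g) (numer phi).
Proof. by congr (_ *: _); apply/matrixP => i j; rewrite !mxE. Qed.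

Lemma regapp_denom0 (K : fieldType) (f : rat -> K) n m (Nu : 'M[entry_poly rat n]_m) g :
  regapp f (RegMap Nu 0) g = rep_eval f Nu g.
Proof. by rewrite regapp_rep expr0 invr1 scale1r. Qed.

Lemma commute_regapp (K : fieldType) (f : rat -> K) n m (mu : regmap rat n m) g
    (A : 'M[K]_m) : g \in unitmx ->
  (A *m regapp f mu g = regapp f mu g *m A <->
   A *m rep_eval f (numer mu) g = rep_eval f (numer mu) g *m A).
Proof.
move=> ug; rewrite regapp_rep -/(rep_eval f (numer mu) g); split=> [e|]; last exact: scale_commute.
have d0 : (\det g) ^+ denom mu != 0 by rewrite expf_neq0 // -unitfE -unitmxE.
have -> : rep_eval f (numer mu) g =
    (\det g) ^+ denom mu *: ((\det g) ^- denom mu *: rep_eval f (numer mu) g).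
  by rewrite scalerA mulfV // scale1r.
exact: scale_commute.
Qed.

Lemma alg_hom_is_rep n m (G : set (entry_poly rat n)) (mu : regmap rat n m) :
  alg_group G -> alg_hom G (general_linear m) mu -> is_rep G (numer mu).
Proof.
move=> grpG hom K f.
have repE g : g \in unitmx -> rep_eval f (numer mu) g = (\det g) ^+ denom mu *: regapp f mu g.
  move=> ug; rewrite regapp_rep scalerA mulfV ?scale1r // expf_neq0 //.
  by rewrite -unitfE -unitmxE.
split=> [|g h Gg Gh].
  by rewrite repE ?unitmx1 // (alg_hom1 f grpG hom) det1 expr1n scale1r.
have [_ hM] := hom K f.
rewrite !repE ?unitmx_mul ?Gg.1 ?Gh.1 // hM // det_mulmx exprMn.
by rewrite -[in RHS]scalemxAl -[in RHS]scalemxAr [in RHS]scalerA.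
Qed.

(** In a connected scheme a clopen piece through 1 leaves an empty complement, so its equations hold
    everywhere. *)
Lemma neutral_component_connected (k : fieldType) n (E : set (entry_poly k n)) :
  alg_connected E -> pts idfun E 1%:M ->
  forall (K : fieldType) (f : {rmorphism k -> K}), pts f (neutral_component E) = pts f E.
Proof.
move=> conn E1 K f; apply/seteqP; split=> g [ug hg]; split=> // P.
  (* The single equation [1 = 0] defines the empty piece. *)
  move=> EP; apply: hg; exists E, [set 1]; split=> // L h; split.
    rewrite -[LHS]setU0; congr (_ `|` _); apply/esym/seteqP; split=> // x [_ /(_ 1 erefl)].
    by rewrite rmorph1 => /eqP; rewrite oner_eq0.
  by apply/seteqP; split=> // x [_ [_ /(_ 1 erefl)]]; rewrite rmorph1 => /eqP; rewrite oner_eq0.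
case=> A [B [part A1 AP]]; have [A0|B0] := conn A B part.
  have := A0 k idfun => e; move: A1; rewrite -[pts idfun A]/(pts (idfun : {rmorphism k -> k}) A) e.
  by case.
have [pE _] := part K f; have : pts f E g by [].
by rewrite pE B0 setU0 => -[_]; apply.
Qed.

Lemma rmorph_ext (A B : nzRingType) (f g : {rmorphism A -> B}) : f =1 g -> f = g.
Proof.
case: f => f [[fa] [fm]]; case: g => g [[ga] [gm]] /= /funext fg.
by subst g; rewrite (Prop_irrelevance fa ga) (Prop_irrelevance fm gm).
Qed.

Lemma closed_idempotent (F : fieldType) m (S : set 'cV[F]_m) :
  S 0 -> (forall a x y, S x -> S y -> S (a *: x + y)) ->
  exists e : 'M[F]_m, e *m e = e /\ forall v, S v <-> e *m v = v.
Proof.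
move=> S0 Slin; have [U UP] := closed_vspace S0 Slin.
pose e : 'M[F]_m := \matrix_(i, j) projv U (delta_mx j 0) i 0.
have eE v : e *m v = projv U v.
  have -> : v = \sum_j v j 0 *: delta_mx j 0 :> 'cV[F]_m.
    apply/matrixP => i j; rewrite (ord1 j) summxE (bigD1 i) //= big1 ?addr0.
      by rewrite !mxE !eqxx mulr1.
    by move=> l li; rewrite !mxE eq_sym (negPf li) mulr0.
  rewrite mulmx_sumr linear_sum; apply: eq_bigr => j _; rewrite -scalemxAr linearZ /=.
  by congr (_ *: _); apply/matrixP => i q; rewrite (ord1 q) -colE !mxE.
have mem v : S v <-> e *m v = v.
  rewrite eE UP; split=> [|<-]; [exact: projv_id|exact: memv_proj].
exists e; split=> //; apply: mx_col_eq => v.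
by rewrite -mulmxA (proj1 (mem _)) // UP eE memv_proj.
Qed.

Lemma vspace_idempotent (F : fieldType) m (W : {vspace 'cV[F]_m}) :
  exists e : 'M[F]_m, e *m e = e /\ forall v, v \in W <-> e *m v = v.
Proof.
by apply: closed_idempotent => [|a x y xW yW]; [exact: mem0v|rewrite memvD // memvZ].
Qed.

Lemma complement_projection (F : fieldType) m (W W' : {vspace 'cV[F]_m}) :
  (W + W')%VS = fullv -> (W :&: W')%VS = 0%VS ->
  exists pi : 'M[F]_m, [/\ forall v, v \in W -> pi *m v = v,
    forall v, v \in W' -> pi *m v = 0 & forall v, pi *m v \in W].
Proof.
move=> WW' W0.
have dec v : exists w w', [/\ w \in W, w' \in W' & v = w + w'].
  have : v \in (W + W')%VS by rewrite WW' memvf.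
  by case/memv_addP=> w wW [w' w'W ->]; exists w, w'.
have uniq v : v \in W -> v \in W' -> v = 0.
  by move=> h h'; apply/eqP; rewrite -memv0 -W0 memv_cap h.
have [pr prP] := boolp.choice (fun v => dec v).
pose pi : 'M[F]_m := \matrix_(i, j) pr (delta_mx j 0) i 0.
have piE v : exists w', [/\ pi *m v \in W, w' \in W' & v = pi *m v + w'].
  have vE : v = \sum_j v j 0 *: delta_mx j 0 :> 'cV[F]_m.
    apply/matrixP => i j; rewrite (ord1 j) summxE (bigD1 i) //= big1 ?addr0.
      by rewrite !mxE !eqxx mulr1.
    by move=> l li; rewrite !mxE eq_sym (negPf li) mulr0.
  have pv : pi *m v = \sum_j v j 0 *: pr (delta_mx j 0).
    apply/matrixP => i j; rewrite (ord1 j) mxE summxE; apply: eq_bigr => l _.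
    by rewrite !mxE mulrC.
  exists (v - pi *m v); split; last by rewrite addrC subrK.
    by rewrite pv memv_suml // => j _; rewrite memvZ //; have [w' []] := prP (delta_mx j 0).
  rewrite {1}vE pv -sumrB memv_suml // => j _; rewrite -scalerBr memvZ //.
  have [w' [_ w'W e]] := prP (delta_mx j 0).
  by rewrite {1}e addrAC subrr add0r.
exists pi; split=> v; last by have [w' []] := piE v.
  move=> vW; have [w' [pW w'W e]] := piE v; rewrite [RHS]e.
  have w'E : w' = v - pi *m v by rewrite {1}e addrAC subrr add0r.
  by rewrite (uniq w') ?addr0 // w'E memvB.
move=> vW; have [w' [pW w'W e]] := piE v; apply: uniq => //.
by have -> : pi *m v = v - w'; [rewrite {2}e addrK|rewrite memvB].
Qed.

Lemma invmx_conj (F : fieldType) m (A g g' : 'M[F]_m) : A \in unitmx -> g *m g' = 1%:M ->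
  invmx (invmx A *m g *m A) = invmx A *m g' *m A.
Proof.
move=> uA gg; apply: invmx_eq; rewrite !mulmxA mulmxK // -(mulmxA _ g) gg mulmx1.
exact: mulVmx.
Qed.

Section StableLattice.
Variables (n d : nat) (G : set (entry_poly rat n)) (l : primeT) (Kl : set 'M[Qp l]_n).
Local Notation Q := (Qp l).
Local Notation iQ := (@padic_of_rat l).
Hypothesis grpG : alg_group G.
Hypothesis KlP : compact_open_subgroup_at G Kl.
Local Notation nu := (rep_eval iQ (translation_mx n d)).

Let Kl_sub : Kl `<=` pts iQ G.
Proof. by have [_ [h _] _] := KlP. Qed.

(** The sets of [g] whose denominators divide [l ^ k] are open, since right multiplication by an
    integral matrix of level 1 preserves them; they increase and cover [Kl], which is compact. *)
Lemma translation_bounded : exists k, forall g, Kl g ->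
  forall i j, Zp_in_Qp ((val l ^ k)%:R * nu g i j).
Proof.
pose U k := [set g | pts iQ G g /\ forall i j, Zp_in_Qp ((val l ^ k)%:R * nu g i j)].
have Umono k k' : (k <= k')%N -> U k `<=` U k'.
  move=> kk' g [Gg h]; split=> // i j.
  have -> : (val l ^ k')%:R * nu g i j = (val l ^ (k' - k))%:R * ((val l ^ k)%:R * nu g i j).
    by rewrite mulrA -natrM -expnD subnK.
  exact: Zint_mul (Zint_nat _ _) (h i j).
have [_ _ cpt] := KlP.
have [||s sU sP] := cpt [set V | exists k, V = U k].
- move=> _ [k ->]; split=> [g []//|g [Gg Zg]]; exists 1%N => // u Gu [Zu _ _].
  have [_ GM _] := grpG iQ; split; first exact: GM.
  move=> i j; rewrite translationM mxE mulr_sumr; apply: Zint_sum => q _.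
  by rewrite mulrA; apply: Zint_mul => //; exact: translation_integral.
- move=> g Kg; have h (ij : 'I_(rep_dim n d) * 'I_(rep_dim n d)) :=
    padic_bounded_denominator (nu g ij.1 ij.2).
  have [k kP] := boolp.choice h.
  exists (U (\max_ij k ij)); first by exists (\max_ij k ij).
  split; first exact: Kl_sub.
  move=> i j; have kk := leq_bigmax (F := k) (i, j).
  have -> : (val l ^ (\max_ij k ij))%:R * nu g i j =
      (val l ^ (\max_ij k ij - k (i, j)))%:R * ((val l ^ k (i, j))%:R * nu g i j).
    by rewrite mulrA -natrM -expnD subnK.
  exact: Zint_mul (Zint_nat _ _) (kP (i, j)).
have [k kP] : exists k, forall V, List.In V s -> V `<=` U k.
  elim: s sU {sP} => [|V s IH] sU; first by exists 0%N.
  have [k kP] : exists k, forall V, List.In V s -> V `<=` U k.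
    by apply: IH => W Ws; apply: sU; right.
  have [k' ->] := sU V (or_introl erefl).
  exists (maxn k k') => W [<-|/kP h]; first by apply: Umono; exact: leq_maxr.
  by apply: (subset_trans h); apply: Umono; exact: leq_maxl.
exists k => g Kg; have [V Vs Vg] := sP g Kg.
by have [_ h] := kP V Vs g Vg; exact: h.
Qed.

(** [L] is the largest [Kl]-stable set of integral vectors. The uniform bound on denominators puts
    [l ^ k0] times the standard lattice inside it, so it has a rational basis. *)
Lemma stable_lattice : exists B, lattice_rep G Kl (RegMap (translation_mx n d) 0) B.
Proof.
have [[K1 KM KV] _ _] := KlP; have [k0 k0P] := translation_bounded.
pose L := [set v : 'cV[Q]_(rep_dim n d) | forall g, Kl g -> forall i, Zp_in_Qp ((nu g *m v) i 0)].
have Ladd v w : L v -> L w -> L (v + w).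
  by move=> Lv Lw g Kg i; rewrite mulmxDr mxE; apply: Zint_add; [exact: Lv|exact: Lw].
have Lscale c v : Zp_in_Qp c -> L v -> L (c *: v).
  by move=> Zc Lv g Kg i; rewrite -scalemxAr mxE; apply: Zint_mul => //; exact: Lv.
have Lint v : L v -> forall i, Zp_in_Qp (v i 0).
  by move=> Lv i; have := Lv _ K1 i; rewrite translation1 mul1mx.
have Lfull j : L ((val l ^ k0)%:R *: delta_mx j 0).
  move=> g Kg i; rewrite -scalemxAr -colE.
  have -> : ((val l ^ k0)%:R *: col j (nu g)) i 0 = (val l ^ k0)%:R * nu g i j.
    by rewrite mxE; congr (_ * _); rewrite mxE.
  exact: k0P.
have L0 : L 0 by move=> g Kg i; rewrite mulmx0 mxE; exact: (Zint_nat l 0).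
have LK g v : Kl g -> L v -> L (nu g *m v).
  by move=> Kg Lv h Kh i; rewrite mulmxA -translationM; apply: Lv; exact: KM.
have [B [uB BP]] := lattice_basis Ladd Lscale Lint Lfull L0.
have uBp : map_mx iQ B \in unitmx by rewrite map_unitmx.
have conj_int g : Kl g -> Zp_mx (invmx (map_mx iQ B) *m nu g *m map_mx iQ B).
  move=> Kg i j.
  have LB : L (map_mx iQ B *m delta_mx j 0).
    apply/BP => q; rewrite mulKmx // mxE; case: eqP => _; rewrite ?andbT.
      exact: (Zint_nat l 1).
    exact: (Zint_nat l 0).
  have /BP/(_ i) := LK g _ Kg LB.
  by rewrite !mulmxA -colE mxE.
exists B; split=> //.
- move=> K f; split=> [g Gg|g h _ _]; last by rewrite !regapp_denom0 translationM.
  split=> //; rewrite regapp_denom0.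
  have := translationM d f g (invmx g); rewrite mulmxV ?Gg.1 // translation1 => e.
  by have [] := mulmx1_unit (esym e).
- move=> g Kg /=; rewrite -[map_mx ratr B]/(map_mx iQ B).
  have -> : regapp ratr (RegMap (translation_mx n d) 0) g = nu g by exact: regapp_denom0.
  split; first exact: conj_int.
  have -> : invmx (invmx (map_mx iQ B) *m nu g *m map_mx iQ B) =
      invmx (map_mx iQ B) *m nu (invmx g) *m map_mx iQ B; last exact/conj_int/KV.
  have e : nu g *m nu (invmx g) = 1%:M.
    have ug : g \in unitmx := (Kl_sub Kg).1.
    by rewrite -translationM mulmxV // translation1.
  exact: invmx_conj uBp e.
Qed.
End StableLattice.

(** * Tate structures and the Mumford-Tate equality *)

Lemma vec_poly_lin n d (K : fieldType) (a : K) (x y : 'cV[K]_(rep_dim n d)) :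
  vec_poly (a *: x + y) = a *: vec_poly x + vec_poly y.
Proof.
rewrite /vec_poly scaler_sumr -big_split; apply: eq_bigr => j _ /=.
by rewrite !mxE scalerDl scalerA.
Qed.

Lemma vec_poly0 n d (K : fieldType) : vec_poly (0 : 'cV[K]_(rep_dim n d)) = 0.
Proof. by rewrite /vec_poly big1 // => j _; rewrite mxE scale0r. Qed.

Lemma vec_poly_map n d (k K : fieldType) (f : {rmorphism k -> K}) (v : 'cV[k]_(rep_dim n d)) :
  vec_poly (map_mx f v) = map_mpoly f (vec_poly v).
Proof.
rewrite /vec_poly rmorph_sum; apply: eq_bigr => j _ /=.
by rewrite map_mpolyZ map_mpolyX mxE.
Qed.

Lemma projection_commute (F : fieldType) m (pi g : 'M[F]_m) (x y : 'cV[F]_m) :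
  pi *m x = x -> pi *m y = 0 -> pi *m (g *m x) = g *m x -> pi *m (g *m y) = 0 ->
  pi *m (g *m (x + y)) = g *m (pi *m (x + y)).
Proof. by move=> px py pgx pgy; rewrite !mulmxDr px py pgx pgy mulmx0. Qed.

Section IdealCoordinates.
Variables (n d : nat) (M : set (entry_poly rat n)).
Local Notation m := (rep_dim n d).

(** By descent one rational idempotent cuts out the polynomials of the ideal over every extension at
    once. *)
Lemma ideal_idempotent : exists e : 'M[rat]_m, e *m e = e /\
  forall (F : fieldType) (i0 : {rmorphism rat -> F}) (w : 'cV[F]_m),
    vanishing_ideal (base_change i0 M) (vec_poly w) <-> map_mx i0 e *m w = w.
Proof.
have [||e [ee eP]] := @closed_idempotent rat m [set v | vanishing_ideal M (vec_poly v)].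
- by move=> K f g _; rewrite vec_poly0 rmorph0.
- move=> a x y Ix Iy K f g Mg; rewrite vec_poly_lin rmorphD /= entry_evalZ.
  by rewrite (Ix K f g Mg) (Iy K f g Mg) mulr0 addr0.
exists e; split=> // F i0 w.
have [r [c [wj [cfree _ wE]]]] := free_span_mx i0 w.
have wP : vec_poly w = \sum_j c j *: map_mpoly i0 (vec_poly (wj j)).
  by rewrite wE vec_poly_sum; apply: eq_bigr => j _; rewrite vec_poly_map.
split=> [|ew].
  rewrite wP => /(ideal_descent cfree) Ij.
  rewrite wE mulmx_sumr; apply: eq_bigr => j _.
  by rewrite -scalemxAr -map_mxM (proj1 (eP _) (Ij j)).
apply/vanishing_ideal_baseP => K f g Mg; rewrite -ew wE mulmx_sumr.
under eq_bigr do rewrite -scalemxAr -map_mxM.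
rewrite vec_poly_sum rmorph_sum big1 // => j _ /=.
rewrite entry_evalZ vec_poly_map entry_eval_map.
have Ie : vanishing_ideal M (vec_poly (e *m wj j)) by apply/eP; rewrite mulmxA ee.
by rewrite (Ie K (f \o i0) g Mg) mulr0.
Qed.

Lemma ideal_stable (e : 'M[rat]_m) : alg_group M ->
  (forall (F : fieldType) (i0 : {rmorphism rat -> F}) (w : 'cV[F]_m),
    vanishing_ideal (base_change i0 M) (vec_poly w) <-> map_mx i0 e *m w = w) ->
  e *m e = e ->
  forall (F : fieldType) (f : {rmorphism rat -> F}) h, pts f M h ->
    rep_eval f (translation_mx n d) h *m map_mx f e =
    map_mx f e *m rep_eval f (translation_mx n d) h *m map_mx f e.
Proof.
move=> grpM eP ee F f h Mh; apply: mx_col_eq => x; rewrite -!mulmxA.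
symmetry; apply/eP; rewrite translation_action.
have/eP Ix : map_mx f e *m (map_mx f e *m x) = map_mx f e *m x.
  by rewrite mulmxA -map_mxM ee.
apply/vanishing_ideal_baseP => K g x' Mx'; rewrite translate_eval.
move/vanishing_ideal_baseP: Ix; apply.
have [_ MM _] := grpM K (g \o f).
by apply: MM => //; exact: pts_map.
Qed.
End IdealCoordinates.

(** * The Galois image at a point *)

Section ShimuraPoint.
Variables (R : realType) (n : nat) (G : set (entry_poly rat n)) (X : set (regmap R 2 n)).
Variables (Sh : set (adele_mx n) -> sh_model R n) (l : primeT).
Variables (K : set (adele_mx n)) (Kl : set 'M[Qp l]_n) (L : set (CC R)).
Variables (s : regmap R 2 n) (rho : {rmorphism Qbar R -> Qbar R} -> adele_mx n).
Hypothesis sp : shimura_point G X Sh K Kl L s rho.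
Local Notation C := (CC R).
Local Notation Q := (Qp l).
Local Notation iQ := (@padic_of_rat l : {rmorphism rat -> Q}).
Local Notation M := (MT G s).
Local Notation Gam := (@l_adic_image R n l L rho).
Local Notation Z := (zariski_closure Gam).

Let datum := sp_datum sp.
Let Xs := sp_point sp.
Let grpG : alg_group G := datum_group datum.
Let grpM : alg_group M := MT_group G s.
Let sMG : alg_subset M G := MT_sub grpG (datum_hom datum Xs).

Lemma image_sub g : Gam g -> pts iQ G g.
Proof.
case=> sigma Ls <-; have [rK _ _] := sp_rho sp.
have /(sp_splits sp)[_ Kg _] := rK _ Ls.
by have [_ [h _] _] := sp_level_l sp; exact: h.
Qed.

Lemma imageM g h : Gam g -> Gam h -> Gam (g *m h).
Proof.
case=> sigma Ls <- [tau Lt <-]; have [_ rM _] := sp_rho sp.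
exists (sigma \o tau : {rmorphism Qbar R -> Qbar R}); last by rewrite rM.
by move=> x Lx /=; rewrite Lt // Ls.
Qed.

Lemma image1 : Gam 1%:M.
Proof.
have [_ rM _] := sp_rho sp; pose id1 : {rmorphism Qbar R -> Qbar R} := idfun.
have L1 : Defs.Gal L id1 by move=> x _.
exists id1 => //; have e := rM id1 id1 L1 L1.
have id2 : (id1 \o id1 : {rmorphism Qbar R -> Qbar R}) = id1 by apply: rmorph_ext.
rewrite id2 in e; have el : rho id1 l = rho id1 l *m rho id1 l by rewrite {1}e.
have [u _] : pts iQ G (rho id1 l) by apply: image_sub; exists id1.
by rewrite -[RHS](mulVmx u) {3}el mulKmx.
Qed.

Lemma closure1 : pts idfun Z 1%:M.
Proof. by split=> [|P ZP]; [exact: unitmx1|exact: ZP image1]. Qed.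

Lemma image_closure g : Gam g -> pts idfun Z g.
Proof. by move=> Gg; split=> [|P ZP]; [have [] := image_sub Gg|exact: ZP]. Qed.

Lemma mumford_tate_pts : mumford_tate_equality G l L s rho <->
  forall (F : fieldType) (f : {rmorphism Q -> F}), pts f Z = pts (f \o iQ) M.
Proof.
have nc := neutral_component_connected (sp_connected sp) closure1.
by split=> h F f; [rewrite -nc h (pts_base_change iQ)|rewrite nc h (pts_base_change iQ)].
Qed.

Let nat_neq0 (N : nat) : (0 < N)%N -> N%:R != 0 :> Q.
Proof. by case: N => // j _; exact: padic_char0. Qed.

Section Representation.
Variables (m : nat) (mu : regmap rat n m) (B : 'M[rat]_m).
Hypothesis latB : lattice_rep G Kl mu B.
Local Notation Nu := (numer mu).
Local Notation V := (shimura_structure l mu B s rho).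
Local Notation BQ := (map_mx iQ B).

Let uB : B \in unitmx. Proof. by case: latB. Qed.
Let uBQ : BQ \in unitmx. Proof. by rewrite map_unitmx. Qed.
Lemma lattice_is_rep : is_rep G Nu.
Proof. by apply: alg_hom_is_rep => //; case: latB. Qed.

Let S_pts z : z != 0 -> pts (ratr : {rmorphism rat -> R}) M (S_real s z).
Proof.
move=> z0; have [sh _] := MT_hom (datum_hom datum Xs) (idfun : {rmorphism R -> R}).
have ab : complex.Re z ^+ 2 + complex.Im z ^+ 2 != 0.
  by apply: contra z0 => /eqP e; apply/eqP/n2_eq0.
have := sh _ (torus_pts idfun ab).
by rewrite (pts_base_change (ratr : {rmorphism rat -> R}) (idfun : {rmorphism R -> R})).
Qed.

(** For a rational [phi] this turns endomorphisms of the Hodge structure into endomorphisms for the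
    Mumford-Tate group, over every field. *)
Lemma hodge_commute (phi : 'M[rat]_m) :
  (forall z : C, z != 0 -> map_mx ratr phi *m hodge V z = hodge V z *m map_mx ratr phi) <->
  (forall (F : fieldType) (f : {rmorphism rat -> F}) g, pts f M g ->
     map_mx f phi *m rep_eval f Nu g = rep_eval f Nu g *m map_mx f phi).
Proof.
split=> [h|h z z0]; last by apply/commute_regapp; [exact: (S_pts z0).1|exact: h (S_pts z0)].
apply: (centralizer_MT grpG (datum_hom datum Xs) lattice_is_rep) => z z0.
by apply/commute_regapp; [exact: (S_pts z0).1|exact: h].
Qed.

Lemma galois_commute (phi : 'M[Q]_m) :
  (forall sigma, Defs.Gal L sigma -> phi *m Defs.galois V sigma = Defs.galois V sigma *m phi) <->
  (forall g, Gam g -> phi *m rep_eval iQ Nu g = rep_eval iQ Nu g *m phi).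
Proof.
split=> [h g Gg|h sigma Ls].
  have [u _] := image_sub Gg; apply/commute_regapp => //.
  by case: Gg => sigma Ls <-; exact: h.
have Gg : Gam (rho sigma l) by exists sigma.
change (phi *m regapp iQ mu (rho sigma l) = regapp iQ mu (rho sigma l) *m phi).
by apply/commute_regapp; [exact: (image_sub Gg).1|exact: h].
Qed.

Lemma galois_stable_rep (W : {vspace 'cV[Q]_m}) : @galois_stable R l L V W <->
  forall g, Gam g -> forall v, v \in W -> rep_eval iQ Nu g *m v \in W.
Proof.
have gE sigma : Defs.galois V sigma = regapp iQ mu (rho sigma l) by [].
split=> [h _ [sigma Ls <-] v vW|h sigma Ls v vW].
  have [ug _] : pts iQ G (rho sigma l) by apply: image_sub; exists sigma.
  have := h sigma Ls v vW; rewrite gE regapp_rep -scalemxAl.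
  move/(memvZ ((\det (rho sigma l)) ^+ denom mu)); rewrite scalerA mulfV ?scale1r //.
  by rewrite expf_neq0 // -unitfE -unitmxE.
rewrite gE regapp_rep -scalemxAl memvZ //; apply: h => //.
by exists sigma.
Qed.

Lemma Zint_rat_mx (A : 'M[rat]_m) : (forall i j, A i j \is a Num.int) -> Zp_mx (map_mx iQ A).
Proof.
move=> h i j; rewrite mxE; have /intrP[z ->] := h i j.
by rewrite rmorph_int; exact: Zint_int.
Qed.

Lemma rat_mx_denominator (A : 'M[rat]_m) : exists N : nat,
  (0 < N)%N /\ forall i j, (N%:R *: A) i j \is a Num.int.
Proof.
pose D (ij : 'I_m * 'I_m) := `|denq (A ij.1 ij.2)|%N.
have D0 ij : (0 < D ij)%N by rewrite absz_gt0 denq_eq0.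
exists (\prod_ij D ij)%N; split; first exact: prodn_gt0.
move=> i j; rewrite mxE (bigD1 (i, j)) //= natrM mulrAC; apply: rpredM; last exact: intr_nat.
have -> : (D (i, j))%:R * A i j = (numq (A i j))%:~R.
  rewrite /D /=; move: (A i j) => x.
  have dE : (`|denq x|%N)%:R = (denq x)%:~R :> rat by rewrite -[in RHS]absz_denq.
  by rewrite dE mulrC -{1}(divq_num_den x) divfK // intr_eq0 denq_eq0.
exact: intr_int.
Qed.

Lemma End_HS_l_commute phi : @End_HS_l R l V phi ->
  forall (F : fieldType) (f : {rmorphism Q -> F}) g, pts (f \o iQ) M g ->
    map_mx f phi *m rep_eval (f \o iQ) Nu g = rep_eval (f \o iQ) Nu g *m map_mx f phi.
Proof.
case=> r [c [psi [h ->]]] F f g Mg.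
rewrite map_mx_sum mulmx_suml mulmx_sumr; apply: eq_bigr => i _.
have [_ [_ /hodge_commute hc]] := h i.
rewrite map_mxZ -scalemxAl -scalemxAr; congr (_ *: _).
have e : map_mx f (map_mx ratr (psi i)) = map_mx (f \o iQ) (psi i) by rewrite -map_mx_comp.
by rewrite e; exact: hc.
Qed.

Section Tate.
Hypothesis tate : @is_tate R l L V.

(** A power of [l] times [pi] preserves the lattice, so the Tate equality expresses it through Hodge
    endomorphisms; the power is divided out again. *)
Lemma galois_multiple (pi : 'M[Q]_m) :
  (forall g, Gam g -> pi *m rep_eval iQ Nu g = rep_eval iQ Nu g *m pi) ->
  forall (F : fieldType) (f : {rmorphism Q -> F}) g, pts (f \o iQ) M g ->
    map_mx f pi *m rep_eval (f \o iQ) Nu g = rep_eval (f \o iQ) Nu g *m map_mx f pi.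
Proof.
move=> com F f g Mg.
pose A := invmx BQ *m pi *m BQ.
have [k kP] := boolp.choice (fun ij : 'I_m * 'I_m => padic_bounded_denominator (A ij.1 ij.2)).
pose q : Q := (val l ^ (\max_ij k ij))%:R.
have q0 : q != 0 by apply: nat_neq0; rewrite expn_gt0 prime_gt0 // (valP l).
have EG : @End_Gal R l L V (q *: pi).
  split; last by apply/galois_commute => h Gh; rewrite -scalemxAl -scalemxAr com.
  move=> i j; rewrite -scalemxAr -scalemxAl -[map_mx ratr _]/BQ -/A mxE.
  have -> : q * A i j = (val l ^ (\max_ij k ij - k (i, j)))%:R * ((val l ^ k (i, j))%:R * A i j).
    by rewrite mulrA -natrM -expnD subnK // (leq_bigmax (F := k) (i, j)).
  exact: Zint_mul (Zint_nat _ _) (kP (i, j)).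
rewrite -(proj2 tate) in EG.
have := End_HS_l_commute EG Mg.
rewrite map_mxZ -scalemxAl -scalemxAr => /(congr1 ( *:%R (f q)^-1)).
by rewrite !scalerA mulVf ?fmorph_eq0 // !scale1r.
Qed.

(** An integer multiple of [pi] is an endomorphism of the integral Hodge structure, to which the
    other inclusion of the Tate equality applies. *)
Lemma rational_multiple (pi : 'M[rat]_m) :
  (forall (F : fieldType) (f : {rmorphism rat -> F}) g, pts f M g ->
     map_mx f pi *m rep_eval f Nu g = rep_eval f Nu g *m map_mx f pi) ->
  forall g, Gam g -> map_mx iQ pi *m rep_eval iQ Nu g = rep_eval iQ Nu g *m map_mx iQ pi.
Proof.
move=> com g Gg; have [N [N0 NP]] := rat_mx_denominator (invmx B *m pi *m B).
have EH : @End_HS R l V (N%:R *: pi).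
  split; first by move=> i j; have := NP i j; rewrite scalemxAl scalemxAr.
  apply/hodge_commute => F f h Mh.
  by rewrite map_mxZ -scalemxAl -scalemxAr com.
have EG : @End_HS_l R l V (map_mx iQ (N%:R *: pi)).
  exists 1%N, (fun=> 1), (fun=> N%:R *: pi); split=> [i|]; last by rewrite big_ord1 scale1r.
  by split=> //; exact: (Zint_nat l 1).
rewrite (proj2 tate) in EG; have [_ /galois_commute/(_ g Gg)] := EG.
rewrite map_mxZ -scalemxAl -scalemxAr rmorph_nat => /(congr1 ( *:%R (N%:R)^-1)).
have NQ : N%:R != 0 :> Q by exact: nat_neq0.
by rewrite !scalerA mulVf // !scale1r.
Qed.
End Tate.
Section FromMumfordTate.
Hypothesis ptsE : forall (F : fieldType) (f : {rmorphism Q -> F}), pts f Z = pts (f \o iQ) M.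

Lemma image_MT g : Gam g -> pts iQ M g.
Proof. by move/image_closure; rewrite (ptsE idfun). Qed.

Lemma galois_commute_MT (phi : 'M[Q]_m) :
  (forall g, Gam g -> phi *m rep_eval iQ Nu g = rep_eval iQ Nu g *m phi) ->
  forall (F : fieldType) (f : {rmorphism Q -> F}) h, pts (f \o iQ) M h ->
    map_mx f phi *m rep_eval (f \o iQ) Nu h = rep_eval (f \o iQ) Nu h *m map_mx f phi.
Proof.
move=> com F f h; rewrite -ptsE => -[_ Zh].
apply/eqP; rewrite -subr_eq0; apply/eqP/matrixP => i j; rewrite [RHS]mxE.
rewrite -commutator_poly_eval; apply: Zh => g Gg.
by rewrite commutator_polyE com // subrr mxE.
Qed.

(** Stability of [W] is a polynomial condition on the Galois image, so it extends to all of [M]; the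
    kernel of an [M]-equivariant projection onto [W] is then a Galois-stable complement. *)
Lemma MT_semisimple : @semisimple R l L V.
Proof.
move=> W /galois_stable_rep Wst.
have [e [ee eW]] := vspace_idempotent W.
have est g : Gam g -> rep_eval iQ Nu g *m e = e *m rep_eval iQ Nu g *m e.
  move=> Gg; apply: mx_col_eq => v; rewrite -!mulmxA; symmetry; apply/eW/Wst => //.
  by apply/eW; rewrite mulmxA ee.
have eMT (F : fieldType) (f : {rmorphism Q -> F}) h : pts (f \o iQ) M h ->
    rep_eval (f \o iQ) Nu h *m map_mx f e = map_mx f e *m rep_eval (f \o iQ) Nu h *m map_mx f e.
  rewrite -ptsE => -[_ Zh].
  (* The entries of [(1 - e) g e] express the stability of the image of [e]. *)
  pose P : 'M[entry_poly Q n]_m := map_mx (@entry_cst Q n) (1%:M - e) *m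
    map_mx (map_mpoly iQ) Nu *m map_mx (@entry_cst Q n) e.
  have PE (F' : fieldType) (f' : {rmorphism Q -> F'}) g : map_mx (entry_eval f' g) P =
      rep_eval (f' \o iQ) Nu g *m map_mx f' e -
      map_mx f' e *m rep_eval (f' \o iQ) Nu g *m map_mx f' e.
    have -> : rep_eval (f' \o iQ) Nu g = map_mx (entry_eval f' g) (map_mx (map_mpoly iQ) Nu).
      by rewrite -map_mx_comp; apply/matrixP => i j; rewrite !mxE /= entry_eval_map.
    by rewrite !map_mxM !map_entry_cst map_mxB map_mx1 !mulmxBl mul1mx.
  apply/eqP; rewrite -subr_eq0 -PE; apply/eqP/matrixP => i j; rewrite [LHS]mxE [RHS]mxE.
  apply: Zh => g Gg; have := PE Q idfun g; rewrite map_mx_idfun est // subrr.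
  by move/matrixP/(_ i j); rewrite mxE [RHS]mxE.
have [pi [epi pie piA]] := invariant_projection datum Xs lattice_is_rep ee eMT.
have piG g : Gam g -> pi *m rep_eval iQ Nu g = rep_eval iQ Nu g *m pi.
  move=> Gg; apply: (commute_envelope _ (image_MT Gg)) => a Aa.
  by rewrite piA.
have [||W' W'P] := @closed_vspace Q 'cV[Q]_m [set v | pi *m v = 0].
- by rewrite /= mulmx0.
- by move=> a x y /= px py; rewrite mulmxDr -scalemxAr px py scaler0 addr0.
exists W'; split.
- apply/galois_stable_rep => g Gg v /W'P /= pv; apply/W'P => /=.
  by rewrite mulmxA piG // -mulmxA pv mulmx0.
- apply/eqP; rewrite eqEsubv subvf; apply/subvP => v _.
  have -> : v = pi *m v + (v - pi *m v) by rewrite addrC subrK.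
  apply: memv_add; first by apply/eW; rewrite mulmxA epi.
  have pp : pi *m pi = pi by rewrite -{2}epi mulmxA pie epi.
  by apply/W'P => /=; rewrite mulmxBr mulmxA pp subrr.
- apply/eqP; rewrite -subv0; apply/subvP => v; rewrite memv_cap memv0.
  case/andP=> /eW ev /W'P /= pv; apply/eqP.
  by rewrite -ev -pie -mulmxA ev pv.
Qed.

Lemma MT_End_sub : @End_HS_l R l V `<=` @End_Gal R l L V.
Proof.
move=> phi EH; split; last first.
  apply/galois_commute => g Gg; have := End_HS_l_commute EH (f := idfun) (image_MT Gg).
  by rewrite map_mx_idfun.
case: EH => r [c [psi [h ->]]] i j.
rewrite -[map_mx ratr _]/BQ mulmx_sumr mulmx_suml summxE; apply: Zint_sum => q _.
have [Zc [int _]] := h q.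
rewrite -scalemxAr -scalemxAl mxE; apply: Zint_mul => //.
have -> : invmx BQ *m map_mx ratr (psi q) *m BQ = map_mx iQ (invmx B *m psi q *m B).
  by rewrite !map_mxM map_invmx.
exact: Zint_rat_mx.
Qed.

(* Splitting the Q_l-coefficients as a rational number plus an l-adic integer, the
   rational part is l-integral because phi is, hence integral. *)
Lemma MT_End_sup : @End_Gal R l L V `<=` @End_HS_l R l V.
Proof.
move=> phi [Zphi /galois_commute com]; have comMT := galois_commute_MT com.
have comA := envelope_commute comMT.
have [r [c [ph [cfree _ phE]]]] := free_span_mx iQ phi.
have phMT j (F : fieldType) (f : {rmorphism rat -> F}) g : pts f M g ->
    map_mx f (ph j) *m rep_eval f Nu g = rep_eval f Nu g *m map_mx f (ph j).
  move=> Mg; apply: (commute_envelope _ Mg) => a Aa.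
  by rewrite -!map_mxM; congr map_mx; apply: (component_commute cfree phE); exact: comA.
have [N NP] := boolp.choice (fun j => rat_mx_denominator (invmx B *m ph j *m B)).
pose ps j := (N j)%:R *: ph j; pose c' j := c j / (N j)%:R.
have N0 j : (N j)%:R != 0 :> Q by apply: nat_neq0; have [] := NP j.
have phiE : phi = \sum_j c' j *: map_mx iQ (ps j).
  rewrite phE; apply: eq_bigr => j _.
  by rewrite map_mxZ rmorph_nat scalerA divfK.
have psHS j : @End_HS R l V (ps j).
  split; first by move=> a b; have [_ h] := NP j; have := h a b; rewrite scalemxAl scalemxAr.
  apply/hodge_commute => F f g Mg.
  by rewrite map_mxZ -scalemxAl -scalemxAr phMT.
have [k kP] := boolp.choice (fun j => padic_bounded_denominator (c' j)).
pose t := \max_j k j.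
have tP j : Zp_in_Qp ((val l ^ t)%:R * c' j).
  have -> : (val l ^ t)%:R * c' j = (val l ^ (t - k j))%:R * ((val l ^ k j)%:R * c' j).
    by rewrite mulrA -natrM -expnD subnK // (leq_bigmax (F := k) j).
  exact: Zint_mul (Zint_nat _ _) (kP j).
have t0 : (val l ^ t)%:R != 0 :> Q by apply: nat_neq0; rewrite expn_gt0 prime_gt0 // (valP l).
have t0r : (val l ^ t)%:R != 0 :> rat by rewrite pnatr_eq0 -lt0n expn_gt0 prime_gt0 // (valP l).
have h j : exists ad : int * Q, Zp_in_Qp ad.2 /\
    (val l ^ t)%:R * c' j = ad.1%:~R + (val l ^ t)%:R * ad.2.
  by have [a [d0 [h1 h2 _]]] := padic_split t (tP j); exists (a, d0).
have [ad adP] := boolp.choice h.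
pose w : 'M[rat]_m := \sum_j ((ad j).1%:~R / (val l ^ t)%:R) *: ps j.
have phiw : phi = map_mx iQ w + \sum_j (ad j).2 *: map_mx iQ (ps j).
  rewrite phiE map_mx_sum -big_split; apply: eq_bigr => j _ /=.
  rewrite [X in _ = X + _]map_mxZ -scalerDl; congr (_ *: _); apply: (mulfI t0).
  have [_ ->] := adP j; rewrite mulrDr; congr (_ + _).
  by rewrite fmorph_div rmorph_int rmorph_nat mulrC divfK.
have wZ : Zp_mx (map_mx iQ (invmx B *m w *m B)).
  have -> : map_mx iQ (invmx B *m w *m B) = invmx BQ *m phi *m BQ +
      (- 1) *: \sum_j (ad j).2 *: map_mx iQ (invmx B *m ps j *m B).
    rewrite phiw mulmxDr mulmxDl !map_mxM map_invmx scaleN1r.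
    rewrite mulmx_sumr mulmx_suml -[LHS]addr0 -addrA; congr (_ + _).
    rewrite -sumrB big1 // => j _.
    by rewrite !map_mxM map_invmx -scalemxAr -scalemxAl subrr.
  move=> a b; rewrite mxE; apply: Zint_add; first exact: Zphi.
  rewrite mxE; apply: Zint_mul; first exact: (Zint_int l (-1)).
  rewrite summxE; apply: Zint_sum => j _; rewrite mxE; apply: Zint_mul.
    by have [] := adP j.
  by apply: Zint_rat_mx; have [] := psHS j.
(* Such an entry has at most a power of [l] as denominator and is [l]-integral, hence it is an
   integer. *)
have wint a b : (invmx B *m w *m B) a b \is a Num.int.
  have [z zE] : exists z : int, (val l ^ t)%:R * (invmx B *m w *m B) a b = z%:~R.
    apply/intrP; have -> : (val l ^ t)%:R * (invmx B *m w *m B) a b =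
        \sum_j (ad j).1%:~R * (invmx B *m ps j *m B) a b.
      rewrite mulmx_sumr mulmx_suml summxE mulr_sumr; apply: eq_bigr => j _.
      by rewrite -scalemxAr -scalemxAl mxE mulrA mulrCA mulfV // mulr1.
    apply: rpred_sum => j _; apply: rpredM; first exact: intr_int.
    by have [] := psHS j.
  have e : z%:~R = (val l ^ t)%:R * iQ ((invmx B *m w *m B) a b) :> Q.
    by rewrite -(rmorph_nat iQ) -rmorphM zE rmorph_int.
  have Zx : Zp_in_Qp (iQ ((invmx B *m w *m B) a b)) by have := wZ a b; rewrite mxE.
  have /dvdzP[y yE] := padic_integer Zx e.
  have -> : (invmx B *m w *m B) a b = y%:~R; last exact: intr_int.
  by apply: (mulfI t0r); rewrite zE yE rmorphM /= -pmulrn mulrC.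
have wHS : @End_HS R l V w.
  split=> //; apply/hodge_commute => F f g Mg.
  rewrite map_mx_sum mulmx_suml mulmx_sumr; apply: eq_bigr => j _.
  have [_ /hodge_commute hj] := psHS j.
  by rewrite map_mxZ -scalemxAl -scalemxAr hj.
(* Index 0 carries the rational part [w] with coefficient 1, the others the [l]-adic integral
   remainders. *)
exists r.+2, (fun i => if unlift ord0 i is Some j then (ad j).2 else 1),
  (fun i => if unlift ord0 i is Some j then ps j else w).
split=> [i|].
  case: (unlift ord0 i) => [j|]; first by have [] := adP j.
  by split=> //; exact: (Zint_nat l 1).
rewrite big_ord_recl unlift_none scale1r phiw; congr (_ + _).
by apply: eq_bigr => j _; rewrite liftK.
Qed.

Lemma MT_tate : @is_tate R l L V.
Proof.
split; first exact: MT_semisimple.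
by apply/seteqP; split; [exact: MT_End_sub|exact: MT_End_sup].
Qed.
End FromMumfordTate.
End Representation.

Section FromTate.
Hypothesis tates : forall m (mu : regmap rat n m) (B : 'M[rat]_m),
  lattice_rep G Kl mu B -> is_tate L (shimura_structure l mu B s rho).

Lemma tate_image_MT g : Gam g -> pts iQ M g.
Proof.
move=> Gg; split=> [|P MP]; first exact: (image_sub Gg).1.
pose d := msize P; have [B latB] := stable_lattice d grpG (sp_level_l sp).
have tate := tates latB.
have [e [ee eP]] := ideal_idempotent d M.
pose nu := rep_eval iQ (translation_mx n d).
have [pi [epi pie piA]] : exists pi : 'M[rat]_(rep_dim n d), [/\ e *m pi = pi, pi *m e = e
    & forall a, envelope M (translation_mx n d) a ->
        map_mx (idfun : {rmorphism rat -> rat}) a *m pi = pi *m map_mx idfun a].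
  apply: (invariant_projection datum Xs (translation_rep d G)) => // F f h Mh.
  exact: (ideal_stable grpM eP ee Mh).
have piMT (F : fieldType) (f : {rmorphism rat -> F}) h : pts f M h ->
    map_mx f pi *m rep_eval f (translation_mx n d) h =
    rep_eval f (translation_mx n d) h *m map_mx f pi.
  move=> Mh; apply: (commute_envelope _ Mh) => a Aa.
  by have := piA a Aa; rewrite map_mx_idfun -!map_mxM => ->.
have piG := rational_multiple latB tate piMT Gg.
pose v := poly_vec d P; have vP : vec_poly v = P by exact: poly_vecK.
have ev : e *m v = v.
  rewrite -{1}[e](map_mx_idfun); apply/(eP rat idfun).
  apply/vanishing_ideal_baseP => F f h [_ Mh]; rewrite vP; exact: Mh.
have piv : pi *m v = v by rewrite -ev mulmxA pie.
pose w := nu g *m map_mx iQ v.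
have ew : map_mx iQ e *m w = w.
  have wE : w = map_mx iQ pi *m w.
    by rewrite /w mulmxA piG -mulmxA -map_mxM piv.
  by rewrite wE mulmxA -map_mxM epi.
(* The value at 1 of the translate of [P] by [g] is the value of [P] at [g]. *)
have/eP/vanishing_ideal_baseP/(_ Q idfun 1%:M) := ew.
rewrite translation_action translate_eval mul1mx map_mx_idfun vec_poly_map vP.
rewrite entry_eval_map; apply.
by have [] := grpM (idfun \o iQ).
Qed.

(** Polynomials vanishing on the Galois image form a Galois-stable space because that image is
    closed under products, and all of them vanish at 1; a translate of [P] by a point of [M] stays
    in this space extended to [F]. *)
Lemma tate_MT_closure (F : fieldType) (f : {rmorphism Q -> F}) h :
  pts (f \o iQ) M h -> pts f Z h.
Proof.
move=> Mh; split=> [|P ZP]; first exact: Mh.1.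
pose d := msize P; have [B latB] := stable_lattice d grpG (sp_level_l sp).
have [ss End_eq] := tates latB.
pose nu := rep_eval iQ (translation_mx n d).
have [||W WP] := @closed_vspace Q 'cV[Q]_(rep_dim n d)
    [set v | forall g, Gam g -> entry_eval idfun g (vec_poly v) = 0].
- by move=> g _; rewrite vec_poly0 rmorph0.
- move=> a x y Wx Wy g Gg; rewrite vec_poly_lin rmorphD /= entry_evalZ.
  by rewrite (Wx g Gg) (Wy g Gg) mulr0 addr0.
have Wst : @galois_stable R l L (shimura_structure l (RegMap (translation_mx n d) 0) B s rho) W.
  apply/galois_stable_rep => g Gg v /WP Wv; apply/WP => g' Gg'.
  rewrite translation_action translate_eval map_mx_idfun; apply: Wv; exact: imageM.
have [W' [W'st WW' W0]] := ss W Wst.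
have [pi [piW piW' piV]] := complement_projection WW' W0.
have piG g : Gam g -> pi *m nu g = nu g *m pi.
  move=> Gg; apply: mx_col_eq => v; rewrite -!mulmxA.
  have : v \in (W + W')%VS by rewrite WW' memvf.
  case/memv_addP=> x xW [y yW' ->].
  have /galois_stable_rep/(_ g Gg x xW) gx := Wst.
  have /galois_stable_rep/(_ g Gg y yW') gy := W'st.
  exact: projection_commute (piW _ xW) (piW' _ yW') (piW _ gx) (piW' _ gy).
have piMT := galois_multiple latB (conj ss End_eq) piG Mh.
pose v := poly_vec d P; have vP : vec_poly v = P by exact: poly_vecK.
have vW : v \in W by apply/WP => g Gg; rewrite vP; exact: ZP.
pose w := rep_eval (f \o iQ) (translation_mx n d) h *m map_mx f v.
have wE : w = map_mx f pi *m w by rewrite /w mulmxA piMT -mulmxA -map_mxM piW.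
(* [w] has coefficients in [F], but the image of [pi] is spanned by its columns, which are
   polynomials over [Q_l] vanishing on the Galois image, in particular at 1. *)
have w1 : entry_eval idfun 1%:M (vec_poly w) = 0.
  rewrite wE; have -> : map_mx f pi *m w = \sum_j w j 0 *: map_mx f (col j pi).
    apply/matrixP => a b; rewrite (ord1 b) mxE summxE; apply: eq_bigr => j _.
    by rewrite !mxE mulrC.
  rewrite vec_poly_sum rmorph_sum big1 // => j _ /=; rewrite entry_evalZ vec_poly_map.
  rewrite entry_eval_map; have : entry_eval idfun 1%:M (vec_poly (col j pi)) = 0 :> Q.
    by have/WP := piV (delta_mx j 0); rewrite -colE; apply; exact: image1.
  move/(congr1 f); rewrite rmorph_entry_eval map_mx1 rmorph0.
  by move=> ->; rewrite mulr0.
move: w1; rewrite translation_action translate_eval mul1mx map_mx_idfun.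
by rewrite vec_poly_map vP entry_eval_map.
Qed.

Lemma tate_mumford_tate : mumford_tate_equality G l L s rho.
Proof.
apply/mumford_tate_pts => F f; apply/seteqP; split=> h; last exact: tate_MT_closure.
case=> uh Zh; split=> // P MP.
rewrite -entry_eval_map; apply: Zh => g Gg; rewrite entry_eval_map.
by have [_ hM] := tate_image_MT Gg; exact: hM.
Qed.
End FromTate.
End ShimuraPoint.

Theorem theorem4p3 (R : realType) :
  (generalised_mumford_tate R <-> isogeny_conjecture R) /\
  forall (n : nat) (G : set (entry_poly rat n)) (X : set (regmap R 2 n))
    (Sh : set (adele_mx n) -> sh_model R n) (l : primeT)
    (K : set (adele_mx n)) (Kl : set 'M[Qp l]_n) (L : set (CC R))
    (s : regmap R 2 n)
    (rho : {rmorphism Qbar R -> Qbar R} -> adele_mx n),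
    shimura_point G X Sh K Kl L s rho ->
    ((forall (m : nat) (mu : regmap rat n m) (B : 'M[rat]_m),
        lattice_rep G Kl mu B ->
        is_tate L (shimura_structure l mu B s rho))
     <-> mumford_tate_equality G l L s rho).
Proof.
have pointwise n G X Sh l K Kl L s rho (sp : @shimura_point R n G X Sh l K Kl L s rho) :
    (forall (m : nat) (mu : regmap rat n m) (B : 'M[rat]_m), lattice_rep G Kl mu B ->
        is_tate L (shimura_structure l mu B s rho))
     <-> mumford_tate_equality G l L s rho.
  split; first exact: (tate_mumford_tate sp).
  move/(mumford_tate_pts sp) => ptsE m mu B latB; exact: (MT_tate sp latB ptsE).
split; last exact: pointwise.
split=> [gmt l L V|iso n G X Sh l K Kl L s rho sp].
  case=> n [G [X [Sh [K [Kl [s [rho [m [mu [B [sp latB ->]]]]]]]]]]].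
  exact: (proj2 (pointwise _ _ _ _ _ _ _ _ _ _ sp) (gmt _ _ _ _ _ _ _ _ _ _ sp) m mu B latB).
apply: (proj1 (pointwise _ _ _ _ _ _ _ _ _ _ sp)) => m mu B latB; apply: iso.
by exists n, G, X, Sh, K, Kl, s, rho, m, mu, B.
Qed.
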